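(* Let $D\subset\mathbb R^2$ be a smooth bounded domain, $\alpha\in(0,1)$ and $\lambda>0$. Let $\delta=\delta(\varepsilon)>1$ be such that $\delta\to1$ and $\tilde\varepsilon:=\varepsilon/\sqrt{\delta-1}\to0$ as $\varepsilon\to0$. Assume that $\Omega=\lambda/\tilde\varepsilon^2$ and that $\varepsilon\ll\tilde\varepsilon^2$ as $\varepsilon\to 0$. Then, for $\varepsilon$ small, $$\min_{\mathcal H}E^\Omega_{\varepsilon,\delta}\le\Omega\,|D|\,\underline E(\lambda,\alpha),$$ where $$\underline E(\lambda,\alpha)=\min_{\mu>0}\min_{\theta\in X_\alpha}\left\{\Big(\frac16+\frac\alpha2-4\int_0^{1/2}x\sin^2\theta(x)\,dx\Big)\mu^2+\frac1{\mu^2}\int_0^{1/2}\theta'(x)^2\,dx+\frac1{4\lambda}\int_0^{1/2}\sin^2(2\theta(x))\,dx\right\},$$ and $X_\alpha$ is the set of $\theta\in H^1(0,1/2)$ such that $$2\int_0^{1/2}\sin^2\theta\,dx=\alpha,\qquad\theta(0)=0,\qquad\theta(1/2)=\frac\pi2.$$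
   Context: Notation: $x^\perp=(-x_2,x_1)$; $a\ll b$ means $a/b\to0$ as $\varepsilon\to0$. $$E^\Omega_{\varepsilon,\delta}(u_1,u_2)=\sum_{k=1}^2\int_D\frac12|\nabla u_k-i\Omega x^\perp u_k|^2+\int_D\frac1{4\varepsilon^2}(1-|u_1|^2-|u_2|^2)^2+\frac{\delta-1}{2\varepsilon^2}|u_1|^2|u_2|^2\,dx,$$ $$\mathcal H=\Big\{(u_1,u_2):u_k\in H^1(D,\mathbb C),\ \frac1{|D|}\int_D|u_1|^2=\alpha,\ \frac1{|D|}\int_D|u_2|^2=1-\alpha\Big\}.$$ *)

(* Defs.v *)
From HB Require Import structures.
From mathcomp Require Import all_boot all_order all_algebra.
From mathcomp Require Import complex.
From mathcomp Require Import all_classical all_reals all_analysis.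

Set Implicit Arguments.
Unset Strict Implicit.
Unset Printing Implicit Defensive.

Import Order.TTheory GRing.Theory Num.Theory numFieldNormedType.Exports.
Import ComplexField.Normc.
Local Open Scope classical_set_scope.
Local Open Scope ring_scope.
Local Open Scope complex_scope.

Definition is_min d (T : porderType d) (A : set T) (m : T) : Prop :=
  A m /\ lbound A m.

Section smooth.
Context {R : realType} {V : normedModType R}.
Implicit Types (U D : set V) (f : V -> R).

(* C^oo on an open set: all iterated directional derivatives are
   differentiable. *)
Definition smooth_on U f : Prop :=
  forall (s : seq V) (x : V), U x ->
    differentiable (foldr (fun v g => 'D_v g) f s) x.

Definition test_function D f : Prop :=
  [/\ smooth_on setT f,
      compact (closure [set x | f x != 0]) &
      closure [set x | f x != 0] `<=` D].

(* Near each boundary point, D is a strict sublevel set of a C^oo function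
   with nonvanishing differential. *)
Definition smooth_boundary D : Prop :=
  forall p, closure D p -> ~ D p ->
    exists (U : set V) (rho : V -> R),
      [/\ open U, U p, smooth_on U rho,
          (exists v, 'D_v rho p != 0) &
          D `&` U = [set x | rho x < 0] `&` U].

Definition smooth_bounded_domain D : Prop :=
  [/\ D !=set0, open D, connected D, bounded_set D & smooth_boundary D].

End smooth.

Definition in_L2 {R : realType} {d} {T : measurableType d}
    (m : {measure set T -> \bar R}) (D : set T) (f : T -> R) : Prop :=
  measurable_fun D f /\ m.-integrable D (fun x => (f x ^+ 2)%:E).

Section H1_dim1.
Context {R : realType}.
Local Notation leb := (@lebesgue_measure R).
Implicit Types (I : set R) (f g : R -> R).

Definition is_weak_deriv1 I f g : Prop :=
  in_L2 leb I g /\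
  forall phi, test_function I phi ->
    \int[leb]_(x in I) (f x * 'D_1 phi x) = - \int[leb]_(x in I) (g x * phi x).

(* A representative of the weak derivative; it is unique almost everywhere,
   and junk when there is none. *)
Definition weak_deriv1 I f : R -> R := get (is_weak_deriv1 I f).

Definition H1_dim1 I f : Prop :=
  in_L2 leb I f /\ exists g, is_weak_deriv1 I f g.

End H1_dim1.

Section H1_plane.
Context {R : realType}.

Local Notation RT := (measurableTypeR R).

(* [RT] is [R] with the sigma-algebra on which [lebesgue_measure] is defined. *)
Definition area : {measure set (RT * RT) -> \bar R} :=
  (@lebesgue_measure R \x @lebesgue_measure R)%E.

Definition e1 : R * R := (1, 0).
Definition e2 : R * R := (0, 1).

Implicit Types (D : set (R * R)) (v x : R * R).

Definition is_weak_deriv D v (f g : R * R -> R) : Prop :=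
  in_L2 area D g /\
  forall phi : R * R -> R, test_function D phi ->
    \int[area]_(x in D) (f x * 'D_v phi x)
    = - \int[area]_(x in D) (g x * phi x).

Definition weak_deriv D v (f : R * R -> R) : R * R -> R :=
  get (is_weak_deriv D v f).

Definition H1 D (f : R * R -> R) : Prop :=
  [/\ in_L2 area D f,
      exists g, is_weak_deriv D e1 f g &
      exists g, is_weak_deriv D e2 f g].

Definition H1C D (u : R * R -> R[i]) : Prop :=
  H1 D (fun x => complex.Re (u x)) /\ H1 D (fun x => complex.Im (u x)).

Definition weak_derivC D v (u : R * R -> R[i]) (x : R * R) : R[i] :=
  weak_deriv D v (fun y => complex.Re (u y)) x
  +i* weak_deriv D v (fun y => complex.Im (u y)) x.

End H1_plane.

Section energy.
Context {R : realType}.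
Implicit Types (D : set (R * R)) (x : R * R) (u : R * R -> R[i]).

Definition perp x : R * R := (- x.2, x.1).

(* |grad u - i Omega x^perp u|^2 *)
Definition cov_grad_sq D (Omega : R) u x : R :=
  normc (weak_derivC D e1 u x - 'i * (Omega * (perp x).1)%:C * u x) ^+ 2
  + normc (weak_derivC D e2 u x - 'i * (Omega * (perp x).2)%:C * u x) ^+ 2.

Definition potential (eps delta : R) (z1 z2 : R[i]) : R :=
  (1 - normc z1 ^+ 2 - normc z2 ^+ 2) ^+ 2 / (4 * eps ^+ 2)
  + (delta - 1) / (2 * eps ^+ 2) * (normc z1 ^+ 2 * normc z2 ^+ 2).

Definition energy D (eps delta Omega : R)
    (w : (R * R -> R[i]) * (R * R -> R[i])) : \bar R :=
  (\int[area]_(x in D) (2^-1 * cov_grad_sq D Omega w.1 x)%:E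
   + \int[area]_(x in D) (2^-1 * cov_grad_sq D Omega w.2 x)%:E
   + \int[area]_(x in D) (potential eps delta (w.1 x) (w.2 x))%:E)%E.

Definition mean_density D u : R :=
  (fine (area D))^-1 * \int[area]_(x in D) (normc (u x) ^+ 2).

Definition admissible D (alpha : R) :
    set ((R * R -> R[i]) * (R * R -> R[i])) :=
  [set w | [/\ H1C D w.1, H1C D w.2,
               mean_density D w.1 = alpha &
               mean_density D w.2 = 1 - alpha]].

End energy.

Section stripes.
Context {R : realType}.
Local Notation leb := (@lebesgue_measure R).

(* Elements of H^1(0,1/2) are given by their continuous representatives on
   [0,1/2], so that the boundary values are pointwise values. *)
Definition profiles (alpha : R) : set (R -> R) :=
  [set theta : R -> R | [/\ {within `[0, 2^-1 : R], continuous theta},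
                   H1_dim1 `]0, 2^-1[ theta,
                   2 * \int[leb]_(x in `]0, 2^-1[) (sin (theta x) ^+ 2) = alpha,
                   theta 0 = 0 &
                   theta 2^-1 = pi / 2]].

Definition stripe_energy (lambda alpha mu : R) (theta : R -> R) : R :=
  (6^-1 + alpha / 2
   - 4 * \int[leb]_(x in `]0, 2^-1[) (x * sin (theta x) ^+ 2)) * mu ^+ 2
  + (mu ^+ 2)^-1
    * \int[leb]_(x in `]0, 2^-1[) (weak_deriv1 `]0, 2^-1[ theta x ^+ 2)
  + (4 * lambda)^-1
    * \int[leb]_(x in `]0, 2^-1[) (sin (2 * theta x) ^+ 2).

(* [m mu] is the inner minimum, [e] the outer one; both are attained. *)
Definition is_stripe_min (lambda alpha e : R) : Prop :=
  exists m : R -> R,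
    (forall mu, 0 < mu ->
       is_min [set stripe_energy lambda alpha mu theta
              | theta in profiles alpha] (m mu)) /\
    is_min [set m mu | mu in [set mu | 0 < mu]] e.

End stripes.

Definition eps_tilde {R : realType} (delta : R -> R) (eps : R) : R :=
  eps / Num.sqrt (delta eps - 1).

(* Main.v *)
(* The competitor is a periodic array of vertical stripes of width T = mu / sqrt Omega, where the
   width mu and the profile theta are optimal: u_1 = sin theta and u_2 = cos theta, with phases
   chosen stripe by stripe. Its energy per unit area is Omega e, with e the value of the
   one-dimensional problem. Restoring the mass constraint by tilting theta costs only O(T^2)
   relative to Omega, after averaging over the translations of the array and subtracting a
   Lagrange multiplier. This loss is compensated at the highest point of D, of height H: adding
   s exp ((x_2 - H) / T) to the phase of u_1 gains a fixed multiple of Omega times the integral of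
   exp ((x_2 - H) / T) over D, and that integral divided by T^2 tends to infinity because the
   boundary is smooth, hence flat, near the highest point.
   Minimizers exist by the direct method in strong form: almost minimizers in midpoint-convex sets
   form Cauchy sequences by the parallelogram identity, and a Poincare inequality on small boxes
   replaces the compact embedding. *)

Require Import Defs.
From mathcomp Require Import all_boot all_order all_algebra.
From mathcomp Require Import complex.
From mathcomp Require Import all_classical all_reals all_analysis.
From mathcomp Require Import measurable_realfun ring lra.
Set Implicit Arguments.
Unset Strict Implicit.
Unset Printing Implicit Defensive.
Import Order.TTheory GRing.Theory Num.Theory numFieldNormedType.Exports.
Local Open Scope classical_set_scope.
Local Open Scope ring_scope.

(** The bound has no error term, so every loss of the construction must be recovered. With the phase
    [Om * z.1 * z.2] the vector potential survives only as [2 * Om * z.2] in the first direction. A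
    phase [Z * b z.2] with [b = - 2 * Om * T * z.2], where [Z] is the position relative to the
    middle of a stripe, cancels it and leaves [- 2 * Om * T * Z] in the second direction; its
    square, weighted by the densities, is the [mu ^+ 2] term of the stripe energy. Each component
    has its own [Z], which jumps where that component vanishes.

    Stripes cut by the boundary change the mass by O(T), so the tilt has size O(T) and its
    first-order effect on the energy is too large by itself. As the mass is exact after the tilt, a
    multiple of it can be subtracted so that the first-order density has mean zero; its integral
    over D is then a boundary effect too, again O(T). Since this density is merely integrable, the
    bound holds only on average over translations.

    The boundary layer gains to first order because its vertical slope has a cross term with
    [- 2 * Om * T * Z]. *)

Section smooth_functions.

(** * Smooth functions on the line and in the plane *)

Context {R : realType}.
(** The derivative of [flat n] is a combination of [flat n.+1] and [flat n.+2], so the family is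
    closed under differentiation up to linear combinations. [flat 0] is the usual building block of
    bump functions. *)
Definition flat (n : nat) (x : R) : R :=
  if 0 < x then x ^- n * expR (- x^-1) else 0.

(** The exponential of 1/x dominates the term of degree [n.+2] of its series. The surplus factor
    [x ^+ 2] makes [flat n] differentiable at 0 with derivative 0. *)
Lemma flat_le n (x : R) : `|flat n x| <= (n.+2)`!%:R * x ^+ 2.
Proof.
rewrite /flat; case: ifPn => [x0|_]; last first.
  by rewrite normr0 mulr_ge0// sqr_ge0.
have xi0 : 0 <= x^-1 by rewrite invr_ge0 ltW.
rewrite ger0_norm; last by rewrite mulr_ge0 ?expR_ge0// invr_ge0 exprn_ge0// ltW.
have := @expR_ge1Dxn R x^-1 n.+1 xi0.
rewrite expRN => H.
have E0 := expR_gt0 x^-1.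
rewrite ler_pdivrMr//.
have H2 : x^-1 ^+ n.+2 / (n.+2)`!%:R <= expR x^-1 by apply: le_trans H; rewrite lerDr.
have F0 : 0 < (n.+2)`!%:R :> R by rewrite ltr0n fact_gt0.
rewrite ler_pdivrMr// in H2.
have -> : x ^- n = x ^+ 2 * x^-1 ^+ n.+2.
  rewrite -(add2n n) exprD mulrA -exprMn divff ?gt_eqF// expr1n mul1r.
  by rewrite exprVn.
by rewrite [leRHS]mulrAC [leRHS]mulrC ler_pM2l ?exprn_gt0// mulrC.
Qed.

Lemma is_derive_flat n (x : R) :
  is_derive x 1 (flat n) (flat n.+2 x - n%:R * flat n.+1 x).
Proof.
have [x0|x0|<-] := ltgtP 0 x; last first.
- have -> : flat n.+2 0 - n%:R * flat n.+1 0 = 0 by rewrite /flat ltxx mulr0 subr0.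
  (* Caratheodory's criterion at the gluing point: the slope function [flat n z / z] is bounded by a
     multiple of |z|, hence continuous at 0 with value 0 (division by 0 gives 0). *)
  apply/is_derive1_caratheodory; exists (fun z => flat n z / z); split.
  + move=> z; rewrite !subr0 {2}/flat ltxx subr0.
    have [->|z0] := eqVneq z 0; first by rewrite mulr0 /flat ltxx.
    by rewrite divfK.
  + have E : flat n 0 / 0 = 0 by rewrite invr0 mulr0.
    change (flat n z / z @[z --> (0:R)] --> flat n 0 / 0); rewrite E.
    apply/cvgr0Pnorm_le => e e0.
    have F0 : 0 < (n.+2)`!%:R :> R by rewrite ltr0n fact_gt0.
    have K : \forall z \near (0:R), `|z| <= e / (n.+2)`!%:R.
      by apply: nbhs0_le; rewrite divr_gt0.
    apply: filterS K => z K.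
    rewrite normrM normfV.
    have [->|z0] := eqVneq z 0; first by rewrite normr0 invr0 mulr0 ltW.
    rewrite ler_pdivrMr ?normr_gt0//.
    apply: (le_trans (flat_le n z)).
    rewrite -real_normK ?num_real// expr2 mulrA ler_pM2r ?normr_gt0//.
    by rewrite mulrC -ler_pdivlMr.
  + by rewrite invr0 mulr0.
- have -> : flat n.+2 x - n%:R * flat n.+1 x = 0.
    by rewrite /flat (ltNge 0 x) (ltW x0) /= mulr0 subr0.
  have H : is_derive x 1 (cst (0:R)) (0:R) by exact: is_derive_cst.
  apply: (near_eq_is_derive _ H).
  near=> z; rewrite /= /flat (ltNge 0 z) ltW//=.
  by near: z; exact: lt_nbhsl.
- rewrite /flat x0.
  have H : is_derive x 1 (fun z : R => z^-1 ^+ n * expR (- z^-1))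
     (x^-1 ^+ n *: ( expR (- x^-1) * - (- x ^- 2 *: 1)) + expR (- x^-1) *:  ((n%:R * x^-1 ^+ n.-1) *: (- x ^- 2 *: 1))).
    have V : is_derive x 1 (fun z : R => z^-1) (- x ^- 2 *: 1).
      by apply: is_deriveV; rewrite gt_eqF.
    have X : is_derive x 1 (fun z : R => z^-1 ^+ n) ((n%:R * x^-1 ^+ n.-1) *: (- x ^- 2 *: 1)).
      by rewrite -exprfctE; exact: is_deriveX.
    have Y : is_derive x 1 (fun z : R => expR (- z^-1)) (expR (- x^-1) * - (- x ^- 2 *: 1)).
      by apply: (@is_derive1_comp _ expR (fun z => - z^-1)).
    exact: is_deriveM X Y.
  apply: (@near_eq_is_derive _ _ _ (fun z : R => z^-1 ^+ n * expR (- z^-1))).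
    near=> z; rewrite ifT ?exprVn//.
    by near: z; exact: lt_nbhsr.
  apply: (is_derive_eq H).
  rewrite -!exprVn /GRing.scale/=.
  case: (n) => [|m] /=; rewrite ?expr0 ?exprS ?expr0; ring.
Unshelve. all: by end_near. Qed.

Lemma flat_ge0 n (x : R) : 0 <= flat n x.
Proof.
rewrite /flat; case: ifPn => // x0.
by rewrite mulr_ge0 ?expR_ge0// invr_ge0 exprn_ge0// ltW.
Qed.

Lemma flat0_le1 (x : R) : flat 0 x <= 1.
Proof.
rewrite /flat; case: ifPn => // x0.
by rewrite expr0 invr1 mul1r -expR0 ler_expR oppr_le0 invr_ge0 ltW.
Qed.

Lemma flat_eq0 n (x : R) : x <= 0 -> flat n x = 0.
Proof. by move=> x0; rewrite /flat ltNge x0. Qed.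

Lemma flat0_cvg (x : R) : 0 < x -> flat 0 (n.+1%:R * x) @[n --> \oo] --> (1:R).
Proof.
move=> x0.
have -> : (fun n => flat 0 (n.+1%:R * x)) = (fun n => expR (- (n.+1%:R^-1 * x^-1))).
  by apply/funext => n; rewrite /flat mulr_gt0// expr0 invr1 mul1r invfM.
have C : - (n.+1%:R^-1 * x^-1) @[n --> \oo] --> - (0 * x^-1).
  by apply: cvgN; apply: cvgM; [exact: cvg_harmonic|exact: cvg_cst].
rewrite mul0r oppr0 in C; rewrite -[X in _ --> X]expR0.
apply: (cvg_comp _ _ C); exact: continuous_expR.
Qed.

(* A class of infinitely differentiable functions on the line: it is closed
   under differentiation by construction. *)
Inductive smooth1 : (R -> R) -> Prop :=
| smooth1_flat n c d : smooth1 (fun x => flat n (c * x + d))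
| smooth1_lin c f g : smooth1 f -> smooth1 g -> smooth1 (fun x => c * f x + g x)
| smooth1_mul f g : smooth1 f -> smooth1 g -> smooth1 (fun x => f x * g x)
| smooth1_prim f F : smooth1 f -> (forall x : R, is_derive x 1 F (f x)) -> smooth1 F.

Lemma smooth1_cst0 : smooth1 (fun=> 0).
Proof.
have := smooth1_flat 0 0 0; congr smooth1; apply/funext => x.
by rewrite mul0r addr0 flat_eq0.
Qed.

Lemma smooth1_scale c f : smooth1 f -> smooth1 (fun x => c * f x).
Proof.
move=> sf; have := smooth1_lin c sf smooth1_cst0; congr smooth1.
by apply/funext => x; rewrite addr0.
Qed.

Lemma smooth1_derive f : smooth1 f ->
  exists2 f', smooth1 f' & forall x : R, is_derive x 1 f (f' x).
Proof.
elim=> {f} [n c d|c f g _ [f' sf df] _ [g' sg dg]|f g sf [f' sf' df] sg [g' sg' dg]|f F sf [f' sf' df] dF].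
- exists (fun x => c * (- n%:R * flat n.+1 (c * x + d) + flat n.+2 (c * x + d))).
    apply: smooth1_scale; apply: smooth1_lin; exact: smooth1_flat.
  move=> x.
  have H : is_derive x 1 (fun x : R => c * x + d) c.
    by apply: is_derive_eq; rewrite /GRing.scale/=; ring.
  have := @is_derive1_comp _ (flat n) (fun x => c * x + d) x _ _ (is_derive_flat n (c * x + d)) H.
  by move=> K; apply: (is_derive_eq K); ring.
- exists (fun x => c * f' x + g' x); first exact: smooth1_lin.
  by move=> x; apply: is_deriveD; apply: is_deriveZ.
- exists (fun x => 1 * (f x * g' x) + g x * f' x).
    by apply: smooth1_lin; apply: smooth1_mul.
  by move=> x; apply: (is_derive_eq (is_deriveM (df x) (dg x))); rewrite mul1r.
- by exists f.
Qed.

Lemma smooth1_cts f : smooth1 f -> continuous f.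
Proof.
move=> /smooth1_derive[f' _ df] x; apply: differentiable_continuous.
by apply/derivable1_diffP; have [] := df x.
Qed.

Lemma smooth1_smooth_on f : smooth1 f -> smooth_on setT f.
Proof.
move=> sf s x _.
have : smooth1 (foldr (fun v g => 'D_v g) f s).
  elim: s => [//|v s /smooth1_derive[g sg dg]] /=.
  have := smooth1_scale v sg; congr smooth1; apply/funext => y.
  have dy := dg y.
  have -> : v = v *: (1 : R) by rewrite /GRing.scale/= mulr1.
  have /derivable1_diffP dd : derivable (foldr (fun v g => 'D_v g) f s) y 1 by case: dy.
  by rewrite deriveE// linearZ -deriveE// derive_val /GRing.scale/= mulr1.
move=> /smooth1_derive[g _ /(_ x)[dg _]].
by apply/derivable1_diffP.
Qed.

(** Sums of tensor products are enough as concrete test functions in the plane, and the product rule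
    keeps this class stable under directional derivatives. *)
Inductive smooth2 : (R * R -> R) -> Prop :=
| smooth2_tensor f g : smooth1 f -> smooth1 g -> smooth2 (fun x => f x.1 * g x.2)
| smooth2_lin c f g : smooth2 f -> smooth2 g -> smooth2 (fun x => c * f x + g x).

Lemma fst_cts : continuous (fst : R * R -> R).
Proof. by move=> x; exact: cvg_fst. Qed.
Lemma snd_cts : continuous (snd : R * R -> R).
Proof. by move=> x; exact: cvg_snd. Qed.

Lemma smooth2_derive f v : smooth2 f ->
  (forall x, differentiable f x) /\ smooth2 ('D_v f).
Proof.
elim=> {f} [f g sf sg|c f g sf [df df'] sg [dg dg']].
  have [f' sf' df] := smooth1_derive sf; have [g' sg' dg] := smooth1_derive sg.
  have Df (x : R * R) : differentiable (f \o fst) x.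
    apply: differentiable_comp; first exact/linear_differentiable/fst_cts.
    by apply/derivable1_diffP; case: (df x.1).
  have Dg (x : R * R) : differentiable (g \o snd) x.
    apply: differentiable_comp; first exact/linear_differentiable/snd_cts.
    by apply/derivable1_diffP; case: (dg x.2).
  split; first by move=> x; apply: differentiableM.
  have := smooth2_lin 1 (smooth2_tensor sf (smooth1_scale v.2 sg'))
             (smooth2_tensor (smooth1_scale v.1 sf') sg).
  congr smooth2; apply/funext => x.
  have E1 : 'D_v (f \o fst) x = v.1 * f' x.1.
    have dfx := df x.1.
    have -> : 'D_v (f \o fst) x = 'D_(v.1) f x.1 by [].
    have /derivable1_diffP dd : derivable f x.1 1 by case: dfx.
    have -> : v.1 = v.1 *: (1 : R) by rewrite /GRing.scale/= mulr1.
    by rewrite deriveE// linearZ -deriveE// derive_val /GRing.scale/= mulr1.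
  have E2 : 'D_v (g \o snd) x = v.2 * g' x.2.
    have dgx := dg x.2.
    have -> : 'D_v (g \o snd) x = 'D_(v.2) g x.2 by [].
    have /derivable1_diffP dd : derivable g x.2 1 by case: dgx.
    have -> : v.2 = v.2 *: (1 : R) by rewrite /GRing.scale/= mulr1.
    by rewrite deriveE// linearZ -deriveE// derive_val /GRing.scale/= mulr1.
  have -> : (fun x : R * R => f x.1 * g x.2) = (f \o fst) * (g \o snd) by [].
  rewrite deriveM; [|exact: diff_derivable|exact: diff_derivable].
  rewrite E1 E2 /GRing.scale/= mul1r; congr (_ + _); ring.
split; first by move=> x; apply: differentiableD => //; apply: differentiableZ.
have := smooth2_lin c df' dg'; congr smooth2; apply/funext => x.
have -> : (fun x : R * R => c * f x + g x) = c *: f + g by [].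
rewrite deriveD ?deriveZ//; try exact: diff_derivable.
by apply: diff_derivable; apply: differentiableZ.
Qed.

Lemma smooth2_smooth_on f : smooth2 f -> smooth_on setT f.
Proof.
move=> sf s x _.
have : smooth2 (foldr (fun v g => 'D_v g) f s).
  by elim: s => [//|v s /(smooth2_derive v)[]].
by move=> /(smooth2_derive 0)[+ _]; exact.
Qed.
End smooth_functions.

(** * Integration of real-valued functions *)

Notation itg m D f := (integrable m D (EFin \o f)) (only parsing).

Section integrability.
Context d (T : measurableType d) (R : realType) (m : {measure set T -> \bar R}).
Context (D : set T) (mD : measurable D).
Implicit Types f g : T -> R.

Lemma itg_meas f : itg m D f -> measurable_fun D f.
Proof. by move=> /measurable_int /measurable_EFinP. Qed.

Lemma itg_le f g : measurable_fun D f -> itg m D g ->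
  (forall x, D x -> `|f x| <= g x) -> itg m D f.
Proof.
move=> mf ig h; apply: le_integrable ig => //; first exact/measurable_EFinP.
move=> x Dx /=; rewrite lee_fin; apply: (le_trans (h x Dx)); exact: ler_norm.
Qed.

Lemma itgD f g : itg m D f -> itg m D g -> itg m D (fun x => f x + g x).
Proof. by move=> a b; have := integrableD mD a b. Qed.

Lemma itgZ c f : itg m D f -> itg m D (fun x => c * f x).
Proof. by move=> a; have := integrableZl mD c a. Qed.

Lemma itgN f : itg m D f -> itg m D (fun x => - f x).
Proof. by move=> a; have := integrableN a. Qed.

Lemma itgB f g : itg m D f -> itg m D g -> itg m D (fun x => f x - g x).
Proof. by move=> a b; exact: itgD a (itgN b). Qed.

Lemma itg0 : itg m D (fun=> 0).
Proof. exact: (integrable0 m D). Qed.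

Lemma itg_abs f : itg m D f -> itg m D (fun x => `|f x|).
Proof. by move=> /integrable_norm. Qed.

Lemma itg_bounded f (c : R) : (m D < +oo)%E -> measurable_fun D f ->
  (forall x, D x -> `|f x| <= c) -> itg m D f.
Proof.
move=> fD mf h; apply: measurable_bounded_integrable => //.
exists c; split; first exact: num_real.
by move=> e ce x Dx; apply: le_trans (h x Dx) (ltW ce).
Qed.

Lemma itg_cst (c : R) : (m D < +oo)%E -> itg m D (fun=> c).
Proof. by move=> fD; apply: (@itg_bounded _ `|c|) => //; exact: measurable_cst. Qed.

Lemma itgM_bounded f g (c : R) : itg m D f -> measurable_fun D g ->
  (forall x, D x -> `|g x| <= c) -> itg m D (fun x => g x * f x).
Proof.
move=> fi mg h; apply: (@itg_le _ (fun x => c * `|f x|)).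
- apply: measurable_funM => //; exact: itg_meas.
- exact: itgZ (itg_abs fi).
- by move=> x Dx; rewrite normrM ler_wpM2r// h.
Qed.

Lemma eq_itg f g : (forall x, D x -> f x = g x) -> itg m D f -> itg m D g.
Proof.
by move=> h fi; apply: eq_integrable fi => // x /set_mem Dx /=; rewrite h.
Qed.

Lemma EFin_Rintegral f : itg m D f -> (\int[m]_(x in D) f x)%:E = (\int[m]_(x in D) (f x)%:E)%E.
Proof. by move=> fi; rewrite fineK//; exact: integrable_fin_num. Qed.

Lemma Rintegral_eq f g : (forall x, D x -> f x = g x) -> \int[m]_(x in D) f x = \int[m]_(x in D) g x.
Proof. by move=> h; apply: eq_Rintegral => x /set_mem; exact: h. Qed.

Lemma Rintegral0 : \int[m]_(x in D) 0 = 0 :> R.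
Proof. by rewrite /Rintegral integral0. Qed.

Lemma ae_Rintegral f g : measurable_fun D f -> measurable_fun D g ->
  ae_eq m D f g -> \int[m]_(x in D) f x = \int[m]_(x in D) g x.
Proof.
move=> mf mg fg; rewrite /Rintegral; congr fine; apply: ae_eq_integral => //.
- exact/measurable_EFinP.
- exact/measurable_EFinP.
- by apply: filterS fg => x /= + Dx => /(_ Dx) ->.
Qed.

Lemma Rintegral_eq0_ae f : itg m D f -> (forall x, D x -> 0 <= f x) ->
  \int[m]_(x in D) f x = 0 -> ae_eq m D f (fun=> 0).
Proof.
move=> fi f0 I0.
have E : (\int[m]_(x in D) `|(f x)%:E| = 0)%E.
  rewrite -[RHS]/((0:R)%:E) -I0 EFin_Rintegral//; apply: eq_integral => x /set_mem Dx.
  by rewrite gee0_abs// lee_fin f0.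
have /ae_eq_integral_abs : measurable_fun D (EFin \o f) by exact: measurable_int fi.
move=> /(_ m mD)[/(_ E) h _].
by apply: filterS h => x /= + Dx => /(_ Dx) [].
Qed.

(** The limit is replaced, almost everywhere, by the lower limit, to which Fatou's lemma applies. *)
Lemma fatou_le (h_ : nat -> T -> R) (h : T -> R) (c : \bar R) :
  (forall n, measurable_fun D (h_ n)) -> measurable_fun D h ->
  (forall n x, D x -> 0 <= h_ n x) ->
  (\forall x \ae m, D x -> h_ n x @[n --> \oo] --> h x) ->
  (\forall n \near \oo, (\int[m]_(x in D) (h_ n x)%:E <= c)%E) ->
  (\int[m]_(x in D) (h x)%:E <= c)%E.
Proof.
move=> mh_ mh h0 hh hc.
have -> : (\int[m]_(x in D) (h x)%:E = \int[m]_(x in D) limn_einf (fun n => (h_ n x)%:E))%E.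
  apply: ae_eq_integral => //.
  - exact/measurable_EFinP.
  - rewrite /limn_einf; apply: measurableT_comp => //.
    apply: (@measurable_fun_limn_esup _ _ _ _ (fun n x => - (h_ n x)%:E)%E) => n.
    by apply: measurableT_comp => //; exact/measurable_EFinP.
  - apply: filterS hh => x + Dx => /(_ Dx) hx.
    have /cvg_limn_einf_sup[-> _] // : (h_ n x)%:E @[n --> \oo] --> (h x)%:E.
    by apply: cvg_EFin; [exact: nearW|exact: hx].
have F := @fatou _ _ _ m D mD (fun n x => (h_ n x)%:E) _ _.
apply: le_trans (F _ _) _.
- by move=> n; exact/measurable_EFinP.
- by move=> n x Dx; rewrite lee_fin h0.
rewrite limn_einf_lim; apply: lime_le; first exact: is_cvg_einfs.
apply: filterS hc => n; apply: le_trans.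
by apply: ereal_inf_lbound; exists n => //=.
Qed.
End integrability.

(** For c > 0 the quadratic is evaluated at its minimum [- b / c]. For c < 0 the mean of its values
    at two large opposite points is negative, and for c = 0 a single value excludes a nonzero b. *)
Lemma discriminant_le (R : realType) (a b c : R) :
  (forall t, 0 <= a + 2 * t * b + t ^+ 2 * c) -> b ^+ 2 <= a * c.
Proof.
move=> h; have a0 : 0 <= a by have := h 0; rewrite mulr0 mul0r expr0n/= mul0r !addr0.
have [c0|c0|c0] := ltgtP c 0.
- have u0 : 0 <= (a + 1) / - c by rewrite divr_ge0//; lra.
  set u := (a + 1) / - c in u0.
  have uc : u * c = - (a + 1) by rewrite /u; field; lra.
  have := h (u + 1); have := h (- (u + 1)).
  have : a + (u + 1) ^+ 2 * c < 0.
    have -> : a + (u + 1) ^+ 2 * c = a + u * (u * c) + 2 * (u * c) + c by ring.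
    rewrite uc; nra.
  rewrite sqrrN; lra.
- have := h (- b / c).
  have -> : a + 2 * (- b / c) * b + (- b / c) ^+ 2 * c = (a * c - b ^+ 2) / c by field; lra.
  by rewrite pmulr_lge0 ?invr_gt0// subr_ge0.
- rewrite c0 mulr0 in h *; have [->|b0] := eqVneq b 0; first by rewrite expr0n.
  have := h (- (a + 1) / (2 * b)).
  have -> : 2 * (- (a + 1) / (2 * b)) * b = - (a + 1) by field.
  lra.
Qed.

(** Trades a first power for a square with an adjustable weight. With [a] a power of 1/2 it turns
    geometric decay of squared distances into geometric decay of integrals. *)
Lemma young_le (R : realType) (a v : R) : 0 < a ->
  v <= 2^-1 * a^-1 * v ^+ 2 + 2^-1 * a.
Proof.
move=> a0; have : 0 <= a^-1 * (v - a) ^+ 2 by rewrite mulr_ge0 ?sqr_ge0// invr_ge0 ltW.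
have -> : a^-1 * (v - a) ^+ 2 = a^-1 * v ^+ 2 - 2 * v + a by field; lra.
lra.
Qed.

(** * Square-integrable functions and completeness *)

Section square_integrable.
Context d (T : measurableType d) (R : realType) (m : {measure set T -> \bar R}).
Context (D : set T) (mD : measurable D).
Implicit Types f g : T -> R.

Lemma in_L2_sqr f : in_L2 m D f -> itg m D (fun x => f x ^+ 2).
Proof. by case. Qed.

Lemma in_L2_itgM f g : in_L2 m D f -> in_L2 m D g -> itg m D (fun x => f x * g x).
Proof.
move=> [mf f2] [mg g2]; apply: (@itg_le _ _ _ _ _ mD _ (fun x => f x ^+ 2 + g x ^+ 2)).
- exact: measurable_funM.
- exact: (itgD mD f2 g2).
- move=> x _; rewrite normrM -(real_normK (num_real (f x))) -(real_normK (num_real (g x))).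
  have := sqr_ge0 (`|f x| - `|g x|); have := normr_ge0 (f x); have := normr_ge0 (g x); nra.
Qed.

Lemma in_L2D f g : in_L2 m D f -> in_L2 m D g -> in_L2 m D (fun x => f x + g x).
Proof.
move=> Lf Lg; have fg := in_L2_itgM Lf Lg; have [mf _] := Lf; have [mg _] := Lg.
have f2 := in_L2_sqr Lf; have g2 := in_L2_sqr Lg; split.
  exact: measurable_funD.
apply: (eq_itg mD (f := fun x => f x ^+ 2 + 2 * (f x * g x) + g x ^+ 2)).
  by move=> x _; ring.
exact: (itgD mD (itgD mD f2 (itgZ mD 2 fg)) g2).
Qed.

Lemma in_L2Z c f : in_L2 m D f -> in_L2 m D (fun x => c * f x).
Proof.
move=> [mf f2]; split; first by apply: measurable_funM => //; exact: measurable_cst.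
apply: (eq_itg mD (f := fun x => c ^+ 2 * f x ^+ 2)); last exact: itgZ.
by move=> x _; rewrite exprMn.
Qed.

Lemma in_L2N f : in_L2 m D f -> in_L2 m D (fun x => - f x).
Proof. by move=> /(in_L2Z (-1)); congr in_L2; apply/funext => x; rewrite mulN1r. Qed.

Lemma in_L2B f g : in_L2 m D f -> in_L2 m D g -> in_L2 m D (fun x => f x - g x).
Proof. by move=> Lf /in_L2N; exact: in_L2D. Qed.

Lemma in_L2_bounded f (c : R) : (m D < +oo)%E -> measurable_fun D f ->
  (forall x, D x -> `|f x| <= c) -> in_L2 m D f.
Proof.
move=> fD mf h; split=> //; apply: (itg_bounded mD (c := c ^+ 2)) => //.
- exact: measurable_funX.
- by move=> x Dx; rewrite normrX lerXn2r ?nnegrE// ?h// (le_trans _ (h x Dx)).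
Qed.

Lemma in_L2M_bounded f g (c : R) : in_L2 m D f -> measurable_fun D g ->
  (forall x, D x -> `|g x| <= c) -> in_L2 m D (fun x => g x * f x).
Proof.
move=> [mf f2] mg h; split; first exact: measurable_funM.
apply: (eq_itg mD (f := fun x => g x ^+ 2 * f x ^+ 2)); first by move=> x _; rewrite exprMn.
apply: (itgM_bounded mD (c := c ^+ 2)) => //; first exact: measurable_funX.
by move=> x Dx; rewrite normrX lerXn2r ?nnegrE// ?h// (le_trans _ (h x Dx)).
Qed.

Lemma in_L2_itg f : (m D < +oo)%E -> in_L2 m D f -> itg m D f.
Proof.
move=> fD Lf; apply: (eq_itg mD (f := fun x => f x * 1)); first by move=> x _; rewrite mulr1.
apply: in_L2_itgM => //; apply: (in_L2_bounded (c := 1)) => //.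
by move=> x _; rewrite normr1.
Qed.

Lemma cauchy_schwarz f g : in_L2 m D f -> in_L2 m D g ->
  (\int[m]_(x in D) (f x * g x)) ^+ 2 <=
  (\int[m]_(x in D) (f x ^+ 2)) * \int[m]_(x in D) (g x ^+ 2).
Proof.
move=> Lf Lg; apply: discriminant_le => t.
have fg := in_L2_itgM Lf Lg; have f2 := in_L2_sqr Lf; have g2 := in_L2_sqr Lg.
have : 0 <= \int[m]_(x in D) ((f x + t * g x) ^+ 2).
  by apply: Rintegral_ge0 => x _; exact: sqr_ge0.
congr (_ <= _).
rewrite -!RintegralZl// -!RintegralD//; first by apply: Rintegral_eq => x _; ring.
- exact: (itgD mD f2 (itgZ mD _ fg)).
- exact: (itgZ mD _ g2).
- exact: (itgZ mD _ fg).
Qed.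

Lemma geometric_half_le (N : nat) : \sum_(0 <= n < N) (2^-1 : R) ^+ n <= 2.
Proof.
have -> : \sum_(0 <= n < N) (2^-1 : R) ^+ n = 2 - 2 * 2^-1 ^+ N; last first.
  by rewrite gerBl mulr_ge0// exprn_ge0// invr_ge0.
elim: N => [|N IH]; first by rewrite big_nil expr0; ring.
by rewrite big_nat_recr//= IH exprS; field.
Qed.

(** The geometric rate makes the series of the absolute differences integrable, hence finite almost
    everywhere, so that the whole sequence converges pointwise almost everywhere. Fatou's lemma
    carries the rate over to the limit. *)
Lemma riesz_fischer (f_ : nat -> T -> R) : (m D < +oo)%E ->
  (forall n, in_L2 m D (f_ n)) ->
  (forall n p, (n <= p)%N -> \int[m]_(x in D) ((f_ n x - f_ p x) ^+ 2) <= 4^-1 ^+ n) ->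
  exists f : T -> R, [/\ in_L2 m D f,
    (forall n, \int[m]_(x in D) ((f_ n x - f x) ^+ 2) <= 4^-1 ^+ n) &
    (\forall x \ae m, D x -> f_ n x @[n --> \oo] --> f x)].
Proof.
move=> fD L2 cau.
have mf n : measurable_fun D (f_ n) by case: (L2 n).
(* This is the constant produced by Young's inequality with parameter [2^-1 ^+ n], since the squared
   differences have integral at most [4^-1 ^+ n]. *)
pose c := (fine (m D) + 1) / 2.
have DE : (fine (m D))%:E = m D by rewrite fineK// ge0_fin_numE.
have c0 : 0 <= c by rewrite divr_ge0// addr_ge0// fine_ge0.
pose g n x : R := `|f_ n.+1 x - f_ n x|.
have g0 n x : (0 <= (g n x)%:E)%E by rewrite lee_fin normr_ge0.
have mg n : measurable_fun D (g n).
  by apply: measurableT_comp => //; exact: measurable_funB.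
have Ig n : (\int[m]_(x in D) (g n x)%:E <= (c * 2^-1 ^+ n)%:E)%E.
  have L := in_L2B (L2 n.+1) (L2 n).
  rewrite -(EFin_Rintegral mD); last exact: itg_abs (in_L2_itg fD L).
  rewrite lee_fin; set a : R := 2^-1 ^+ n.
  have a0 : 0 < a by rewrite exprn_gt0// invr_gt0.
  apply: (@le_trans _ _ (\int[m]_(x in D) (2^-1 * a^-1 * (f_ n.+1 x - f_ n x) ^+ 2 + 2^-1 * a))).
    apply: le_Rintegral => //.
    - exact: itg_abs (in_L2_itg fD L).
    - exact: (itgD mD (itgZ mD _ (in_L2_sqr L)) (itg_cst mD _ fD)).
    move=> x _; rewrite /g -(real_normK (num_real (f_ n.+1 x - f_ n x))).
    exact: young_le.
  rewrite RintegralD//; last 2 first.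
  - exact: (itgZ mD _ (in_L2_sqr L)).
  - exact: (itg_cst mD _ fD).
  rewrite (RintegralZl _ mD (in_L2_sqr L)) (Rintegral_cst _ mD).
  have := cau n n.+1 (leqnSn n).
  have -> : \int[m]_(x in D) ((f_ n x - f_ n.+1 x) ^+ 2) = \int[m]_(x in D) ((f_ n.+1 x - f_ n x) ^+ 2).
    by apply: Rintegral_eq => x _; rewrite -sqrrN opprB.
  set I := Rintegral _ _ _.
  have -> : 4^-1 ^+ n = a * a :> R by rewrite /a -exprMn; congr (_ ^+ _); field.
  move=> I1; have : a^-1 * I <= a by rewrite ler_pdivrMl.
  rewrite /c -/a; lra.
pose G x := (\sum_(0 <= n <oo) (g n x)%:E)%E.
have G0 x : (0 <= G x)%E by apply: nneseries_ge0.
have mG : measurable_fun D G.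
  by apply: ge0_emeasurable_sum => // n _; exact/measurable_EFinP.
have IG : m.-integrable D G.
  apply/integrableP; split => //.
  have -> : (\int[m]_(x in D) `|G x| = \int[m]_(x in D) G x)%E.
    by apply: eq_integral => x _; rewrite gee0_abs.
  rewrite /G integral_nneseries//; last by move=> n; exact/measurable_EFinP.
  apply: (@le_lt_trans _ _ (c * 2)%:E); last exact: ltry.
  apply: lime_le.
    by apply: is_cvg_nneseries => n _ _; apply: integral_ge0.
  apply: nearW => N.
  apply: (@le_trans _ _ (\sum_(0 <= n < N) (c * 2^-1 ^+ n)%:E)%E).
    by apply: lee_sum => n _; exact: Ig.
  by rewrite sumEFin lee_fin -mulr_sumr ler_wpM2l// geometric_half_le.
have cv : \forall x \ae m, D x -> cvgn (f_ ^~ x).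
  apply: filterS (integrable_ae mD IG) => x + Dx => /(_ Dx) Gf.
  have -> : (f_ ^~ x) = (fun n => f_ 0 x + series (telescope (f_ ^~ x)) n).
    by apply/funext => n; rewrite -eq_sum_telescope.
  apply: is_cvgD; first exact: is_cvg_cst.
  apply: normed_cvg; apply: nondecreasing_is_cvgn.
    by apply: nondecreasing_series => n _ _; exact: normr_ge0.
  exists (fine (G x)) => _ [n _ <-].
  rewrite -lee_fin fineK// /series/= -sumEFin.
  by apply: nneseries_lim_ge.
(* The upper limit is defined and measurable everywhere, and it equals the limit almost
   everywhere. *)
pose f x := fine (limn_esup (fun n => (f_ n x)%:E)).
have fc : \forall x \ae m, D x -> f_ n x @[n --> \oo] --> f x.
  apply: filterS cv => x + Dx => /(_ Dx) h.
  have /cvg_limn_einf_sup[_ E] : (f_ n x)%:E @[n --> \oo] --> (limn (f_ ^~ x))%:E.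
    by apply: cvg_EFin; [exact: nearW|exact: h].
  by rewrite /f E.
have mf' : measurable_fun D f.
  apply: (@measurableT_comp _ _ _ _ _ _ fine) => //.
  by apply: (@measurable_fun_limn_esup _ _ _ _ (fun n x => (f_ n x)%:E)) => n; exact/measurable_EFinP.
have F n : (\int[m]_(x in D) ((f_ n x - f x) ^+ 2)%:E <= (4^-1 ^+ n)%:E)%E.
  apply: (@fatou_le _ _ _ _ _ mD (fun p x => (f_ n x - f_ p x) ^+ 2)).
  - by move=> p; apply: measurable_funX; apply: measurable_funB.
  - by apply: measurable_funX; apply: measurable_funB.
  - by move=> p x _; exact: sqr_ge0.
  - apply: filterS fc => x + Dx => /(_ Dx) h.
    have k : f_ n x - f_ p x @[p --> \oo] --> f_ n x - f x.
      by apply: cvgB => //; exact: cvg_cst.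
    exact: (cvgM k k).
  - exists n => // p /= np; rewrite -EFin_Rintegral ?lee_fin ?cau//.
    by have [] := in_L2B (L2 n) (L2 p).
have LF n : in_L2 m D (fun x => f_ n x - f x).
  split; first exact: measurable_funB.
  apply/integrableP; split.
    by apply/measurable_EFinP; apply: measurable_funX; apply: measurable_funB.
  have -> : (\int[m]_(x in D) `|((f_ n x - f x) ^+ 2)%:E| = \int[m]_(x in D) ((f_ n x - f x) ^+ 2)%:E)%E.
    by apply: eq_integral => x _; rewrite gee0_abs// lee_fin sqr_ge0.
  exact: le_lt_trans (F n) (ltry _).
exists f; split => //.
- have := in_L2B (L2 0) (LF 0); congr in_L2; apply/funext => x; ring.
- by move=> n; rewrite -lee_fin EFin_Rintegral//; case: (LF n).
Qed.
End square_integrable.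

(* The direct method without weak topologies: elements of almost minimal
   "energy" [q] in a decreasing sequence of midpoint-convex sets form a Cauchy
   sequence, by the parallelogram identity. *)
Lemma almost_minimizers_cauchy (R : realType) (V : Type) (half : V -> V -> V) (q : V -> R)
    (dist : V -> V -> R) (C : nat -> set V) (k : R) :
  (forall n p, (n <= p)%N -> C p `<=` C n) ->
  (forall n u v, C n u -> C n v -> C n (half u v)) ->
  (forall u, C 0 u -> 0 <= q u) ->
  (forall u v, C 0 u -> C 0 v -> dist u v = 2 * q u + 2 * q v - 4 * q (half u v)) ->
  (forall n e, 0 < e -> exists2 u, C n u & q u <= k + e) ->
  exists v : nat -> V, exists a : R,
    [/\ a <= k, forall n, C n (v n), forall n, q (v n) <= a + 4^-1 ^+ n &
        forall n p, (n <= p)%N -> dist (v n) (v p) <= 4^-1 ^+ n].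
Proof.
move=> decr mid q0 par bnd.
have C0 n u : C n u -> C 0 u by exact: decr.
have inf_n n : has_inf (q @` C n).
  split; first by have [u Cu _] := bnd n 1 ltr01; exists (q u), u.
  by exists 0 => _ [u /C0 Cu <-]; exact: q0.
pose a_ n := inf (q @` C n).
have a_le n u : C n u -> a_ n <= q u by move=> Cu; apply: ge_inf; [case: (inf_n n)|exists u].
have a_k n : a_ n <= k.
  apply/ler_addgt0Pr => e e0; have [u Cu] := bnd n e e0.
  exact: le_trans (a_le _ _ Cu).
have sup_a : has_sup (range a_).
  by split; [exists (a_ 0), 0|exists k => _ [n _ <-]].
(* The sets shrink, so the infima [a_ n] increase; [a] is their limit, and the energies of the
   chosen elements will approach it. *)
pose a := sup (range a_).
have a_a n : a_ n <= a by apply: sup_ubound; [case: sup_a|exists n].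
have near_a e : 0 < e -> exists n, a - e < a_ n.
  by move=> e0; have [_ [n _ <-] h] := sup_adherent e0 sup_a; exists n.
have a_mono n p : (n <= p)%N -> a_ n <= a_ p.
  move=> np; apply: lb_le_inf; first by case: (inf_n p).
  by move=> _ [u Cu <-]; apply: a_le; exact: decr Cu.
(* Two chosen elements have energy at most [a + d n] and their midpoint has energy above [a - d n];
   the parallelogram identity then bounds their distance by [8 * d n]. *)
pose d n : R := 4^-1 ^+ n / 8.
have d0 n : 0 < d n by rewrite divr_gt0// exprn_gt0// invr_gt0.
have d_mono n p : (n <= p)%N -> d p <= d n.
  by move=> np; rewrite ler_pM2r ?invr_gt0// ler_wiXn2l// ?invr_ge0// invf_le1// ler1n.
have /choice[N_ hN] : forall n, exists N, a - d n < a_ N by move=> n; exact: near_a.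
(* Summation makes the indices nondecreasing, so that later elements also belong to the earlier
   sets, and gives [n <= M n]. *)
pose M n := (\sum_(i < n.+1) (N_ i).+1)%N.
have M_mono n p : (n <= p)%N -> (M n <= M p)%N.
  move=> np; rewrite /M -!(big_mkord xpredT (fun i => (N_ i).+1)).
  by rewrite [leqRHS](@big_cat_nat _ _ _ n.+1)//= leq_addr.
have M_n n : (n <= M n)%N.
  rewrite /M -[leqLHS](card_ord n) -sum1_card big_ord_recr/=.
  by apply: leq_trans (leq_addr _ _); exact: leq_sum.
have hM n : a - d n < a_ (M n).
  apply: lt_le_trans (hN n) _; apply: a_mono.
  by rewrite /M big_ord_recr/=; apply: leq_trans (leq_addl _ _); exact: leqnSn.
have /choice[v hv] : forall n, exists v, C (M n) v /\ q v < a_ (M n) + d n.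
  move=> n; have [_ [u Cu <-] h] := inf_adherent (d0 n) (inf_n (M n)).
  by exists u.
have d4 n : 8 * d n = 4^-1 ^+ n by rewrite /d; field.
exists v, a; split.
- by apply: ge_sup => [|_ [n _ <-]//]; case: sup_a.
- by move=> n; have [Cv _] := hv n; exact: (decr _ _ (M_n n)).
- by move=> n; have [_ h] := hv n; have := a_a (M n); have := d0 n; rewrite -d4; lra.
- move=> n p np; have [Cn hn] := hv n; have [Cp hp] := hv p.
  have Cp' : C (M n) (v p) by apply: decr Cp; exact: M_mono.
  rewrite par; [|exact: C0 Cn|exact: C0 Cp].
  have := a_le _ _ (mid _ _ _ Cn Cp').
  have := hM n; have := a_a (M n); have := a_a (M p); have := d_mono _ _ np.
  rewrite -d4; lra.
Qed.

(** * Absolutely continuous functions as primitives *)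

Section absolutely_continuous.
Context {R : realType}.
Local Notation leb := (@lebesgue_measure R).
Implicit Types (a b c e x y : R) (f g F : R -> R).

Lemma continuous_meas f (D : set R) : measurable (D : set (measurableTypeR R)) -> continuous f ->
  measurable_fun D f.
Proof.
by move=> _ cf; apply: measurable_funTS; exact: continuous_measurable_fun.
Qed.

Lemma continuous_itg f a b : continuous f -> itg leb `[a, b] f.
Proof.
move=> cf; apply: continuous_compact_integrable; first exact: segment_compact.
exact: continuous_subspaceT.
Qed.

Lemma within_itg f a b : {within `[a, b], continuous f} -> itg leb `[a, b] f.
Proof. by move=> cf; apply: continuous_compact_integrable => //; exact: segment_compact. Qed.

Lemma itg_sub f a b c e : itg leb `[a, b] f -> a <= c -> e <= b -> itg leb `[c, e] f.
Proof.
move=> fi ac eb; apply: integrableS fi => //; apply: subset_itvScc.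
- by rewrite bnd_simp.
- by rewrite bnd_simp.
Qed.

Lemma Rintegral_split f a b c : itg leb `[a, c] f -> a <= b <= c ->
  \int[leb]_(x in `[a, c]) f x = \int[leb]_(x in `[a, b]) f x + \int[leb]_(x in `[b, c]) f x.
Proof.
move=> fi /andP[ab bc].
have := @Rintegral_itvB R f (BLeft a) (BRight c) b fi; rewrite !bnd_simp ab bc => /(_ isT isT).
rewrite Rintegral_itv_obnd_cbnd; last first.
  by apply: integrableS fi => //; apply: subset_itv; rewrite bnd_simp.
by move=> <-; rewrite addrC subrK.
Qed.

Lemma Rintegral_point f a : \int[leb]_(x in `[a, a]) f x = 0.
Proof. by rewrite set_itv1 Rintegral_set1. Qed.

Lemma Rintegral_le_norm f a b : itg leb `[a, b] f ->
  `|\int[leb]_(x in `[a, b]) f x| <= \int[leb]_(x in `[a, b]) `|f x|.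
Proof. by move=> fi; exact: le_normr_Rintegral. Qed.

Lemma le_Rintegral_sub f a b c e : itg leb `[a, b] f -> a <= c -> e <= b ->
  (forall x, 0 <= f x) ->
  \int[leb]_(x in `[c, e]) f x <= \int[leb]_(x in `[a, b]) f x.
Proof.
move=> fi ac eb f0; rewrite /Rintegral; apply: fine_le.
- by apply: integrable_fin_num => //; exact: itg_sub ac eb.
- exact: integrable_fin_num.
- apply: ge0_subset_integral => //.
  + by case/integrableP: fi.
  + by move=> x _; rewrite lee_fin.
  + by apply: subset_itvScc; rewrite bnd_simp.
Qed.

Lemma Rintegral_itv_cst c a b : a <= b -> \int[leb]_(x in `[a, b]) c = c * (b - a).
Proof.
move=> ab; rewrite Rintegral_cst//=; congr (_ * _).
have := @lebesgue_measure_itv R `[a, b]; rewrite /= => ->.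
rewrite lte_fin; case: ifPn => [_|]; first by rewrite -EFinB.
by rewrite -leNgt => ba; have -> : a = b; [lra|rewrite subrr].
Qed.

(** Absolute continuity on [[a, b]] with a chosen derivative. The rules of calculus for this notion
    are obtained by approximating [g] in L^1 by continuous functions. *)
Definition is_primitive a b f g : Prop :=
  itg leb `[a, b] g /\
  forall x, a <= x <= b -> f x = f a + \int[leb]_(t in `[a, x]) g t.

Lemma FTC f g a b : a <= b -> (forall x, a <= x <= b -> is_derive x 1 f (g x)) ->
  {within `[a, b], continuous g} -> \int[leb]_(x in `[a, b]) g x = f b - f a.
Proof.
rewrite le_eqVlt => /orP[/eqP ->|ab] df cg; first by rewrite Rintegral_point subrr.
have cf x : a <= x <= b -> {for x, continuous f}.
  move=> /df dfx; apply: differentiable_continuous; apply/derivable1_diffP.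
  by case: dfx.
have := @continuous_FTC2 R g f a b ab cg.
rewrite /Rintegral => -> //.
- split.
  + move=> x; rewrite in_itv/= => /andP[/ltW ax /ltW xb].
    by have [] : is_derive x 1 f (g x) by apply: df; rewrite ax xb.
  + by apply: cvg_at_right_filter; apply: cf; rewrite lexx ltW.
  + by apply: cvg_at_left_filter; apply: cf; rewrite lexx ltW.
- move=> x; rewrite in_itv/= => /andP[/ltW ax /ltW xb].
  have dx : is_derive x 1 f (g x) by apply: df; rewrite ax xb.
  by rewrite derive1E derive_val.
Qed.

Lemma primitive_of_continuous h a y : continuous h ->
  exists F, F a = y /\ forall x, a <= x -> is_derive x 1 F (h x).
Proof.
move=> ch; pose F x := \int[leb]_(t in `[a - 1, x]) h t.
exists (fun x => F x + (y - F a)); split; first by rewrite addrC subrK.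
move=> x ax.
have : derivable F x 1 /\ F^`()%classic x = h x.
  apply: (@continuous_FTC1_closed R h (a - 1) x (x + 1)).
  - by rewrite ltrDl.
  - exact: continuous_itg.
  - lra.
  - exact: ch.
move=> [dF]; rewrite derive1E => EF.
have dF' : is_derive x 1 F (h x) by split.
rewrite -[h x]addr0; apply: is_deriveD; exact: dF'.
Qed.

(** Continuous functions are dense in L^1, and primitives with the same initial value are uniformly
    close when their derivatives are close in L^1. This reduces identities for primitives to the
    fundamental theorem for continuous integrands. *)
Lemma is_primitive_approx a b f g e : is_primitive a b f g -> a <= b -> 0 < e ->
  exists h F, [/\ continuous h, forall x, a <= x -> is_derive x 1 F (h x), F a = f a,
    \int[leb]_(x in `[a, b]) `|g x - h x| <= e &
    forall x, a <= x <= b -> `|f x - F x| <= e].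
Proof.
move=> [gi fg] ab e0.
have abl : (leb (`[a, b] : set R) < +oo)%E.
  by rewrite lebesgue_measure_itv/=; case: ifP => _; rewrite ?ltry// -EFinB ltry.
have [h_ [ch hi hc]] := @approximation_continuous_integrable R `[a, b] g
  (measurable_itv _) abl gi.
have /(_ _ e0) : forall e, 0 < e -> exists n,
    (\int[leb]_(z in `[a, b]) `|(g z - h_ n z)%:E| <= e%:E)%E.
  move=> e1 e10; have /fine_cvgP[fin /cvgr0Pnorm_le /(_ _ e10) cv] := hc.
  have [n [fn hn]] := filter_ex (filterI fin cv); exists n.
  by rewrite -(fineK fn) lee_fin; apply: le_trans hn; exact: ler_norm.
move=> [n hn].
have gh : itg leb `[a, b] (fun x => g x - h_ n x) by exact: (itgB _ gi (hi n)).
have hn' : \int[leb]_(x in `[a, b]) `|g x - h_ n x| <= e.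
  rewrite -lee_fin EFin_Rintegral//; exact: itg_abs.
have [F [Fa dF]] := primitive_of_continuous a (f a) (ch n).
exists (h_ n), F; split => // x /andP[ax xb].
have fx := fg x; rewrite ax xb in fx.
have -> : F x = f a + \int[leb]_(t in `[a, x]) h_ n t.
  have -> : \int[leb]_(t in `[a, x]) h_ n t = F x - F a.
    apply: FTC => // [z /andP[az _]|]; first exact: dF.
    by apply: continuous_subspaceT; exact: ch.
  by rewrite Fa addrC subrK.
rewrite fx// opprD addrACA subrr add0r -RintegralB//; last 2 first.
- exact: itg_sub gi (lexx _) xb.
- exact: itg_sub (hi n) (lexx _) xb.
apply: le_trans (Rintegral_le_norm _) _; first exact: itg_sub gh (lexx _) xb.
apply: le_trans hn'; apply: le_Rintegral_sub => //; exact: itg_abs.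
Qed.

Lemma is_primitive_sub a b c e f g : is_primitive a b f g -> a <= c -> c <= e -> e <= b ->
  is_primitive c e f g.
Proof.
move=> [gi fg] ac ce eb; split; first exact: itg_sub gi ac eb.
move=> x /andP[cx xe].
rewrite (fg x); last by apply/andP; split; lra.
rewrite (fg c); last by apply/andP; split; lra.
rewrite -addrA -Rintegral_split//; last by rewrite ac cx.
by apply: itg_sub gi _ _ => //; lra.
Qed.

Lemma is_primitive_cts a b f g : a <= b -> is_primitive a b f g -> {within `[a, b], continuous f}.
Proof.
move=> ab [gi fg].
have : {within `[a, b], continuous (fun x => f a + \int[leb]_(t in `[a, x]) g t)}.
  move=> x; apply: cvgD; first exact: cvg_cst.
  exact: (parameterized_integral_continuous ab gi).
apply: subspace_eq_continuous => x /set_mem; rewrite /= in_itv/= => axb.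
by rewrite /from_subspace (fg x axb).
Qed.

Lemma eps_eq0 (z K : R) : (forall e, 0 < e -> `|z| <= K * e) -> z = 0.
Proof.
move=> h; apply/eqP; rewrite -normr_le0; apply/ler_addgt0Pr => e e0; rewrite add0r.
have K1 : 0 < `|K| + 1 by rewrite ltr_pwDr.
apply: le_trans (h (e / (`|K| + 1)) _) _; first by rewrite divr_gt0.
rewrite mulrCA ger_pMr// ler_pdivrMr// mul1r; have := ler_norm K; lra.
Qed.

(* Both sides depend continuously on [(f, g)], in the uniform and the [L^1]
   norms, so that it suffices to consider continuous [g]. *)
Lemma is_primitive_ibp a b f g (p p' : R -> R) : a <= b -> is_primitive a b f g ->
  (forall x, is_derive x 1 p (p' x)) -> continuous p' ->
  \int[leb]_(x in `[a, b]) (g x * p x + f x * p' x) = f b * p b - f a * p a.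
Proof.
move=> ab fg dp cp'; have [gi _] := fg.
have cp : continuous p.
  move=> x; apply: differentiable_continuous; apply/derivable1_diffP; by case: (dp x).
have fi : {within `[a, b], continuous f} by exact: is_primitive_cts fg.
have [c1 _ M1] := EVT_max ab (continuous_subspaceT (fun x => cvg_norm (cp x))).
have [c2 _ M2] := EVT_max ab (continuous_subspaceT (fun x => cvg_norm (cp' x))).
pose M : R := `|p c1| + `|p' c2|.
have hM x : a <= x <= b -> `|p x| <= M /\ `|p' x| <= M.
  move=> axb; split; [apply: le_trans (M1 x axb) _|apply: le_trans (M2 x axb) _].
    by rewrite lerDl.
  by rewrite lerDr.
have M0 : 0 <= M by rewrite addr_ge0.
apply/eqP; rewrite -subr_eq0; apply/eqP.
apply: (@eps_eq0 _ (M * (3 + (b - a)))) => e e0.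
have [h [F [ch dF Fa gh fF]]] := is_primitive_approx fg ab e0.
have cF : {within `[a, b], continuous F}.
  apply: derivable_within_continuous => x; rewrite in_itv/= => /andP[ax _].
  by have [] := dF x ax.
have E : \int[leb]_(x in `[a, b]) (F x * p' x + p x * h x) = F b * p b - F a * p a.
  apply: (@FTC (fun x => F x * p x)) => // [x /andP[ax _]|].
    exact: is_deriveM (dF x ax) (dp x).
  move=> x; apply: cvgD; apply: cvgM; first exact: cF.
  - by apply: continuous_subspaceT; exact: cp'.
  - by apply: continuous_subspaceT; exact: cp.
  - by apply: continuous_subspaceT; exact: ch.
have gp : itg leb `[a, b] (fun x => p x * (g x - h x) + (f x - F x) * p' x).
  apply: itgD => //.
    apply: (itgM_bounded _ (c := M)) => //.
    - exact: itgB gi (continuous_itg _ _ ch).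
    - exact: continuous_meas cp.
    - by move=> x; rewrite /= in_itv/= => /hM[].
  apply: within_itg => x; apply: cvgM; first by apply: cvgB; [exact: fi|exact: cF].
  by apply: continuous_subspaceT; exact: cp'.
have Ei : itg leb `[a, b] (fun x => F x * p' x + p x * h x).
  apply: within_itg => x; apply: cvgD; apply: cvgM; first exact: cF.
  - by apply: continuous_subspaceT; exact: cp'.
  - by apply: continuous_subspaceT; exact: cp.
  - by apply: continuous_subspaceT; exact: ch.
have -> : \int[leb]_(x in `[a, b]) (g x * p x + f x * p' x) - (f b * p b - f a * p a) =
    \int[leb]_(x in `[a, b]) (p x * (g x - h x) + (f x - F x) * p' x) - (f b - F b) * p b.
  have -> : \int[leb]_(x in `[a, b]) (g x * p x + f x * p' x) =
      \int[leb]_(x in `[a, b]) (p x * (g x - h x) + (f x - F x) * p' x) +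
      \int[leb]_(x in `[a, b]) (F x * p' x + p x * h x).
    by rewrite -RintegralD//; apply: Rintegral_eq => x _; ring.
  rewrite E Fa; ring.
have I1 : `|\int[leb]_(x in `[a, b]) (p x * (g x - h x) + (f x - F x) * p' x)| <=
   M * e + M * e * (b - a).
  apply: le_trans (Rintegral_le_norm gp) _.
  have ghi : itg leb `[a, b] (fun x => `|g x - h x|).
    by apply: itg_abs => //; apply: itgB => //; exact: continuous_itg.
  have ci : itg leb `[a, b] (fun=> M * e) by apply: continuous_itg; exact: cst_continuous.
  apply: (@le_trans _ _ (\int[leb]_(x in `[a, b]) (M * `|g x - h x| + M * e))).
    apply: le_Rintegral => //.
    - exact: itg_abs.
    - by apply: itgD => //; exact: itgZ.
    move=> x; rewrite /= in_itv/= => axb; have [px p'x] := hM x axb.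
    apply: le_trans (ler_normD _ _) _; rewrite !normrM lerD//.
      by rewrite ler_wpM2r.
    by rewrite mulrC ler_pM// fF.
  rewrite RintegralD//; last exact: itgZ.
  rewrite RintegralZl// Rintegral_itv_cst//.
  by rewrite lerD// ler_wpM2l.
apply: le_trans (ler_normB _ _) _.
have I2 : `|(f b - F b) * p b| <= e * M.
  rewrite normrM ler_pM//; first by rewrite fF// ab lexx.
  by case: (hM b) => //; rewrite ab lexx.
have : 0 <= M * e by rewrite mulr_ge0// ltW.
lra.
Qed.
End absolutely_continuous.

(** * Almost-everywhere statements and dominated convergence *)

Section almost_everywhere.
Context d (T : measurableType d) (R : realType) (m : {measure set T -> \bar R}).
Implicit Types P Q S : T -> Prop.

Lemma ae_mono P Q : (forall x, P x -> Q x) ->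
  (\forall x \ae m, P x) -> \forall x \ae m, Q x.
Proof. by move=> PQ; apply: filterS. Qed.

Lemma ae_mono2 P Q S : (forall x, P x -> Q x -> S x) ->
  (\forall x \ae m, P x) -> (\forall x \ae m, Q x) -> \forall x \ae m, S x.
Proof. by move=> PQ; apply: filterS2. Qed.
End almost_everywhere.

Section dominated.
Context d (T : measurableType d) (R : realType) (m : {measure set T -> \bar R}).
Context (D : set T) (mD : measurable D).

Lemma Rdominated (f_ : nat -> T -> R) (f g : T -> R) :
  (forall n, measurable_fun D (f_ n)) -> measurable_fun D f ->
  (forall x, D x -> f_ n x @[n --> \oo] --> f x) -> itg m D g ->
  (forall n x, D x -> `|f_ n x| <= g x) ->
  \int[m]_(x in D) f_ n x @[n --> \oo] --> \int[m]_(x in D) f x.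
Proof.
move=> mf_ mf ff gi fg.
have fi : itg m D f.
  apply: itg_le gi _ => // x Dx.
  have cv : `|f_ n x| @[n --> \oo] --> `|f x| by apply: cvg_norm; exact: ff.
  rewrite -(cvg_lim _ cv)//.
  by apply: limr_le; [exact: cvgP cv|apply: nearW => n; exact: fg].
have fni n : itg m D (f_ n) by apply: itg_le gi _ => // x; exact: fg.
have [] := @dominated_convergence _ _ _ m D mD (fun n x => (f_ n x)%:E) (EFin \o f) (EFin \o g).
- by move=> n; exact/measurable_EFinP.
- exact/measurable_EFinP.
- by apply: aeW => x Dx; apply: cvg_EFin; [exact: nearW|exact: ff].
- exact: gi.
- by apply: aeW => x n Dx; rewrite lee_fin fg.
move=> _ _ h; apply/fine_cvg; rewrite EFin_Rintegral//; exact: h.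
Qed.

Lemma Rintegral_eq0 (f : T -> R) : (forall x, D x -> f x = 0) ->
  \int[m]_(x in D) f x = 0.
Proof. by move=> f0; rewrite (Rintegral_eq m f0) Rintegral0. Qed.
End dominated.

(** * Chain rule, vanishing integrals and bump functions on the line *)

Section one_dimensional.
Context {R : realType}.
Local Notation leb := (@lebesgue_measure R).
Implicit Types (a b c e x y p q : R) (f g F : R -> R) (n : nat).

Lemma lipschitz1 (K K' : R -> R) : (forall x, is_derive x 1 K (K' x)) ->
  (forall x, `|K' x| <= 1) -> forall x y, `|K x - K y| <= `|x - y|.
Proof.
move=> dK K1.
have cK : continuous K.
  by move=> x; apply: differentiable_continuous; apply/derivable1_diffP; case: (dK x).
have H x y : x <= y -> `|K x - K y| <= `|x - y|.
  move=> xy; have [z _ E] := @MVT_segment R K K' x y xy (fun z _ => dK z) (continuous_subspaceT cK).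
  by rewrite distrC E normrM distrC ler_piMl.
move=> x y; have [|/ltW] := leP x y; first exact: H.
by move/H; rewrite distrC (distrC y).
Qed.

(** Chain rule by approximation: as [K] and [K'] are 1-Lipschitz, both sides change little when [g]
    is replaced by a continuous function close to it in L^1. The bounds by 1 are those of the sine
    and the cosine. *)
Lemma is_primitive_comp a b f g (K K' K'' : R -> R) : a <= b -> is_primitive a b f g ->
  (forall x, is_derive x 1 K (K' x)) -> (forall x, is_derive x 1 K' (K'' x)) ->
  (forall x, `|K' x| <= 1) -> (forall x, `|K'' x| <= 1) ->
  is_primitive a b (fun x => K (f x)) (fun x => K' (f x) * g x).
Proof.
move=> ab fg dK dK' K'1 K''1; have [gi fgE] := fg.
have lK := lipschitz1 dK K'1; have lK' := lipschitz1 dK' K''1.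
have cK' : continuous K'.
  by move=> x; apply: differentiable_continuous; apply/derivable1_diffP; case: (dK' x).
have cf := is_primitive_cts ab fg.
have cKf : {within `[a, b], continuous (fun x => K' (f x))}.
  by move=> x; apply: (continuous_comp (cf x)); exact: cK'.
have Ki : itg leb `[a, b] (fun x => K' (f x) * g x).
  apply: (itgM_bounded _ (c := 1)) => //.
  by have := itg_meas (within_itg cKf).
split=> // x /andP[ax xb].
have fgx := is_primitive_sub fg (lexx a) ax xb.
have gix : itg leb `[a, x] g by case: fgx.
have Kix := itg_sub Ki (lexx a) xb.
apply/eqP; rewrite -subr_eq0; apply/eqP.
apply: (@eps_eq0 _ _ (2 + \int[leb]_(t in `[a, x]) `|g t|)) => e e0.
have [h [F [ch dF Fa gh fF]]] := is_primitive_approx fgx ax e0.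
have cF : {within `[a, x], continuous F}.
  apply: derivable_within_continuous => z; rewrite in_itv/= => /andP[az _].
  by have [] := dF z az.
have cFh : {within `[a, x], continuous (fun t => K' (F t) * h t)}.
  move=> z; apply: cvgM; first by apply: (continuous_comp (cF z)); exact: cK'.
  by apply: continuous_subspaceT; exact: ch.
have E : \int[leb]_(t in `[a, x]) (K' (F t) * h t) = K (F x) - K (f a).
  rewrite -Fa; apply: (@FTC _ (fun x => K (F x))) => // z /andP[az _].
  exact: (is_derive1_comp (dK _) (dF z az)).
have Fhi := within_itg cFh.
have -> : K (f x) - (K (f a) + \int[leb]_(t in `[a, x]) (K' (f t) * g t)) =
   (K (f x) - K (F x)) + \int[leb]_(t in `[a, x]) (K' (F t) * h t - K' (f t) * g t).
  rewrite RintegralB// E; ring.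
apply: le_trans (ler_normD _ _) _.
have ghi : itg leb `[a, x] (fun t => `|g t - h t|).
  by apply: itg_abs => //; apply: itgB => //; exact: continuous_itg.
have gai : itg leb `[a, x] (fun t => `|g t|) by apply: itg_abs.
have I1 : `|K (f x) - K (F x)| <= e.
  by apply: le_trans (lK _ _) _; apply: fF; rewrite ax lexx.
have I2 : `|\int[leb]_(t in `[a, x]) (K' (F t) * h t - K' (f t) * g t)| <=
    e + e * \int[leb]_(t in `[a, x]) `|g t|.
  apply: le_trans (Rintegral_le_norm _) _; first by apply: itgB.
  apply: (@le_trans _ _ (\int[leb]_(t in `[a, x]) (`|g t - h t| + e * `|g t|))).
    apply: le_Rintegral => //.
    - by apply: itg_abs => //; apply: itgB.
    - by apply: itgD => //; apply: itgZ.
    move=> t; rewrite /= in_itv/= => axt.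
    have -> : K' (F t) * h t - K' (f t) * g t = (K' (F t) * (h t - g t)) + (K' (F t) - K' (f t)) * g t by ring.
    apply: le_trans (ler_normD _ _) _; rewrite !normrM lerD//.
      by rewrite (distrC (g t)) ler_piMl.
    rewrite ler_wpM2r//; apply: le_trans (lK' _ _) _; rewrite distrC; exact: fF.
  rewrite RintegralD//; last by apply: itgZ.
  by rewrite RintegralZl// lerD.
lra.
Qed.

Lemma is_primitive_sin a b f g : a <= b -> is_primitive a b f g ->
  is_primitive a b (fun x => sin (f x)) (fun x => cos (f x) * g x).
Proof.
move=> ab fg; apply: (is_primitive_comp ab fg (K'' := fun x => - sin x)) => x.
- exact: cos_max.
- by rewrite normrN sin_max.
Qed.

Lemma is_primitive_cos a b f g : a <= b -> is_primitive a b f g ->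
  is_primitive a b (fun x => cos (f x)) (fun x => - sin (f x) * g x).
Proof.
move=> ab fg; apply: (is_primitive_comp ab fg (K'' := fun x => - cos x)) => x.
- by rewrite normrN sin_max.
- by rewrite normrN cos_max.
Qed.

(** Lebesgue differentiation: the indefinite integral of the extension by zero is constant, and its
    derivative is the integrand almost everywhere. *)
Lemma itg_zero_intervals p q f : p < q -> itg leb `[p, q] f ->
  (forall x, p <= x <= q -> \int[leb]_(t in `[p, x]) f t = 0) ->
  \forall x \ae leb, p < x < q -> f x = 0.
Proof.
move=> pq fi f0; pose w := f \_ `[p, q].
have wi : itg leb setT w.
  have mpq : measurable (`[p, q]%classic : set (measurableTypeR R)) by [].
  by rewrite /w -restrict_EFin; apply: (integrable_mkcond _ mpq).1.
have wi' y : itg leb [set` Interval (BLeft p) (BRight y)] w.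
  by apply: integrableS wi.
have wl : locally_integrable setT w by apply: integrable_locally_restrict.
have F0 : (fun x => \int[leb]_(t in `[p, x]) w t) = cst 0.
  apply/funext => x; rewrite /= /w.
  have [xp|px] := ltP x p.
    by rewrite set_itv_ge ?bnd_simp -?ltNge// /Rintegral integral_set0.
  have [xq|qx] := leP x q.
    rewrite -(f0 x) ?px//; apply: Rintegral_eq => t; rewrite /= in_itv/= => /andP[pt tx].
    by rewrite patchE ifT// inE/= in_itv/= pt (le_trans tx).
  rewrite -(f0 q) ?lexx ?(ltW pq)// -[RHS]/(Rintegral leb _ _).
  rewrite [RHS]Rintegral_mkcond [LHS]Rintegral_mkcond; apply: Rintegral_eq => t _.
  rewrite /patch; case: ifPn => //; case: ifPn => //.
  move=> /set_mem/=; rewrite in_itv/= => /andP[pt tq] /negP[].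
  by apply/mem_set; rewrite /= in_itv/= pt; lra.
have H := @FTC1 R w (BLeft p) wi' wl; cbv zeta in H; rewrite F0 in H.
apply: ae_mono H => x h /andP[px xq].
have [_] := h px.
by rewrite derive1_cst /w patchE ifT// inE/= in_itv/= !ltW.
Qed.

Lemma itg_oo_cc a b f : itg leb `]a, b[ f -> itg leb `[a, b] f.
Proof.
move=> fi; have [|ab] := leP b a.
  rewrite le_eqVlt => /orP[/eqP->|ba]; last first.
    by rewrite set_itv_ge ?bnd_simp -?ltNge//; exact: integrable_set0.
  by rewrite set_itv1; apply/integrableP; split; [exact: measurable_fun_set1|rewrite integral_set1// ltry].
have E : `[a, b]%classic = [set a] `|` (`]a, b[ `|` [set b]).
  apply/seteqP; split => x /=; rewrite !in_itv/=.
    move=> /andP[]; rewrite le_eqVlt => /orP[/eqP->|ax]; first by left.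
    by rewrite le_eqVlt => /orP[/eqP->|xb]; right; [right|left; rewrite ax].
  by case=> [->|[/andP[/ltW -> /ltW ->]//|->]]; rewrite ?lexx ltW.
have mf : measurable_fun `[a, b] f.
  have mo : measurable (`]a, b[ `|` [set b] : set (measurableTypeR R)) by exact: measurableU.
  rewrite E; apply: (measurable_funU f _ mo).2 => //; split; first exact: measurable_fun_set1.
  apply: (measurable_funU f _ _).2 => //; split; last exact: measurable_fun_set1.
  exact: itg_meas fi.
apply/integrableP; split; first exact/measurable_EFinP.
have /integrableP[mf' h] := fi; rewrite -integral_itv_obnd_cbnd; last first.
  apply: measurableT_comp => //; apply/measurable_EFinP.
  by apply: measurable_funS mf => //; apply: subset_itv; rewrite bnd_simp.
rewrite -integral_itv_bndo_bndc//.
by apply: measurableT_comp.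
Qed.

(** For each [n] it vanishes outside []p, q[], and as [n] grows it tends pointwise to the indicator
    of this interval, so that tested identities become identities for integrals over intervals. *)
Definition bump p q n x : R := flat 0 (n.+1%:R * (x - p)) * flat 0 (n.+1%:R * (q - x)).

Lemma bump_smooth p q n : smooth1 (bump p q n).
Proof.
have H : smooth1 (fun x => flat 0 (n.+1%:R * x + n.+1%:R * - p) * flat 0 (- n.+1%:R * x + n.+1%:R * q)).
  by apply: smooth1_mul; exact: smooth1_flat.
by congr smooth1: H; apply/funext => x; rewrite /bump; congr (flat _ _ * flat _ _); ring.
Qed.

Lemma bump_ge0 p q n x : 0 <= bump p q n x.
Proof. by rewrite mulr_ge0// flat_ge0. Qed.

Lemma bump_le1 p q n x : bump p q n x <= 1.
Proof. by rewrite mulr_ile1// ?flat_ge0// flat0_le1. Qed.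

Lemma bump_eq0 p q n x : ~~ (p < x < q) -> bump p q n x = 0.
Proof.
rewrite negb_and -!leNgt => /orP[xp|qx]; rewrite /bump.
  by rewrite flat_eq0 ?mul0r// pmulr_rle0// subr_le0.
by rewrite (@flat_eq0 _ _ (_ * (q - x))) ?mulr0// pmulr_rle0// subr_le0.
Qed.

Lemma bump_cvg p q x : bump p q n x @[n --> \oo] --> (((p < x < q)%R : bool)%:R : R).
Proof.
have [/andP[px xq]|h] /= := boolP (p < x < q).
  by rewrite -[X in _ --> X](mulr1 1); apply: cvgM; apply: flat0_cvg; rewrite subr_gt0.
by under eq_fun do rewrite bump_eq0//; exact: cvg_cst.
Qed.

Lemma bump_test a b p q f : a < p -> q < b -> smooth1 f ->
  (forall x, ~~ (p <= x <= q) -> f x = 0) -> test_function `]a, b[ f.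
Proof.
move=> ap qb sf f0.
have sub : closure [set x | f x != 0] `<=` `[p, q].
  have cl : closed ([set` `[p, q]] : set R) by exact: itv_closed.
  rewrite [X in _ `<=` X](_ : _ = closure ([set` `[p, q]] : set R)); last exact/closure_id.
  apply: closure_subset => x /=; apply: contraR => h; rewrite f0//.
split.
- exact: smooth1_smooth_on.
- by apply: (subclosed_compact _ (@segment_compact _ p q)) => //; exact: closed_closure.
- move=> x /sub; rewrite /= !in_itv/= => /andP[px xq]; apply/andP; split; lra.
Qed.

Lemma ae_itv_ex p q (P : R -> Prop) : p < q -> (\forall x \ae leb, P x) ->
  exists2 x, p < x < q & P x.
Proof.
move=> pq [N [mN N0 hN]]; apply: contrapT => h.
have sub : `]p, q[%classic `<=` N.
  move=> x; rewrite /= in_itv/= => pxq; apply: hN => /= Px; apply: h; by exists x.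
have : (leb `]p, q[%classic <= leb N)%E by apply: le_measure => //; rewrite inE.
rewrite N0; have -> : leb `]p, q[%classic = (q - p)%:E.
  by have := @lebesgue_measure_itv R `]p, q[; rewrite /= => ->; rewrite lte_fin pq EFinB.
by rewrite lee_fin subr_le0 leNgt pq.
Qed.

Lemma bump_gt0 p q n x : p < x < q -> 0 < bump p q n x.
Proof.
move=> /andP[px xq]; rewrite /bump /flat !ifT ?mulr_gt0 ?subr_gt0//.
all: by rewrite ?invr_gt0 ?expR_gt0// expr0.
Qed.

Lemma bump_int_gt0 a b p q n : a < p -> p < q -> q < b -> 0 < \int[leb]_(x in `[a, b]) bump p q n x.
Proof.
move=> ap pq qb; have bi : itg leb `[a, b] (bump p q n).
  by apply: continuous_itg; exact: smooth1_cts (bump_smooth _ _ _).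
have b0 x : [set` `[a, b]] x -> 0 <= bump p q n x by move=> _; exact: bump_ge0.
rewrite lt_neqAle Rintegral_ge0 ?andbT//; apply/eqP => I0.
have [//|x pxq] := ae_itv_ex pq (Rintegral_eq0_ae _ bi b0 (esym I0)).
have /andP[px xq] := pxq.
have /[swap] /[apply] E : [set` `[a, b]] x by rewrite /= in_itv/=; apply/andP; split; lra.
by have := bump_gt0 n pxq; rewrite E ltxx.
Qed.

(** Subtracting [k] times a reference bump removes the mean, and a compactly supported function of
    mean zero has a compactly supported primitive. So modulo one fixed function every bump is the
    derivative of a test function: the device of du Bois-Reymond. *)
Lemma bump_primitive a b p q p0 q0 n : a < p -> a < p0 -> q < b -> q0 < b -> p0 < q0 ->
  let k := (\int[leb]_(x in `[a, b]) bump p q n x) / \int[leb]_(x in `[a, b]) bump p0 q0 0 x in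
  exists A p1 q1, [/\ smooth1 A, a < p1, q1 < b,
    forall x, is_derive x 1 A (bump p q n x - k * bump p0 q0 0 x) &
    forall x, ~~ (p1 <= x <= q1) -> A x = 0].
Proof.
move=> ap ap0 qb q0b pq0 k.
have cb p' q' n' := smooth1_cts (bump_smooth p' q' n').
pose c x := bump p q n x - k * bump p0 q0 0 x.
have sc : smooth1 c.
  have := smooth1_lin (- k) (bump_smooth p0 q0 0) (bump_smooth p q n).
  by congr smooth1; apply/funext => x; rewrite /c mulNr addrC.
have cc := smooth1_cts sc.
pose p1 := Num.min p p0; pose q1 := Num.max q q0.
have ap1 : a < p1 by rewrite lt_min ap.
have q1b : q1 < b by rewrite gt_max qb.
have p1p : p1 <= p by rewrite ge_min lexx.
have p1p0 : p1 <= p0 by rewrite ge_min lexx orbT.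
have qq1 : q <= q1 by rewrite le_max lexx.
have q0q1 : q0 <= q1 by rewrite le_max lexx orbT.
have c0 x : ~~ (p1 < x < q1) -> c x = 0.
  rewrite negb_and -!leNgt /c => h; rewrite (@bump_eq0 p) ?(@bump_eq0 p0) ?mulr0 ?subr0//.
    by apply/negP => /andP[? ?]; case/orP: h => h; lra.
  by apply/negP => /andP[? ?]; case/orP: h => h; lra.
have I0 : 0 < \int[leb]_(x in `[a, b]) bump p0 q0 0 x by exact: bump_int_gt0.
have kE : \int[leb]_(x in `[a, b]) c x = 0.
  rewrite RintegralB//; last 2 first.
  - exact: continuous_itg.
  - by apply: itgZ => //; exact: continuous_itg.
  rewrite RintegralZl//; last exact: continuous_itg.
  by rewrite /k divfK ?subrr// gt_eqF.
have [F [Fa dF]] := primitive_of_continuous a 0 cc.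
have F1 x : a <= x -> F x = \int[leb]_(t in `[a, x]) c t.
  move=> ax; apply/esym; rewrite -[RHS]subr0 -Fa; apply: FTC => // [z /andP[az _]|].
    exact: dF.
  exact: continuous_subspaceT.
(* [F] is a primitive to the right of [a] only; to the left the function is continued by 0, which
   agrees with [F] up to [p1]. *)
pose A x := if x <= a then 0 else F x.
have A0 x : ~~ (p1 <= x <= q1) -> A x = 0.
  rewrite negb_and -!ltNge /A => /orP h; case: ifPn => //; rewrite -ltNge => ax.
  case: h => h.
    rewrite F1 ?(ltW ax)// Rintegral_eq0//.
    move=> t; rewrite /= in_itv/= => /andP[at_ tx].
    by apply: c0; apply/negP => /andP[? ?]; lra.
  have [xb|bx] := leP x b.
    have E : \int[leb]_(t in `[x, b]) c t = 0.
      apply: Rintegral_eq0 => // t; rewrite /= in_itv/= => /andP[xt tb].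
      by apply: c0; apply/negP => /andP[? ?]; lra.
    rewrite F1 ?(ltW ax)// -kE (@Rintegral_split _ _ a x b) ?(ltW ax)//; last exact: continuous_itg.
    by rewrite E addr0.
  have E : \int[leb]_(t in `[b, x]) c t = 0.
    apply: Rintegral_eq0 => // t; rewrite /= in_itv/= => /andP[xt tb].
    by apply: c0; apply/negP => /andP[? ?]; lra.
  rewrite F1 ?(ltW ax)// (@Rintegral_split _ _ a b x) ?kE ?E ?addr0//.
  - exact: continuous_itg.
  - by apply/andP; split; lra.
have dA x : is_derive x 1 A (c x).
  have [xp|px] := ltP x p1.
    rewrite c0; last by apply/negP => /andP[? ?]; lra.
    apply: (@near_eq_is_derive _ _ _ (cst 0)).
    near=> z; rewrite /= A0//; apply/negP => /andP[+ _].
    by apply/negP; rewrite -ltNge; near: z; exact: lt_nbhsl.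
  have ax : a < x by exact: lt_le_trans px.
  apply: near_eq_is_derive (dF x (ltW ax)); near=> z; rewrite /A ifF//; apply/negbTE; rewrite -ltNge.
  by near: z; exact: lt_nbhsr.
exists A, p1, q1; split => //.
exact: smooth1_prim sc dA.
Unshelve. all: by end_near. Qed.
End one_dimensional.

(** * The plane: boxes, sections and Fubini's theorem *)

Section plane.
Context {R : realType}.
Local Notation leb := (@lebesgue_measure R).
Local Notation RT := (measurableTypeR R).
Implicit Types (A D : set (R * R)) (a b c p q r s x y : R) (f g : R * R -> R).

Definition box a b c e : set (R * R) := `[a, b]%classic `*` `[c, e]%classic.

Lemma boxP a b c e (z : R * R) : box a b c e z <-> (a <= z.1 <= b /\ c <= z.2 <= e).
Proof. by rewrite /box /setX /= !in_itv/=. Qed.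

Lemma measurable_box a b c e : measurable (box a b c e : set (RT * RT)).
Proof. by apply: measurableX. Qed.

(** The boxes have rational centres and half-widths 1/(n+1). An index that decodes to no box inside
    [A] is given degenerate bounds, whence the guard [a n < b n]. *)
Lemma open_boxes A : open A -> exists a b c e : nat -> R,
  (forall n, a n < b n -> box (a n) (b n) (c n) (e n) `<=` A) /\
  (forall z, A z -> exists n, a n < z.1 < b n /\ c n < z.2 < e n).
Proof.
move=> oA.
pose P (i : rat * rat * nat) := let r : R := i.2.+1%:R^-1 in
  box (ratr i.1.1 - r) (ratr i.1.1 + r) (ratr i.1.2 - r) (ratr i.1.2 + r) `<=` A.
pose G (i : option (rat * rat * nat)) : (R * R) * (R * R) :=
  if i is Some j then if `[< P j >] then let r : R := j.2.+1%:R^-1 in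
    ((ratr j.1.1 - r, ratr j.1.1 + r), (ratr j.1.2 - r, ratr j.1.2 + r)) else (0, 0) else (0, 0).
pose H n := G (unpickle n).
exists (fun n => (H n).1.1), (fun n => (H n).1.2), (fun n => (H n).2.1), (fun n => (H n).2.2); split.
- move=> n; rewrite /H /G; case: (unpickle n) => [j|]/=; last by rewrite ltxx.
  by case: ifPn => [/asboolP//|_]/=; rewrite ltxx.
- move=> z Az.
  have /nbhs_ballP[d /= d0 dA] : nbhs z A by exact: open_nbhs_nbhs.
  have [n hn] : exists n, n.+1%:R^-1 < d / 2.
    have := @cvg_harmonic R => /cvgr0Pnorm_lt /(_ (d / 2)).
    rewrite divr_gt0// => /(_ isT) /filter_ex[n]; rewrite /harmonic ger0_norm ?invr_ge0// => h.
    by exists n.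
  set r : R := n.+1%:R^-1 in hn; have r0 : 0 < r by rewrite invr_gt0.
  have [q1] : exists q1 : rat, ratr q1 \in `]z.1 - r, z.1 + r[ by apply: rat_in_itvoo; lra.
  have [q2] : exists q2 : rat, ratr q2 \in `]z.2 - r, z.2 + r[ by apply: rat_in_itvoo; lra.
  rewrite !in_itv/= => /andP[h1 h2] /andP[h3 h4].
  exists (pickle (q1, q2, n)); rewrite /H /G pickleK /= ifT /= -/r.
    by split; apply/andP; split; lra.
  apply/asboolP; rewrite /P /= -/r => w /boxP[/= /andP[? ?] /andP[? ?]]; apply: dA.
  by split; rewrite /ball/= ltr_norml; apply/andP; split; lra.
Qed.

(** Measurability refers to the product sigma-algebra, so the open set is written as a countable
    union of open boxes. *)
Lemma open_meas A : open A -> measurable (A : set (RT * RT)).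
Proof.
move=> /open_boxes[a [b [c [e [hA Ah]]]]].
have -> : A = \bigcup_n (`]a n, b n[%classic `*` `]c n, e n[%classic).
  apply/seteqP; split => z.
    move=> /Ah[n [h1 h2]]; exists n => //; split; by rewrite /= in_itv.
  move=> [n _ [/=]]; rewrite !in_itv/= => /andP[h1 h2] /andP[h3 h4].
  apply: (hA n); first exact: lt_trans h2.
  by apply/boxP; rewrite !ltW.
apply: bigcup_measurable => n _; apply: measurableX; exact: measurable_itv.
Qed.

Lemma continuous_meas2 f (D : set (RT * RT)) : continuous f ->
  measurable_fun D (f : RT * RT -> R).
Proof.
move=> cf; apply: measurable_funTS.
apply: (measurability _ (RGenOInfty.measurableE R)).
move=> /= _ [_ [a ->]] <-; apply: measurableI => //; apply: open_meas.
rewrite preimage_itvoy; move/continuousP : cf => /(_ `]a, +oo[%classic).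
by rewrite preimage_itvoy; apply; exact: interval_open.
Qed.

Lemma leb_itv a b : a <= b -> leb `[a, b]%classic = (b - a)%:E.
Proof.
move=> ab; have := @lebesgue_measure_itv R `[a, b]; rewrite /= => ->; rewrite lte_fin.
case: ifPn => [_|]; first by rewrite EFinB.
by rewrite -leNgt => ba; have -> : a = b; [lra|rewrite subrr].
Qed.

Lemma area_box_lty a b c e : (area (box a b c e) < +oo)%E.
Proof.
rewrite /area /= /box product_measure1E//=.
have H p q : exists2 r, 0 <= r & leb `[p, q]%classic = r%:E.
  have [pq|qp] := leP p q; first by exists (q - p); rewrite ?subr_ge0// leb_itv.
  by exists 0 => //; rewrite set_itv_ge ?measure0// bnd_simp -ltNge.
by have [r _ ->] := H a b; have [t _ ->] := H c e; rewrite -EFinM ltry.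
Qed.

Lemma integrable_fubiniG (f : R * R -> \bar R) : integrable area setT f ->
  integrable leb setT (fubini_G leb f).
Proof.
move=> fi; have mf : measurable_fun setT f by case/integrableP: fi.
have mG := @measurable_fubini_G _ _ _ _ _ leb leb f fi.
apply/integrableP; split => //.
have /(@integrable21ltyP _ _ _ _ _ leb leb f mf) := fi.
apply: le_lt_trans; apply: ge0_le_integral => //.
- by apply: measurableT_comp.
- apply: (@measurable_fun_fubini_tonelli_G _ _ _ _ _ leb (fun z => `|f z|)%E) => //.
  by apply: measurableT_comp.
- move=> y _; apply: le_abse_integral => //.
  by apply: (measurableT_comp mf).
Qed.

(** The real inner integral is [fine] of an extended one; the two agree because almost every section
    is integrable. *)
Lemma Rfubini1 f : itg area setT f ->
  \int[area]_z f z = \int[leb]_x (\int[leb]_y f (x, y)).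
Proof.
move=> fi; rewrite /Rintegral; congr fine.
rewrite -(@integral12_prod_meas1 _ _ _ _ _ leb leb (EFin \o f) fi).
have Fi := @integrable_fubini_F _ _ _ _ _ leb leb (EFin \o f) fi.
apply: ae_eq_integral => //.
- exact: measurable_int Fi.
- apply/measurable_EFinP; apply: (@measurableT_comp _ _ _ _ _ _ fine) => //.
  exact: measurable_int Fi.
- apply: ae_mono (integrable_ae measurableT Fi) => x /(_ Logic.I) h _.
  by rewrite fineK.
Qed.

Lemma Rfubini2 f : itg area setT f ->
  \int[area]_z f z = \int[leb]_y (\int[leb]_x f (x, y)).
Proof.
move=> fi; rewrite /Rintegral; congr fine.
rewrite -(@integral21_prod_meas1 _ _ _ _ _ leb leb (EFin \o f) fi).
have Fi := @integrable_fubiniG (EFin \o f) fi.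
apply: ae_eq_integral => //.
- exact: measurable_int Fi.
- apply/measurable_EFinP; apply: (@measurableT_comp _ _ _ _ _ _ fine) => //.
  exact: measurable_int Fi.
- apply: ae_mono (integrable_ae measurableT Fi) => x /(_ Logic.I) h _.
  by rewrite fineK.
Qed.

Lemma fine_abs_le (z : \bar R) : (`|(fine z)%:E| <= `|z|)%E.
Proof. by case: z => [z||] //=; rewrite normr0 leey. Qed.

Lemma itg_section1 f : itg area setT f -> itg leb setT (fun x => \int[leb]_y f (x, y)).
Proof.
move=> fi; have Fi := @integrable_fubini_F _ _ _ _ _ leb leb (EFin \o f) fi.
apply: (@le_integrable _ _ _ leb _ measurableT _ (fubini_F leb (EFin \o f))) => //.
- apply/measurable_EFinP; apply: (@measurableT_comp _ _ _ _ _ _ fine) => //.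
  exact: measurable_int Fi.
- move=> x _ /=; exact: fine_abs_le.
Qed.

Lemma itg_section2 f : itg area setT f -> itg leb setT (fun y => \int[leb]_x f (x, y)).
Proof.
move=> fi; have Fi := @integrable_fubiniG (EFin \o f) fi.
apply: (@le_integrable _ _ _ leb _ measurableT _ (fubini_G leb (EFin \o f))) => //.
- apply/measurable_EFinP; apply: (@measurableT_comp _ _ _ _ _ _ fine) => //.
  exact: measurable_int Fi.
- move=> x _ /=; exact: fine_abs_le.
Qed.

Lemma ae_section1 f : itg area setT f -> \forall x \ae leb, itg leb setT (fun y => f (x, y)).
Proof. by move=> fi; have := @ae_integrable1 _ _ _ _ _ leb leb (EFin \o f) fi. Qed.

Lemma ae_section2 f : itg area setT f -> \forall y \ae leb, itg leb setT (fun x => f (x, y)).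
Proof. by move=> fi; have := @ae_integrable2 _ _ _ _ _ leb leb (EFin \o f) fi. Qed.

Lemma itg_patch d (T : measurableType d) (m : {measure set T -> \bar R}) (E : set T) (g : T -> R) :
  measurable E -> itg m E g -> itg m setT (g \_ E).
Proof.
move=> mE gi; rewrite -restrict_EFin.
exact: (integrable_mkcond _ mE).1.
Qed.

Lemma ae_area (P : R * R -> Prop) : measurable ([set z | ~ P z] : set (RT * RT)) ->
  (\forall x \ae leb, \forall y \ae leb, P (x, y)) -> \forall z \ae area, P z.
Proof.
move=> mP h; exists [set z | ~ P z]; split => //.
rewrite /area /= /product_measure1.
rewrite -[RHS](integral0 leb setT).
apply: ae_eq_integral => //.
  exact: measurable_fun_xsection.
apply: ae_mono h => x h _ /=; apply: measure_negligible.
  exact: measurable_xsection.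
by apply: negligibleS h => y; rewrite /xsection /= inE.
Qed.

(** Null sets can be united over countably many parameters only, so vanishing is first obtained at
    rational parameters and then extended by continuity. *)
Lemma zero_on_rationals r s (f : R -> R) : r < s -> {within `[r, s], continuous f} -> f r = 0 ->
  (forall k : rat, r <= ratr k <= s -> f (ratr k) = 0) -> forall y, r <= y <= s -> f y = 0.
Proof.
move=> rs cf fr fk y /andP[]; rewrite le_eqVlt => /orP[/eqP<-//|ry ys].
apply: contrapT => /eqP fy.
have fy0 : 0 < `|f y| by rewrite normr_gt0.
have yrs : [set` `[r, s]] y by rewrite /= in_itv/= ys ltW.
have /cvgr_dist_lt /(_ _ fy0) : f z @[z --> within [set` `[r, s]] (nbhs y)] --> f y.
  by apply: ((subspace_continuousP _ _).1 cf).
move=> /nbhs_ballP[d /= d0 hd].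
have [k] : exists k : rat, ratr k \in `]Num.max r (y - d), y[.
  by apply: rat_in_itvoo; rewrite gt_max ry ltrBlDr ltrDl.
rewrite in_itv/= gt_max => /andP[/andP[rk dk] ky].
have krs : r <= ratr k <= s by apply/andP; split; lra.
have := hd (ratr k); rewrite /ball/= fk// subr0 ltxx => H.
suff : false by []. apply: H; last by rewrite in_itv.
by rewrite ltr_norml; apply/andP; split; lra.
Qed.

(** The one-dimensional statement is applied in each variable. The exceptional set of [x] depends on
    the upper limit [y]; one null set is enough for all rational [y], and the inner primitive is
    continuous in [y]. *)
Lemma itg_zero_boxes p q r s f : p < q -> r < s -> itg area setT f ->
  (forall x y, p <= x <= q -> r <= y <= s -> \int[area]_(z in box p x r y) f z = 0) ->
  \forall z \ae area, p < z.1 < q -> r < z.2 < s -> f z = 0.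
Proof.
move=> pq rs fi f0.
have mf : measurable_fun setT (f : RT * RT -> R) by exact: itg_meas fi.
have slice y : r <= y <= s ->
    \forall x \ae leb, p < x < q -> \int[leb]_(t in `[r, y]) f (x, t) = 0.
  move=> rys; pose g := f \_ (setT `*` `[r, y]%classic).
  have mE : measurable (setT `*` `[r, y]%classic : set (RT * RT)) by exact: measurableX.
  have gi : itg area setT g by apply: itg_patch => //; apply: integrableS fi.
  have gE x : \int[leb]_t g (x, t) = \int[leb]_(t in `[r, y]) f (x, t).
    rewrite [RHS]Rintegral_mkcond; apply: Rintegral_eq => t _.
    by rewrite /g /patch in_setX in_setT.
  have Gi := itg_section1 gi.
  have Gi' : itg leb `[p, q] (fun x => \int[leb]_t g (x, t)) by apply: integrableS Gi.
  apply: ae_mono (itg_zero_intervals pq Gi' _) => [x|x pxq]; first by rewrite gE.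
  rewrite -(f0 x y pxq rys).
  pose h := f \_ (box p x r y).
  have hi : itg area setT h.
    by apply: itg_patch; [exact: measurable_box|apply: integrableS fi => //; exact: measurable_box].
  rewrite [RHS]Rintegral_mkcond -/h (Rfubini1 hi) [LHS]Rintegral_mkcond.
  apply: Rintegral_eq => u _; rewrite [LHS]/patch; case: ifPn => ux.
    by apply: Rintegral_eq => t _; rewrite /h /g /patch !in_setX in_setT ux.
  by apply/esym; apply: Rintegral_eq0 => // t _; rewrite /h /patch in_setX (negbTE ux).
have slices : \forall x \ae leb, forall n, p < x < q ->
    if unpickle n is Some k then r <= (ratr (k : rat) : R) <= s -> \int[leb]_(t in `[r, ratr k]) f (x, t) = 0
    else True.
  apply: ae_foralln => n; case: (unpickle n) => [k|]; last exact: aeW.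
  have [h|h] := boolP (r <= (ratr (k : rat) : R) <= s).
    by apply: ae_mono (slice _ h) => x + pxq => /(_ pxq).
  by apply: aeW.
apply: ae_area.
  rewrite [X in measurable X](_ : _ = (`]p, q[%classic `*` `]r, s[%classic) `&` [set z | f z != 0]).
    apply: measurableI; first exact: measurableX.
    rewrite -[X in measurable X]setTI.
    apply: (mf measurableT [set x : R | x != 0]).
    rewrite [X in measurable X](_ : _ = ~` [set 0]); first exact: measurableC.
    by apply/seteqP; split => x /= /eqP.
  apply/seteqP; split => z /=.
    move=> /not_implyP[h1 /not_implyP[h2 /eqP h3]].
    by split => //; split; rewrite /= in_itv.
  by rewrite !in_itv/= => -[[h1 h2] /eqP h3] h; exact: h3 (h h1 h2).
apply: ae_mono2 slices (ae_section1 fi) => x hx fxi.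
have [pxq|h] := boolP (p < x < q); last by apply: aeW => y pxq; case/negP: h.
have fxi' : itg leb `[r, s] (fun y => f (x, y)) by apply: integrableS fxi.
apply: ae_mono (itg_zero_intervals rs fxi' _) => [y /= + _|y rys]; first by [].
apply: (@zero_on_rationals r s (fun y => \int[leb]_(t in `[r, y]) f (x, t)) rs) => //.
- exact: (parameterized_integral_continuous (ltW rs) fxi').
- exact: Rintegral_point.
- by move=> k rks; have := hx (pickle k) pxq; rewrite pickleK; exact.
Qed.

Lemma tensor_test D p q r s (f g : R -> R) : smooth1 f -> smooth1 g -> box p q r s `<=` D ->
  (forall x, ~~ (p <= x <= q) -> f x = 0) -> (forall x, ~~ (r <= x <= s) -> g x = 0) ->
  test_function D (fun z => f z.1 * g z.2).
Proof.
move=> sf sg sub f0 g0.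
have cbox : compact (box p q r s) by apply: compact_setX; exact: segment_compact.
have cl : closure [set z : R * R | f z.1 * g z.2 != 0] `<=` box p q r s.
  rewrite [X in _ `<=` X](_ : _ = closure (box p q r s)); last first.
    have hs : hausdorff_space (R * R)%type by exact: norm_hausdorff.
    by apply/closure_id; exact: (compact_closed hs cbox).
  apply: closure_subset => z /= fg; apply/boxP; split.
    by apply: contraNT fg => /f0 ->; rewrite mul0r.
  by apply: contraNT fg => /g0 ->; rewrite mulr0.
split; [exact/smooth2_smooth_on/smooth2_tensor| |exact: subset_trans sub].
by apply: subclosed_compact cbox cl; exact: closed_closure.
Qed.

Lemma derive_tensor1 (f f' g : R -> R) (z : R * R) : is_derive z.1 1 f (f' z.1) ->
  'D_e1 (fun z : R * R => f z.1 * g z.2) z = f' z.1 * g z.2.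
Proof.
move=> df.
have E : is_derive z e1 (f \o fst : R * R -> R) (f' z.1) by case: df => df1 df2; split.
have C : is_derive z e1 (g \o snd : R * R -> R) 0.
  have [h1 h2] : is_derive z.2 0 g 0.
    by split; [exact: derivable0|exact: derive0].
  by split.
have H := is_deriveM E C.
by rewrite -[LHS]/('D_e1 ((f \o fst) * (g \o snd)) z) derive_val /GRing.scale/= mulr0 add0r mulrC.
Qed.

Lemma derive_tensor2 (f g g' : R -> R) (z : R * R) : is_derive z.2 1 g (g' z.2) ->
  'D_e2 (fun z : R * R => f z.1 * g z.2) z = f z.1 * g' z.2.
Proof.
move=> dg.
have E : is_derive z e2 (g \o snd : R * R -> R) (g' z.2) by case: dg => dg1 dg2; split.
have C : is_derive z e2 (f \o fst : R * R -> R) 0.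
  have [h1 h2] : is_derive z.1 0 f 0.
    by split; [exact: derivable0|exact: derive0].
  by split.
have H := is_deriveM C E.
by rewrite -[LHS]/('D_e2 ((f \o fst) * (g \o snd)) z) derive_val /GRing.scale/= mulr0 addr0.
Qed.
End plane.

(** * Test functions in the plane and the fundamental lemma *)

Section plane_tests.
Context {R : realType}.
Local Notation leb := (@lebesgue_measure R).
Local Notation RT := (measurableTypeR R).
Implicit Types (A D : set (R * R)) (a b c e p q r s x y : R) (f g u w : R * R -> R).

Lemma ae_neq p : \forall x \ae leb, x != p.
Proof.
exists [set p]; split; [by []|exact: lebesgue_measure_set1|].
by move=> x /= /negP; rewrite negbK => /eqP.
Qed.

Definition obox a b c e : set (R * R) := `]a, b[%classic `*` `]c, e[%classic.

Lemma oboxP a b c e (z : R * R) : obox a b c e z <-> (a < z.1 < b /\ c < z.2 < e).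
Proof. by rewrite /obox /setX /= !in_itv/=. Qed.

Lemma measurable_obox a b c e : measurable (obox a b c e : set (RT * RT)).
Proof. by apply: measurableX. Qed.

Lemma ae_obox p q r s : \forall z \ae (area : {measure set (RT * RT) -> \bar R}),
  box p q r s z -> obox p q r s z.
Proof.
apply: ae_area.
  rewrite [X in measurable X](_ : _ = box p q r s `\` obox p q r s).
    by apply: measurableD; [exact: measurable_box|exact: measurable_obox].
  by apply/seteqP; split => z /=; [move/not_implyP|move=> [h1 h2] h; exact: h2 (h h1)].
apply: ae_mono2 (ae_neq p) (ae_neq q) => x xp xq.
apply: ae_mono2 (ae_neq r) (ae_neq s) => y yr ys /boxP[/= /andP[? ?] /andP[? ?]].
apply/oboxP => /=; rewrite !lt_neqAle (eq_sym p) (eq_sym r) xp xq yr ys.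
by split; apply/andP; split.
Qed.

Lemma Rintegral_obox p q r s f : itg area (box p q r s) f ->
  \int[area]_(z in obox p q r s) f z = \int[area]_(z in box p q r s) f z.
Proof.
move=> fi.
have sub : obox p q r s `<=` box p q r s.
  by move=> z /oboxP[/andP[/ltW? /ltW?] /andP[/ltW? /ltW?]]; apply/boxP; split; apply/andP.
have mb := @measurable_box R p q r s; have mo := measurable_obox p q r s.
have fo : itg area (obox p q r s) f by apply: integrableS fi.
rewrite Rintegral_mkcond [RHS]Rintegral_mkcond.
apply: ae_Rintegral => //.
- exact: itg_meas (itg_patch mo fo).
- exact: itg_meas (itg_patch mb fi).
apply: ae_mono (ae_obox p q r s) => z h _; rewrite /patch.
case: ifPn => [/set_mem /sub /mem_set -> //|zo].
by case: ifPn => // /set_mem /h /mem_set; rewrite (negbTE zo).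
Qed.

(** Dominated convergence: the products of bumps tend to the indicator of the open box, and the
    sides of the box form a null set. *)
Lemma cvg_bump2 p q r s D w : measurable (D : set (RT * RT)) -> itg area D w ->
  box p q r s `<=` D ->
  \int[area]_(z in D) (bump p q n z.1 * bump r s n z.2 * w z) @[n --> \oo] -->
  \int[area]_(z in box p q r s) w z.
Proof.
move=> mD wi sub.
have mw := itg_meas wi.
have wb : itg area (box p q r s) w by apply: integrableS wi => //; exact: measurable_box.
have mo := measurable_obox p q r s.
have osub : obox p q r s `<=` D.
  move=> z /oboxP[/andP[/ltW? /ltW?] /andP[/ltW? /ltW?]].
  by apply: sub; apply/boxP; split; apply/andP.
rewrite -Rintegral_obox//.
have -> : \int[area]_(z in obox p q r s) w z = \int[area]_(z in D) (\1_(obox p q r s) z * w z).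
  rewrite Rintegral_mkcond [RHS]Rintegral_mkcond; apply: Rintegral_eq => z _.
  rewrite /patch; case: ifPn => zo; last first.
    by case: ifP => //; rewrite indicE (negbTE zo) mul0r.
  by rewrite ifT; [rewrite indicE zo mul1r|exact/mem_set/osub/set_mem].
have cb (p' q' : R) n : continuous (bump p' q' n) := smooth1_cts (bump_smooth p' q' n).
apply: (@Rdominated _ _ R area D mD (fun n z => bump p q n z.1 * bump r s n z.2 * w z)
  (fun z => \1_(obox p q r s) z * w z) (fun z => `|w z|)).
- move=> n; apply: measurable_funM => //; apply: continuous_meas2 => z.
  by apply: cvgM; apply: (continuous_comp _ (cb _ _ _ _)); [exact: fst_cts|exact: snd_cts].
- apply: measurable_funM => //; exact: measurable_indic.
- move=> z Dz; apply: cvgMr_tmp.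
  have -> : \1_(obox p q r s) z = (p < z.1 < q)%R%:R * (r < z.2 < s)%R%:R :> R.
    rewrite indicE; have [h|h] := boolP (z \in obox p q r s).
      by move: h => /set_mem/oboxP[-> ->]; rewrite mulr1.
    have [h1|] := boolP (p < z.1 < q); last by rewrite mul0r.
    have [h2|] := boolP (r < z.2 < s); last by rewrite mulr0.
    by case/negP: h; apply/mem_set/oboxP.
  by apply: cvgM; exact: bump_cvg.
- exact: itg_abs.
- move=> n z Dz; have b1 : `|bump p q n z.1 * bump r s n z.2| <= 1.
    rewrite ger0_norm; last by apply: mulr_ge0; exact: bump_ge0.
    by apply: mulr_ile1; rewrite ?bump_ge0 ?bump_le1.
  by rewrite normrM ler_piMl.
Qed.

Lemma cvg_unique0 (F : nat -> R) (l : R) : (forall n, F n = 0) -> F n @[n --> \oo] --> l -> l = 0.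
Proof.
move=> F0 Fl; have -> : l = lim (F n @[n --> \oo]) by apply/esym/cvg_lim.
by rewrite (funext F0); exact: lim_cst.
Qed.

(** An open set is covered by countably many open boxes, so the exceptional null sets can be
    united. *)
Lemma open_ae D (P : R * R -> Prop) : open D ->
  (forall a b c e, a < b -> c < e -> box a b c e `<=` D ->
     \forall z \ae (area : {measure set (RT * RT) -> \bar R}), a < z.1 < b -> c < z.2 < e -> P z) ->
  \forall z \ae (area : {measure set (RT * RT) -> \bar R}), D z -> P z.
Proof.
move=> oD h; have [a [b [c [e [sub cov]]]]] := open_boxes oD.
have : \forall z \ae (area : {measure set (RT * RT) -> \bar R}), forall n, a n < z.1 < b n -> c n < z.2 < e n -> P z.
  apply: ae_foralln => n.
  have [ab|ab] := ltP (a n) (b n); last first.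
    by apply: aeW => z /andP[h1 h2]; have := lt_trans h1 h2; rewrite ltNge ab.
  have [ce|ce] := ltP (c n) (e n); last first.
    by apply: aeW => z _ /andP[h1 h2]; have := lt_trans h1 h2; rewrite ltNge ce.
  by apply: h => //; exact: sub.
by apply: ae_mono => z hz /cov[n [h1 h2]]; exact: hz h1 h2.
Qed.

(** Testing with products of bumps shows that the integral over every box vanishes, which determines
    the integrand almost everywhere. *)
Lemma fundamental_lemma D w : open D -> itg area D w ->
  (forall phi, test_function D phi -> \int[area]_(z in D) (w z * phi z) = 0) ->
  \forall z \ae (area : {measure set (RT * RT) -> \bar R}), D z -> w z = 0.
Proof.
move=> oD wi h; have mD := open_meas oD.
apply: open_ae => // a b c e ab ce sub.
have mb := @measurable_box R a b c e.
have wb : itg area (box a b c e) w by apply: integrableS wi.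
have H := itg_zero_boxes ab ce (itg_patch mb wb).
apply: ae_mono (H _) => [z hz h1 h2|x y /andP[ax xb] /andP[cy ye]].
  rewrite -(hz h1 h2) patchE ifT//; apply/mem_set/boxP.
  by move: h1 h2 => /andP[/ltW-> /ltW->] /andP[/ltW-> /ltW->].
have sub' : box a x c y `<=` box a b c e.
  by move=> z /boxP[/andP[? ?] /andP[? ?]]; apply/boxP; split; apply/andP; split; lra.
have -> : \int[area]_(z in box a x c y) (w \_ (box a b c e)) z = \int[area]_(z in box a x c y) w z.
  by apply: Rintegral_eq => z /sub' zb; rewrite patchE ifT//; exact/mem_set.
apply: cvg_unique0 (cvg_bump2 mD wi (subset_trans sub' sub)) => n.
rewrite -(h (fun z => bump a x n z.1 * bump c y n z.2)).
  by apply: Rintegral_eq => z _; rewrite mulrC.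
apply: (tensor_test (bump_smooth _ _ _) (bump_smooth _ _ _) (subset_trans sub' sub)) => t.
  move=> h1; apply: bump_eq0; apply: contra h1 => /andP[/ltW -> /ltW ->//].
by move=> h1; apply: bump_eq0; apply: contra h1 => /andP[/ltW -> /ltW ->//].
Qed.

Lemma test_cts D phi : test_function D phi -> continuous phi.
Proof.
move=> [s _ _] x; apply: differentiable_continuous; exact: (s [::] x).
Qed.

Lemma test_bounded D phi : test_function D phi -> exists M, forall z, `|phi z| <= M.
Proof.
move=> tphi; have [_ cs _] := tphi; have cphi := test_cts tphi.
have /compact_bounded[M [_ hM]] : compact (phi @` closure [set z | phi z != 0]).
  by apply: continuous_compact => //; exact: continuous_subspaceT.
exists (`|M| + 1) => z.
have [->|pz] := eqVneq (phi z) 0; first by rewrite normr0 addr_ge0.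
apply: (hM (`|M| + 1)); first by have := ler_norm M; lra.
by exists z => //; exact: subset_closure.
Qed.

Lemma test_derive D v phi : test_function D phi -> test_function D ('D_v phi).
Proof.
move=> [sphi cs sub].
have sub' : closure [set z | 'D_v phi z != 0] `<=` closure [set z | phi z != 0].
  rewrite [X in _ `<=` X](closure_id _).1; last exact: closed_closure.
  apply: closure_subset => z /= dz; apply: contrapT => nz; move/negP: dz; apply; apply/eqP.
  have oz : open (~` closure [set z | phi z != 0]) by apply: closed_openC; exact: closed_closure.
  have : \forall y \near z, phi y = 0.
    have : nbhs z (~` closure [set z | phi z != 0]) by exact: open_nbhs_nbhs.
    apply: filterS => y ny; apply: contrapT => /eqP py; apply: ny; exact: subset_closure.
  move=> h; have d0 : is_derive z v (cst (0 : R) : R * R -> R) 0 by exact: is_derive_cst.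
  have hz : \forall y \near z, cst (0 : R) y = phi y by apply: filterS h => y ->.
  have d1 := near_eq_is_derive hz d0.
  by rewrite derive_val.
split.
- move=> s x _; have := sphi (rcons s v) x Logic.I.
  by rewrite foldr_rcons.
- by apply: subclosed_compact cs sub'; exact: closed_closure.
- exact: subset_trans sub.
Qed.

Lemma test_meas D (E : set (RT * RT)) phi : test_function D phi -> measurable_fun E (phi : RT * RT -> R).
Proof. by move=> /test_cts; exact: continuous_meas2. Qed.

Lemma test_mul_itg D phi g : measurable (D : set (RT * RT)) -> test_function D phi -> itg area D g ->
  itg area D (fun z => g z * phi z).
Proof.
move=> mD tphi gi; have [M hM] := test_bounded tphi.
apply: (eq_itg mD (f := fun z => phi z * g z)); first by move=> z _; rewrite mulrC.
by apply: (itgM_bounded mD (c := M)) => //; exact: test_meas tphi.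
Qed.

(** As [weak_deriv] is an arbitrary choice by [get], this is what allows it to be replaced by an
    explicit weak derivative under integrals. *)
Lemma weak_deriv_unique D (v : R * R) f g1 g2 : open D -> (area D < +oo)%E ->
  is_weak_deriv D v f g1 -> is_weak_deriv D v f g2 -> ae_eq area D g1 g2.
Proof.
move=> oD fD [L1 h1] [L2 h2]; have mD := open_meas oD.
have i1 := in_L2_itg mD fD L1; have i2 := in_L2_itg mD fD L2.
have : \forall z \ae (area : {measure set (RT * RT) -> \bar R}), D z -> g1 z - g2 z = 0.
  apply: (@fundamental_lemma D (fun z => g1 z - g2 z)) => //; first exact: itgB.
  move=> phi tphi; have cphi := test_cts tphi.
  have p1 := test_mul_itg mD tphi i1; have p2 := test_mul_itg mD tphi i2.
  have -> : \int[area]_(z in D) ((g1 z - g2 z) * phi z) =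
     \int[area]_(z in D) (g1 z * phi z) - \int[area]_(z in D) (g2 z * phi z).
    by rewrite -RintegralB//; apply: Rintegral_eq => z _; rewrite mulrBl.
  have := h1 _ tphi; have := h2 _ tphi; lra.
by apply: ae_mono => z h Dz; have := h Dz; move/eqP; rewrite subr_eq0 => /eqP.
Qed.
End plane_tests.

(** * Poincare's inequality on boxes *)

Section poincare.
Context {R : realType}.
Local Notation leb := (@lebesgue_measure R).
Local Notation RT := (measurableTypeR R).
Local Notation area := (@area R).
Implicit Types (a b c e p q r s x y : R) (f g u w : R * R -> R).

Lemma measurable_Rint d (T : measurableType d) (F : T * R -> R) :
  measurable_fun setT (F : T * RT -> R) ->
  measurable_fun setT (fun z => \int[leb]_t F (z, t)).
Proof.
move=> mF; rewrite /Rintegral; apply: (@measurableT_comp _ _ _ _ _ _ fine) => //.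
have mE : measurable_fun setT (fun z : T * RT => (F z)%:E) by exact/measurable_EFinP.
rewrite (_ : (fun z => _) = (fun z => \int[leb]_t (fun t => (F (z, t))%:E)^\+%E t -
   \int[leb]_t (fun t => (F (z, t))%:E)^\-%E t)%E); last first.
  by apply/funext => z; rewrite integralE.
apply: emeasurable_funB.
- have H : measurable_fun setT (fubini_F leb ((fun z : T * RT => (F z)%:E)^\+)%E).
    by apply: measurable_fun_fubini_tonelli_F => //; exact: measurable_funepos.
  apply: eq_measurable_fun H => z _; apply: eq_integral => t _.
  by rewrite !funeposE.
- have H : measurable_fun setT (fubini_F leb ((fun z : T * RT => (F z)%:E)^\-)%E).
    by apply: measurable_fun_fubini_tonelli_F => //; exact: measurable_funeneg.
  apply: eq_measurable_fun H => z _; apply: eq_integral => t _.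
  by rewrite !funenegE.
Qed.

Lemma tensor_itg (F G : R -> R) : itg leb setT F -> itg leb setT G ->
  itg area setT (fun z => F z.1 * G z.2).
Proof.
move=> Fi Gi; have mF := itg_meas Fi; have mG := itg_meas Gi.
have mFG : measurable_fun setT (fun z : RT * RT => (F z.1 * G z.2)%:E).
  apply/measurable_EFinP; apply: measurable_funM.
    by apply: (measurableT_comp mF); exact: measurable_fst.
  by apply: (measurableT_comp mG); exact: measurable_snd.
apply/(@integrable12ltyP _ _ _ _ _ leb leb _ mFG) => /=.
rewrite (_ : (fun x => _) = (fun x => `|(F x)%:E| * \int[leb]_y `|(G y)%:E|)%E); last first.
  apply/funext => x; rewrite -ge0_integralZl//.
    by apply: eq_integral => y _; rewrite normrM EFinM.
  by apply: measurableT_comp => //; exact/measurable_EFinP.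
rewrite ge0_integralZr//; last 2 first.
- by apply: measurableT_comp => //; exact/measurable_EFinP.
- exact: integral_ge0.
by apply: lte_mul_pinfty; [exact: integral_ge0| |]; case/integrableP: Fi => _ h1; case/integrableP: Gi => _ h2 //;
  rewrite ge0_fin_numE//; exact: integral_ge0.
Qed.

Lemma Rintegral_tensor (F G : R -> R) : itg leb setT F -> itg leb setT G ->
  \int[area]_z (F z.1 * G z.2) = (\int[leb]_x F x) * \int[leb]_y G y.
Proof.
move=> Fi Gi; rewrite Rfubini1; last exact: tensor_itg.
under eq_Rintegral do rewrite /= RintegralZl//.
by rewrite RintegralZr.
Qed.

Lemma itg_le_ae d (T : measurableType d) (m : {measure set T -> \bar R}) (D : set T) (f g : T -> R) :
  measurable D -> measurable_fun D f -> itg m D g ->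
  (\forall t \ae m, D t -> `|f t| <= g t) -> itg m D f.
Proof.
move=> mD mf gi h; apply/integrableP; split; first exact/measurable_EFinP.
have mg := itg_meas gi; have /integrableP[_] := itg_abs gi; apply: le_lt_trans.
apply: ae_ge0_le_integral => //.
- by apply: measurableT_comp => //; exact/measurable_EFinP.
- by apply: measurableT_comp => //; apply/measurable_EFinP; exact: measurableT_comp.
- apply: ae_mono h => x + Dx => /(_ Dx) k; rewrite /= lee_fin normr_id.
  exact: le_trans k (ler_norm _).
Qed.

Lemma le_Rintegral_ae d (T : measurableType d) (m : {measure set T -> \bar R}) (D : set T) (f g : T -> R) :
  measurable D -> itg m D f -> itg m D g ->
  (\forall t \ae m, D t -> f t <= g t) -> \int[m]_(t in D) f t <= \int[m]_(t in D) g t.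
Proof.
move=> mD fi gi h; rewrite -subr_ge0 -RintegralB//.
have mfg : measurable_fun D (fun t : T => g t - f t).
  by have /itg_meas := itgB mD gi fi.
rewrite (@ae_Rintegral _ _ _ m D mD (fun t : T => g t - f t) (fun t : T => `|g t - f t|)) //.
- by apply: Rintegral_ge0 => x _.
- exact: measurableT_comp.
- by apply: ae_mono h => x + Dx => /(_ Dx) k; rewrite ger0_norm ?subr_ge0.
Qed.

(** Derivatives are analysed in the first variable; this exchange transfers the results to the
    second one. *)
Definition swap (z : R * R) : R * R := (z.2, z.1).

Lemma measurable_swap : measurable_fun setT (swap : RT * RT -> RT * RT).
Proof. by apply: measurable_fun_pair; [exact: measurable_snd|exact: measurable_fst]. Qed.

Lemma integral_swap (f : R * R -> \bar R) : measurable_fun setT (f : RT * RT -> \bar R) ->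
  (forall z, 0 <= f z)%E -> (\int[area]_z f (swap z) = \int[area]_z f z)%E.
Proof.
move=> mf f0; rewrite /area.
rewrite (@fubini_tonelli1 _ _ _ _ _ leb leb (f \o swap)); last 2 first.
- by apply: (measurableT_comp mf); exact: measurable_swap.
- by move=> z; exact: f0.
by rewrite (@fubini_tonelli1 _ _ _ _ _ leb leb f)// (@fubini_tonelli _ _ _ _ _ leb leb f).
Qed.

Lemma itg_swap f : itg area setT f -> itg area setT (fun z => f (swap z)).
Proof.
move=> /integrableP[mf fi]; have mf' : measurable_fun setT (f : RT * RT -> R) by exact/measurable_EFinP.
apply/integrableP; split.
  by apply/measurable_EFinP; apply: (measurableT_comp mf'); exact: measurable_swap.
by rewrite (integral_swap (f := fun z => `|(f z)%:E|%E))//; exact: measurableT_comp.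
Qed.

Lemma Rintegral_swap f : itg area setT f -> \int[area]_z f (swap z) = \int[area]_z f z.
Proof. by move=> fi; rewrite Rfubini1 ?itg_swap// [RHS]Rfubini2. Qed.

Lemma ae_swap (P : R * R -> Prop) : (\forall z \ae area, P z) -> \forall z \ae area, P (swap z).
Proof.
move=> [N [mN N0 hN]]; exists (swap @^-1` N); split.
- by rewrite -[X in measurable X]setTI; exact: measurable_swap.
- have := @integral_swap (EFin \o \1_N) _ _.
  rewrite (_ : (fun z => _) = (EFin \o \1_(swap @^-1` N))); last by apply/funext => z; rewrite /= !indicE.
  rewrite !integral_indic// ?setIT ?N0; last by rewrite -[X in measurable X]setTI; exact: measurable_swap.
  by apply; [exact/measurable_EFinP|move=> z; rewrite lee_fin].
- by move=> z /= nP; exact: hN.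
Qed.

Definition primitive1 a g (z : R * R) : R := \int[leb]_(t in `[a, z.1]) g (t, z.2).

(** The variable upper limit is written as an indicator function of three variables, which reduces
    the claim to the measurability of a parameter integral. *)
Lemma measurable_primitive1 a g : measurable_fun setT (g : RT * RT -> R) ->
  measurable_fun setT (primitive1 a g : RT * RT -> R).
Proof.
move=> mg.
pose S : set ((RT * RT) * RT) := [set z | a <= z.2 <= z.1.1].
have mS : measurable S.
  have -> : S = setT `&` (fun z : (RT * RT) * RT => z.2) @^-1` `[a, +oo[ `&`
      (setT `&` (fun z : (RT * RT) * RT => z.1.1 - z.2 : R) @^-1` `[0, +oo[).
    rewrite !setTI; apply/seteqP; split => z; rewrite /S /= !in_itv/= !andbT subr_ge0.
      by move=> /andP[].
    by move=> [-> ->].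
  apply: measurableI; [apply: measurableI => //; rewrite -[X in measurable X]setTI|].
    by apply: (@measurable_snd _ _ (RT * RT)%type RT) => //; exact: measurable_itv.
  have H : measurable_fun setT (fun z : (RT * RT) * RT => z.1.1 - z.2 : R).
    apply: measurable_funB; last exact: measurable_snd.
    by apply: (@measurableT_comp _ _ _ _ _ _ fst); [exact: measurable_fst|exact: measurable_fst].
  by apply: H => //; exact: measurable_itv.
pose F (z : (R * R) * R) := \1_S z * g (z.2, z.1.2).
have mF : measurable_fun setT (F : (RT * RT) * RT -> R).
  apply: measurable_funM; first exact: measurable_indic.
  apply: (measurableT_comp mg); apply: measurable_fun_pair; first exact: measurable_snd.
  by apply: (@measurableT_comp _ _ _ _ _ _ snd); [exact: measurable_snd|exact: measurable_fst].
apply: eq_measurable_fun (measurable_Rint mF) => z _.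
rewrite /primitive1 [RHS]Rintegral_mkcond; apply: Rintegral_eq => t _.
rewrite /F indicE /patch; case: ifPn => h.
  rewrite mem_set ?mul1r//; move/set_mem: h; by rewrite /S /= in_itv.
rewrite memNset ?mul0r//; move=> h'; move/negP: h; apply; apply/mem_set.
by rewrite /= in_itv.
Qed.

Lemma Rintegral_box f a b c e : itg area (box a b c e) f ->
  \int[area]_(z in box a b c e) f z =
  \int[leb]_(y in `[c, e]) (\int[leb]_(x in `[a, b]) f (x, y)).
Proof.
move=> fi; rewrite Rintegral_mkcond Rfubini2; last by apply: itg_patch => //; exact: measurable_box.
rewrite [RHS]Rintegral_mkcond; apply: Rintegral_eq => y _.
rewrite [RHS]/patch; case: ifPn => yce.
  by rewrite [RHS]Rintegral_mkcond; apply: Rintegral_eq => x _; rewrite /patch in_setX yce andbT.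
by apply: Rintegral_eq0 => // x _; rewrite /patch in_setX (negbTE yce) andbF.
Qed.

Lemma ae_section_box f a b c e : itg area (box a b c e) f ->
  \forall y \ae leb, c <= y <= e -> itg leb `[a, b] (fun x => f (x, y)).
Proof.
move=> fi; have := ae_section2 (itg_patch (@measurable_box R a b c e) fi).
apply: ae_mono => y fy yce.
have : itg leb `[a, b] (fun x => (f \_ (box a b c e)) (x, y)) by apply: integrableS fy.
apply: eq_itg => // x; rewrite /= in_itv/= => xab.
by rewrite patchE ifT//; apply/mem_set/boxP.
Qed.

Lemma tensor_itg_box (F G : R -> R) a b c e : itg leb `[a, b] F -> itg leb `[c, e] G ->
  itg area (box a b c e) (fun z => F z.1 * G z.2) /\
  \int[area]_(z in box a b c e) (F z.1 * G z.2) =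
  (\int[leb]_(x in `[a, b]) F x) * \int[leb]_(y in `[c, e]) G y.
Proof.
move=> Fi Gi.
have mRT p q : measurable (`[p, q]%classic : set RT) by [].
have Fi' := itg_patch (mRT a b) Fi.
have Gi' := itg_patch (mRT c e) Gi.
have E : (fun z => F z.1 * G z.2) \_ (box a b c e) =
    (fun z : R * R => (F \_ `[a, b]) z.1 * (G \_ `[c, e]) z.2).
  apply/funext => z; rewrite /patch in_setX.
  by case: ifP => [/andP[-> ->]//|/negbT]; rewrite negb_and => /orP[/negbTE ->|/negbTE ->]; rewrite ?mul0r ?mulr0.
have Ti := tensor_itg Fi' Gi'; split.
  apply/(integrable_mkcond _ (@measurable_box R a b c e)); rewrite restrict_EFin E.
  exact: Ti.
by rewrite Rintegral_mkcond E Rintegral_tensor// -!Rintegral_mkcond.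
Qed.

End poincare.
Section poincare2.
Context {R : realType}.
Local Notation leb := (@lebesgue_measure R).
Local Notation RT := (measurableTypeR R).
Local Notation area := (@area R).
Implicit Types (a b c e p q r s x y : R) (f g u w : R * R -> R).

Lemma itg_section_box f a b c e : itg area (box a b c e) f ->
  itg leb `[c, e] (fun y => \int[leb]_(x in `[a, b]) f (x, y)).
Proof.
move=> fi; have mb := @measurable_box R a b c e.
have H := itg_section2 (itg_patch mb fi).
have H' : itg leb `[c, e] (fun y => \int[leb]_x (f \_ (box a b c e)) (x, y)) by apply: integrableS H.
apply: eq_itg H' => // y; rewrite /= in_itv/= => yce.
rewrite [RHS]Rintegral_mkcond; apply: Rintegral_eq => x _.
by rewrite /patch in_setX (@mem_set _ [set` `[c, e]] y) ?andbT// /= in_itv.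
Qed.

Lemma Rintegral_box_eq0 f a b c e : itg area (box a b c e) f ->
  (\forall y \ae leb, c <= y <= e -> itg leb `[a, b] (fun x => f (x, y)) ->
     \int[leb]_(x in `[a, b]) f (x, y) = 0) ->
  \int[area]_(z in box a b c e) f z = 0.
Proof.
move=> fi h; rewrite Rintegral_box// -[RHS](@Rintegral0 _ _ R leb [set` `[c, e]]).
apply: ae_Rintegral => //; first by have /itg_meas := itg_section_box fi.
apply: ae_mono2 h (ae_section_box fi) => y h1 h2 /=.
by rewrite in_itv/= => yce; exact: h1 (h2 yce).
Qed.

(** Du Bois-Reymond in the first variable: the difference between [u] and the primitive of [g] is
    orthogonal to all derivatives in the first variable of product test functions, hence coincides
    with its weighted mean over horizontal sections, which depends on the second variable only. *)
Lemma primitive_of_weak a b c e u g : a < b -> c < e ->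
  itg area (box a b c e) u -> measurable_fun setT (g : RT * RT -> R) ->
  itg area (box a b c e) g -> itg area (box a b c e) (primitive1 a g) ->
  (forall (A A' B : R -> R) p q r s, smooth1 A -> smooth1 B -> (forall x, is_derive x 1 A (A' x)) ->
     continuous A' -> a < p -> q < b -> c < r -> s < e ->
     (forall x, ~~ (p <= x <= q) -> A x = 0) -> (forall y, ~~ (r <= y <= s) -> B y = 0) ->
     \int[area]_(z in box a b c e) (u z * (A' z.1 * B z.2)) =
     - \int[area]_(z in box a b c e) (g z * (A z.1 * B z.2))) ->
  exists2 w : R -> R, itg leb `[c, e] w &
    \forall z \ae area, obox a b c e z -> u z = w z.2 + primitive1 a g z.
Proof.
move=> ab ce ui mg gi Ui weak.
have mb := @measurable_box R a b c e.
pose p0 := (2 * a + b) / 3; pose q0 := (a + 2 * b) / 3.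
have [ap0 pq0 q0b] : [/\ a < p0, p0 < q0 & q0 < b] by rewrite /p0 /q0; split; lra.
have cb (p' q' : R) n : continuous (bump p' q' n) := smooth1_cts (bump_smooth p' q' n).
pose c0 := \int[leb]_(x in `[a, b]) bump p0 q0 0 x.
have c00 : 0 < c0 by exact: bump_int_gt0.
pose W z := u z - primitive1 a g z.
have Wi : itg area (box a b c e) W by exact: itgB.
(* Integrating [V] over a horizontal section gives the mean of [W] with respect to the normalised
   reference bump; this mean is the candidate for [w]. *)
pose V z := c0^-1 * (bump p0 q0 0 z.1 * W z).
have bounded_mul (h1 h2 : R -> R) (k : R * R -> R) (M : R) : continuous h1 -> continuous h2 ->
    (forall x, `|h1 x| <= M) -> (forall x, `|h2 x| <= 1) -> itg area (box a b c e) k ->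
    itg area (box a b c e) (fun z => (h1 z.1 * h2 z.2) * k z).
  move=> ch1 ch2 b1 b2 ki; apply: (itgM_bounded mb (c := M)) => //.
    apply: continuous_meas2 => z; apply: cvgM.
      by apply: (continuous_comp (@fst_cts R z)); exact: ch1.
    by apply: (continuous_comp (@snd_cts R z)); exact: ch2.
  move=> z _; rewrite normrM -[M]mulr1 ler_pM//.
have bb (p' q' : R) n x : `|bump p' q' n x| <= 1.
  by rewrite ger0_norm ?bump_ge0// bump_le1.
have Vi : itg area (box a b c e) V.
  apply: itgZ => //; apply: (itgM_bounded mb (c := 1)) => //.
  by apply: continuous_meas2 => z; apply: (continuous_comp (@fst_cts R z)); exact: cb.
pose w y := \int[leb]_x (V \_ (box a b c e)) (x, y).
have wi : itg leb setT w by exact: (itg_section2 (itg_patch mb Vi)).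
have wi' : itg leb `[c, e] w by apply: integrableS wi.
have wE y : c <= y <= e -> w y = \int[leb]_(x in `[a, b]) V (x, y).
  move=> yce; rewrite /w [RHS]Rintegral_mkcond; apply: Rintegral_eq => x _.
  by rewrite /patch in_setX (@mem_set _ [set` `[c, e]] y) ?andbT// /= in_itv.
have [wbi _] := tensor_itg_box (continuous_itg a b (@cst_continuous R R (1 : R))) wi'.
have {}wbi : itg area (box a b c e) (fun z => w z.2).
  by apply: eq_itg wbi => // z _; rewrite mul1r.
exists w; first exact: wi'.
pose v z := W z - w z.2.
have vi : itg area (box a b c e) v by exact: itgB.
(* The bump minus [k] times the reference bump is the derivative of a test function [A]. The weak
   equation for [u] and integration by parts for the primitive of [g] produce the same term, so that
   only the weighted mean remains. *)
have key p q r s n : a < p -> q < b -> c < r -> s < e ->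
    \int[area]_(z in box a b c e) (bump p q n z.1 * bump r s n z.2 * v z) = 0.
  move=> ap qb cr se.
  have /= [A [p1 [q1 [sA ap1 q1b dA A0]]]] := bump_primitive n ap ap0 qb q0b pq0.
  pose k := (\int[leb]_(x in `[a, b]) bump p q n x) / c0.
  pose A' x := bump p q n x - k * bump p0 q0 0 x.
  have {}dA : forall x, is_derive x 1 A (A' x) := dA.
  have cA' : continuous A'.
    by move=> x; apply: cvgB; [exact: cb|apply: cvgM; [exact: cvg_cst|exact: cb]].
  have cA := smooth1_cts sA.
  have bA' x : `|A' x| <= 1 + `|k|.
    apply: le_trans (ler_normB _ _) _; rewrite lerD//.
    by rewrite normrM ler_piMr.
  have [MA hMA] : exists M, forall x, `|A x| <= M.
    have [xm _ hm] := EVT_max (ltW ab) (continuous_subspaceT (fun x => cvg_norm (cA x))).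
    exists `|A xm| => x; have [axb|nab] := boolP (a <= x <= b); first exact: hm.
    rewrite A0 ?normr0//; apply/negP => /andP[h1 h2]; move/negP: nab; apply.
    by rewrite (le_trans (ltW ap1) h1) (le_trans h2 (ltW q1b)).
  have B0 y : ~~ (r <= y <= s) -> bump r s n y = 0.
    by move=> h; apply: bump_eq0; apply: contra h => /andP[/ltW-> /ltW->].
  have E1 := weak A A' (bump r s n) p1 q1 r s sA (bump_smooth _ _ _) dA cA' ap1 q1b cr se A0 B0.
  have uAi := bounded_mul _ _ _ _ cA' (cb r s n) bA' (bb _ _ _) ui.
  have UAi := bounded_mul _ _ _ _ cA' (cb r s n) bA' (bb _ _ _) Ui.
  have gAi := bounded_mul _ _ _ _ cA (cb r s n) hMA (bb _ _ _) gi.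
  have WCi := bounded_mul _ _ _ _ (cb p q n) (cb r s n) (bb _ _ _) (bb _ _ _) Wi.
  have WAi := bounded_mul _ _ _ _ (cb p0 q0 0%N) (cb r s n) (bb _ _ _) (bb _ _ _) Wi.
  have wCi := bounded_mul _ _ _ _ (cb p q n) (cb r s n) (bb _ _ _) (bb _ _ _) wbi.
  have E2 : \int[area]_(z in box a b c e) (A' z.1 * bump r s n z.2 * primitive1 a g z
      + A z.1 * bump r s n z.2 * g z) = 0.
    apply: Rintegral_box_eq0; first by apply: itgD.
    apply: ae_mono (ae_section_box gi) => y gy yce _; have {}gy := gy yce.
    have prim : is_primitive a b (fun x => primitive1 a g (x, y)) (fun x => g (x, y)).
      split; first exact: gy.
      by move=> x _; rewrite /primitive1 /= Rintegral_point add0r.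
    have := is_primitive_ibp (ltW ab) prim dA cA'.
    rewrite (A0 a) ?(A0 b); last 2 first.
    + by rewrite [b <= q1]leNgt q1b andbF.
    + by rewrite leNgt ap1.
    rewrite !mulr0 subrr => E.
    rewrite -[RHS](mulr0 (bump r s n y)) -E -RintegralZl//; last first.
      apply: itgD => //.
        have Agi : itg leb `[a, b] (fun x => A x * g (x, y)).
          by apply: (itgM_bounded _ (c := MA)) => //; exact: continuous_meas.
        by apply: eq_itg Agi => // x _; rewrite mulrC.
      apply: within_itg => x; apply: cvgM.
        exact: (is_primitive_cts (ltW ab) prim).
      by apply: continuous_subspaceT; exact: cA'.
    by apply: Rintegral_eq => x _ /=; ring.
  have E3 : \int[area]_(z in box a b c e) (bump p q n z.1 * bump r s n z.2 * W z) =
      k * \int[area]_(z in box a b c e) (bump p0 q0 0 z.1 * bump r s n z.2 * W z).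
    rewrite RintegralD// in E2.
    have E1' : \int[area]_(z in box a b c e) (A' z.1 * bump r s n z.2 * u z) =
        - \int[area]_(z in box a b c e) (A z.1 * bump r s n z.2 * g z).
      transitivity (\int[area]_(z in box a b c e) (u z * (A' z.1 * bump r s n z.2))).
        by apply: Rintegral_eq => z _; rewrite mulrC.
      by rewrite E1; congr (- _); apply: Rintegral_eq => z _; rewrite mulrC.
    apply/eqP; rewrite -subr_eq0 -RintegralZl// -RintegralB//; last exact: itgZ.
    transitivity ((\int[area]_(z in box a b c e) (A' z.1 * bump r s n z.2 * u z) -
       \int[area]_(z in box a b c e) (A' z.1 * bump r s n z.2 * primitive1 a g z)) == 0).
      rewrite -RintegralB//; congr (_ == _); apply: Rintegral_eq => z _.
      by rewrite /A' /W; ring.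
    by apply/eqP; clear -E1' E2; lra.
  have Bwi : itg leb `[c, e] (fun y => bump r s n y * w y).
    have mce : measurable (`[c, e]%classic : set RT) by [].
    exact: (itgM_bounded mce wi' (continuous_meas mce (cb r s n)) (fun y _ => bb r s n y)).
  have [T1 T2] := tensor_itg_box (continuous_itg a b (cb p q n)) Bwi.
  have E4 : \int[leb]_(y in `[c, e]) (bump r s n y * w y) =
      c0^-1 * \int[area]_(z in box a b c e) (bump p0 q0 0 z.1 * bump r s n z.2 * W z).
    rewrite -RintegralZl//  Rintegral_box; last exact: itgZ.
    apply: ae_Rintegral => //; [by have /itg_meas := Bwi| |].
      by have /itg_meas := itg_section_box (itgZ mb c0^-1 WAi).
    apply: ae_mono (ae_section_box Vi) => y Vy; rewrite /= in_itv/= => yce.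
    rewrite wE// -RintegralZl//; last exact: Vy.
    by apply: Rintegral_eq => x _; rewrite /V /=; ring.
  transitivity (\int[area]_(z in box a b c e) (bump p q n z.1 * bump r s n z.2 * W z) -
     \int[area]_(z in box a b c e) (bump p q n z.1 * (bump r s n z.2 * w z.2))).
    rewrite -RintegralB//; apply: Rintegral_eq => z _; rewrite /v; ring.
  rewrite T2 E3 E4 /k -/c0; clear -c00; field; lra.
(* Test functions must vanish near the sides of the box. Hence a margin 1/(n+1) is kept first; the
   smaller boxes exhaust the open box. *)
have zero n : \forall z \ae area, a + n.+1%:R^-1 < z.1 < b - n.+1%:R^-1 ->
    c + n.+1%:R^-1 < z.2 < e - n.+1%:R^-1 -> v z = 0.
  set d : R := n.+1%:R^-1; have d0 : 0 < d by rewrite invr_gt0.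
  have [pq|pq] := ltP (a + d) (b - d); last by apply: aeW => z /andP[? ?]; lra.
  have [rs|rs] := ltP (c + d) (e - d); last by apply: aeW => z _ /andP[? ?]; lra.
  apply: ae_mono (itg_zero_boxes pq rs (itg_patch mb vi) _) => [z h h1 h2|x y /andP[px xq] /andP[ry ys]].
    rewrite -(h h1 h2) patchE ifT//; apply/mem_set/boxP; move: h1 h2 => /andP[k1 k2] /andP[k3 k4].
    by clear -d0 k1 k2 k3 k4; split; apply/andP; split; lra.
  have sub : box (a + d) x (c + d) y `<=` box a b c e.
    by clear -px xq ry ys d0; move=> z /boxP[/andP[? ?] /andP[? ?]]; apply/boxP; split; apply/andP; split; lra.
  transitivity (\int[area]_(z in box (a + d) x (c + d) y) v z).
    by apply: Rintegral_eq => z /sub zb; rewrite patchE ifT//; exact/mem_set.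
  apply: cvg_unique0 (cvg_bump2 mb vi sub) => m; by apply: key; clear -px xq ry ys d0; lra.
apply: ae_mono (ae_foralln zero) => z h /oboxP[/andP[az zb] /andP[cz ze]].
have [n hn] : exists n, n.+1%:R^-1 < Num.min (Num.min (z.1 - a) (b - z.1)) (Num.min (z.2 - c) (e - z.2)).
  set d := Num.min _ _; have d0 : 0 < d by rewrite !lt_min !subr_gt0 az zb cz ze.
  have := @cvg_harmonic R => /cvgr0Pnorm_lt /(_ d d0) /filter_ex[n].
  by rewrite /harmonic ger0_norm ?invr_ge0// => h1; exists n.
have : v z = 0.
  move: hn; rewrite !lt_min !ltrBrDr => /andP[/andP[h1 h2] /andP[h3 h4]].
  by apply: (h n); rewrite ltrBrDr addrC ?h1 ?h3 [_ + n.+1%:R^-1]addrC ?h2 ?h4.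
by rewrite /v /W; lra.
Qed.
End poincare2.
Section poincare3.
Context {R : realType}.
Local Notation leb := (@lebesgue_measure R).
Local Notation RT := (measurableTypeR R).
Local Notation area := (@area R).
Implicit Types (a b c e p q r s x y : R) (f g u w : R * R -> R) (D : set (R * R)).

Lemma itg_swap_box f a b c e : itg area (box a b c e) f ->
  itg area (box c e a b) (fun z => f (swap z)) /\
  \int[area]_(z in box c e a b) f (swap z) = \int[area]_(z in box a b c e) f z.
Proof.
move=> fi; have fi' := itg_patch (@measurable_box R a b c e) fi.
have E : (fun z => f (swap z)) \_ (box c e a b) = (fun z => (f \_ (box a b c e)) (swap z)).
  by apply/funext => z; rewrite /patch !in_setX andbC.
split.
  apply/(integrable_mkcond _ (@measurable_box R c e a b)); rewrite restrict_EFin E.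
  exact: itg_swap fi'.
by rewrite Rintegral_mkcond E Rintegral_swap// -Rintegral_mkcond.
Qed.

Lemma ae_snd (P : R -> Prop) : (\forall y \ae leb, P y) -> \forall z \ae area, P z.2.
Proof.
move=> [N [mN N0 hN]]; exists (setT `*` N); split; first exact: measurableX.
  by rewrite /area /= product_measure1E//= N0 mule0.
by move=> z nP; split => //; exact: hN.
Qed.

(** Cauchy-Schwarz against the constant 1 on each horizontal section gives one factor [b - a];
    integration over the section gives the other. *)
Lemma primitive1_sqr a b c e g : a <= b -> measurable_fun setT (g : RT * RT -> R) ->
  itg area (box a b c e) (fun z => g z ^+ 2) ->
  itg area (box a b c e) (fun z => primitive1 a g z ^+ 2) /\
  \int[area]_(z in box a b c e) (primitive1 a g z ^+ 2) <=
  (b - a) ^+ 2 * \int[area]_(z in box a b c e) (g z ^+ 2).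
Proof.
move=> ab mg gi; have mRT p q : measurable (`[p, q]%classic : set RT) by []. 
have mb := @measurable_box R a b c e.
pose k y := \int[leb]_(x in `[a, b]) (g (x, y) ^+ 2).
have ki : itg leb `[c, e] k := itg_section_box gi.
have [Ki KE] := tensor_itg_box (continuous_itg a b (@cst_continuous R R (b - a))) ki.
have bound : \forall z \ae area, box a b c e z -> primitive1 a g z ^+ 2 <= (b - a) * k z.2.
  apply: ae_mono (ae_snd (ae_section_box gi)) => z h /boxP[/andP[az zb] /h sl].
  have lim x : x <= b -> in_L2 leb `[a, x] (fun x => g (x, z.2)).
    move=> xb; split.
      apply: measurable_funS (measurableT) _ _ => //.
      by apply: (measurableT_comp mg); exact: measurable_fun_pair.
    exact: itg_sub sl (lexx a) xb.
  have one : in_L2 leb `[a, z.1] (fun=> 1 : R).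
    by apply: (@in_L2_bounded _ _ _ leb _ _ _ 1) => //=; rewrite ?leb_itv ?ltry// => x _; rewrite normr1.
  have := cauchy_schwarz (mRT _ _) one (lim _ zb).
  rewrite /primitive1; under eq_Rintegral do rewrite mul1r.
  move=> /le_trans; apply.
  under eq_Rintegral do rewrite expr1n.
  rewrite Rintegral_itv_cst// mul1r; apply: ler_pM.
  - by rewrite subr_ge0.
  - by apply: Rintegral_ge0 => x _; exact: sqr_ge0.
  - by rewrite lerD2r.
  - by apply: le_Rintegral_sub sl _ _ _ => // x; exact: sqr_ge0.
have Ui : itg area (box a b c e) (fun z => primitive1 a g z ^+ 2).
  apply: (itg_le_ae mb _ Ki).
    apply: measurable_funS (measurableT) _ _ => //.
    by apply: measurable_funX; exact: measurable_primitive1.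
  by apply: ae_mono bound => z h /h; rewrite ger0_norm ?sqr_ge0.
split=> //; apply: le_trans (le_Rintegral_ae mb Ui Ki bound) _.
by rewrite KE Rintegral_itv_cst// -expr2 Rintegral_box.
Qed.

Lemma is_derive_zero_outside (A A' : R -> R) p q : (forall x, is_derive x 1 A (A' x)) ->
  (forall x, ~~ (p <= x <= q) -> A x = 0) -> forall x, ~~ (p <= x <= q) -> A' x = 0.
Proof.
move=> dA A0 x h.
have o : open (~` `[p, q]%classic) by apply: closed_openC; exact: itv_closed.
have nx : \forall y \near x, (fun=> 0 : R) y = A y.
  have : nbhs x (~` `[p, q]%classic).
    by apply: open_nbhs_nbhs; split => //=; rewrite in_itv/=; exact/negP.
  by apply: filterS => y /= ; rewrite in_itv/= => /negP hy; rewrite A0.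
have [_ <-] := dA x; have [_ ->] := near_eq_is_derive nx (is_derive_cst (0 : R) x 1).
by [].
Qed.

Lemma weak_box1 D a b c e u g (A A' B : R -> R) p q r s : measurable (D : set (RT * RT)) ->
  box a b c e `<=` D -> is_weak_deriv D e1 u g ->
  smooth1 A -> smooth1 B -> (forall x, is_derive x 1 A (A' x)) ->
  a < p -> q < b -> c < r -> s < e ->
  (forall x, ~~ (p <= x <= q) -> A x = 0) -> (forall y, ~~ (r <= y <= s) -> B y = 0) ->
  \int[area]_(z in box a b c e) (u z * (A' z.1 * B z.2)) =
  - \int[area]_(z in box a b c e) (g z * (A z.1 * B z.2)).
Proof.
move=> mD bD [_ w] sA sB dA ap qb cr se A0 B0.
have mb := @measurable_box R a b c e.
have A'0 := is_derive_zero_outside dA A0.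
have sub : box p q r s `<=` box a b c e.
  move=> z /boxP[/andP[h1 h2] /andP[h3 h4]]; apply/boxP.
  by rewrite (ltW (lt_le_trans ap h1)) (ltW (le_lt_trans h2 qb)) (ltW (lt_le_trans cr h3)) (ltW (le_lt_trans h4 se)).
have toD (h : R * R -> R) : (forall z, ~ box p q r s z -> h z = 0) ->
    \int[area]_(z in D) h z = \int[area]_(z in box a b c e) h z.
  move=> h0; rewrite Rintegral_mkcond [RHS]Rintegral_mkcond; apply: Rintegral_eq => z _.
  rewrite /patch; case: (asboolP (box p q r s z)) => hz.
    by rewrite !mem_set//; [exact: sub|apply: bD; exact: sub].
  by rewrite h0//; case: ifP; case: ifP.
have out (z : R * R) : ~ box p q r s z -> ~~ (p <= z.1 <= q) \/ ~~ (r <= z.2 <= s).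
  by move=> hz; apply/orP; rewrite -negb_and; apply/negP => /andP h; apply: hz; exact/boxP.
have := w _ (tensor_test sA sB (subset_trans sub bD) A0 B0).
under eq_Rintegral do rewrite (derive_tensor1 _ (dA _)).
rewrite toD; last by move=> z /out[h|h]; [rewrite (A'0 _ h)|rewrite (B0 _ h)]; rewrite ?(mul0r, mulr0).
by rewrite toD; last by move=> z /out[h|h]; [rewrite (A0 _ h)|rewrite (B0 _ h)]; rewrite ?(mul0r, mulr0).
Qed.

Lemma weak_box2 D a b c e u g (A A' B : R -> R) p q r s : measurable (D : set (RT * RT)) ->
  box a b c e `<=` D -> is_weak_deriv D e2 u g ->
  smooth1 A -> smooth1 B -> (forall x, is_derive x 1 A (A' x)) ->
  c < p -> q < e -> a < r -> s < b ->
  (forall x, ~~ (p <= x <= q) -> A x = 0) -> (forall y, ~~ (r <= y <= s) -> B y = 0) ->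
  \int[area]_(z in box a b c e) (u z * (B z.1 * A' z.2)) =
  - \int[area]_(z in box a b c e) (g z * (B z.1 * A z.2)).
Proof.
move=> mD bD [_ w] sA sB dA cp qe ar sb A0 B0.
have mb := @measurable_box R a b c e.
have A'0 := is_derive_zero_outside dA A0.
have sub : box r s p q `<=` box a b c e.
  move=> z /boxP[/andP[h1 h2] /andP[h3 h4]]; apply/boxP.
  by rewrite (ltW (lt_le_trans ar h1)) (ltW (le_lt_trans h2 sb)) (ltW (lt_le_trans cp h3)) (ltW (le_lt_trans h4 qe)).
have toD (h : R * R -> R) : (forall z, ~ box r s p q z -> h z = 0) ->
    \int[area]_(z in D) h z = \int[area]_(z in box a b c e) h z.
  move=> h0; rewrite Rintegral_mkcond [RHS]Rintegral_mkcond; apply: Rintegral_eq => z _.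
  rewrite /patch; case: (asboolP (box r s p q z)) => hz.
    by rewrite !mem_set//; [exact: sub|apply: bD; exact: sub].
  by rewrite h0//; case: ifP; case: ifP.
have out (z : R * R) : ~ box r s p q z -> ~~ (r <= z.1 <= s) \/ ~~ (p <= z.2 <= q).
  by move=> hz; apply/orP; rewrite -negb_and; apply/negP => /andP h; apply: hz; exact/boxP.
have := w _ (tensor_test sB sA (subset_trans sub bD) B0 A0).
under eq_Rintegral do rewrite (derive_tensor2 _ (dA _)).
rewrite toD; last by move=> z /out[h|h]; [rewrite (B0 _ h)|rewrite (A'0 _ h)]; rewrite ?(mul0r, mulr0).
by rewrite toD; last by move=> z /out[h|h]; [rewrite (B0 _ h)|rewrite (A0 _ h)]; rewrite ?(mul0r, mulr0).
Qed.

End poincare3.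
Section poincare4.
Context {R : realType}.
Local Notation leb := (@lebesgue_measure R).
Local Notation RT := (measurableTypeR R).
Local Notation area := (@area R).
Implicit Types (a b c e p q r s x y : R) (f g u w : R * R -> R) (D : set (R * R)).

Lemma in_L2_sub (D E : set (RT * RT)) f : measurable D -> measurable E -> E `<=` D -> in_L2 area D f -> in_L2 area E f.
Proof. by move=> mD mE ED [mf fi]; split; [exact: measurable_funS mf|exact: integrableS fi]. Qed.

Lemma in_L2_patch a b c e g : in_L2 area (box a b c e) g ->
  let G := g \_ (box a b c e) in
  [/\ measurable_fun setT (G : RT * RT -> R), itg area (box a b c e) (fun z => G z ^+ 2),
      itg area (box a b c e) G, forall z, box a b c e z -> G z = g z &
      \int[area]_(z in box a b c e) (G z ^+ 2) = \int[area]_(z in box a b c e) (g z ^+ 2)].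
Proof.
move=> [mg gi] G; have mb := @measurable_box R a b c e.
have GE z : box a b c e z -> G z = g z by move=> h; rewrite /G patchE ifT//; exact/mem_set.
split => //.
- exact/(measurable_restrictT _ mb).
- by apply: eq_itg gi => // z /GE ->.
- have := in_L2_itg mb (area_box_lty _ _ _ _) (conj mg gi).
  by apply: eq_itg => // z /GE ->.
- by apply: Rintegral_eq => z /GE ->.
Qed.

(** One half of Poincare's inequality: up to a remainder controlled by a single derivative, the
    function depends on the other variable only. *)
Lemma split1 a b c e u g : a < b -> c < e ->
  in_L2 area (box a b c e) u -> in_L2 area (box a b c e) g ->
  (forall (A A' B : R -> R) p q r s, smooth1 A -> smooth1 B -> (forall x, is_derive x 1 A (A' x)) ->
     a < p -> q < b -> c < r -> s < e ->
     (forall x, ~~ (p <= x <= q) -> A x = 0) -> (forall y, ~~ (r <= y <= s) -> B y = 0) ->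
     \int[area]_(z in box a b c e) (u z * (A' z.1 * B z.2)) =
     - \int[area]_(z in box a b c e) (g z * (A z.1 * B z.2))) ->
  exists (w : R -> R) U, [/\ itg leb `[c, e] w, in_L2 area (box a b c e) U,
    \int[area]_(z in box a b c e) (U z ^+ 2) <= (b - a) ^+ 2 * \int[area]_(z in box a b c e) (g z ^+ 2) &
    \forall z \ae area, box a b c e z -> u z = w z.2 + U z].
Proof.
move=> ab ce u2 g2 weak; have mb := @measurable_box R a b c e.
have [mG G2 Gi GE GG] := in_L2_patch g2.
set G := g \_ _ in mG G2 Gi GE GG.
have [U2 UG] := primitive1_sqr (ltW ab) mG G2.
have mU : measurable_fun (box a b c e) (primitive1 a G : RT * RT -> R).
  by apply: measurable_funS (measurableT) _ _ => //; exact: measurable_primitive1.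
have UL : in_L2 area (box a b c e) (primitive1 a G) by split.
have [|w wi h] := primitive_of_weak ab ce (in_L2_itg mb (area_box_lty _ _ _ _) u2) mG Gi
  (in_L2_itg mb (area_box_lty _ _ _ _) UL).
  move=> A A' B p q r s sA sB dA _ ap qb cr se A0 B0.
  rewrite (weak A A' B p q r s)//; congr (- _).
  by apply: Rintegral_eq => z /GE ->.
exists w, (primitive1 a G); split => //; first by rewrite -GG.
by apply: ae_mono2 h (@ae_obox R a b c e) => z h1 h2 /h2 /h1.
Qed.

(** By splitting in each direction, [u] is close both to a function of [z.2] and to a function of
    [z.1]. The integral of the product of these two functions factorises, and each factor is, up to
    a remainder, the integral of [u] divided by a side length. Hence the square of [u] is controlled
    by its mean and its gradient. *)
Lemma poincare_box D a b c e u g1 g2 : measurable (D : set (RT * RT)) ->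
  box a b c e `<=` D -> a < b -> c < e -> in_L2 area D u ->
  is_weak_deriv D e1 u g1 -> is_weak_deriv D e2 u g2 ->
  \int[area]_(z in box a b c e) (u z ^+ 2) <=
  4 / ((b - a) * (e - c)) * (\int[area]_(z in box a b c e) u z) ^+ 2 +
  5 * ((b - a) ^+ 2 * (\int[area]_(z in box a b c e) (g1 z ^+ 2)) +
       (e - c) ^+ 2 * \int[area]_(z in box a b c e) (g2 z ^+ 2)).
Proof.
move=> mD bD ab ce uD wg1 wg2; have mb := @measurable_box R a b c e.
have u2 := in_L2_sub mD mb bD uD.
have g12 := in_L2_sub mD mb bD wg1.1; have g22 := in_L2_sub mD mb bD wg2.1.
have [w1 [U1 [w1i U1L U1g E1]]] := split1 ab ce u2 g12
  (fun A A' B p q r s sA sB dA => weak_box1 mD bD wg1 sA sB dA).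
have swapL f : in_L2 area (box a b c e) f -> in_L2 area (box c e a b) (fun z => f (swap z)).
  move=> fL; split; last exact: (itg_swap_box (in_L2_sqr fL)).1.
  exact: (itg_meas (itg_swap_box (in_L2_itg mb (area_box_lty _ _ _ _) fL)).1).
have mb' := @measurable_box R c e a b.
have lift_itg f : in_L2 area (box c e a b) f -> in_L2 area (box a b c e) (fun z => f (swap z)).
  move=> fL; split; last exact: (itg_swap_box (in_L2_sqr fL)).1.
  exact: (itg_meas (itg_swap_box (in_L2_itg mb' (area_box_lty _ _ _ _) fL)).1).
have [|w2 [U2' [w2i U2'L U2'g E2']]] := split1 ce ab (swapL _ u2) (swapL _ g22).
  move=> A A' B p q r s sA sB dA ap qb cr se A0 B0.
  have := weak_box2 mD bD wg2 sA sB dA ap qb cr se A0 B0.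
  have cA' : continuous A'.
    have [A2 sA2 dA2] := smooth1_derive sA.
    suff -> : A' = A2 by exact: smooth1_cts.
    by apply/funext => x; have [_ <-] := dA x; have [_ <-] := dA2 x.
  have bdd (h : R -> R) x0 x1 : continuous h -> (forall x, ~~ (x0 <= x <= x1) -> h x = 0) ->
      exists M, forall x, `|h x| <= M.
    move=> ch h0; have [x01|x10] := leP x0 x1.
      have [xm _ hm] := EVT_max x01 (continuous_subspaceT (fun x => cvg_norm (ch x))).
      exists `|h xm| => x; have [axb|nab] := boolP (x0 <= x <= x1); first exact: hm.
      by rewrite h0 ?normr0.
    exists 0 => x; rewrite h0 ?normr0//; apply/negP => /andP[h1 h2].
    by have := le_lt_trans (le_trans h1 h2) x10; rewrite ltxx.
  have [M1 hM1] := bdd _ _ _ (smooth1_cts sA) A0.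
  have [M1' hM1'] := bdd _ _ _ cA' (is_derive_zero_outside dA A0).
  have [M2 hM2] := bdd _ _ _ (smooth1_cts sB) B0.
  have tr (f : R * R -> R) (h k : R -> R) Mh Mk : in_L2 area (box a b c e) f -> continuous h -> continuous k ->
      (forall x, `|h x| <= Mh) -> (forall x, `|k x| <= Mk) ->
      \int[area]_(z in box c e a b) (f (swap z) * (h z.1 * k z.2)) =
      \int[area]_(z in box a b c e) (f z * (k z.1 * h z.2)).
    move=> fL ch ck hh hk.
    have Fi : itg area (box a b c e) (fun z => (k z.1 * h z.2) * f z).
      apply: (itgM_bounded mb (c := Mk * Mh)); first exact: in_L2_itg (area_box_lty _ _ _ _) fL.
        apply: continuous_meas2 => z; apply: cvgM.
          by apply: (continuous_comp (@fst_cts R z)); exact: ck.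
        by apply: (continuous_comp (@snd_cts R z)); exact: ch.
      by move=> z _; rewrite normrM ler_pM.
    have [_ E] := itg_swap_box Fi.
    transitivity (\int[area]_(z in box a b c e) (k z.1 * h z.2 * f z)).
      by rewrite -E; apply: Rintegral_eq => z _; rewrite mulrC [k _ * _]mulrC.
    by apply: Rintegral_eq => z _; rewrite mulrC.
  rewrite (tr _ _ _ _ _ u2 cA' (smooth1_cts sB) hM1' hM2) => ->; congr (- _).
  by rewrite (tr _ _ _ _ _ g22 (smooth1_cts sA) (smooth1_cts sB) hM1 hM2).
pose U2 z := U2' (swap z).
have U2L : in_L2 area (box a b c e) U2 := lift_itg _ U2'L.
have U2g : \int[area]_(z in box a b c e) (U2 z ^+ 2) <= (e - c) ^+ 2 * \int[area]_(z in box a b c e) (g2 z ^+ 2).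
  by rewrite -(itg_swap_box (in_L2_sqr g22)).2 -(itg_swap_box (in_L2_sqr U2L)).2; apply: le_trans U2'g;
    rewrite le_eqVlt; apply/orP; left; apply/eqP; apply: Rintegral_eq => -[z1 z2] _.
have E2 : \forall z \ae area, box a b c e z -> u z = w2 z.1 + U2 z.
  apply: ae_mono (ae_swap E2') => z h /boxP[z1 z2].
  have := h ((boxP c e a b (swap z)).2 (conj z2 z1)); by case: z z1 z2 {h} => z1 z2.
set W1 := \int[leb]_(y in `[c, e]) w1 y; set W2 := \int[leb]_(x in `[a, b]) w2 x.
have one (p q : R) : itg leb `[p, q] (fun=> 1 : R) by exact: (continuous_itg p q (@cst_continuous R R (1 : R))).
have [T1i T1] := tensor_itg_box (one a b) w1i.
have [T2i T2] := tensor_itg_box w2i (one c e).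
have [T3i T3] := tensor_itg_box w2i w1i.
have ui := in_L2_itg mb (area_box_lty _ _ _ _) u2.
have U1i := in_L2_itg mb (area_box_lty _ _ _ _) U1L.
have U2i := in_L2_itg mb (area_box_lty _ _ _ _) U2L.
have m1 := in_L2_sqr u2; have m2 := in_L2_sqr U1L; have m3 := in_L2_sqr U2L.
have A1 : \int[area]_(z in box a b c e) u z = (b - a) * W1 + \int[area]_(z in box a b c e) U1 z.
  rewrite -[b - a]mul1r -Rintegral_itv_cst ?(ltW ab)// -T1 -RintegralD//.
  apply: ae_Rintegral => //; [exact: itg_meas ui|by have /itg_meas := itgD mb T1i U1i|].
  by apply: ae_mono E1 => z h /h ->; rewrite mul1r.
have A2 : \int[area]_(z in box a b c e) u z = (e - c) * W2 + \int[area]_(z in box a b c e) U2 z.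
  rewrite -[e - c]mul1r -Rintegral_itv_cst ?(ltW ce)// [_ * W2]mulrC -T2 -RintegralD//.
  apply: ae_Rintegral => //; [exact: itg_meas ui|by have /itg_meas := itgD mb T2i U2i|].
  by apply: ae_mono E2 => z h /h ->; rewrite mulr1.
(* Pointwise, [w1] and [w2] are [u - U1] and [u - U2]; in their product the mixed term
   [u * (U1 + U2)] is absorbed by a quarter of [u ^+ 2]. *)
have pw : 3 / 4 * \int[area]_(z in box a b c e) (u z ^+ 2) <=
    W2 * W1 + 5 / 2 * (\int[area]_(z in box a b c e) (U1 z ^+ 2) + \int[area]_(z in box a b c e) (U2 z ^+ 2)).
  rewrite -T3 -RintegralZl// -RintegralD// -RintegralZl//; last exact: itgD.
  rewrite -RintegralD//; last by apply: itgZ => //; exact: itgD.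
  apply: le_Rintegral_ae => //.
  - exact: itgZ.
  - by apply: itgD => //; apply: itgZ => //; exact: itgD.
  apply: ae_mono2 E1 E2 => z h1 h2 zb; have {}h1 := h1 zb; have {}h2 := h2 zb.
  have -> : w2 z.1 = u z - U2 z by rewrite h2 addrK.
  have -> : w1 z.2 = u z - U1 z by rewrite h1 addrK.
  have := sqr_ge0 (2^-1 * u z - U1 z - U2 z); have := sqr_ge0 (U1 z - U2 z).
  move: (u z) (U1 z) (U2 z) => r s t; clear; nra.
have cs f : in_L2 area (box a b c e) f ->
    (\int[area]_(z in box a b c e) f z) ^+ 2 <= (b - a) * (e - c) * \int[area]_(z in box a b c e) (f z ^+ 2).
  move=> fL; have oneL : in_L2 area (box a b c e) (fun=> 1 : R).
    apply: (@in_L2_bounded _ _ _ area _ mb _ 1) => //; first exact: area_box_lty.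
    by move=> x _; rewrite normr1.
  have := cauchy_schwarz mb oneL fL.
  under eq_Rintegral do rewrite mul1r.
  move=> /le_trans; apply; under eq_Rintegral do rewrite expr1n.
  suff -> : \int[area]_(z in box a b c e) 1 = (b - a) * (e - c) by [].
  have [_] := tensor_itg_box (one a b) (one c e); under eq_Rintegral do rewrite mulr1.
  by move=> ->; rewrite !Rintegral_itv_cst ?(ltW ab, ltW ce)// !mul1r.
have c1 := cs _ U1L; have c2 := cs _ U2L.
move: A1 A2 pw c1 c2 U1g U2g ab ce.
move: (\int[area]_(z in _) u z) (\int[area]_(z in _) U1 z) (\int[area]_(z in _) U2 z)
  (\int[area]_(z in _) (u z ^+ 2)) (\int[area]_(z in _) (U1 z ^+ 2)) (\int[area]_(z in _) (U2 z ^+ 2))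
  ((b - a) ^+ 2 * _) ((e - c) ^+ 2 * _) W1 W2 => I J1 J2 K L1 L2 H1 H2 V1 V2.
clear => A1 A2 pw c1 c2 h1 h2 ab ce.
have A0 : 0 < (b - a) * (e - c) by apply: mulr_gt0; rewrite subr_gt0.
set Q := (b - a) * (e - c) in A0 c1 c2 *.
have VV : Q * (V2 * V1) = (I - J1) * (I - J2) by rewrite [in I - J1]A1 [in I - J2]A2 !addrK /Q; ring.
have : Q * K <= 4 * I ^+ 2 + 5 * Q * (H1 + H2).
  have q1 : Q * (3 / 4 * K) <= (I - J1) * (I - J2) + Q * (5 / 2 * (L1 + L2)).
    by rewrite -VV -mulrDr ler_pM2l.
  have q2 : Q * L1 <= Q * H1 by rewrite ler_pM2l.
  have q3 : Q * L2 <= Q * H2 by rewrite ler_pM2l.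
  have := sqr_ge0 (J1 - J2); have := sqr_ge0 (I + J1); have := sqr_ge0 (I + J2); have := sqr_ge0 I.
  have := sqr_ge0 (I + J1 + J2); have := sqr_ge0 J1; have := sqr_ge0 J2.
  by move: q1 q2 q3 c1 c2; rewrite !expr2; clear; nra.
rewrite -ler_pdivlMl//; move=> /le_trans; apply.
by rewrite le_eqVlt; apply/orP; left; apply/eqP; field; rewrite gt_eqF.
Qed.

End poincare4.

(** * Cauchy conditions along an ultrafilter *)

Section filter_cauchy.
Context {R : realType} (F : set_system nat) {UF : UltraFilter F}.
Implicit Types (X Y : nat -> nat -> R) (c e : R).

(* A one-sided Cauchy condition along [F]; [X] may take negative values. *)
Definition fcauchy X : Prop :=
  forall e, 0 < e -> exists S, F S /\ forall n p, S n -> S p -> X n p <= e.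

Lemma fcauchy_le X Y : (forall n p, X n p <= Y n p) -> fcauchy Y -> fcauchy X.
Proof.
move=> XY hY e e0; have [S [FS h]] := hY e e0; exists S; split => // n p Sn Sp.
exact: le_trans (XY n p) (h n p Sn Sp).
Qed.

Lemma fcauchyD X Y : fcauchy X -> fcauchy Y -> fcauchy (fun n p => X n p + Y n p).
Proof.
move=> hX hY e e0; have e20 : 0 < e / 2 by rewrite divr_gt0.
have [S [FS h]] := hX _ e20; have [S' [FS' h']] := hY _ e20.
exists (S `&` S'); split; first exact: filterI.
move=> n p [Sn Sn'] [Sp Sp']; have := h n p Sn Sp; have := h' n p Sn' Sp'; lra.
Qed.

Lemma fcauchyZ c X : 0 <= c -> fcauchy X -> fcauchy (fun n p => c * X n p).
Proof.
move=> c0 hX e e0; have [|S [FS h]] := hX (e / (c + 1)); first by rewrite divr_gt0// ltr_wpDl.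
exists S; split => // n p Sn Sp.
have [X0|X0] := leP (X n p) 0; first by apply: le_trans (ltW e0); rewrite mulr_ge0_le0.
have c1 : 0 < c + 1 by rewrite ltr_wpDl.
have := h n p Sn Sp; rewrite ler_pdivlMr//; nra.
Qed.

Lemma fcauchy_sum (N : nat) (X : nat -> nat -> nat -> R) :
  (forall i, fcauchy (X i)) -> fcauchy (fun n p => \sum_(i < N) X i n p).
Proof.
move=> h; elim: N => [|N IH].
  by move=> e e0; exists setT; split => [|n p _ _]; [exact: filterT|rewrite big_ord0 ltW].
by apply: fcauchy_le (fcauchyD IH (h N)) => n p; rewrite big_ord_recr.
Qed.

Lemma fmap_ultra (T : Type) (x : nat -> T) : UltraFilter (fmap x F).
Proof.
split; first exact: fmap_proper_filter.
move=> G GF sub; rewrite predeqE => A; split => [GA|]; last exact: sub.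
have [//|h] := in_ultra_setVsetC (x @^-1` A) UF.
have /sub GCA : fmap x F (~` A) by [].
have GI : G (A `&` ~` A) by exact: filterI.
by have /filter_ex[t []] := GI.
Qed.

(** Compactness of a bounded interval. Along one ultrafilter all bounded numerical sequences
    converge at once, so no successive extraction of subsequences is necessary. *)
Lemma ultra_limit (x : nat -> R) c : (forall n, `|x n| <= c) -> exists l : R, x n @[n --> F] --> l.
Proof.
move=> xc; have := @segment_compact R (- c) c; rewrite compact_ultra => h.
have [|l [_ hl]] := h (x @ F) (fmap_ultra x); last by exists l.
suff : F (x @^-1` `[- c, c]%classic) by [].
by apply: filterS (@filterT _ F _) => n _; rewrite /= in_itv/= -ler_norml.
Qed.

Lemma fcauchy_cvg (x : nat -> R) (l : R) : x n @[n --> F] --> l ->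
  fcauchy (fun n p => (x n - x p) ^+ 2).
Proof.
move=> /cvgrPdist_lt h e e0; pose d := Num.min 1 (e / 4).
have d0 : 0 < d by rewrite lt_min ltr01 divr_gt0.
exists [set n | `|l - x n| < d]; split; first exact: (h d d0).
move=> n p; rewrite /= !ltr_norml => /andP[h1 h2] /andP[h3 h4].
have d1 : d <= 1 by rewrite ge_min lexx.
have d2 : d <= e / 4 by rewrite ge_min lexx orbT.
nra.
Qed.
End filter_cauchy.

(** * L^2 compactness of sequences bounded in H^1 and in L^4 *)

Section rellich.
Context {R : realType}.
Local Notation leb := (@lebesgue_measure R).
Local Notation RT := (measurableTypeR R).
Local Notation area := (@area R).
Implicit Types (a b c e p q r s x y : R) (f g u w : R * R -> R) (D : set (R * R)).

Lemma weak_deriv_lin D v c f1 f2 g1 g2 : measurable (D : set (RT * RT)) -> (area D < +oo)%E ->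
  in_L2 area D f1 -> in_L2 area D f2 -> is_weak_deriv D v f1 g1 -> is_weak_deriv D v f2 g2 ->
  is_weak_deriv D v (fun z => c * f1 z + f2 z) (fun z => c * g1 z + g2 z).
Proof.
move=> mD fD f1L f2L [g1L w1] [g2L w2]; split; first by apply: in_L2D => //; exact: in_L2Z.
move=> phi tphi.
have i f psi : in_L2 area D f -> test_function D psi -> itg area D (fun z => f z * psi z).
  by move=> fL tpsi; apply: test_mul_itg => //; exact: in_L2_itg.
have td := test_derive v tphi.
have E (f1' f2' : R * R -> R) psi : in_L2 area D f1' -> in_L2 area D f2' -> test_function D psi ->
    \int[area]_(z in D) ((c * f1' z + f2' z) * psi z) =
    c * \int[area]_(z in D) (f1' z * psi z) + \int[area]_(z in D) (f2' z * psi z).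
  move=> h1 h2 h3; rewrite -RintegralZl//; last exact: i.
  rewrite -RintegralD//; [|by apply: itgZ => //; exact: i|exact: i].
  by apply: Rintegral_eq => z _; ring.
by rewrite !E// w1// w2//; ring.
Qed.

Lemma box_split2 a b c m e f : itg area (box a b c e) f -> c <= m <= e ->
  \int[area]_(z in box a b c e) f z =
  \int[area]_(z in box a b c m) f z + \int[area]_(z in box a b m e) f z.
Proof.
move=> fi /andP[cm me].
have sub c' e' : c <= c' -> e' <= e -> box a b c' e' `<=` box a b c e.
  move=> h1 h2 z /boxP[h3 /andP[h4 h5]]; apply/boxP; split => //.
  by rewrite (le_trans h1 h4) (le_trans h5 h2).
have mb c' e' := @measurable_box R a b c' e'.
have fi1 : itg area (box a b c m) f := integrableS (mb _ _) (mb _ _) (sub _ _ (lexx c) me) fi.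
have fi2 : itg area (box a b m e) f := integrableS (mb _ _) (mb _ _) (sub _ _ cm (lexx e)) fi.
rewrite (Rintegral_box fi) (Rintegral_box fi1) (Rintegral_box fi2).
apply: Rintegral_split; first exact: itg_section_box.
by rewrite cm me.
Qed.

Lemma box_split1 a m b c e f : itg area (box a b c e) f -> a <= m <= b ->
  \int[area]_(z in box a b c e) f z =
  \int[area]_(z in box a m c e) f z + \int[area]_(z in box m b c e) f z.
Proof.
move=> fi /andP[am mb].
have sub a' b' : a <= a' -> b' <= b -> itg area (box a' b' c e) f.
  move=> h1 h2; apply: integrableS fi; [exact: measurable_box|exact: measurable_box|].
  move=> z /boxP[/andP[h4 h5] h3]; apply/boxP; split => //.
  by rewrite (le_trans h1 h4) (le_trans h5 h2).
rewrite -(itg_swap_box fi).2 -(itg_swap_box (sub _ _ (lexx a) mb)).2 -(itg_swap_box (sub _ _ am (lexx b))).2.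
by apply: box_split2; rewrite ?am//; exact: (itg_swap_box fi).1.
Qed.

Section sequence.
Context (D : set (R * R)) (f g1 g2 : nat -> R * R -> R) (M : R) (F : set_system nat).
Context (UF : UltraFilter F) (oD : open D) (Dfin : (area D < +oo)%E).
Context (fL : forall n, in_L2 area D (f n)).
Context (wg1 : forall n, is_weak_deriv D e1 (f n) (g1 n)).
Context (wg2 : forall n, is_weak_deriv D e2 (f n) (g2 n)).
Context (fM : forall n, \int[area]_(z in D) (f n z ^+ 2) <= M).
Context (g1M : forall n, \int[area]_(z in D) (g1 n z ^+ 2) <= M).
Context (g2M : forall n, \int[area]_(z in D) (g2 n z ^+ 2) <= M).
Context (f4 : forall n, in_L2 area D (fun z => f n z ^+ 2)).
Context (f4M : forall n, \int[area]_(z in D) (f n z ^+ 4) <= M).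

Local Notation df n p := (fun z => f n z - f p z).

Let mD : measurable (D : set (RT * RT)) := open_meas oD.

Lemma weak_deriv_sub v (n p : nat) (g : nat -> R * R -> R) : (forall n, is_weak_deriv D v (f n) (g n)) ->
  is_weak_deriv D v (df n p) (fun z => g n z - g p z).
Proof.
move=> w; have := weak_deriv_lin (-1) mD Dfin (fL p) (fL n) (w p) (w n).
have E (h k : R * R -> R) : (fun z => -1 * h z + k z) = (fun z => k z - h z).
  by apply/funext => z; ring.
by rewrite !E.
Qed.

Lemma sqr_sub_le (h : nat -> R * R -> R) (n p : nat) : (forall n, in_L2 area D (h n)) ->
  (forall n, \int[area]_(z in D) (h n z ^+ 2) <= M) ->
  \int[area]_(z in D) ((h n z - h p z) ^+ 2) <= 4 * M.
Proof.
move=> hL hM; have hn := in_L2_sqr (hL n); have hp := in_L2_sqr (hL p).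
apply: (@le_trans _ _ (\int[area]_(z in D) (2 * h n z ^+ 2 + 2 * h p z ^+ 2))).
  apply: le_Rintegral => //; first exact: (in_L2_sqr (in_L2B mD (hL n) (hL p))).
    by apply: itgD => //; exact: itgZ.
  by move=> z _; have := sqr_ge0 (h n z + h p z); rewrite !expr2; lra.
rewrite RintegralD ?RintegralZl//; [|exact: itgZ|exact: itgZ].
by have := hM n; have := hM p; lra.
Qed.

(** Each subdivision into four boxes halves the sides and so divides the gradient term of Poincare's
    inequality by 4. At level [k] it remains to control the means over finitely many small boxes,
    and these converge along the ultrafilter. *)
Lemma box_fcauchy k a b c e : a < b -> c < e -> box a b c e `<=` D ->
  fcauchy F (fun (n p : nat) => \int[area]_(z in box a b c e) ((f n z - f p z) ^+ 2) -
    5 * 4^-1 ^+ k * ((b - a) ^+ 2 * (\int[area]_(z in box a b c e) ((g1 n z - g1 p z) ^+ 2)) +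
    (e - c) ^+ 2 * \int[area]_(z in box a b c e) ((g2 n z - g2 p z) ^+ 2))).
Proof.
elim: k a b c e => [|k IH] a b c e ab ce bD; have mb := @measurable_box R a b c e.
  pose I n := \int[area]_(z in box a b c e) f n z.
  have fi n : itg area (box a b c e) (f n).
    exact: in_L2_itg (area_box_lty _ _ _ _) (in_L2_sub mD mb bD (fL n)).
  have aux (t C : R) : t ^+ 2 <= C -> `|t| <= 1 + C.
    by rewrite -real_normK ?num_real// => h; have := sqr_ge0 (`|t| - 1); nra.
  have Ibd : exists C : R, forall n, `|I n| <= C.
    have Afin := area_box_lty a b c e.
    have oneL : in_L2 area (box a b c e) (fun=> 1 : R).
      by apply: (@in_L2_bounded _ _ _ area _ mb _ 1) => // x _; rewrite normr1.
    exists (1 + (\int[area]_(z in box a b c e) (1 ^+ 2)) * M) => n.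
    have := cauchy_schwarz mb oneL (in_L2_sub mD mb bD (fL n)).
    under eq_Rintegral do rewrite mul1r.
    rewrite -/(I n) => h.
    have h2 : \int[area]_(z in box a b c e) (f n z ^+ 2) <= M.
      apply: le_trans (fM n); rewrite Rintegral_mkcond [leRHS]Rintegral_mkcond.
      have i1 := itg_patch mb (in_L2_sqr (in_L2_sub mD mb bD (fL n))).
      have i2 := itg_patch mD (in_L2_sqr (fL n)).
      apply: le_Rintegral => // z _; rewrite /patch; case: ifPn => [/set_mem/bD h1|_].
        by rewrite mem_set.
      by case: ifPn => // _; exact: sqr_ge0.
    apply: aux; apply: le_trans h _; rewrite ler_wpM2l//.
    by apply: Rintegral_ge0 => z _; exact: sqr_ge0.
  have [C hC] := Ibd; have [l hl] := ultra_limit hC.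
  have Q0 : 0 <= 4 / ((b - a) * (e - c)) by rewrite divr_ge0// mulr_ge0// subr_ge0 ltW.
  apply: fcauchy_le (fcauchyZ Q0 (fcauchy_cvg hl)) => n p.
  rewrite expr0 mulr1 lerBlDr /I -RintegralB//.
  apply: poincare_box (weak_deriv_sub n p wg1) (weak_deriv_sub n p wg2) => //.
  exact: in_L2B.
pose m := (a + b) / 2; pose h := (c + e) / 2.
have [am mb'] : (a < m) * (m < b) := midf_lt ab.
have [cm me] : (c < h) * (h < e) := midf_lt ce.
have sub a' b' c' e' : a <= a' -> b' <= b -> c <= c' -> e' <= e -> box a' b' c' e' `<=` D.
  move=> h1 h2 h3 h4 z /boxP[/andP[k1 k2] /andP[k3 k4]]; apply: bD; apply/boxP.
  by rewrite (le_trans h1 k1) (le_trans k2 h2) (le_trans h3 k3) (le_trans k4 h4).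
have amb : a <= m <= b by rewrite !ltW.
have cme : c <= h <= e by rewrite !ltW.
have split4 (w : R * R -> R) : itg area D w ->
    \int[area]_(z in box a b c e) w z =
    (\int[area]_(z in box a m c h) w z + \int[area]_(z in box a m h e) w z) +
    (\int[area]_(z in box m b c h) w z + \int[area]_(z in box m b h e) w z).
  move=> wi; have bi a' b' c' e' : box a' b' c' e' `<=` D -> itg area (box a' b' c' e') w.
    by move=> s; apply: integrableS wi => //; exact: measurable_box.
  rewrite (box_split1 (bi _ _ _ _ bD) amb).
  have b1 := bi _ _ _ _ (sub a m c e (lexx _) (ltW mb') (lexx _) (lexx _)).
  have b2 := bi _ _ _ _ (sub m b c e (ltW am) (lexx _) (lexx _) (lexx _)).
  by rewrite (box_split2 b1 cme) (box_split2 b2 cme).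
have L (u : nat -> R * R -> R) (n p : nat) : (forall n, in_L2 area D (u n)) ->
    itg area D (fun z => (u n z - u p z) ^+ 2).
  by move=> uL; exact: (in_L2_sqr (in_L2B mD (uL n) (uL p))).
have i11 := IH a m c h am cm (sub _ _ _ _ (lexx _) (ltW mb') (lexx _) (ltW me)).
have i12 := IH a m h e am me (sub _ _ _ _ (lexx _) (ltW mb') (ltW cm) (lexx _)).
have i21 := IH m b c h mb' cm (sub _ _ _ _ (ltW am) (lexx _) (lexx _) (ltW me)).
have i22 := IH m b h e mb' me (sub _ _ _ _ (ltW am) (lexx _) (ltW cm) (lexx _)).
apply: fcauchy_le (fcauchyD (fcauchyD i11 i12) (fcauchyD i21 i22)) => n p.
rewrite !split4; [|exact: L (fun n => (wg2 n).1)|exact: L (fun n => (wg1 n).1)|exact: L].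
rewrite le_eqVlt; apply/orP; left; apply/eqP.
rewrite (_ : m - a = (b - a) / 2); last by rewrite /m; field.
rewrite (_ : b - m = (b - a) / 2); last by rewrite /m; field.
rewrite (_ : h - c = (e - c) / 2); last by rewrite /h; field.
rewrite (_ : e - h = (e - c) / 2); last by rewrite /h; field.
rewrite exprS; set t := 4^-1 ^+ k.
do 12 (set X := (\int[area]_(z in _) _); move: X => ?).
by field.
Qed.

Lemma Rintegral_subset (E : set (RT * RT)) w : measurable E -> E `<=` D -> itg area D w ->
  (forall z, 0 <= w z) -> \int[area]_(z in E) w z <= \int[area]_(z in D) w z.
Proof.
move=> mE ED wi w0; rewrite Rintegral_mkcond [leRHS]Rintegral_mkcond.
apply: le_Rintegral => //.
- by apply: (itg_patch mE); exact: integrableS wi.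
- exact: itg_patch mD wi.
- move=> z _; rewrite /patch; case: ifPn => [/set_mem/ED h1|_]; first by rewrite mem_set.
  by case: ifPn.
Qed.

Lemma pow4_small c e : 0 < e -> exists k, c * 4^-1 ^+ k <= e.
Proof.
move=> e0; have c0 : 0 < e / (`|c| + 1) by rewrite divr_gt0// ltr_wpDl.
have q1 : `|4^-1 : R| < 1 by rewrite ger0_norm ?invr_ge0// invf_lt1// ltr1n.
have /cvgr0Pnorm_lt/(_ _ c0)/filter_ex[k hk] := cvg_expr q1.
exists k; rewrite ger0_norm ?exprn_ge0 ?invr_ge0// ltr_pdivlMr ?ltr_wpDl// in hk.
have := ler_norm c; have : 0 <= 4^-1 ^+ k :> R by rewrite exprn_ge0 ?invr_ge0.
move: (4^-1 ^+ k) hk => t h1 h2 h3; nra.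
Qed.

Lemma box_fcauchy_L2 a b c e : a < b -> c < e -> box a b c e `<=` D ->
  fcauchy F (fun n p : nat => \int[area]_(z in box a b c e) ((f n z - f p z) ^+ 2)).
Proof.
move=> ab ce bD h h0; have mb := @measurable_box R a b c e.
have h20 : 0 < h / 2 by rewrite divr_gt0.
have [k hk] := pow4_small (5 * (((b - a) ^+ 2 + (e - c) ^+ 2) * (4 * M))) h20.
have [S [FS hS]] := box_fcauchy k ab ce bD h20; exists S; split => // n p Sn Sp.
have g1b : \int[area]_(z in box a b c e) ((g1 n z - g1 p z) ^+ 2) <= 4 * M.
  apply: le_trans (sqr_sub_le n p (fun n => (wg1 n).1) g1M).
  apply: Rintegral_subset => // [|z]; last exact: sqr_ge0.
  exact: (in_L2_sqr (in_L2B mD (wg1 n).1 (wg1 p).1)).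
have g2b : \int[area]_(z in box a b c e) ((g2 n z - g2 p z) ^+ 2) <= 4 * M.
  apply: le_trans (sqr_sub_le n p (fun n => (wg2 n).1) g2M).
  apply: Rintegral_subset => // [|z]; last exact: sqr_ge0.
  exact: (in_L2_sqr (in_L2B mD (wg2 n).1 (wg2 p).1)).
have := hS n p Sn Sp; move: hk.
have : 0 <= 5 * 4^-1 ^+ k :> R by rewrite mulr_ge0 ?exprn_ge0 ?invr_ge0.
rewrite mulrAC.
set t := 5 * 4^-1 ^+ k => t0 hk.
have : t * ((b - a) ^+ 2 * (\int[area]_(z in box a b c e) ((g1 n z - g1 p z) ^+ 2)) +
    (e - c) ^+ 2 * (\int[area]_(z in box a b c e) ((g2 n z - g2 p z) ^+ 2))) <=
    t * (((b - a) ^+ 2 + (e - c) ^+ 2) * (4 * M)).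
  by rewrite ler_wpM2l// mulrDl lerD// ler_wpM2l ?sqr_ge0.
lra.
Qed.

(** On finitely many boxes inside [D] the sequence is already Cauchy. What they leave of [D] has
    small area, and there the bound on fourth powers and Cauchy-Schwarz exclude concentration. *)
Lemma L2_fcauchy : fcauchy F (fun n p : nat => \int[area]_(z in D) ((f n z - f p z) ^+ 2)).
Proof.
move=> h h0; have [a [b [c [e [hB hD]]]]] := open_boxes oD.
pose B i : set (RT * RT) := if (a i < b i) && (c i < e i) then box (a i) (b i) (c i) (e i) else set0.
pose U N : set (RT * RT) := \bigcup_(i in `I_N) B i.
have mB i : measurable (B i : set (RT * RT)) by rewrite /B; case: ifP => // _; exact: measurable_box.
have BD i : B i `<=` D by rewrite /B; case: ifP => [/andP[/hB]|_ z].
have Bcauchy i : fcauchy F (fun n p : nat => \int[area]_(z in B i) ((f n z - f p z) ^+ 2)).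
  rewrite /B; case: ifP => [/andP[ab ce]|_]; first exact: box_fcauchy_L2 (hB i ab).
  move=> h' h'0; exists setT; split; first exact: filterT.
  by move=> n p _ _; rewrite Rintegral_set0 ltW.
have mU N : measurable (U N : set (RT * RT)) by apply: bigcup_measurable.
have mI N : measurable_fun D (\1_(~` U N) : RT * RT -> R).
  have mUC : measurable (~` U N) by exact: measurableC.
  exact: measurable_indic.
have tail : \int[area]_(z in D) (\1_(~` U N) z) @[N --> \oo] --> (0 : R).
  rewrite -[X in _ --> X](@Rintegral0 _ _ R area D).
  apply: (@Rdominated _ _ _ area D mD _ _ (fun=> 1)) => //.
  - move=> z Dz; have [N0 [h1 h2]] := hD z Dz.
    apply: cvg_near_cst; exists N0.+1 => // N /= N0N; rewrite indicE memNset//; apply.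
    exists N0 => //; move: h1 h2 => /andP[h1 h2] /andP[h3 h4].
    by rewrite /B (lt_trans h1 h2) (lt_trans h3 h4)/=; apply/boxP; rewrite !ltW.
  - exact: itg_cst.
  - by move=> N z _; rewrite indicE ger0_norm//; case: (_ \in _).
have M0 : 0 <= M by apply: le_trans (fM 0); apply: Rintegral_ge0 => z _; exact: sqr_ge0.
(* This area threshold makes Cauchy-Schwarz yield [h / 2], as the fourth powers of the differences
   have integral at most [16 * M]. *)
have h40 : 0 < (h / 2) ^+ 2 / (16 * M + 1).
  by rewrite divr_gt0 ?exprn_gt0 ?divr_gt0// ltr_wpDl ?mulr_ge0.
have /cvgr0Pnorm_lt/(_ _ h40)/filter_ex[N hN] := tail.
have h20 : 0 < h / 2 by rewrite divr_gt0.
have [S [FS hS]] := @fcauchy_sum _ F _ N _ Bcauchy _ h20.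
exists S; split => // n p Sn Sp; have {hS Sn Sp} := hS n p Sn Sp.
pose w z := f n z - f p z.
have wL : in_L2 area D w by exact: in_L2B.
have wi := in_L2_sqr wL.
have w4 z : w z ^+ 4 <= 8 * f n z ^+ 4 + 8 * f p z ^+ 4.
  rewrite /w; have := sqr_ge0 (f n z ^+ 2 - f p z ^+ 2); have := sqr_ge0 (f n z + f p z).
  have := sqr_ge0 ((f n z + f p z) ^+ 2); move: (f n z) (f p z) => x y h1 h2 h3.
  have := sqr_ge0 ((x + y) * (x - y)); have := sqr_ge0 (x * y); have := mulr_ge0 h2 (sqr_ge0 x).
  have := mulr_ge0 h2 (sqr_ge0 y). 
  rewrite !expr2 ![_ ^+ 4]exprS !exprS !expr0; move: h1 h2 h3; rewrite !expr2; nra.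
have i4 m : itg area D (fun z => f m z ^+ 4).
  by apply: eq_itg (in_L2_sqr (f4 m)) => // z _; rewrite -exprM.
have w2L : in_L2 area D (fun z => w z ^+ 2).
  split; first by have /itg_meas := wi.
  suff : itg area D (fun z => w z ^+ 4) by apply: eq_itg => // z _; rewrite -exprM.
  apply: (@itg_le _ _ _ _ _ mD _ (fun z => 8 * f n z ^+ 4 + 8 * f p z ^+ 4)).
  - by apply: measurable_funX; case: wL.
  - by apply: itgD => //; exact: itgZ.
  - by move=> z _; rewrite ger0_norm// exprn_even_ge0.
have w4M : \int[area]_(z in D) ((w z ^+ 2) ^+ 2) <= 16 * M.
  apply: (@le_trans _ _ (\int[area]_(z in D) (8 * f n z ^+ 4 + 8 * f p z ^+ 4))).
    apply: le_Rintegral => //; first exact: in_L2_sqr w2L.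
      by apply: itgD => //; exact: itgZ.
    by move=> z _; rewrite -exprM.
  rewrite RintegralD ?RintegralZl//; [|exact: itgZ|exact: itgZ].
  by have := f4M n; have := f4M p; lra.
have oneL : in_L2 area D (\1_(~` U N) : R * R -> R).
  apply: (in_L2_bounded mD (c := 1)); [exact: Dfin|exact: mI|].
  by move=> z _; rewrite indicE ger0_norm//; case: (_ \in _).
have cs := cauchy_schwarz mD oneL w2L.
have {}cs : \int[area]_(z in D) (\1_(~` U N) z * w z ^+ 2) <= h / 2.
  have h1 : \int[area]_(z in D) (\1_(~` U N) z ^+ 2) <= (h / 2) ^+ 2 / (16 * M + 1).
    apply: le_trans (ltW hN); rewrite ger0_norm; last by apply: Rintegral_ge0 => z _; rewrite indicE.
    rewrite le_eqVlt; apply/orP; left; apply/eqP; apply: Rintegral_eq => z _.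
    by rewrite indicE; case: (_ \in _); rewrite ?expr1n ?expr0n.
  rewrite -(ler_pXn2r (n := 2))// ?nnegrE ?(ltW h20)//; last first.
    by apply: Rintegral_ge0 => z _; rewrite mulr_ge0 ?sqr_ge0// indicE.
  apply: le_trans cs _; apply: (@le_trans _ _ ((h / 2) ^+ 2 / (16 * M + 1) * (16 * M + 1))).
    apply: ler_pM => //; [by apply: Rintegral_ge0 => z _; exact: sqr_ge0|by apply: Rintegral_ge0 => z _; exact: sqr_ge0|].
    by apply: le_trans w4M _; rewrite lerDl.
  by rewrite divfK// gt_eqF// ltr_wpDl ?mulr_ge0.
have Ui K : itg area D (fun z => \1_(U K) z * w z ^+ 2).
  apply: (itgM_bounded mD (c := 1)) => //.
  by move=> z _; rewrite indicE ger0_norm//; case: (_ \in _).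
(* The boxes may overlap, so the integral over their union is only bounded by the sum. *)
have cover K : \int[area]_(z in D) (\1_(U K) z * w z ^+ 2) <=
    \sum_(i < K) \int[area]_(z in B i) (w z ^+ 2).
  elim: K => [|K IH].
    rewrite big_ord0 Rintegral_eq0// => z _; rewrite indicE memNset ?mul0r//.
    by case=> i; rewrite /= ltn0.
  rewrite big_ord_recr/=; apply: le_trans (_ : _ <= \int[area]_(z in D) (\1_(U K) z * w z ^+ 2 + \1_(B K) z * w z ^+ 2)) _.
    have BKi : itg area D (fun z => \1_(B K) z * w z ^+ 2).
      apply: (itgM_bounded mD (c := 1)) => //.
      by move=> z _; rewrite indicE ger0_norm//; case: (_ \in _).
    apply: le_Rintegral => //; first exact: itgD.
    move=> z _; rewrite -mulrDl ler_wpM2r ?sqr_ge0// !indicE.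
    have [/set_mem[i /= iK Bi]|_] := boolP (z \in U K.+1); last by rewrite addr_ge0.
    move: iK; rewrite ltnS leq_eqVlt => /orP[/eqP iK|iK].
      by rewrite (@mem_set _ (B K)) -?iK// lerDr.
    by rewrite (@mem_set _ (U K)) ?lerDl//; exists i.
  rewrite RintegralD//; last first.
    apply: (itgM_bounded mD (c := 1)) => //.
    by move=> z _; rewrite indicE ger0_norm//; case: (_ \in _).
  rewrite lerD// [leLHS]Rintegral_mkcond [leRHS]Rintegral_mkcond.
  rewrite le_eqVlt; apply/orP; left; apply/eqP; apply: Rintegral_eq => z _.
  rewrite /patch indicE; have [zB|zB] := boolP (z \in B K).
    by rewrite mul1r mem_set//; apply: (BD K); exact: set_mem zB.
  by rewrite mul0r; case: ifP.
move=> hs; have := cover N; rewrite -/w => hc.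
have -> : \int[area]_(z in D) (w z ^+ 2) =
    \int[area]_(z in D) (\1_(U N) z * w z ^+ 2) + \int[area]_(z in D) (\1_(~` U N) z * w z ^+ 2).
  rewrite -RintegralD//; last first.
    apply: (itgM_bounded mD (c := 1)); [exact: wi|exact: mI|].
    by move=> z _; rewrite indicE ger0_norm//; case: (_ \in _).
  by apply: Rintegral_eq => z _; rewrite -mulrDl !indicE in_setC; case: (_ \in _); rewrite /= ?addr0 ?add0r mul1r.
by move: hc hs cs; rewrite /B /w; lra.
Qed.

End sequence.
End rellich.

(** * Passage to the limit in L^2 *)

Section L2_limits.
Context d (T : measurableType d) (R : realType) (m : {measure set T -> \bar R}).
Context (D : set T) (mD : measurable D).
Implicit Types f g h : T -> R.

Lemma cvg_pow4 (c : R) : (fun n => c * 4^-1 ^+ n) @ \oo --> (0 : R).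
Proof.
rewrite -[X in _ --> X](mulr0 c); apply: cvgMr; apply: cvg_expr.
by rewrite ger0_norm ?invr_ge0// invf_lt1// ltr1n.
Qed.

Lemma L2_cvg_mul (f_ : nat -> T -> R) f h (c : R) : (forall n, in_L2 m D (f_ n)) -> in_L2 m D f ->
  in_L2 m D h -> (forall n, \int[m]_(x in D) ((f_ n x - f x) ^+ 2) <= c * 4^-1 ^+ n) ->
  \int[m]_(x in D) (f_ n x * h x) @[n --> \oo] --> \int[m]_(x in D) (f x * h x).
Proof.
move=> fL fL0 hL le4; apply/subr_cvg0.
pose H := \int[m]_(x in D) (h x ^+ 2).
have H0 : 0 <= H by apply: Rintegral_ge0 => x _; exact: sqr_ge0.
have sq n : (\int[m]_(x in D) (f_ n x * h x) - \int[m]_(x in D) (f x * h x)) ^+ 2 <= (c * H) * 4^-1 ^+ n.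
  rewrite -RintegralB//; [|exact: in_L2_itgM|exact: in_L2_itgM].
  rewrite (_ : \int[m]_(x in D) _ = \int[m]_(x in D) ((f_ n x - f x) * h x)).
    apply: le_trans (cauchy_schwarz mD (in_L2B mD (fL n) fL0) hL) _.
    by rewrite mulrAC ler_wpM2r.
  by apply: Rintegral_eq => x _; rewrite mulrBl.
apply/cvgr0Pnorm_lt => e e0.
have /cvgr0Pnorm_lt/(_ (e ^+ 2)) := @cvg_pow4 (c * H); rewrite exprn_gt0// => /(_ isT).
apply: filterS => n hn; rewrite -(ltr_pXn2r (n := 2)) ?nnegrE ?(ltW e0)// real_normK ?num_real//.
by apply: le_lt_trans (sq n) _; exact: le_lt_trans (ler_norm _) hn.
Qed.

(** The square of [f_ n] is written as the square of [f_ n - f] plus terms linear in [f_ n], whose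
    integrals converge by the previous lemma. *)
Lemma L2_cvg_sqr (f_ : nat -> T -> R) f (c : R) : (forall n, in_L2 m D (f_ n)) -> in_L2 m D f ->
  (forall n, \int[m]_(x in D) ((f_ n x - f x) ^+ 2) <= c * 4^-1 ^+ n) ->
  \int[m]_(x in D) (f_ n x ^+ 2) @[n --> \oo] --> \int[m]_(x in D) (f x ^+ 2).
Proof.
move=> fL fL0 le4.
have E : (fun n => \int[m]_(x in D) (f_ n x ^+ 2)) = (fun n => \int[m]_(x in D) ((f_ n x - f x) ^+ 2) +
    (2 * \int[m]_(x in D) (f_ n x * f x) - \int[m]_(x in D) (f x ^+ 2))).
  apply/funext => n; have i1 := in_L2_sqr (in_L2B mD (fL n) fL0).
  have i2 := in_L2_itgM mD (fL n) fL0; have i3 := in_L2_sqr fL0.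
  rewrite -RintegralZl// -RintegralB//; last exact: itgZ.
  rewrite -RintegralD//; last by apply: itgB => //; exact: itgZ.
  by apply: Rintegral_eq => x _; ring.
rewrite E -[X in _ --> X]add0r; apply: cvgD.
  apply: (@squeeze_cvgr _ _ _ _ (fun=> 0) (fun n => c * 4^-1 ^+ n)).
  - by apply: nearW => n; rewrite le4 andbT; apply: Rintegral_ge0 => x _; exact: sqr_ge0.
  - exact: cvg_cst.
  - exact: cvg_pow4.
have E2 : \int[m]_(x in D) (f x ^+ 2) = 2 * (\int[m]_(x in D) (f x * f x)) - \int[m]_(x in D) (f x ^+ 2).
  by under [in RHS]eq_Rintegral do rewrite -expr2; ring.
rewrite [X in _ --> X]E2.
apply: cvgB; last exact: cvg_cst.
apply: cvgM; first exact: cvg_cst.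
exact: (L2_cvg_mul fL fL0 fL0 le4).
Qed.

End L2_limits.

(** Finitely many sets of the filter and a tail of the integers always meet. The bound [k <= phi k]
    replaces monotonicity of the extracted indices. *)
Lemma extraction (F : set_system nat) (S : nat -> set nat) : ProperFilter F -> \oo `<=` F ->
  (forall k, F (S k)) -> exists phi : nat -> nat, forall k, (k <= phi k)%N /\
    forall j, (j <= k)%N -> S j (phi k).
Proof.
move=> FF Foo FS.
suff /choice[phi h] : forall k, exists n, (k <= n)%N /\ forall j, (j <= k)%N -> S j n by exists phi.
move=> k.
have FT : F [set n | forall j, (j <= k)%N -> S j n].
  elim: k => [|k IH]; first by apply: filterS (FS 0%N) => n Sn j; rewrite leqn0 => /eqP ->.
  apply: filterS2 IH (FS k.+1) => n h Sn j; rewrite leq_eqVlt ltnS => /orP[/eqP ->//|]; exact: h.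
have Fk : F [set n | (k <= n)%N] by apply: Foo; exists k.
have FI : F ([set n | (k <= n)%N] `&` [set n | forall j, (j <= k)%N -> S j n]) by exact: filterI.
by have /filter_ex[n []] := FI; exists n.
Qed.

(** * Existence of minimizers by the direct method *)

Section existence.
Context {R : realType}.
Local Notation RT := (measurableTypeR R).
Local Notation area := (@area R).
Local Notation F := (R * R -> R).
Context (I : finType) (D : set (R * R)) (oD : open D) (Dfin : (area D < +oo)%E).
Context (sg : I -> I) (a : bool * I -> F) (A : R).
Context (ma : forall j, measurable_fun (D : set (RT * RT)) (a j : RT * RT -> R)).
Context (aA : forall j z, D z -> `|a j z| <= A).
Context (P : (I -> R) -> R) (C : R).
Context (P0 : forall t, 0 <= P t).
Context (Pcvg : forall (x : nat -> I -> R) (l : I -> R), (forall i, x n i @[n --> \oo] --> l i) ->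
  P (x n) @[n --> \oo] --> P l).
Context (Pmeas : forall f : I -> F, (forall i, measurable_fun (D : set (RT * RT)) (f i : RT * RT -> R)) ->
  measurable_fun (D : set (RT * RT)) (fun z : RT * RT => P (f ^~ z))).
Context (C0 : 0 <= C) (Pcoer : forall (t : I -> R) i, t i ^+ 4 <= C * (1 + P t)).
Context (Adm : set (I -> F)).
Context (Aclosed : forall (f_ : nat -> I -> F) f, (forall n, Adm (f_ n)) ->
  (forall n i, in_L2 area D (f_ n i)) -> (forall i, in_L2 area D (f i)) ->
  (forall n i, \int[area]_(z in D) ((f_ n i z - f i z) ^+ 2) <= 4^-1 ^+ n) -> Adm f).

Definition dir (b : bool) : R * R := if b then e1 else e2.

(* The second component holds the weak first derivatives, indexed by direction. *)
Definition state := ((I -> F) * (bool * I -> F))%type.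
Implicit Types u v : state.

Definition in_H1 v : Prop := (forall i, in_L2 area D (v.1 i)) /\
  forall j, is_weak_deriv D (dir j.1) (v.1 j.2) (v.2 j).

(** A covariant derivative in real form: multiplication by i exchanges real and imaginary parts,
    which is the role of [sg], while [a] holds the vector potential with its sign. *)
Definition cov v (j : bool * I) : F := fun z => v.2 j z + a j z * v.1 (sg j.2) z.

Definition kin v : R := \sum_j \int[area]_(z in D) (cov v j z ^+ 2).

Definition pot (f : I -> F) : \bar R := (\int[area]_(z in D) (P (f ^~ z))%:E)%E.

Definition comb (c : R) u v : state :=
  (fun i z => c * u.1 i z + v.1 i z, fun j z => c * u.2 j z + v.2 j z).

Let mD : measurable (D : set (RT * RT)) := open_meas oD.

Lemma in_H1_comb c u v : in_H1 u -> in_H1 v -> in_H1 (comb c u v).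
Proof.
move=> [u1 u2] [v1 v2]; split=> [i|j]; first by apply: in_L2D => //; exact: in_L2Z.
exact: weak_deriv_lin.
Qed.

Lemma in_L2_a j f : in_L2 area D f -> in_L2 area D (fun z => a j z * f z).
Proof. by move=> fL; apply: (in_L2M_bounded mD fL (ma j) (c := A)) => z; exact: aA. Qed.

Lemma in_L2_cov v j : in_H1 v -> in_L2 area D (cov v j).
Proof. by move=> [v1 v2]; apply: in_L2D => //; [exact: (v2 j).1|exact: in_L2_a]. Qed.

Lemma cov_comb c u v j z : cov (comb c u v) j z = c * cov u j z + cov v j z.
Proof. by rewrite /cov /comb /=; ring. Qed.

(** For a fixed test function both sides of the defining identity are continuous in L^2. *)
Lemma weak_deriv_closed d (f_ g_ : nat -> F) f g c : (forall n, in_L2 area D (f_ n)) ->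
  in_L2 area D f -> in_L2 area D g -> (forall n, is_weak_deriv D d (f_ n) (g_ n)) ->
  (forall n, \int[area]_(z in D) ((f_ n z - f z) ^+ 2) <= c * 4^-1 ^+ n) ->
  (forall n, \int[area]_(z in D) ((g_ n z - g z) ^+ 2) <= c * 4^-1 ^+ n) ->
  is_weak_deriv D d f g.
Proof.
move=> fL fL0 gL w hf hg; split => // phi tphi.
have test_L2 psi : test_function D psi -> in_L2 area D psi.
  move=> tpsi; have [M hM] := test_bounded tpsi.
  by apply: (in_L2_bounded mD (c := M)) => //; exact: test_meas tpsi.
have l1 := L2_cvg_mul mD fL fL0 (test_L2 _ (test_derive d tphi)) hf.
have l2 := L2_cvg_mul mD (fun n => (w n).1) gL (test_L2 _ tphi) hg.
have l3 : (- \int[area]_(x in D) (g_ n x * phi x)) @[n --> \oo] --> - \int[area]_(x in D) (g x * phi x).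
  exact: cvgN.
have E : (fun n => \int[area]_(z in D) (f_ n z * 'D_d phi z)) = (fun n => - \int[area]_(z in D) (g_ n z * phi z)).
  by apply/funext => n; exact: (w n).2.
by rewrite E in l1; rewrite -(cvg_lim _ l1)// -(cvg_lim _ l3).
Qed.

Lemma itg_sqr_le f g h (c : R) : in_L2 area D g -> in_L2 area D h -> in_L2 area D f ->
  (forall z, D z -> `|f z| <= `|g z| + c * `|h z|) ->
  \int[area]_(z in D) (f z ^+ 2) <=
  2 * \int[area]_(z in D) (g z ^+ 2) + 2 * c ^+ 2 * \int[area]_(z in D) (h z ^+ 2).
Proof.
move=> gL hL fL le; have g2 := in_L2_sqr gL; have h2 := in_L2_sqr hL.
rewrite -RintegralZl// -RintegralZl// -RintegralD//; [|exact: itgZ|exact: itgZ].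
apply: le_Rintegral => //; [exact: in_L2_sqr|by apply: itgD => //; exact: itgZ|].
move=> z Dz; have := le z Dz; have := normr_ge0 (f z).
rewrite -(real_normK (num_real (f z))) -(real_normK (num_real (g z))) -(real_normK (num_real (h z))).
move: (`|f z|) (`|g z|) (`|h z|) => r s t r0 rst.
have : r ^+ 2 <= (s + c * t) ^+ 2 by rewrite ler_sqr ?nnegrE// (le_trans r0).
by have := sqr_ge0 (s - c * t); rewrite !expr2; nra.
Qed.

(** A minimizing sequence has an L^2 limit [f] and kinetic energies tending to some [l]; Fatou's
    lemma bounds the potential energy of [f] by the infimum minus [l / 2]. To bound the kinetic
    energy, new states with fields close to [f] are chosen that almost minimize [kin]; their
    covariant derivatives converge strongly. *)
Lemma exists_minimizer : (exists v, [/\ in_H1 v, Adm v.1 & (pot v.1 < +oo)%E]) ->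
  exists v, [/\ in_H1 v, Adm v.1 & forall u, in_H1 u -> Adm u.1 ->
    ((kin v / 2)%:E + pot v.1 <= (kin u / 2)%:E + pot u.1)%E].
Proof.
move=> [w [wH wA wfin]].
have kin0 v : 0 <= kin v by apply: sumr_ge0 => j _; apply: Rintegral_ge0 => z _; exact: sqr_ge0.
have pot0 f : (0 <= pot f)%E by apply: integral_ge0 => z _; rewrite lee_fin.
pose E v := ((kin v / 2)%:E + pot v.1)%E.
have E0 v : (0 <= E v)%E by apply: adde_ge0 => //; rewrite lee_fin divr_ge0.
pose m := ereal_inf [set E v | v in [set v | in_H1 v /\ Adm v.1]].
have m0 : (0 <= m)%E by apply: le_ereal_inf_tmp => _ [v _ <-].
have mle v : in_H1 v -> Adm v.1 -> (m <= E v)%E by move=> h1 h2; apply: ereal_inf_lbound; exists v.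
have mfin : m \is a fin_num.
  rewrite ge0_fin_numE//; apply: le_lt_trans (mle _ wH wA) _.
  by rewrite /E lte_add_pinfty// ltry.
pose mr := fine m.
have mE : m = mr%:E by rewrite fineK.
have mr0 : 0 <= mr by rewrite -lee_fin -mE.
have /choice[v hv] : forall n, exists v, [/\ in_H1 v, Adm v.1 & (E v <= (mr + 4^-1 ^+ n)%:E)%E].
  move=> n; have e0 : 0 < 4^-1 ^+ n :> R by rewrite exprn_gt0// invr_gt0.
  have [_ [v [h1 h2] <-] h] := @lb_ereal_inf_adherent _ [set E v | v in [set v | in_H1 v /\ Adm v.1]] _ e0 mfin.
  by exists v; split => //; apply: ltW; rewrite EFinD -mE.
have vH n : in_H1 (v n) by case: (hv n).
have vL n i : in_L2 area D ((v n).1 i) := (vH n).1 i.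
have pow1 n : 4^-1 ^+ n <= 1 :> R by rewrite exprn_ile1 ?invr_ge0// invf_le1// ler1n.
have pow0 n : 0 < 4^-1 ^+ n :> R by rewrite exprn_gt0// invr_gt0.
have mP f : (forall i, in_L2 area D (f i)) -> measurable_fun (D : set (RT * RT)) (fun z : RT * RT => P (f ^~ z)).
  by move=> fL; apply: Pmeas => i; case: (fL i).
have Pi n : itg area D (fun z => P ((v n).1 ^~ z)).
  apply/integrableP; split; first by apply/measurable_EFinP; exact: (mP _ (vL n)).
  rewrite (_ : integral _ _ _ = pot (v n).1); last first.
    by apply: eq_integral => z _; rewrite /= ger0_norm.
  have [_ _ h] := hv n; have := le_lt_trans h (ltry _).
  by apply: le_lt_trans; rewrite leeDr// lee_fin divr_ge0.
pose p n := \int[area]_(z in D) P ((v n).1 ^~ z).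
have pE n : pot (v n).1 = (p n)%:E by rewrite EFin_Rintegral.
have p0 n : 0 <= p n by apply: Rintegral_ge0.
have Ele n : kin (v n) / 2 + p n <= mr + 4^-1 ^+ n.
  by have [_ _] := hv n; rewrite /E pE -EFinD lee_fin.
have kinle n : kin (v n) <= 2 * (mr + 1).
  have := Ele n; have := p0 n; have := pow1 n; lra.
have ple n : p n <= mr + 1.
  by have := Ele n; have := kin0 (v n); have := pow1 n; lra.
have one1 : itg area D (fun=> 1 : R) by exact: itg_cst.
pose Da := \int[area]_(z in D) (1 : R).
have Da0 : 0 <= Da by apply: Rintegral_ge0.
have i4 n i : itg area D (fun z => (v n).1 i z ^+ 4).
  apply: (@itg_le _ _ _ _ _ mD _ (fun z => C * (1 + P ((v n).1 ^~ z)))).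
  - by apply: measurable_funX; case: (vL n i).
  - by apply: itgZ => //; exact: itgD.
  - by move=> z _; rewrite ger0_norm ?exprn_even_ge0//; exact: Pcoer.
(* Coercivity of the potential gives the bound on fourth powers that [L2_fcauchy] uses near the
   boundary. *)
have f4 n i : \int[area]_(z in D) ((v n).1 i z ^+ 4) <= C * (Da + (mr + 1)).
  apply: (@le_trans _ _ (C * (Da + p n))); last by rewrite ler_wpM2l// lerD2l.
  rewrite -RintegralD// -RintegralZl//; last exact: itgD.
  apply: le_Rintegral => //; first by apply: itgZ => //; exact: itgD.
  by move=> z _; exact: Pcoer.
set M4 := C * (Da + (mr + 1)) in f4.
have f2 n i : \int[area]_(z in D) ((v n).1 i z ^+ 2) <= Da + M4.
  apply: (@le_trans _ _ (\int[area]_(z in D) (1 + (v n).1 i z ^+ 4))).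
    apply: le_Rintegral => //; [exact: in_L2_sqr|exact: itgD|move=> z _].
    have := sqr_ge0 ((v n).1 i z ^+ 2 - 1); have := sqr_ge0 ((v n).1 i z).
    rewrite (_ : (v n).1 i z ^+ 4 = ((v n).1 i z ^+ 2) ^+ 2); last by rewrite -exprM.
    by rewrite sqrrB expr1n; nra.
  by rewrite RintegralD// lerD2l.
have covle n j : \int[area]_(z in D) (cov (v n) j z ^+ 2) <= 2 * (mr + 1).
  apply: le_trans (kinle n); rewrite /kin (bigD1 j)//= lerDl.
  by apply: sumr_ge0 => k _; apply: Rintegral_ge0 => z _; exact: sqr_ge0.
(* The weak derivatives are recovered from the covariant ones because the term of order zero has a
   bounded coefficient. *)
have g2 n j : \int[area]_(z in D) ((v n).2 j z ^+ 2) <= 2 * (2 * (mr + 1)) + 2 * A ^+ 2 * (Da + M4).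
  apply: le_trans (itg_sqr_le (c := A) (in_L2_cov j (vH n)) (vL n (sg j.2)) ((vH n).2 j).1 _) _.
    move=> z Dz; rewrite /cov; have -> : (v n).2 j z = (v n).2 j z + a j z * (v n).1 (sg j.2) z - a j z * (v n).1 (sg j.2) z.
      by rewrite addrK.
    apply: le_trans (ler_normB _ _) _; rewrite addrK lerD2l normrM.
    by rewrite ler_wpM2r//; exact: aA.
  by apply: lerD; rewrite ler_wpM2l// mulr_ge0// sqr_ge0.
have A20 : 0 <= A ^+ 2 := sqr_ge0 A.
have M40 : 0 <= M4 by rewrite mulr_ge0// !addr_ge0.
pose M := (2 * (2 * (mr + 1)) + 2 * A ^+ 2 * (Da + M4)) + (Da + M4).
have DM0 : 0 <= Da + M4 by exact: addr_ge0.
have gM0 : 0 <= 2 * (2 * (mr + 1)) + 2 * A ^+ 2 * (Da + M4).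
  by have := mulr_ge0 A20 DM0; rewrite -mulrA; lra.
have b1 : Da + M4 <= M by rewrite /M lerDr.
have b2 : M4 <= M by apply: le_trans b1; rewrite lerDr.
have b3 : 2 * (2 * (mr + 1)) + 2 * A ^+ 2 * (Da + M4) <= M by rewrite /M lerDl.
(* One ultrafilter makes all field components and the kinetic energies converge; afterwards [phi]
   extracts an ordinary sequence with explicit rates. *)
have [F [UF Foo]] := @ultraFilterLemma nat \oo _.
have cau i : fcauchy F (fun n p : nat => \int[area]_(z in D) (((v n).1 i z - (v p).1 i z) ^+ 2)).
  apply: (@L2_fcauchy R D (fun n => (v n).1 i) (fun n => (v n).2 (true, i)) (fun n => (v n).2 (false, i)) M F UF oD Dfin).
  - by move=> n.
  - by move=> n; exact: ((vH n).2 (true, i)).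
  - by move=> n; exact: ((vH n).2 (false, i)).
  - by move=> n; exact: le_trans (f2 n i) b1.
  - by move=> n; exact: le_trans (g2 n _) b3.
  - by move=> n; exact: le_trans (g2 n _) b3.
  - move=> n; split; first by apply: measurable_funX; case: (vL n i).
    by apply: eq_itg (i4 n i) => // z _; rewrite -exprM.
  - by move=> n; exact: le_trans (f4 n i) b2.
have [l hl] : exists l : R, kin (v n) @[n --> F] --> l.
  by apply: (@ultra_limit _ F UF _ (2 * (mr + 1))) => n; rewrite ger0_norm.
have /choice[S0 hS0] : forall ik : I * nat, exists S, F S /\
    forall n p, S n -> S p -> \int[area]_(z in D) (((v n).1 ik.1 z - (v p).1 ik.1 z) ^+ 2) <= 4^-1 ^+ ik.2.
  by move=> ik; exact: cau.
pose S k := [set n | (forall i, S0 (i, k) n) /\ `|l - kin (v n)| < 4^-1 ^+ k].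
have [phi hphi] : exists phi : nat -> nat, forall k, (k <= phi k)%N /\
    forall j, (j <= k)%N -> S j (phi k).
  apply: (@extraction F) => // k; apply: filterI.
    by apply: filter_forall => i; exact: (hS0 (i, k)).1.
  by move/cvgrPdist_lt : hl; apply.
pose y n := v (phi n).
have ycau i n q : (n <= q)%N -> \int[area]_(z in D) (((y n).1 i z - (y q).1 i z) ^+ 2) <= 4^-1 ^+ n.
  move=> nq; apply: (hS0 (i, n)).2; first exact: ((hphi n).2 n (leqnn n)).1.
  exact: ((hphi q).2 n nq).1.
have /choice[f hf] : forall i, exists f : R * R -> R, [/\ in_L2 area D f,
    forall n, \int[area]_(z in D) (((y n).1 i z - f z) ^+ 2) <= 4^-1 ^+ n &
    \forall z \ae area, D z -> (y n).1 i z @[n --> \oo] --> f z].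
  by move=> i; apply: (riesz_fischer mD Dfin (fun n => vL (phi n) i)) => n q; exact: ycau.
have fL i : in_L2 area D (f i) by case: (hf i).
have fA : Adm f.
  apply: (@Aclosed (fun n => (y n).1)) => // [n|n i|n i]; first by have [_ ? _] := hv (phi n).
    exact: vL.
  by have [_ h _] := hf i.
have kcl n : `|l - kin (y n)| < 4^-1 ^+ n by exact: ((hphi n).2 n (leqnn n)).2.
have powle n q : (n <= q)%N -> 4^-1 ^+ q <= 4^-1 ^+ n :> R.
  by move=> nq; rewrite ler_wiXn2l// ?invr_ge0// invf_le1// ler1n.
have potf : (pot f <= (mr - l / 2)%:E)%E.
  apply/lee_addgt0Pr => e e0; rewrite -EFinD.
  apply: (@fatou_le _ _ _ area _ mD (fun n z => P ((y n).1 ^~ z))).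
  - by move=> n; apply: mP => i; exact: vL.
  - exact: mP.
  - by move=> n z _.
  - have : \forall z \ae area, forall i, D z -> (y n).1 i z @[n --> \oo] --> f i z.
      by apply: filter_forall => i; case: (hf i).
    apply: ae_mono => z h Dz; apply: (@Pcvg (fun n => (y n).1 ^~ z)) => i; exact: h.
  - have [N hN] := @pow4_small R 2 e e0.
    exists N => // n /= Nn; rewrite -(EFin_Rintegral mD); last exact: Pi.
    rewrite lee_fin; have := Ele (phi n); have := kcl n; rewrite ltr_norml => /andP[].
    have := powle _ _ (hphi n).1; have := powle _ _ Nn; rewrite /p /y; lra.
(* The mass constraint is not convex and is left out of these sets: their fields converge to [f],
   which is already known to be admissible. *)
pose Cs n : set state := [set u | in_H1 u /\ forall i, \int[area]_(z in D) ((u.1 i z - f i z) ^+ 2) <= 4^-1 ^+ n].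
(* [comb] has coefficient 1 on its last argument, so the midpoint is completed by the zero state
   [comb (-1) u1 u1]. *)
pose half u0 u1 : state := comb 2^-1 u0 (comb 2^-1 u1 (comb (-1) u1 u1)).
have halfH u0 u1 : in_H1 u0 -> in_H1 u1 -> in_H1 (half u0 u1).
  by move=> h0 h1; do ! apply: in_H1_comb => //.
have halfE u0 u1 i z : (half u0 u1).1 i z = 2^-1 * u0.1 i z + 2^-1 * u1.1 i z.
  by rewrite /half /comb/=; ring.
pose dist u0 u1 := kin (comb (-1) u1 u0).
have distE u0 u1 j z : cov (comb (-1) u1 u0) j z = cov u0 j z - cov u1 j z by rewrite cov_comb; ring.
have [u_ [al [all uC uk ud]]] : exists v_ : nat -> state, exists al : R,
    [/\ al <= l, forall n, Cs n (v_ n), forall n, kin (v_ n) <= al + 4^-1 ^+ n &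
        forall n p, (n <= p)%N -> dist (v_ n) (v_ p) <= 4^-1 ^+ n].
  apply: (@almost_minimizers_cauchy R state half kin dist Cs l).
  - by move=> n q nq u [uH uf]; split => // i; exact: le_trans (uf i) (powle _ _ nq).
  - move=> n u0 u1 [h0 f0] [h1 f1]; split=> [|i]; first exact: halfH.
    have d0 := in_L2_sqr (in_L2B mD (h0.1 i) (fL i)); have d1 := in_L2_sqr (in_L2B mD (h1.1 i) (fL i)).
    apply: (@le_trans _ _ (\int[area]_(z in D) (2^-1 * (u0.1 i z - f i z) ^+ 2 + 2^-1 * (u1.1 i z - f i z) ^+ 2))).
      apply: le_Rintegral => //; first exact: in_L2_sqr (in_L2B mD ((halfH _ _ h0 h1).1 i) (fL i)).
        by apply: itgD => //; exact: itgZ.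
      by move=> z _; rewrite halfE; have := sqr_ge0 (u0.1 i z - u1.1 i z); rewrite !expr2; lra.
    rewrite RintegralD//; [|exact: itgZ|exact: itgZ].
    by rewrite !RintegralZl//; have := f0 i; have := f1 i; lra.
  - by move=> u _; exact: kin0.
  - move=> u0 u1 [h0 _] [h1 _]; rewrite /dist /kin !mulr_sumr -big_split -sumrB; apply: eq_bigr => j _.
    have k0 := in_L2_sqr (in_L2_cov j h0); have k1 := in_L2_sqr (in_L2_cov j h1).
    have k2 := in_L2_sqr (in_L2_cov j (halfH _ _ h0 h1)).
    rewrite /= -!RintegralZl// -RintegralD//; [|exact: itgZ|exact: itgZ].
    rewrite -RintegralB//; [|by apply: itgD => //; exact: itgZ|exact: itgZ].
    by apply: Rintegral_eq => z _; rewrite distE /half !cov_comb; field.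
  - move=> n e e0; have [N hN] := @pow4_small R 1 e e0.
    exists (y (maxn n N)).
      split; first exact: vH.
      by move=> i; have [_ h _] := hf i; exact: le_trans (h _) (powle _ _ (leq_maxl _ _)).
    have := kcl (maxn n N); have := powle _ _ (leq_maxr n N); rewrite mul1r in hN.
    by rewrite ltr_norml => h /andP[h1 h2]; lra.
have uH n : in_H1 (u_ n) by case: (uC n).
have /choice[ka hka] : forall j, exists k : R * R -> R, [/\ in_L2 area D k,
    forall n, \int[area]_(z in D) ((cov (u_ n) j z - k z) ^+ 2) <= 4^-1 ^+ n &
    \forall z \ae area, D z -> cov (u_ n) j z @[n --> \oo] --> k z].
  move=> j; apply: (riesz_fischer mD Dfin (fun n => in_L2_cov j (uH n))) => n q nq.
  apply: le_trans (ud n q nq); rewrite /dist /kin (bigD1 j)//=.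
  under [X in _ <= X + _]eq_Rintegral do rewrite distE.
  by rewrite lerDl; apply: sumr_ge0 => k _; apply: Rintegral_ge0 => z _; exact: sqr_ge0.
have kaL j : in_L2 area D (ka j) by case: (hka j).
(* Removing the term of order zero from the limit of the covariant derivatives gives the candidate
   for the weak derivative of [f]. *)
pose g j z := ka j z - a j z * f (sg j.2) z.
have gL j : in_L2 area D (g j) by apply: in_L2B => //; exact: in_L2_a.
have c1 : 1 <= 2 + 2 * A ^+ 2 by lra.
have le_c n (r : R) : r <= 4^-1 ^+ n -> r <= (2 + 2 * A ^+ 2) * 4^-1 ^+ n.
  by move=> /le_trans; apply; rewrite ler_peMl// ltW.
have fH : in_H1 (f, g).
  split=> [i|j]; first exact: fL.
  apply: (@weak_deriv_closed _ (fun n => (u_ n).1 j.2) (fun n => (u_ n).2 j) _ _ (2 + 2 * A ^+ 2)) => //.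
  - by move=> n; exact: (uH n).1.
  - by move=> n; exact: (uH n).2.
  - by move=> n; apply: le_c; exact: (uC n).2.
  - move=> n; have q1 := in_L2B mD (in_L2_cov j (uH n)) (kaL j).
    have q2 := in_L2B mD ((uH n).1 (sg j.2)) (fL (sg j.2)).
    apply: le_trans (itg_sqr_le (c := A) q1 q2 (in_L2B mD ((uH n).2 j).1 (gL j)) _) _.
      move=> z Dz; have -> : (u_ n).2 j z - g j z = (cov (u_ n) j z - ka j z) - a j z * ((u_ n).1 (sg j.2) z - f (sg j.2) z).
        by rewrite /g /cov; ring.
      apply: le_trans (ler_normB _ _) _; rewrite lerD2l normrM.
      by rewrite ler_wpM2r//; exact: aA.
    rewrite [leRHS]mulrDl; apply: lerD; first by rewrite ler_wpM2l//; case: (hka j).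
    apply: ler_wpM2l; first by rewrite mulr_ge0.
    have [_ h] := uC n; exact: h.
have covE j z : cov (f, g) j z = ka j z by rewrite /cov /g /= subrK.
have kinle2 : kin (f, g) <= al.
  have kcvg : kin (u_ n) @[n --> \oo] --> kin (f, g).
    apply: cvg_big => [|j _]; first exact: add_continuous.
  under [X in _ --> X]eq_Rintegral do rewrite covE.
    apply: (L2_cvg_sqr mD (c := 1)) => [n||n]; [exact: in_L2_cov|exact: kaL|].
    by rewrite mul1r; case: (hka j).
  have acvg : (fun n => al + 1 * 4^-1 ^+ n) @ \oo --> al + 0.
    by apply: cvgD; [exact: cvg_cst|exact: cvg_pow4].
  rewrite -[al]addr0; apply: ler_cvg_to kcvg acvg _.
  by apply: nearW => n; rewrite mul1r.
exists (f, g); split=> // u uH1 uA.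
apply: le_trans (mle u uH1 uA); rewrite mE.
apply: le_trans (leeD2l _ potf) _; rewrite -EFinD lee_fin; lra.
Qed.

End existence.

(** * Weak derivatives on an interval *)

Section weak_derivative_1d.
Context {R : realType}.
Local Notation leb := (@lebesgue_measure R).
Implicit Types (a b c e x y p q : R) (f g w : R -> R).

Lemma Rintegral_oo_cc f a b : itg leb `[a, b] f ->
  \int[leb]_(x in `]a, b[) f x = \int[leb]_(x in `[a, b]) f x.
Proof.
move=> fi; rewrite Rintegral_itv_bndo_bndc ?Rintegral_itv_obnd_cbnd//.
- by apply: integrableS fi => //; apply: subset_itv; rewrite bnd_simp.
- by apply: integrableS fi => //; apply: subset_itv; rewrite bnd_simp.
Qed.

Lemma cvg_bump1 a b p q w : itg leb `[a, b] w -> a <= p -> q <= b ->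
  \int[leb]_(x in `[a, b]) (bump p q n x * w x) @[n --> \oo] --> \int[leb]_(x in `[p, q]) w x.
Proof.
move=> wi ap qb; have wi' := itg_sub wi ap qb.
rewrite (_ : \int[leb]_(x in `[p, q]) w x = \int[leb]_(x in `[a, b]) (((p < x < q)%R : bool)%:R * w x)); last first.
  rewrite -Rintegral_oo_cc// Rintegral_mkcond [RHS]Rintegral_mkcond; apply: Rintegral_eq => x _.
  rewrite /patch; case: ifPn => [/set_mem|/negP h].
    rewrite /= in_itv/= => /[dup] /andP[h1 h2] ->; rewrite mul1r mem_set//= in_itv/=.
    by rewrite (le_trans ap (ltW h1)) (le_trans (ltW h2) qb).
  have -> : (p < x < q) = false by apply/negbTE/negP => h'; apply: h; apply/mem_set; rewrite /= in_itv.
  by rewrite mul0r; case: ifP.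
have mw := itg_meas wi.
apply: (@Rdominated _ _ _ leb _ (measurable_itv _) _ _ (fun x => `|w x|)).
- move=> n; apply: measurable_funM => //; apply: continuous_meas => //.
  exact: smooth1_cts (bump_smooth _ _ _).
- apply: measurable_funM => //.
  rewrite (_ : (fun x => _) = \1_(`]p, q[%classic : set (measurableTypeR R))).
    by apply: measurable_indic.
  by apply/funext => x; rewrite indicE mem_setE in_itv.
- by move=> x _; apply: cvgM; [exact: bump_cvg|exact: cvg_cst].
- exact: itg_abs.
- by move=> n x _; rewrite normrM ler_piMl// ger0_norm ?bump_ge0 ?bump_le1.
Qed.

(** Du Bois-Reymond again: [f] minus the primitive of [g] has the same weighted mean against all
    bumps, hence equals a constant almost everywhere, and everywhere by continuity. *)
Lemma primitive_of_weak1 a b f g : a < b -> {within `[a, b], continuous f} -> itg leb `[a, b] g ->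
  (forall (A A' : R -> R) p q, smooth1 A -> (forall x, is_derive x 1 A (A' x)) -> continuous A' ->
     a < p -> q < b -> (forall x, ~~ (p <= x <= q) -> A x = 0) ->
     \int[leb]_(x in `[a, b]) (f x * A' x) = - \int[leb]_(x in `[a, b]) (g x * A x)) ->
  is_primitive a b f g.
Proof.
move=> ab fc gi weak.
pose U x := \int[leb]_(t in `[a, x]) g t.
have Up : is_primitive a b U g by split => // x _; rewrite /U Rintegral_point add0r.
have Uc := is_primitive_cts (ltW ab) Up.
pose v x := f x - U x.
have vc : {within `[a, b], continuous v} by move=> x; apply: cvgB; [exact: fc|exact: Uc].
pose p0 := (2 * a + b) / 3; pose q0 := (a + 2 * b) / 3.
have [ap0 pq0 q0b] : [/\ a < p0, p0 < q0 & q0 < b] by rewrite /p0 /q0; split; lra.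
have cb (p' q' : R) n : continuous (bump p' q' n) := smooth1_cts (bump_smooth p' q' n).
pose c0 := \int[leb]_(x in `[a, b]) bump p0 q0 0 x.
have c00 : 0 < c0 by exact: bump_int_gt0.
have cM (h k : R -> R) : {within `[a, b], continuous h} -> continuous k ->
    itg leb `[a, b] (fun x => h x * k x).
  by move=> hc kc; apply: within_itg => x; apply: cvgM; [exact: hc|exact: continuous_subspaceT].
pose c := (\int[leb]_(x in `[a, b]) (v x * bump p0 q0 0 x)) / c0.
pose w x := v x - c.
have wc : {within `[a, b], continuous w}.
  by move=> x; apply: cvgB; [exact: vc|exact: continuous_subspaceT (@cst_continuous _ _ c) x].
have key p q : a < p -> q < b -> \int[leb]_(x in `[p, q]) w x = 0.
  move=> ap qb; apply: cvg_unique0 (cvg_bump1 (within_itg wc) (ltW ap) (ltW qb)) => n.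
  have /= [A [p1 [q1 [sA ap1 q1b dA A0]]]] := bump_primitive n ap ap0 qb q0b pq0.
  pose k := (\int[leb]_(x in `[a, b]) bump p q n x) / c0.
  pose A' x := bump p q n x - k * bump p0 q0 0 x.
  have {}dA : forall x, is_derive x 1 A (A' x) := dA.
  have cA' : continuous A'.
    by move=> x; apply: cvgB; [exact: cb|apply: cvgM; [exact: cvg_cst|exact: cb]].
  have E1 := weak A A' p1 q1 sA dA cA' ap1 q1b A0.
  have E2 := is_primitive_ibp (ltW ab) Up dA cA'.
  have Ab : A b = 0 by rewrite A0// [b <= q1]leNgt q1b andbF.
  have Aa : A a = 0 by rewrite A0// leNgt ap1.
  rewrite Ab Aa !mulr0 subrr RintegralD// in E2; last 2 first.
  - have [MA hMA] : exists M : R, forall x, x \in `[a, b] -> `|A x| <= M.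
      have [xm _ hm] := EVT_max (ltW ab) (continuous_subspaceT (fun x => cvg_norm (smooth1_cts sA (x := x)))).
      by exists `|A xm|.
    have Agi : itg leb `[a, b] (fun x => A x * g x).
      apply: (itgM_bounded _ (c := MA)) => //; exact: continuous_meas (smooth1_cts sA).
    by apply: eq_itg Agi => // x _; rewrite mulrC.
  - exact: cM Uc cA'.
  have vA : \int[leb]_(x in `[a, b]) (v x * A' x) = 0.
    rewrite (_ : \int[leb]_(x in _) _ = \int[leb]_(x in `[a, b]) (f x * A' x - U x * A' x)).
      rewrite RintegralB//; [|exact: cM fc cA'|exact: cM Uc cA'].
      by rewrite E1 -opprD E2 oppr0.
    by apply: Rintegral_eq => x _; rewrite mulrBl.
  have i1 := cM _ _ vc (cb p q n); have i2 := cM _ _ vc (cb p0 q0 0%N).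
  have bi (p' q' : R) m := continuous_itg a b (cb p' q' m).
  have E3 : \int[leb]_(x in `[a, b]) (v x * bump p q n x) = k * \int[leb]_(x in `[a, b]) (v x * bump p0 q0 0 x).
    apply/eqP; rewrite -subr_eq0 -RintegralZl// -RintegralB//; last exact: itgZ.
    by rewrite -vA; apply/eqP; apply: Rintegral_eq => x _; rewrite /A'; ring.
  transitivity (\int[leb]_(x in `[a, b]) (v x * bump p q n x) - c * \int[leb]_(x in `[a, b]) bump p q n x).
    rewrite -RintegralZl// -RintegralB//; last by apply: itgZ.
    by apply: Rintegral_eq => x _; rewrite /w; ring.
  by rewrite E3 /k /c; field; rewrite gt_eqF.
have w0 x : a <= x <= b -> w x = 0.
  move=> /andP[ax xb]; apply: contrapT => /eqP wx.
  have e0 : 0 < `|w x| by rewrite normr_gt0.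
  have := (subspace_continuousP _ _).1 wc x; rewrite /= in_itv/= ax xb => /(_ isT).
  move=> /cvgrPdist_lt/(_ _ e0); rewrite near_withinE => -[d /= d0 hd].
  pose lo := Num.max a (x - d); pose hi := Num.min b (x + d).
  have lohi : lo < hi by rewrite /lo /hi lt_min !gt_max; apply/andP; split; apply/andP; split; lra.
  have [lo1 lo2] : a <= lo /\ x - d <= lo by rewrite /lo !le_max !lexx ?orbT.
  have [hi1 hi2] : hi <= b /\ hi <= x + d by rewrite /hi !ge_min !lexx ?orbT.
  pose p := (2 * lo + hi) / 3; pose q := (lo + 2 * hi) / 3.
  have [P1 P2 P3] : [/\ lo < p, p < q & q < hi] by rewrite /p /q; split; lra.
  have [||y /andP[py yq] hy] := ae_itv_ex P2 (@itg_zero_intervals R p q w P2 _ _).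
  - by apply: (itg_sub (within_itg wc)); lra.
  - by move=> y /andP[py yq]; apply: key; lra.
  have : `|w x - w y| < `|w x|.
    apply: hd; first by rewrite /= ltr_norml; apply/andP; split; lra.
    by rewrite /= in_itv/=; apply/andP; split; lra.
  by rewrite hy ?py// subr0 ltxx.
split => // x axb; have := w0 x axb; have := w0 a; rewrite lexx (ltW ab) => /(_ isT).
by rewrite /w /v /U Rintegral_point; lra.
Qed.

Lemma smooth_is_derive (phi : R -> R) x : smooth_on setT phi -> is_derive x 1 phi ('D_1 phi x).
Proof. by move=> s; apply/derivableP; apply: diff_derivable; exact: (s [::] x). Qed.

Lemma weak1_primitive a b f g : a < b -> {within `[a, b], continuous f} ->
  is_weak_deriv1 `]a, b[ f g -> is_primitive a b f g.
Proof.
move=> ab fc [gL w]; have Ifin : (leb `]a, b[%classic < +oo)%E.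
  by rewrite lebesgue_measure_itv/=; case: ifP => // _; rewrite -EFinB ltry.
have gi : itg leb `[a, b] g by apply: itg_oo_cc; apply: in_L2_itg gL => //.
apply: primitive_of_weak1 => // A A' p q sA dA cA' ap qb A0.
have := w _ (bump_test ap qb sA A0).
have E : \int[leb]_(x in `]a, b[) (f x * A' x) = \int[leb]_(x in `]a, b[) (f x * 'D_1 A x).
  by apply: Rintegral_eq => x _; have [_ <-] := dA x.
rewrite -E Rintegral_oo_cc; last first.
  by apply: within_itg => x; apply: cvgM; [exact: fc|exact: continuous_subspaceT].
rewrite Rintegral_oo_cc// .
have [MA hMA] : exists M : R, forall x, x \in `[a, b] -> `|A x| <= M.
  have [xm _ hm] := EVT_max (ltW ab) (continuous_subspaceT (fun x => cvg_norm (smooth1_cts sA (x := x)))).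
  by exists `|A xm|.
have Agi : itg leb `[a, b] (fun x => A x * g x).
  apply: (itgM_bounded _ (c := MA)) => //; exact: continuous_meas (smooth1_cts sA).
by apply: eq_itg Agi => // x _; rewrite mulrC.
Qed.

Lemma primitive_weak1 a b f g : a < b -> is_primitive a b f g -> in_L2 leb `]a, b[ g ->
  is_weak_deriv1 `]a, b[ f g.
Proof.
move=> ab fg gL; split => // phi [sphi cs sub].
have fc := is_primitive_cts (ltW ab) fg.
have dphi x := smooth_is_derive x sphi.
have cphi : continuous phi by move=> x; apply: differentiable_continuous; exact: (sphi [::] x).
have cdphi : continuous ('D_1 phi) by move=> x; apply: differentiable_continuous; exact: (sphi [:: 1] x).
have phi0 x : ~ (a < x < b) -> phi x = 0.
  move=> h; apply: contrapT => /eqP px; apply: h.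
  by have := sub x (@subset_closure _ [set x | phi x != 0] x px); rewrite /= in_itv.
have := is_primitive_ibp (ltW ab) fg dphi cdphi.
rewrite (phi0 a) ?(phi0 b) ?ltxx ?andbF// !mulr0 subrr.
have i1 : itg leb `[a, b] (fun x => f x * 'D_1 phi x).
  by apply: within_itg => x; apply: cvgM; [exact: fc|exact: continuous_subspaceT].
have i2 : itg leb `[a, b] (fun x => g x * phi x).
  have [MA hMA] : exists M : R, forall x, x \in `[a, b] -> `|phi x| <= M.
    have [xm _ hm] := EVT_max (ltW ab) (continuous_subspaceT (fun x => cvg_norm (cphi x))).
    by exists `|phi xm|.
  have Agi : itg leb `[a, b] (fun x => phi x * g x).
    by apply: (itgM_bounded _ (c := MA)) => //; [exact: fg.1|exact: continuous_meas].
  by apply: eq_itg Agi => // x _; rewrite mulrC.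
by rewrite !Rintegral_oo_cc// RintegralD//; lra.
Qed.

Lemma is_primitive_unique a b f g1 g2 : a < b -> is_primitive a b f g1 -> is_primitive a b f g2 ->
  \forall x \ae leb, a < x < b -> g1 x = g2 x.
Proof.
move=> ab [i1 h1] [i2 h2]; have := @itg_zero_intervals R a b (fun x => g1 x - g2 x) ab (itgB _ i1 i2).
move=> /(_ (measurable_itv _)) => H; apply: ae_mono (H _) => [x h /h /eqP|x xab].
  by rewrite subr_eq0 => /eqP.
have := h1 x xab; rewrite h2// => /addrI E; move: xab => /andP[ax xb].
by rewrite RintegralB ?E ?subrr//; [exact: itg_sub i1 _ xb|exact: itg_sub i2 _ xb].
Qed.

(** The representative chosen by [get] agrees with [g] almost everywhere only, which is enough under
    the integral. *)
Lemma weak_deriv1_sqr a b f g : a < b -> is_primitive a b f g -> in_L2 leb `]a, b[ g ->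
  \int[leb]_(x in `]a, b[) (weak_deriv1 `]a, b[ f x ^+ 2) = \int[leb]_(x in `]a, b[) (g x ^+ 2).
Proof.
move=> ab fg gL; have w := primitive_weak1 ab fg gL.
have := @getPex _ (is_weak_deriv1 `]a, b[ f) (ex_intro _ g w); rewrite -/(weak_deriv1 _ _) => w'.
have fc := is_primitive_cts (ltW ab) fg.
have ae := is_primitive_unique ab (weak1_primitive ab fc w') fg.
apply: ae_Rintegral => //; [by apply: measurable_funX; case: w'.1|by apply: measurable_funX; case: gL|].
by apply: ae_mono ae => x h; rewrite /= in_itv/= => /h ->.
Qed.

End weak_derivative_1d.

(** * An explicit profile with prescribed mass *)

Section ramp.
Context {R : realType}.
Local Notation leb := (@lebesgue_measure R).
Implicit Types (a b c e x y p q s w : R) (f g : R -> R).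

Lemma leb_itv_lty a b : (leb `[a, b]%classic < +oo)%E.
Proof.
have [ab|ba] := leP a b; first by rewrite leb_itv// ltry.
by rewrite set_itv_ge ?measure0// bnd_simp -ltNge.
Qed.

Lemma is_primitive_max a b p : is_primitive a b (fun x => Num.max (x - p) 0) \1_(`[p, +oo[%classic : set R).
Proof.
have mp : measurable (`[p, +oo[%classic : set (measurableTypeR R)) by [].
split.
  apply: (@itg_bounded _ _ _ leb _ (measurable_itv _) _ 1).
  - exact: leb_itv_lty.
  - exact: measurable_indic.
  - by move=> x _; rewrite indicE ger0_norm//; case: (_ \in _).
move=> x /andP[ax xb].
have -> : \int[leb]_(t in `[a, x]) \1_(`[p, +oo[%classic : set R) t = fine (leb (`[p, +oo[%classic `&` `[a, x]%classic)).
  by rewrite /Rintegral integral_indic.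
have [px|xp] := leP (Num.max a p) x.
  have -> : `[p, +oo[%classic `&` `[a, x]%classic = `[Num.max a p, x]%classic.
    apply/seteqP; split => t; rewrite /= !in_itv/= andbT ge_max.
      by move=> [-> /andP[-> ->]].
    by move=> /andP[/andP[-> ->] ->].
  rewrite leb_itv//=; move: px; rewrite ge_max => /andP[_ px].
  by case: (lerP a p) => ap; case: (lerP (x - p) 0); case: (lerP (a - p) 0); lra.
have -> : `[p, +oo[%classic `&` `[a, x]%classic = set0.
  apply/seteqP; split => t //; rewrite /= !in_itv/= andbT => -[pt /andP[a_t tx]].
  by move: xp; rewrite lt_max !ltNge ax (le_trans pt tx).
rewrite measure0 /=; move: xp; rewrite lt_max ltNge ax /= => xp.
by case: (lerP (x - p) 0); case: (lerP (a - p) 0); lra.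
Qed.

Lemma is_primitive_lin a b c f1 f2 g1 g2 : is_primitive a b f1 g1 -> is_primitive a b f2 g2 ->
  is_primitive a b (fun x => c * f1 x + f2 x) (fun x => c * g1 x + g2 x).
Proof.
move=> [i1 h1] [i2 h2]; split; first by apply: itgD => //; exact: itgZ.
move=> x axb; have /andP[ax xb] := axb.
have j1 := itg_sub i1 (lexx a) xb; have j2 := itg_sub i2 (lexx a) xb.
by rewrite h1// h2// RintegralD ?RintegralZl//; [ring|exact: itgZ].
Qed.

(** The squared sine has mean 1/2 along a linear ramp from 0 to pi / 2, whatever the width of the
    ramp. *)
Lemma ramp_mass p w : 0 < w -> let s := pi / (2 * w) in
  \int[leb]_(x in `[p, p + w]) (sin (s * (x - p)) ^+ 2) = w / 2.
Proof.
move=> w0 s; have s0 : 0 < s by rewrite divr_gt0 ?pi_gt0// mulr_gt0.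
pose F x := x / 2 - sin (2 * (s * (x - p))) / (4 * s).
have -> : \int[leb]_(x in `[p, p + w]) (sin (s * (x - p)) ^+ 2) = F (p + w) - F p.
  apply: FTC; first by rewrite lerDl ltW.
    move=> x _; rewrite /F; apply: is_derive_eq.
    rewrite -![_ *: _]/(_ * _) mulr_natl cos_mulr2n; have := cos2Dsin2 (s * (x - p)).
    move=> e; have -> : cos (s * (x - p)) ^+ 2 = 1 - sin (s * (x - p)) ^+ 2 by lra.
    by rewrite mulr2n; field; lra.
  apply: continuous_subspaceT => x; apply: (@continuous_comp _ _ _ (fun x => sin (s * (x - p))) (fun t => t ^+ 2)); last exact: exprn_continuous.
  apply: (@continuous_comp _ _ _ (fun x => s * (x - p)) sin); last exact: continuous_sin.
  by apply: cvgM; [exact: cvg_cst|apply: cvgB; [exact: cvg_id|exact: cvg_cst]].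
rewrite /F subrr mulr0 mulr0 sin0 mul0r subr0.
have -> : 2 * (s * (p + w - p)) = pi by rewrite /s; field; lra.
by rewrite sinpi; lra.
Qed.

Lemma exists_ramp (alpha : R) : 0 < alpha < 1 -> exists f g,
  [/\ is_primitive 0 2^-1 f g, in_L2 leb `[0, 2^-1] g,
      2 * \int[leb]_(x in `[0, 2^-1]) (sin (f x) ^+ 2) = alpha, f 0 = 0 & f 2^-1 = pi / 2].
Proof.
(* [p] solves w / 2 + (1 / 2 - p - w) = alpha / 2, the mass of a ramp followed by the constant pi /
   2; the width alpha (1 - alpha) keeps the ramp inside [0, 1/2]. *)
move=> /andP[al0 al1]; pose w := alpha * (1 - alpha); pose p := (1 - alpha - w) / 2.
have w0 : 0 < w by rewrite mulr_gt0// subr_gt0.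
have w1 : w <= 1 - alpha by rewrite ler_piMl// ?subr_ge0 ltW.
have w2 : w <= alpha by rewrite ler_piMr// ?lerBlDr ?lerDl ltW.
have p0 : 0 <= p by rewrite divr_ge0// subr_ge0.
have pw : p + w <= 2^-1 by rewrite /p; lra.
pose s := pi / (2 * w).
pose f x := s * (Num.max (x - p) 0 + (-1) * Num.max (x - (p + w)) 0).
have fE0 x : x <= p -> f x = 0.
  move=> xp; rewrite /f !max_r ?subr_le0//; first by ring.
  by rewrite (le_trans xp)// lerDl ltW.
have fE1 x : p <= x <= p + w -> f x = s * (x - p).
  move=> /andP[px xp]; rewrite /f; have -> : Num.max (x - (p + w)) 0 = 0 by rewrite max_r// subr_le0.
  by rewrite max_l ?subr_ge0// mulr0 addr0.
have fE2 x : p + w <= x -> f x = pi / 2.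
  move=> px; rewrite /f max_l ?subr_ge0 1?(le_trans _ px) ?lerDl ?(ltW w0)//.
  by rewrite max_l ?subr_ge0// /s; field; lra.
(* The summand with coefficient 0 is the derivative of the zero function, added so that
   [is_primitive_lin] can form the multiple by [s]. *)
have fp : is_primitive 0 2^-1 f (fun x => s * (-1 * \1_(`[p + w, +oo[%classic : set R) x + \1_(`[p, +oo[%classic : set R) x)+ 0 * \1_(`[p, +oo[%classic : set R) x).
  have := is_primitive_lin s (is_primitive_lin (-1) (is_primitive_max 0 2^-1 (p + w)) (is_primitive_max 0 2^-1 p))
    (is_primitive_lin (-1) (is_primitive_max 0 2^-1 p) (is_primitive_max 0 2^-1 p)).
  have E1 : (fun x => s * (-1 * Num.max (x - (p + w)) 0 + Num.max (x - p) 0) + (-1 * Num.max (x - p) 0 + Num.max (x - p) 0)) = f.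
    by apply/funext => x; rewrite /f; ring.
  rewrite E1; congr (is_primitive _ _ _ _); apply/funext => x; ring.
exists f, (fun x => s * (-1 * \1_(`[p + w, +oo[%classic : set R) x + \1_(`[p, +oo[%classic : set R) x) + 0 * \1_(`[p, +oo[%classic : set R) x).
split => //.
- apply: (@in_L2_bounded _ _ _ leb _ (measurable_itv _) _ (2 * `|s|)); [exact: leb_itv_lty|exact: itg_meas fp.1|].
  move=> x _; rewrite mul0r addr0 normrM mulrC ler_wpM2r// !indicE.
  by case: (_ \in _); case: (_ \in _); rewrite ?(mulr1n, mulr0n, mulr0, mulr1, addr0, add0r, addNr, normr0, normrN, normr1); lra.
- have fc := is_primitive_cts (_ : 0 <= 2^-1) fp; have {}fc : {within `[0, 2^-1], continuous f} by apply: fc; rewrite invr_ge0.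
  have fi : itg leb `[0, 2^-1] (fun x => sin (f x) ^+ 2).
    apply: (@itg_bounded _ _ _ leb _ (measurable_itv _) _ 1).
    + exact: leb_itv_lty.
    + apply: measurable_funX; apply: (@measurableT_comp _ _ _ _ _ _ sin).
        exact: continuous_meas (@continuous_sin R).
      exact: itg_meas (within_itg fc).
    + by move=> x _; rewrite normrX exprn_ile1// ?normr_ge0// ler_norml sin_geN1 sin_le1.
  have p1 : p <= p + w by rewrite lerDl ltW.
  rewrite (Rintegral_split fi (b := p)) ?p0 ?(le_trans p1 pw)//.
  rewrite (Rintegral_split (itg_sub fi p0 (lexx _)) (b := p + w)) ?p1//.
  rewrite (_ : \int[leb]_(x in `[0, p]) _ = 0); last first.
    by apply: Rintegral_eq0 => x; rewrite /= in_itv/= => /andP[_ xp]; rewrite fE0// sin0 expr0n.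
  rewrite (_ : \int[leb]_(x in `[p, p + w]) _ = w / 2); last first.
    rewrite -(ramp_mass p w0); apply: Rintegral_eq => x; rewrite /= in_itv/= => xp.
    by rewrite fE1.
  rewrite (_ : \int[leb]_(x in `[p + w, 2^-1]) _ = \int[leb]_(x in `[p + w, 2^-1]) 1); last first.
    by apply: Rintegral_eq => x; rewrite /= in_itv/= => /andP[xp _]; rewrite fE2// sin_pihalf expr1n.
  by rewrite Rintegral_itv_cst// /p; lra.
- exact: fE0.
- exact: fE2.
Qed.
End ramp.

(** * Minimizers of the stripe energy *)

Section stripe_minimizers.
Context {R : realType}.
Local Notation leb := (@lebesgue_measure R).
Local Notation h := (2^-1 : R).
Implicit Types (x y mu : R) (f g theta : R -> R).
Context (lambda alpha : R) (l0 : 0 < lambda) (al01 : 0 < alpha < 1).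

(** The derivative is carried as a separate datum, which avoids the choice made by [weak_deriv1] in
    all estimates. *)
Definition profile_pair theta g : Prop :=
  [/\ is_primitive 0 h theta g, in_L2 leb `[0, h] g,
      2 * \int[leb]_(x in `[0, h]) (sin (theta x) ^+ 2) = alpha, theta 0 = 0 & theta h = pi / 2].

(** Under the mass constraint this is 4 times the integral over [0, 1/2] of (x - 1/2)^2 sin^2 theta
    + x^2 cos^2 theta: the second moments of the two densities, each about the middle of its own
    stripe. *)
Definition moment theta : R :=
  6^-1 + alpha / 2 - 4 * \int[leb]_(x in `[0, h]) (x * sin (theta x) ^+ 2).

Definition mixing theta : R := \int[leb]_(x in `[0, h]) (sin (2 * theta x) ^+ 2).

Definition pair_energy mu theta g : R :=
  moment theta * mu ^+ 2 + (mu ^+ 2)^-1 * (\int[leb]_(x in `[0, h]) (g x ^+ 2))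
  + (4 * lambda)^-1 * mixing theta.

Let h0 : 0 < h. Proof. by rewrite invr_gt0. Qed.

Lemma itg_cts_comp (F : R -> R) theta : continuous F -> {within `[0, h], continuous theta} ->
  itg leb `[0, h] (fun x => F (theta x)).
Proof.
by move=> cF tc; apply: within_itg => x; apply: (cvg_comp _ _ (tc x)); exact: cF.
Qed.

Lemma itg_trig (k : R) theta : {within `[0, h], continuous theta} ->
  itg leb `[0, h] (fun x => sin (k * theta x) ^+ 2).
Proof.
apply: (itg_cts_comp (F := fun t => sin (k * t) ^+ 2)) => t.
apply: (@continuous_comp _ _ _ (fun x => sin (k * x)) (fun t => t ^+ 2)); last exact: exprn_continuous.
apply: (@continuous_comp _ _ _ (fun x => k * x) sin); last exact: continuous_sin.
by apply: cvgM; [exact: cvg_cst|exact: cvg_id].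
Qed.

Lemma itg_sin2 theta : {within `[0, h], continuous theta} ->
  itg leb `[0, h] (fun x => sin (theta x) ^+ 2).
Proof. by move=> /(itg_trig 1); apply: eq_itg => // x _; rewrite mul1r. Qed.

Lemma itg_moment theta : {within `[0, h], continuous theta} ->
  itg leb `[0, h] (fun x => x * sin (theta x) ^+ 2).
Proof.
move=> tc; have ti := itg_sin2 tc.
apply: (itgM_bounded _ (c := h)) => //.
by move=> x; rewrite /= in_itv/= => /andP[x0 xh]; rewrite ger0_norm.
Qed.

Lemma in_L2_oo (g : R -> R) : in_L2 leb `]0, h[ g <-> in_L2 leb `[0, h] g.
Proof.
split=> [[mg gi]|[mg gi]].
  split; last exact: itg_oo_cc.
  have gi' : itg leb `]0, h[ g.
    apply: in_L2_itg (conj mg gi) => //; apply: le_lt_trans (leb_itv_lty 0 h).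
    by apply: le_measure; rewrite ?inE//; apply: subset_itv; rewrite bnd_simp.
  exact: itg_meas (itg_oo_cc gi').
have s : `]0, h[%classic `<=` `[0, h]%classic by apply: subset_itv; rewrite bnd_simp.
by split; [exact: measurable_funS mg|exact: integrableS gi].
Qed.

Lemma profilesP theta : profiles alpha theta -> exists2 g, profile_pair theta g &
  forall mu, stripe_energy lambda alpha mu theta = pair_energy mu theta g.
Proof.
move=> [tc [tL [g w]] mass t0 t1].
have tp := weak1_primitive h0 tc w.
have ti := itg_sin2 tc.
have gL := (in_L2_oo g).1 w.1.
exists g; first by split => //; rewrite -mass Rintegral_oo_cc.
move=> mu; rewrite /stripe_energy /pair_energy /moment /mixing.
rewrite (weak_deriv1_sqr h0 tp w.1) (Rintegral_oo_cc (itg_moment tc)) (Rintegral_oo_cc (itg_trig 2 tc)).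
by rewrite (Rintegral_oo_cc (in_L2_sqr gL)).
Qed.

Lemma profile_pair_profiles theta g : profile_pair theta g -> profiles alpha theta.
Proof.
move=> [tp gL mass t0 t1]; have tc := is_primitive_cts (ltW h0) tp.
have ti := itg_sin2 tc.
split => //; last by rewrite Rintegral_oo_cc.
split; last by exists g; apply: primitive_weak1 => //; exact/in_L2_oo.
apply/in_L2_oo; split; first exact: itg_meas (within_itg tc).
by apply: (itg_cts_comp (F := fun t => t ^+ 2)) tc; exact: exprn_continuous.
Qed.

Lemma pair_energyE theta g mu : profile_pair theta g ->
  stripe_energy lambda alpha mu theta = pair_energy mu theta g.
Proof.
move=> pg; have [tp gL mass t0 t1] := pg.
have [g' pg' ->] := profilesP (profile_pair_profiles pg).
have [tp' gL' _ _ _] := pg'; rewrite /pair_energy; congr (_ + _ * _ + _).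
rewrite -!Rintegral_oo_cc; [|exact: in_L2_sqr gL|exact: in_L2_sqr gL'].
by rewrite -(weak_deriv1_sqr h0 tp ((in_L2_oo _).2 gL)) (weak_deriv1_sqr h0 tp' ((in_L2_oo _).2 gL')).
Qed.

(* The bathtub principle: the moment is extremal when sin^2 theta is the
   indicator function of the interval of length alpha/2 ending at 1/2. *)
Lemma moment_ge theta g : profile_pair theta g -> 24^-1 <= moment theta.
Proof.
move=> [tp gL mass t0 t1]; have tc := is_primitive_cts (ltW h0) tp.
have ti := itg_sin2 tc.
have mi := itg_moment tc.
move/andP: al01 => [a0 a1]; pose c := (1 - alpha) / 2.
have c0 : 0 <= c by rewrite divr_ge0// subr_ge0 ltW.
have ch : c <= h by rewrite /c; lra.
have li : itg leb `[c, h] (fun x => x - c).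
  by apply: continuous_itg => x; apply: cvgB; [exact: cvg_id|exact: cvg_cst].
have Ilin : \int[leb]_(x in `[c, h]) (x - c) = alpha ^+ 2 / 8.
  have -> : \int[leb]_(x in `[c, h]) (x - c) = (h - c) ^+ 2 / 2 - (c - c) ^+ 2 / 2; last first.
    by rewrite /c; field.
  apply: (@FTC R (fun x => (x - c) ^+ 2 / 2)).
  - exact: ch.
  - by move=> x _; apply: is_derive_eq; rewrite -![_ *: _]/(_ * _); field.
  - by apply: continuous_subspaceT => x; apply: cvgB; [exact: cvg_id|exact: cvg_cst].
have s01 x : 0 <= sin (theta x) ^+ 2 <= 1.
  rewrite sqr_ge0 -real_normK ?num_real// exprn_ile1 ?normr_ge0//; exact: sin_max.
have k : \int[leb]_(x in `[0, h]) (x * sin (theta x) ^+ 2 - c * sin (theta x) ^+ 2) <= alpha ^+ 2 / 8.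
  have ki : itg leb `[0, h] (fun x => x * sin (theta x) ^+ 2 - c * sin (theta x) ^+ 2) by apply: itgB => //; exact: itgZ.
  rewrite (Rintegral_split ki (b := c)) ?c0// -Ilin -[leRHS]add0r; apply: lerD.
    apply: (@le_trans _ _ (\int[leb]_(x in `[0, c]) 0)); last by rewrite Rintegral0.
    apply: le_Rintegral => //; [exact: itg_sub ki _ ch|exact: itg0|].
    move=> x; rewrite /= in_itv/= => /andP[_ xc]; rewrite -mulrBl mulr_le0_ge0 ?subr_le0//; by case/andP: (s01 x).
  apply: le_Rintegral => //; first exact: itg_sub ki c0 _.
  move=> x; rewrite /= in_itv/= => /andP[cx _]; rewrite -mulrBl ler_piMr ?subr_ge0//; by case/andP: (s01 x).
move: k; rewrite RintegralB ?RintegralZl//; last exact: itgZ.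
rewrite /moment -/h; set J := \int[leb]_(x in _) (x * _); move: mass; set I := \int[leb]_(x in _) (sin _ ^+ 2).
move=> mass; have -> : I = alpha / 2 by lra.
by have := sqr_ge0 (alpha - 2^-1); rewrite /c !expr2; nra.
Qed.

Lemma mixing_ge0 theta : 0 <= mixing theta.
Proof. by apply: Rintegral_ge0 => x _; exact: sqr_ge0. Qed.

Lemma primitive_holder theta g x y : is_primitive 0 h theta g -> in_L2 leb `[0, h] g ->
  0 <= x -> x <= y -> y <= h ->
  (theta y - theta x) ^+ 2 <= (y - x) * \int[leb]_(t in `[0, h]) (g t ^+ 2).
Proof.
move=> tp gL x0 xy yh; have [gi tE] := tp.
have -> : theta y - theta x = \int[leb]_(t in `[x, y]) g t.
  rewrite tE ?(le_trans x0 xy)// (tE x) ?x0 ?(le_trans xy)//.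
  by rewrite (Rintegral_split (itg_sub gi (lexx 0) yh) (b := x)) ?x0//; ring.
have sub : `[x, y]%classic `<=` `[0, h]%classic by apply: subset_itv; rewrite bnd_simp.
have gL' : in_L2 leb `[x, y] g.
  by split; [exact: measurable_funS gL.1|exact: itg_sub gL.2 _ _].
have one : in_L2 leb `[x, y] (fun=> 1 : R).
  by apply: (@in_L2_bounded _ _ _ leb _ (measurable_itv _) _ 1) => //=; [exact: leb_itv_lty|move=> t _; rewrite normr1].
have mxy : measurable (`[x, y]%classic : set (measurableTypeR R)) by [].
have := cauchy_schwarz mxy one gL'.
under eq_Rintegral do rewrite mul1r.
under [X in _ <= X * _ -> _]eq_Rintegral do rewrite expr1n.
rewrite Rintegral_itv_cst// mul1r => /le_trans; apply; rewrite ler_wpM2l ?subr_ge0//.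
by apply: le_Rintegral_sub => //; [exact: gL.2|move=> t; exact: sqr_ge0].
Qed.

(** Climbing to pi / 2 over a length 1/2 costs at least 2 (pi / 2)^2. This keeps [mu] away from 0
    along minimizing sequences. *)
Lemma energy_ge2 theta g : profile_pair theta g -> 2 <= \int[leb]_(t in `[0, h]) (g t ^+ 2).
Proof.
move=> [tp gL _ t0 t1]; have := primitive_holder tp gL (lexx 0) (ltW h0) (lexx h).
rewrite t0 t1 !subr0; have := @pi_ge2 R; move: (\int[leb]_(t in _) _) => G p2.
have : 1 <= (pi / 2) ^+ 2 :> R by rewrite expr_ge1//; lra.
lra.
Qed.

(** Arzela-Ascoli on a grid: the mesh 1 / N is such that the Hoelder bound allows an oscillation of
    at most e / 3 on each cell, and only finitely many grid points have to converge. *)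
Lemma uniform_limit (F : set_system nat) (UF : UltraFilter F) (th : nat -> R -> R) (t : R -> R) (G e : R) :
  (forall n x y, 0 <= x -> x <= y -> y <= h -> (th n y - th n x) ^+ 2 <= (y - x) * G) -> 0 <= G ->
  (forall x, 0 <= x <= h -> th n x @[n --> F] --> t x) -> 0 < e ->
  F [set n | forall x, 0 <= x <= h -> `|th n x - t x| <= e].
Proof.
move=> hold G0 lim e0.
have thold x y : 0 <= x -> x <= y -> y <= h -> (t y - t x) ^+ 2 <= (y - x) * G.
  move=> x0 xy yh; have cx := lim x; have cy := lim y.
  have c : (th n y - th n x) ^+ 2 @[n --> F] --> (t y - t x) ^+ 2.
    by rewrite expr2; under eq_fun do rewrite expr2; apply: cvgM; apply: cvgB; apply: lim; rewrite ?x0 ?yh ?(le_trans x0 xy) ?(le_trans xy yh).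
  by apply: ler_cvg_to c (cvg_cst ((y - x) * G)) _; apply: nearW => n; exact: hold.
have d0 : 0 < e / 3 by rewrite divr_gt0.
pose N := (Num.truncn (G / (e / 3) ^+ 2)).+1.
have N0 : 0 < N%:R :> R by rewrite ltr0n.
have NG : N%:R^-1 * G <= (e / 3) ^+ 2.
  rewrite mulrC ler_pdivrMr// mulrC -ler_pdivrMr ?exprn_gt0//.
  by have /andP[_ /ltW] := @truncn_itv R (G / (e / 3) ^+ 2) (divr_ge0 G0 (sqr_ge0 _)).
pose pt (i : 'I_N.+1) : R := Num.min h (i%:R / N%:R).
have pt01 i : 0 <= pt i <= h by rewrite /pt le_min ge_min lexx (ltW h0) divr_ge0.
have FI : F [set n | forall i : 'I_N.+1, `|t (pt i) - th n (pt i)| < e / 3].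
  by apply: filter_forall => i; have /cvgrPdist_lt := lim _ (pt01 i); exact.
apply: filterS FI => n hn x /andP[x0 xh].
have xN : 0 <= x * N%:R by rewrite mulr_ge0// ltW.
have /andP[k1 k2] := truncn_itv xN; set k := Num.truncn _ in k1 k2.
have kN : (k < N.+1)%N.
  rewrite -(ltr_nat R); apply: le_lt_trans k1 _; apply: (@le_lt_trans _ _ N%:R); last by rewrite ltr_nat.
  by rewrite ler_piMl// (le_trans xh)// invf_le1// ler1n.
pose i := Ordinal kN.
have ptx : pt i <= x.
  by rewrite /pt ge_min; apply/orP; right; rewrite ler_pdivrMr.
have xpt : x - pt i <= N%:R^-1.
  have ik : i%:R / N%:R <= x by rewrite ler_pdivrMr.
  rewrite /pt min_r ?(le_trans ik)// lerBlDl -[X in _ + X]mul1r -mulrDl ler_pdivlMr//.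
  by rewrite natr1 ltW.
have /andP[p0 ph] := pt01 i.
have close (f : R -> R) : (forall x y, 0 <= x -> x <= y -> y <= h -> (f y - f x) ^+ 2 <= (y - x) * G) ->
    `|f x - f (pt i)| <= e / 3.
  move=> hf; rewrite -(ler_pXn2r (n := 2))// ?nnegrE ?(ltW d0)// real_normK ?num_real//.
  by apply: le_trans (hf _ _ p0 ptx xh) _; apply: le_trans NG; rewrite ler_wpM2r.
have c1 := close _ (hold n); have c2 := close _ thold; have c3 := ltW (hn i).
move: c1 c2 c3; rewrite !ler_norml => /andP[? ?] /andP[? ?] /andP[? ?].
by apply/andP; split; lra.
Qed.

Lemma cvg_uniform_int (th : nat -> R -> R) (t : R -> R) (F : R -> R) (w : R -> R) c :
  continuous F -> (forall n, {within `[0, h], continuous (th n)}) -> {within `[0, h], continuous t} ->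
  continuous w -> (forall x, `|F x| <= 1) -> (forall x, 0 <= x <= h -> `|w x| <= c) ->
  (forall x, 0 <= x <= h -> th n x @[n --> \oo] --> t x) ->
  \int[leb]_(x in `[0, h]) (w x * F (th n x)) @[n --> \oo] --> \int[leb]_(x in `[0, h]) (w x * F (t x)).
Proof.
move=> cF ct ctt cw F1 wc lim.
have m f : {within `[0, h], continuous f} -> measurable_fun `[0, h] (fun x => w x * F (f x)).
  move=> cf; apply: measurable_funM; first exact: continuous_meas.
  exact: itg_meas (itg_cts_comp cF cf).
apply: (@Rdominated _ _ _ leb _ (measurable_itv _) _ _ (fun=> c)).
- by move=> n; exact: m.
- exact: m.
- move=> x; rewrite /= in_itv/= => xh; apply: cvgM; first exact: cvg_cst.
  by apply: (cvg_comp _ _ (lim x xh)); exact: cF.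
- by apply: continuous_itg; exact: cst_continuous.
- move=> n x; rewrite /= in_itv/= => xh; rewrite normrM -[c]mulr1.
  by apply: ler_pM => //; exact: wc.
Qed.

Lemma sin2_cts (k : R) : continuous (fun t : R => sin (k * t) ^+ 2).
Proof.
move=> t; apply: (@continuous_comp _ _ _ (fun x => sin (k * x)) (fun t => t ^+ 2)); last exact: exprn_continuous.
apply: (@continuous_comp _ _ _ (fun x => k * x) sin); last exact: continuous_sin.
by apply: cvgM; [exact: cvg_cst|exact: cvg_id].
Qed.

Lemma sin2_le1 (k t : R) : `|sin (k * t) ^+ 2| <= 1.
Proof. by rewrite normrX exprn_ile1// ?normr_ge0//; exact: sin_max. Qed.

Definition triple := (R * ((R -> R) * (R -> R)))%type.
Definition triple_in (S : set R) (t : triple) : Prop := S t.1 /\ profile_pair t.2.1 t.2.2.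
Definition triple_energy (t : triple) : R := pair_energy t.1 t.2.1 t.2.2.

(** The moment term bounds [mu] from above and the derivative term bounds it from below, so
    minimizing sequences stay in a compact part of the half-line. *)
Lemma triple_bounds (S : set R) (t : triple) : (forall mu, S mu -> 0 < mu) -> triple_in S t ->
  [/\ t.1 ^+ 2 <= 24 * triple_energy t, 2 <= t.1 ^+ 2 * triple_energy t,
    \int[leb]_(x in `[0, h]) (t.2.2 x ^+ 2) <= t.1 ^+ 2 * triple_energy t & 0 <= triple_energy t].
Proof.
case: t => mu [theta g] Spos [/= Smu pt]; rewrite /triple_energy /=.
have mu2 : 0 < mu ^+ 2 by rewrite exprn_gt0// Spos.
have m24 := moment_ge pt; have g2 := energy_ge2 pt; have mg := mixing_ge0 theta.
have im2 : 0 < (mu ^+ 2)^-1 by rewrite invr_gt0.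
have il0 : 0 < (4 * lambda)^-1 by rewrite invr_gt0 mulr_gt0.
rewrite /pair_energy; move: (\int[leb]_(x in _) _) g2 => G g2.
have G0 : 0 <= G by lra.
have h1 : 0 <= (mu ^+ 2)^-1 * G by rewrite mulr_ge0// ltW.
have h2 : 0 <= (4 * lambda)^-1 * mixing theta by rewrite mulr_ge0// ltW.
have h3 : 24^-1 * mu ^+ 2 <= moment theta * mu ^+ 2 by rewrite ler_wpM2r// ltW.
move: h1 h2 h3; set X := (mu ^+ 2)^-1 * G; set Y := (4 * lambda)^-1 * _; set Z := moment _ * _ => h1 h2 h3.
have h5 : G <= mu ^+ 2 * (Z + X + Y).
  by have : X <= Z + X + Y by [lra]; rewrite /X mulrC ler_pdivrMr// [_ * mu ^+ 2]mulrC.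
by split; [lra|exact: le_trans h5|exact: h5|lra].
Qed.

Definition pairT := ((R -> R) * (R -> R))%type.

(** One argument serves both minima: [S] is a single point for the inner problem and the whole
    positive half-line for the outer one. The closure condition says that [S] is closed relative to
    the half-line. Profiles converge uniformly by the Hoelder bound, and the derivatives are made
    strongly convergent as in the plane. *)
Lemma stripe_joint (S : set R) : (forall mu, S mu -> 0 < mu) -> S !=set0 ->
  (forall mu, closure S mu -> 0 < mu -> S mu) ->
  exists mu theta g, [/\ S mu, profile_pair theta g &
    forall mu' theta' g', S mu' -> profile_pair theta' g' ->
      pair_energy mu theta g <= pair_energy mu' theta' g'].
Proof.
move=> Spos [mu1 Smu1] Scl.
pose P := triple_in S; pose E := triple_energy.
have Gge0 (g : R -> R) : 0 <= \int[leb]_(x in `[0, h]) (g x ^+ 2) by apply: Rintegral_ge0 => x _; exact: sqr_ge0.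
have parts t : P t -> [/\ t.1 ^+ 2 <= 24 * E t, 2 <= t.1 ^+ 2 * E t,
    \int[leb]_(x in `[0, h]) (t.2.2 x ^+ 2) <= t.1 ^+ 2 * E t & 0 <= E t] := triple_bounds Spos.
have [th0 [gg0 pp0]] := exists_ramp al01.
have inf_E : has_inf (E @` P).
  by split; [exists (E (mu1, (th0, gg0))), (mu1, (th0, gg0))|exists 0 => _ [t Pt <-]; case: (parts t Pt)].
pose mr := inf (E @` P).
have mr_le t : P t -> mr <= E t by move=> Pt; apply: ge_inf; [case: inf_E|exists t].
have pow0 n : 0 < 4^-1 ^+ n :> R by rewrite exprn_gt0// invr_gt0.
have pow1 n : 4^-1 ^+ n <= 1 :> R by rewrite exprn_ile1 ?invr_ge0// invf_le1// ler1n.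
have powle n q : (n <= q)%N -> 4^-1 ^+ q <= 4^-1 ^+ n :> R.
  by move=> nq; rewrite ler_wiXn2l// ?invr_ge0// invf_le1// ler1n.
have /choice[t ht] : forall n, exists t, P t /\ E t < mr + 4^-1 ^+ n.
  by move=> n; have [_ [t Pt <-] hh] := inf_adherent (pow0 n) inf_E; exists t.
have Pt n : P (t n) by case: (ht n).
have Et n : E (t n) <= mr + 4^-1 ^+ n by rewrite ltW//; case: (ht n).
have mr0 : 0 <= mr by apply: lb_le_inf; [case: inf_E|move=> _ [u Pu <-]; case: (parts u Pu)].
have Eb n : E (t n) <= mr + 1 by apply: le_trans (Et n) _; rewrite lerD2l.
pose B := 24 * (mr + 1).
have muB n : (t n).1 ^+ 2 <= B by have [k1 _ _ _] := parts _ (Pt n); have := Eb n; rewrite /B; lra.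
have mr1 : 0 < mr + 1 by rewrite ltr_wpDl.
have mub n : 2 / (mr + 1) <= (t n).1 ^+ 2.
  have [_ k2 _ _] := parts _ (Pt n); rewrite ler_pdivrMr//; apply: le_trans k2 _.
  by rewrite ler_wpM2l ?sqr_ge0.
have GB n : \int[leb]_(x in `[0, h]) ((t n).2.2 x ^+ 2) <= B * (mr + 1).
  have [_ _ k3 k4] := parts _ (Pt n); apply: le_trans k3 _.
  by apply: ler_pM => //; exact: sqr_ge0.
have B0 : 0 <= B by rewrite /B mulr_ge0// ltW.
have G0 : 0 <= B * (mr + 1) by rewrite mulr_ge0// ltW.
set G := B * (mr + 1) in GB G0.
have hold n x y : 0 <= x -> x <= y -> y <= h -> ((t n).2.1 y - (t n).2.1 x) ^+ 2 <= (y - x) * G.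
  move=> x0 xy yh; have [_ [tp gL _ _ _]] := Pt n.
  by apply: le_trans (primitive_holder tp gL x0 xy yh) _; rewrite ler_wpM2l ?subr_ge0.
have [F [UF Foo]] := @ultraFilterLemma nat \oo _.
have bnd (x c : R) : 0 <= c -> x ^+ 2 <= c -> `|x| <= c + 1.
  move=> c0; rewrite -real_normK ?num_real// => hh; have := sqr_ge0 (`|x| - 1); rewrite sqrrB expr1n mulr1; lra.
have [mu hmu] : exists l : R, (t n).1 @[n --> F] --> l.
  by apply: (@ultra_limit _ F UF _ (B + 1)) => n; exact: bnd.
have [q hq] : exists l : R, \int[leb]_(x in `[0, h]) ((t n).2.2 x ^+ 2) @[n --> F] --> l.
  by apply: (@ultra_limit _ F UF _ G) => n; rewrite ger0_norm.
have /choice[th hth] : forall x, exists l : R, 0 <= x <= h -> (t n).2.1 x @[n --> F] --> l.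
  move=> x; have [xh|nx] := boolP (0 <= x <= h); last by exists 0.
  have /andP[x0 x1] := xh.
  have [|l hl] := @ultra_limit _ F UF (fun n => (t n).2.1 x) (G + 1); last by exists l.
  move=> n; apply: bnd => //; have := hold n 0 x (lexx 0) x0 x1; have [_ [_ _ _ -> _]] := Pt n.
  by rewrite !subr0 => /le_trans; apply; rewrite ler_piMl// (le_trans x1)// invf_le1// ler1n.
pose Sk k := [set n | [/\ forall x, 0 <= x <= h -> `|(t n).2.1 x - th x| <= 4^-1 ^+ k,
   `|q - \int[leb]_(x in `[0, h]) ((t n).2.2 x ^+ 2)| < 4^-1 ^+ k & `|mu - (t n).1| < 4^-1 ^+ k]].
have [phi hphi] : exists phi : nat -> nat, forall k, (k <= phi k)%N /\
    forall j, (j <= k)%N -> Sk j (phi k).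
  apply: (@extraction F) => // k.
  have f1 := uniform_limit UF hold G0 hth (pow0 k).
  have f2 : F [set n | `|q - \int[leb]_(x in `[0, h]) ((t n).2.2 x ^+ 2)| < 4^-1 ^+ k] by move/cvgrPdist_lt : hq; exact.
  have f3 : F [set n | `|mu - (t n).1| < 4^-1 ^+ k] by move/cvgrPdist_lt : hmu; exact.
  by apply: filterS3 f1 f2 f3 => n h1 h2 h3; split.
have Sphi n : Sk n (phi n) := (hphi n).2 n (leqnn n).
have to_cvg (a : nat -> R) (l : R) : (forall n, `|a n - l| <= 4^-1 ^+ n) -> a n @[n --> \oo] --> l.
  move=> al; apply/cvgrPdist_le => e e0; have [N hN] := @pow4_small R 1 e e0; rewrite mul1r in hN.
  by exists N => // n /= Nn; rewrite distrC; apply: le_trans (al n) (le_trans (powle _ _ Nn) hN).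
pose y n := t (phi n).
have ythe x : 0 <= x <= h -> (y n).2.1 x @[n --> \oo] --> th x.
  by move=> xh; apply: to_cvg => n; have [k1 _ _] := Sphi n; exact: k1.
have yq : \int[leb]_(x in `[0, h]) ((y n).2.2 x ^+ 2) @[n --> \oo] --> q.
  by apply: to_cvg => n; have [_ k1 _] := Sphi n; rewrite distrC ltW.
have ymu : (y n).1 @[n --> \oo] --> mu.
  by apply: to_cvg => n; have [_ _ k1] := Sphi n; rewrite distrC ltW.
(* Only conditions stable under midpoints are imposed here. The mass and the value at 1/2 are later
   read off from the uniformly convergent sequence [y]. *)
pose Cs n : set pairT := [set u | [/\ is_primitive 0 h u.1 u.2, in_L2 leb `[0, h] u.2,
   u.1 0 = 0 & forall x, 0 <= x <= h -> `|u.1 x - th x| <= 4^-1 ^+ n]].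
pose half (u0 u1 : pairT) : pairT :=
  (fun x => 2^-1 * u0.1 x + (- 2^-1 * u1.1 x + u1.1 x), fun x => 2^-1 * u0.2 x + (- 2^-1 * u1.2 x + u1.2 x)).
pose Q (u : pairT) := \int[leb]_(x in `[0, h]) (u.2 x ^+ 2).
pose dist (u0 u1 : pairT) := \int[leb]_(x in `[0, h]) ((u0.2 x - u1.2 x) ^+ 2).
have mh : measurable (`[0, h]%classic : set (measurableTypeR R)) by [].
have halfL (u0 u1 : pairT) : in_L2 leb `[0, h] u0.2 -> in_L2 leb `[0, h] u1.2 -> in_L2 leb `[0, h] (half u0 u1).2.
  by move=> L0 L1; apply: in_L2D => //; [exact: in_L2Z|apply: in_L2D => //; exact: in_L2Z].
have [u_ [al [alq uC uk ud]]] : exists v_ : nat -> pairT, exists al : R,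
    [/\ al <= q, forall n, Cs n (v_ n), forall n, Q (v_ n) <= al + 4^-1 ^+ n &
        forall n p, (n <= p)%N -> dist (v_ n) (v_ p) <= 4^-1 ^+ n].
  apply: (@almost_minimizers_cauchy R _ half Q dist Cs q).
  - by move=> n p np u [k1 k2 k3 k4]; split => // x xh; exact: le_trans (k4 x xh) (powle _ _ np).
  - move=> n u0 u1 [k1 k2 k3 k4] [j1 j2 j3 j4]; split.
    + exact: (is_primitive_lin 2^-1 k1 (is_primitive_lin (- 2^-1) j1 j1)).
    + exact: halfL.
    + by rewrite /= k3 j3; ring.
    + move=> x xh; have := k4 x xh; have := j4 x xh; rewrite !ler_norml /= => /andP[? ?] /andP[? ?].
      by apply/andP; split; lra.
  - by move=> u _; exact: Gge0.
  - move=> u0 u1 [k1 k2 k3 k4] [j1 j2 j3 j4]; rewrite /dist /Q.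
    have i0 := in_L2_sqr k2; have i1 := in_L2_sqr j2; have i2 := in_L2_sqr (halfL _ _ k2 j2).
    rewrite -!RintegralZl// -RintegralD//; [|exact: itgZ|exact: itgZ].
    rewrite -RintegralB//; [|by apply: itgD => //; exact: itgZ|exact: itgZ].
    by apply: Rintegral_eq => x _; rewrite /half /=; field.
  - move=> n e e0; have [N hN] := @pow4_small R 1 e e0; rewrite mul1r in hN.
    exists (y (maxn n N)).2.
      have [_ [tp gL _ t0 _]] := Pt (phi (maxn n N)); split => // x xh.
      by have [k1 _ _] := Sphi (maxn n N); exact: le_trans (k1 x xh) (powle _ _ (leq_maxl _ _)).
    have [_ k1 _] := Sphi (maxn n N); have := powle _ _ (leq_maxr n N).
    by move: k1; rewrite ltr_norml /Q /y => /andP[k1 k2]; lra.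
have hfin := @leb_itv_lty R 0 h.
have uL n : in_L2 leb `[0, h] (u_ n).2 by case: (uC n).
have [g [gL gd _]] := riesz_fischer mh hfin uL ud.
have gi := in_L2_itg mh hfin gL.
have th0E x : 0 <= x <= h -> th x = \int[leb]_(s in `[0, x]) g s.
  move=> xh; have /andP[x0 x1] := xh.
  have mx : measurable (`[0, x]%classic : set (measurableTypeR R)) by [].
  have sub f : in_L2 leb `[0, h] f -> in_L2 leb `[0, x] f.
    move=> [mf fi]; split; last exact: itg_sub fi _ x1.
    by apply: measurable_funS mf => //; apply: subset_itv; rewrite bnd_simp.
  have one : in_L2 leb `[0, x] (fun=> 1 : R).
    by apply: (in_L2_bounded mx (c := 1)) => //=; [exact: leb_itv_lty|move=> s _; rewrite normr1].
  have l1 : \int[leb]_(s in `[0, x]) ((u_ n).2 s * 1) @[n --> \oo] --> \int[leb]_(s in `[0, x]) (g s * 1).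
    apply: (L2_cvg_mul mx (c := 1)) one _ => [n||n]; [exact: sub|exact: sub|].
    rewrite mul1r; apply: le_trans (gd n); apply: le_Rintegral_sub => //.
      exact: in_L2_sqr (in_L2B mh (uL n) gL).
    by move=> s; exact: sqr_ge0.
  have l2 : (u_ n).1 x @[n --> \oo] --> th x by apply: to_cvg => n; have [_ _ _ k] := uC n; exact: k.
  have E1 : (fun n => (u_ n).1 x) = (fun n => \int[leb]_(s in `[0, x]) ((u_ n).2 s * 1)).
    apply/funext => n; have [[_ k1] _ k2 _] := uC n; rewrite k1// k2 add0r.
    by apply: Rintegral_eq => s _; rewrite mulr1.
  rewrite E1 in l2; have <- := cvg_lim (@norm_hausdorff _ R) l2; have -> := cvg_lim (@norm_hausdorff _ R) l1.
  by apply: Rintegral_eq => s _; rewrite mulr1.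
have tp : is_primitive 0 h th g.
  split => // x xh; rewrite [in RHS](th0E 0) ?lexx ?ltW//.
  by rewrite Rintegral_point add0r; exact: th0E.
have tc := is_primitive_cts (ltW h0) tp.
have yc n : {within `[0, h], continuous (y n).2.1}.
  by have [_ [tpn _ _ _ _]] := Pt (phi n); exact: is_primitive_cts (ltW h0) tpn.
have Qg : \int[leb]_(x in `[0, h]) (g x ^+ 2) <= q.
  apply: le_trans alq; rewrite -[al]addr0.
  have l1 := L2_cvg_sqr mh (c := 1) uL gL (fun n => _).
  have {}l1 : Q (u_ n) @[n --> \oo] --> \int[leb]_(x in `[0, h]) (g x ^+ 2).
    by apply: l1 => n; rewrite mul1r; exact: gd.
  have l2 : (fun n => al + 1 * 4^-1 ^+ n) @ \oo --> al + 0 by apply: cvgD; [exact: cvg_cst|exact: cvg_pow4].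
  by apply: ler_cvg_to l1 l2 _; apply: nearW => n; rewrite mul1r.
have one_cts : continuous (fun _ : R => 1 : R) by exact: cst_continuous.
have lsin (k : R) (w : R -> R) (c : R) : continuous w -> (forall x, 0 <= x <= h -> `|w x| <= c) ->
   \int[leb]_(x in `[0, h]) (w x * sin (k * (y n).2.1 x) ^+ 2) @[n --> \oo] -->
   \int[leb]_(x in `[0, h]) (w x * sin (k * th x) ^+ 2).
  move=> cw wc; apply: (cvg_uniform_int (F := fun s => sin (k * s) ^+ 2) (c := c)) => //.
  - exact: sin2_cts.
  - by move=> s; exact: sin2_le1.
have ext (a b : nat -> R) (la lb : R) : (forall n, a n = b n) -> la = lb ->
    a n @[n --> \oo] --> la -> b n @[n --> \oo] --> lb.
  by move=> ab <-; rewrite (funext ab).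
have uniq (a : nat -> R) (l c : R) : (forall n, a n = c) -> a n @[n --> \oo] --> l -> l = c.
  move=> ac H; rewrite (funext ac) in H; have <- := cvg_lim (@norm_hausdorff _ R) H.
  exact: lim_cst.
have one_le x : 0 <= x <= h -> `|1 : R| <= 1 by rewrite normr1.
have id_le x : 0 <= x <= h -> `|x| <= h by move=> /andP[x0 x1]; rewrite ger0_norm.
have lmass : \int[leb]_(x in `[0, h]) (sin ((y n).2.1 x) ^+ 2) @[n --> \oo] --> \int[leb]_(x in `[0, h]) (sin (th x) ^+ 2).
  by apply: ext (lsin 1 _ 1 one_cts one_le) => [n|]; apply: Rintegral_eq => x _; rewrite !mul1r.
have pth : profile_pair th g.
  split => //.
  - apply: (uniq (fun n => 2 * \int[leb]_(x in `[0, h]) (sin ((y n).2.1 x) ^+ 2))) => [n|].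
      by have [_ [_ _]] := Pt (phi n).
    by apply: cvgM; [exact: cvg_cst|exact: lmass].
  - by rewrite th0E ?lexx ?ltW// Rintegral_point.
  - apply: (uniq (fun n => (y n).2.1 h)) => [n|]; first by have [_ [_ _ _ _]] := Pt (phi n).
    by apply: ythe; rewrite lexx ltW.
have mu2 : (y n).1 ^+ 2 @[n --> \oo] --> mu ^+ 2.
  by rewrite expr2; under eq_fun do rewrite expr2; apply: cvgM.
have mu2b : 2 / (mr + 1) <= mu ^+ 2.
  by apply: ler_cvg_to (cvg_cst (2 / (mr + 1))) mu2 _; apply: nearW => n; exact: mub.
have mu2p : 0 < mu ^+ 2 by apply: lt_le_trans mu2b; rewrite divr_gt0.
have mu0 : 0 < mu.
  have : 0 <= mu by apply: ler_cvg_to (cvg_cst (0 : R)) ymu _; apply: nearW => n; apply: ltW; apply: Spos; exact: (Pt (phi n)).1.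
  by rewrite le_eqVlt => /orP[/eqP m0|//]; move: mu2p; rewrite -m0 expr0n ltxx.
have Smu : S mu.
  apply: Scl => // U [d /= d0 hd]; have [N hN] := @pow4_small R 1 d d0; rewrite mul1r in hN.
  exists (y N).1; split; first exact: (Pt (phi N)).1.
  by apply: hd; have [_ _ k] := Sphi N; exact: lt_le_trans k hN.
exists mu, th, g; split => // mu' th' g' Smu' pth'.
apply: le_trans (mr_le (mu', (th', g')) _); last by split.
have lE : E (y n) @[n --> \oo] --> moment th * mu ^+ 2 + (mu ^+ 2)^-1 * q + (4 * lambda)^-1 * mixing th.
  rewrite /E /triple_energy /pair_energy; apply: cvgD; first apply: cvgD.
  - apply: cvgM => //; rewrite /moment; apply: cvgB; first exact: cvg_cst.
    apply: cvgM; first exact: cvg_cst.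
    by apply: ext (lsin 1 (fun x => x) h (fun x => cvg_id) id_le) => [n|]; apply: Rintegral_eq => x _; rewrite mul1r.
  - by apply: cvgM => //; apply: cvgV => //; exact: lt0r_neq0.
  - apply: cvgM; first exact: cvg_cst.
    by apply: ext (lsin 2 _ 1 one_cts one_le) => [n|]; apply: Rintegral_eq => x _; rewrite mul1r.
have lm : (fun n => mr + 1 * 4^-1 ^+ n) @ \oo --> mr + 0 by apply: cvgD; [exact: cvg_cst|exact: cvg_pow4].
have Ele : moment th * mu ^+ 2 + (mu ^+ 2)^-1 * q + (4 * lambda)^-1 * mixing th <= mr + 0.
  apply: ler_cvg_to lE lm _; apply: nearW => n; rewrite mul1r; apply: le_trans (Et (phi n)) _.
  by rewrite lerD2l; apply: powle; exact: (hphi n).1.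
rewrite addr0 in Ele; apply: le_trans Ele; rewrite /pair_energy lerD2r lerD2l.
by rewrite ler_wpM2l// invr_ge0 ltW.
Qed.

(** A joint minimizer over [mu] and the profile attains the outer minimum, because at its own [mu]
    it also attains the inner one. *)
Lemma stripe_min_exists : exists mu theta g, [/\ 0 < mu, profile_pair theta g &
  is_stripe_min lambda alpha (pair_energy mu theta g)].
Proof.
have inner mu : 0 < mu -> exists m, is_min [set stripe_energy lambda alpha mu theta | theta in profiles alpha] m.
  move=> mu0; case: (@stripe_joint [set mu]) => [_ ->//||nu|mu' [th [g [-> pg hmin]]]].
  - by exists mu.
  - by rewrite -(closure_id [set mu]).1//; exact: closed_eq.
  exists (pair_energy mu th g); split.
    by exists th; [exact: profile_pair_profiles pg|exact: pair_energyE].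
  move=> _ [th' /profilesP[g' pg' ->] <-]; exact: hmin.
have [m hm] : exists m : R -> R, forall mu, 0 < mu ->
    is_min [set stripe_energy lambda alpha mu theta | theta in profiles alpha] (m mu).
  suff /choice[m hm] : forall mu, exists r, 0 < mu ->
      is_min [set stripe_energy lambda alpha mu theta | theta in profiles alpha] r by exists m.
  move=> mu; have [mu0|mu0] := boolP (0 < mu); last by exists 0.
  by have [r hr] := inner mu mu0; exists r.
have [mu [th [g [mu0 pg hmin]]]] := @stripe_joint [set mu | 0 < mu] (fun _ h => h) (ex_intro _ 1 ltr01) (fun _ _ h => h).
exists mu, th, g; split => //; exists m; split => //; split.
  exists mu => //; have [[th' /profilesP[g' pg' E'] E1] lb] := hm mu mu0.
  apply/eqP; rewrite eq_le; apply/andP; split.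
    by apply: lb; exists th; [exact: profile_pair_profiles pg|exact: pair_energyE].
  by rewrite -E1 E'; exact: hmin.
move=> _ [mu' mu'0 <-]; have [[th' /profilesP[g' pg' E'] <-] _] := hm mu' mu'0.
by rewrite E'; exact: hmin.
Qed.

End stripe_minimizers.

(** * Affine changes of variables *)

Section affine.
Context {R : realType}.
Local Notation leb := (@lebesgue_measure R).
Local Notation RT := (measurableTypeR R).
Implicit Types (a b c e x y : R) (f g F G p k : R -> R).

Lemma aff_meas c e : measurable_fun setT (fun x : RT => c * x + e : RT).
Proof.
apply: continuous_meas => // x; apply: cvgD; last exact: cvg_cst.
by apply: cvgM; [exact: cvg_cst|exact: cvg_id].
Qed.

(** The rescaled image measure agrees with Lebesgue measure on half-open intervals, hence on all
    measurable sets by uniqueness. *)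
Lemma integral_affine c e (F : R -> \bar R) : c != 0 -> measurable_fun setT (F : RT -> \bar R) ->
  (forall x, 0 <= F x)%E ->
  (\int[leb]_x F x = (`|c|)%:E * \int[leb]_x F (c * x + e)%R)%E.
Proof.
move=> c0 mF F0.
have ma := aff_meas c e.
pose r : {nonneg R} := NngNum (normr_ge0 c).
pose m : {measure set RT -> \bar R} := mscale r (pushforward leb (fun x : RT => c * x + e : RT)).
have c0' : 0 < `|c| by rewrite normr_gt0.
have E (A : set RT) : measurable A -> leb A = m ma A.
  apply: lebesgue_measure_unique => X [[a b] _ <-] /=.
  have -> : m ma `]a, b]%classic = ((`|c|)%:E * leb ((fun x : R => (c * x + e)%R) @^-1` `]a, b]%classic))%E by [].
  have [cn|cp] := ltP c 0.
    have -> : (fun x : R => c * x + e) @^-1` `]a, b]%classic = `[(b - e) / c, (a - e) / c[%classic.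
      apply/seteqP; split => x; rewrite /= !in_itv/= ler_ndivrMr// ltr_ndivlMr// [x * c]mulrC => /andP[h1 h2]; apply/andP; split; lra.
    rewrite !lebesgue_measure_itv/= !lte_fin ltr_ndivrMr// divfK ?lt_eqF// ltrD2r.
    case: ifP => _; last by rewrite mule0.
    rewrite -!EFinB -EFinM ltr0_norm//; congr (_%:E); field; exact: c0.
  have {}cp : 0 < c by rewrite lt_def c0.
  have -> : (fun x : R => c * x + e) @^-1` `]a, b]%classic = `](a - e) / c, (b - e) / c]%classic.
    apply/seteqP; split => x; rewrite /= !in_itv/= ltr_pdivrMr// ler_pdivlMr// [x * c]mulrC => /andP[h1 h2]; apply/andP; split; lra.
  rewrite !lebesgue_measure_itv/= !lte_fin ltr_pdivrMr// divfK ?gt_eqF// ltrD2r.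
  case: ifP => _; last by rewrite mule0.
  rewrite -!EFinB -EFinM gtr0_norm//; congr (_%:E); field; exact: c0.
rewrite (eq_measure_integral (m ma)); last by move=> A mA _; exact: E.
by rewrite ge0_integral_mscale// ge0_integral_pushforward.
Qed.

Lemma itg_affine c e F : c != 0 -> itg leb setT F ->
  itg leb setT (fun x => F (c * x + e)) /\
  \int[leb]_x F x = `|c| * \int[leb]_x F (c * x + e).
Proof.
move=> c0 Fi; have mF : measurable_fun setT (F : RT -> R) := itg_meas Fi.
have pos (H : R -> R) : itg leb setT H -> (forall x, 0 <= H x) -> itg leb setT (fun x => H (c * x + e)) /\
    \int[leb]_x H x = `|c| * \int[leb]_x H (c * x + e).
  move=> Hi H0; have mH : measurable_fun setT (H : RT -> R) := itg_meas Hi.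
  have mEH : measurable_fun setT (fun x : RT => (H x)%:E) by exact/measurable_EFinP.
  have E := @integral_affine c e (fun x => (H x)%:E) c0 mEH (fun x => H0 x).
  have c0' : 0 < `|c| by rewrite normr_gt0.
  have Hi' : itg leb setT (fun x => H (c * x + e)).
    apply/integrableP; split.
      by apply/measurable_EFinP; apply: (measurableT_comp mH); exact: aff_meas.
    have : (\int[leb]_x (H x)%:E < +oo)%E.
      by rewrite -EFin_Rintegral// ltry.
    rewrite [X in (X < _)%E]E.
    under [X in _ -> (X < _)%E]eq_integral do rewrite /= ger0_norm//.
    have I0 : (0 <= \int[leb]_x (H (c * x + e)%R)%:E)%E by apply: integral_ge0 => x _; rewrite lee_fin.
    move: I0; case: (integral _ _ _) => [z _ _|_|//]; first exact: ltry.
    by rewrite mulry gtr0_sg// mul1e.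
  split => //; apply: EFin_inj; rewrite EFinM !EFin_Rintegral//; exact: E.
have ai := itg_abs Fi.
pose P x := `|F x| + F x; pose N x := `|F x| - F x.
have [||P1 P2] := pos P; [exact: itgD|by move=> x; rewrite /P -[F x]opprK subr_ge0 opprK -normrN ler_norm|].
have [||N1 N2] := pos N; [exact: itgB|by move=> x; rewrite /N subr_ge0 ler_norm|].
have E : F = (fun x => 2^-1 * (P x - N x)) by apply/funext => x; rewrite /P /N; field.
split.
  have -> : (fun x => F (c * x + e)) = (fun x => 2^-1 * (P (c * x + e) - N (c * x + e))).
    by apply/funext => x; rewrite {1}E.
  by apply: itgZ => //; exact: itgB.
have Pi : itg leb setT P by exact: itgD.
have Ni : itg leb setT N by exact: itgB.
rewrite {1}E RintegralZl//; last exact: itgB.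
rewrite RintegralB// P2 N2.
rewrite (_ : \int[leb]_x F (c * x + e) = 2^-1 * (\int[leb]_x P (c * x + e) - \int[leb]_x N (c * x + e))); first ring.
rewrite -RintegralB// -RintegralZl//; last exact: itgB.
by apply: Rintegral_eq => x _; rewrite {1}E.
Qed.

Lemma itg_affine_pos c e a b F : 0 < c -> itg leb `[c * a + e, c * b + e] F ->
  itg leb `[a, b] (fun x => F (c * x + e)) /\
  \int[leb]_(x in `[c * a + e, c * b + e]) F x = c * \int[leb]_(x in `[a, b]) F (c * x + e).
Proof.
move=> c0 Fi; have mI (p q : R) : measurable (`[p, q]%classic : set RT) by [].
have [h1 h2] := itg_affine e (lt0r_neq0 c0) (itg_patch (mI _ _) Fi).
have E : (fun x => (F \_ `[c * a + e, c * b + e]%classic) (c * x + e)) = (fun x => F (c * x + e)) \_ `[a, b]%classic.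
  apply/funext => x; rewrite /patch; congr (if _ then _ else _).
  by rewrite !mem_setE !in_itv/= !lerD2r !ler_pM2l.
rewrite E in h1 h2; split.
  by apply/(integrable_mkcond _ (mI a b)); rewrite restrict_EFin.
by rewrite Rintegral_mkcond [in RHS]Rintegral_mkcond h2 gtr0_norm.
Qed.

Lemma itg_affine_neg c e a b F : c < 0 -> itg leb `[c * b + e, c * a + e] F ->
  itg leb `[a, b] (fun x => F (c * x + e)) /\
  \int[leb]_(x in `[c * b + e, c * a + e]) F x = - c * \int[leb]_(x in `[a, b]) F (c * x + e).
Proof.
move=> c0 Fi; have mI (p q : R) : measurable (`[p, q]%classic : set RT) by [].
have [h1 h2] := itg_affine e (ltr0_neq0 c0) (itg_patch (mI _ _) Fi).
have E : (fun x => (F \_ `[c * b + e, c * a + e]%classic) (c * x + e)) = (fun x => F (c * x + e)) \_ `[a, b]%classic.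
  apply/funext => x; rewrite /patch; congr (if _ then _ else _).
  by rewrite !mem_setE !in_itv/= !lerD2r !ler_nM2l// andbC.
rewrite E in h1 h2; split.
  by apply/(integrable_mkcond _ (mI a b)); rewrite restrict_EFin.
by rewrite Rintegral_mkcond [in RHS]Rintegral_mkcond h2 ltr0_norm.
Qed.

Lemma is_primitive_affine_pos c e a b F G : 0 < c -> is_primitive (c * a + e) (c * b + e) F G ->
  is_primitive a b (fun x => F (c * x + e)) (fun x => c * G (c * x + e)).
Proof.
move=> c0 [Gi FE]; have [Gi' _] := itg_affine_pos c0 Gi; split; first exact: itgZ.
move=> x /andP[ax xb].
have h1 : c * a + e <= c * x + e by rewrite lerD2r ler_pM2l.
have h2 : c * x + e <= c * b + e by rewrite lerD2r ler_pM2l.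
have Gx := itg_sub Gi (lexx _) h2.
rewrite FE ?h1// (itg_affine_pos c0 Gx).2 RintegralZl//; exact: itg_sub Gi' (lexx a) xb.
Qed.

Lemma is_primitive_affine_neg c e a b F G : c < 0 -> is_primitive (c * b + e) (c * a + e) F G ->
  is_primitive a b (fun x => F (c * x + e)) (fun x => c * G (c * x + e)).
Proof.
move=> c0 [Gi FE]; have [Gi' _] := itg_affine_neg c0 Gi; split; first exact: itgZ.
move=> x /andP[ax xb].
have h1 : c * x + e <= c * a + e by rewrite lerD2r ler_nM2l.
have h2 : c * b + e <= c * x + e by rewrite lerD2r ler_nM2l.
have Gx := itg_sub Gi h2 (lexx _).
rewrite FE ?h2// (FE (c * a + e)) ?(le_trans h2 h1) ?lexx//.
rewrite (Rintegral_split Gi (b := c * x + e)) ?h2// (itg_affine_neg c0 Gx).2 RintegralZl//; last exact: itg_sub Gi' (lexx a) xb.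
ring.
Qed.

Lemma itg_glue a b c f : a <= b -> b <= c -> itg leb `[a, b] f -> itg leb `[b, c] f -> itg leb `[a, c] f.
Proof.
move=> ab bc i1 i2; have mI (p q : R) : measurable (`[p, q]%classic : set RT) by [].
have j1 := itg_patch (mI _ _) i1; have j2 := itg_patch (mI _ _) i2.
have U : `[a, c]%classic = (`[a, b]%classic `|` `[b, c]%classic : set RT).
  apply/seteqP; split => x; rewrite /= !in_itv/=.
    by move=> /andP[ax xc]; case: (leP x b) => [xb|/ltW bx]; [left|right]; apply/andP.
  by move=> [/andP[-> /le_trans]|/andP[/(le_trans ab) -> ->//]]; apply.
have m : measurable_fun (`[a, c]%classic : set RT) (f : RT -> R).
  by rewrite U; apply/measurable_funU => //; split; [exact: itg_meas i1|exact: itg_meas i2].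
apply: (@itg_le _ _ _ leb _ (mI a c) _ (fun x => `|(f \_ `[a, b]) x| + `|(f \_ `[b, c]) x|)) => //.
  apply: integrableS (itgD _ (itg_abs j1) (itg_abs j2)) => //.
move=> x; rewrite U => -[h|h].
  by rewrite {1}patchE mem_set// lerDl.
by rewrite [(f \_ `[b, c]) x]patchE (mem_set h) lerDr.
Qed.

Lemma is_primitive_glue a b c f g : a <= b -> b <= c -> is_primitive a b f g -> is_primitive b c f g ->
  is_primitive a c f g.
Proof.
move=> ab bc [i1 h1] [i2 h2]; have i := itg_glue ab bc i1 i2; split => // x /andP[ax xc].
have [xb|/ltW bx] := leP x b; first by apply: h1; rewrite ax.
rewrite h2 ?bx// h1 ?ab ?lexx// (Rintegral_split (itg_sub i (lexx a) xc) (b := b)) ?ab//; ring.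
Qed.

(** This is integration by parts with a variable upper limit. *)
Lemma is_primitive_mul a b f g k k' : a <= b -> is_primitive a b f g ->
  (forall x, is_derive x 1 k (k' x)) -> continuous k' ->
  is_primitive a b (fun x => f x * k x) (fun x => g x * k x + f x * k' x).
Proof.
move=> ab fg dk ck'.
have ck : continuous k.
  move=> x; apply: differentiable_continuous; apply/derivable1_diffP.
  by have [] := dk x.
have fc := is_primitive_cts ab fg.
split.
  apply: itgD => //.
    have [M hM] : exists M : R, forall x, x \in `[a, b] -> `|k x| <= M.
      have [xm _ hm] := EVT_max ab (continuous_subspaceT (fun x => cvg_norm (ck x))).
      by exists `|k xm|.
    have kg : itg leb `[a, b] (fun x => k x * g x).
      by apply: (itgM_bounded _ (c := M)) => //; [exact: fg.1|exact: continuous_meas].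
    by apply: eq_itg kg => // x _; rewrite mulrC.
  by apply: within_itg => x; apply: cvgM; [exact: fc|exact: continuous_subspaceT].
move=> x /andP[ax xb].
have := is_primitive_ibp ax (is_primitive_sub fg (lexx a) ax xb) dk ck'.
by move=> ->; ring.
Qed.

Lemma eq_is_primitive a b f1 f2 g : (forall x, a <= x <= b -> f1 x = f2 x) -> a <= b -> is_primitive a b f1 g -> is_primitive a b f2 g.
Proof.
move=> E ab [gi h]; split => // x xab; rewrite -!E ?lexx//; exact: h.
Qed.

End affine.

(** * Functions of period 1 *)

Section periodic.
Context {R : realType}.
Local Notation leb := (@lebesgue_measure R).
Local Notation RT := (measurableTypeR R).
Implicit Types (a b c e x y : R) (f g F G p k : R -> R).

Definition periodic p := forall y, p (y + 1) = p y.

Lemma periodicN p n y : periodic p -> p (y + n%:R) = p y.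
Proof. by move=> pp; elim: n => [|n IH]; rewrite ?addr0// -natr1 addrA pp. Qed.

Lemma int_bounds a b : exists n : nat, - n%:R <= a /\ b <= n%:R.
Proof.
exists (Num.truncn (`|a| + `|b|)).+1.
have /andP[_ h] := @truncn_itv R (`|a| + `|b|) (addr_ge0 (normr_ge0 a) (normr_ge0 b)).
have := ler_norm b; have := ler_norm (- a); rewrite normrN; have := normr_ge0 a; have := normr_ge0 b.
by split; lra.
Qed.

Lemma itg_shift a b p e : itg leb `[a + e, b + e] p -> itg leb `[a, b] (fun x => p (x + e)) /\
  \int[leb]_(x in `[a + e, b + e]) p x = \int[leb]_(x in `[a, b]) p (x + e).
Proof.
have := @itg_affine_pos R 1 e a b p ltr01; rewrite !mul1r => h /h.
have -> : (fun x => p (1 * x + e)) = (fun x => p (x + e)) by apply/funext => x; rewrite mul1r.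
by [].
Qed.

Lemma periodic_itg p a b : periodic p -> itg leb `[0, 1] p -> itg leb `[a, b] p.
Proof.
move=> pp pi.
have nat_itg (n : nat) : itg leb `[0, n%:R] p.
  elim: n => [|n IH].
    by apply: (@itg_sub R p 0 1) => //.
  apply: (itg_glue _ _ IH) => //; first by rewrite ler_nat.
  have h : itg leb `[n%:R + (- n%:R), n.+1%:R + (- n%:R)] p.
    by rewrite subrr -natr1 addrAC subrr add0r.
  have [h1 _] := itg_shift h; apply: eq_itg h1 => // x _.
  by rewrite -(@periodicN p n (x - n%:R) pp) subrK.
have [n [na bn]] := int_bounds a b.
suff h : itg leb `[- n%:R, n%:R] p by exact: itg_sub h na bn.
have h : itg leb `[- n%:R + n%:R, n%:R + n%:R] p by rewrite addNr -natrD.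
by have [h1 _] := itg_shift h; apply: eq_itg h1 => // x _; rewrite periodicN.
Qed.

Lemma periodic_int p a : periodic p -> itg leb `[0, 1] p ->
  \int[leb]_(x in `[a, a + 1]) p x = \int[leb]_(x in `[0, 1]) p x.
Proof.
move=> pp pi; have I u v := periodic_itg u v pp pi.
have base c : 0 <= c <= 1 -> \int[leb]_(x in `[c, c + 1]) p x = \int[leb]_(x in `[0, 1]) p x.
  move=> /andP[c0 c1]; rewrite (Rintegral_split (I c (c + 1)) (b := 1)) ?c1 ?lerDr//.
  rewrite (Rintegral_split (I 0 1) (b := c)) ?c0// addrC; congr (_ + _).
  have := (@itg_shift 0 c p 1 (I _ _)).2; rewrite add0r => ->.
  by apply: Rintegral_eq => x _; exact: pp.
have step c (n : nat) : \int[leb]_(x in `[c + n%:R, c + n%:R + 1]) p x = \int[leb]_(x in `[c, c + 1]) p x.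
  have := (@itg_shift c (c + 1) p n%:R (I _ _)).2; rewrite addrAC => ->.
  by apply: Rintegral_eq => x _; exact: periodicN.
have [n [na _]] := int_bounds a a.
have an0 : 0 <= a + n%:R by lra.
have /andP[m1 m2] := truncn_itv an0; set m := Num.truncn _ in m1 m2.
have <- := step a n.
have e : a + n%:R = (a + n%:R - m%:R) + m%:R by rewrite subrK.
rewrite e step base// subr_ge0 m1/=; move: m2; rewrite -natr1; lra.
Qed.

Lemma periodic_primitive p q a b : periodic p -> periodic q -> is_primitive 0 1 p q -> a <= b -> is_primitive a b p q.
Proof.
move=> pp pq h ab.
have shift c e (n : nat) : is_primitive c e p q -> is_primitive (c - n%:R) (e - n%:R) p q.
  have := @is_primitive_affine_pos R 1 n%:R (c - n%:R) (e - n%:R) p q ltr01; rewrite !mul1r !subrK => hh /hh.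
  by congr (is_primitive _ _ _ _); apply/funext => x; rewrite !mul1r periodicN.
have shift' c e (n : nat) : is_primitive c e p q -> is_primitive (c + n%:R) (e + n%:R) p q.
  have := @is_primitive_affine_pos R 1 (- n%:R) (c + n%:R) (e + n%:R) p q ltr01; rewrite !mul1r !addrK => hh /hh.
  by congr (is_primitive _ _ _ _); apply/funext => x; rewrite !mul1r -(@periodicN _ n (x - n%:R))// subrK.
have nat_p (n : nat) : is_primitive 0 n.+1%:R p q.
  elim: n => // n IH; apply: (is_primitive_glue _ _ IH); rewrite ?ler_nat//.
  by have := shift' _ _ n.+1 h; rewrite add0r nat1r.
have [n [na bn]] := int_bounds a b.
have := shift _ _ n.+1 (nat_p (n.+1 + n)%N); rewrite sub0r -[(n.+1 + n).+1]addnS natrD addrAC subrr add0r => H.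
by apply: (is_primitive_sub H) => //; [apply: le_trans na|apply: le_trans bn _]; rewrite ?lerN2 ler_nat.
Qed.

End periodic.

(** * Weak derivatives from absolutely continuous slices *)

Section slices.
Context {R : realType}.
Local Notation leb := (@lebesgue_measure R).
Local Notation RT := (measurableTypeR R).
Local Notation area := (@area R).
Implicit Types (a b c e x y : R) (f g phi : R * R -> R) (D : set (R * R)).

Lemma pair1_cts y : continuous (fun x => (x, y) : R * R).
Proof. by move=> x; apply: (cvg_pair (F := nbhs x) (G := nbhs x) (H := nbhs y)); [exact: cvg_id|exact: cvg_cst]. Qed.

Lemma pair2_cts x : continuous (fun y => (x, y) : R * R).
Proof. by move=> y; apply: (cvg_pair (F := nbhs y) (G := nbhs x) (H := nbhs y)); [exact: cvg_cst|exact: cvg_id]. Qed.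

Lemma slice_derive1 f (z : R * R) : differentiable f z ->
  is_derive z.1 1 (fun s => f (s, z.2)) ('D_e1 f z).
Proof.
move=> df; have [d E] : is_derive z e1 f ('D_e1 f z) by apply: derivableP; exact: diff_derivable.
have Q : (fun h : R => h^-1 *: (((fun s => f (s, z.2)) \o shift z.1) (h *: (1 : R)) - f (z.1, z.2))) =
    (fun h : R => h^-1 *: ((f \o shift z) (h *: (e1 : R * R)) - f z)).
  apply/funext => h; rewrite /= /shift /=; congr (_ *: (f _ - f _)); last by case: z {df d E}.
  by apply/pair_equal_spec; rewrite /= scaler0 add0r; split.
split; first by rewrite /derivable Q.
by rewrite /derive Q.
Qed.

Lemma slice_derive2 f (z : R * R) : differentiable f z ->
  is_derive z.2 1 (fun s => f (z.1, s)) ('D_e2 f z).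
Proof.
move=> df; have [d E] : is_derive z e2 f ('D_e2 f z) by apply: derivableP; exact: diff_derivable.
have Q : (fun h : R => h^-1 *: (((fun s => f (z.1, s)) \o shift z.2) (h *: (1 : R)) - f (z.1, z.2))) =
    (fun h : R => h^-1 *: ((f \o shift z) (h *: (e2 : R * R)) - f z)).
  apply/funext => h; rewrite /= /shift /=; congr (_ *: (f _ - f _)); last by case: z {df d E}.
  by apply/pair_equal_spec; rewrite /= scaler0 add0r; split.
split; first by rewrite /derivable Q.
by rewrite /derive Q.
Qed.

Lemma test_outside D phi z : test_function D phi -> ~ D z -> phi z = 0.
Proof.
move=> [_ _ sub] nD; apply: contrapT => /eqP pz; apply: nD; apply: sub.
exact: (@subset_closure _ [set x | phi x != 0]).
Qed.

Section test.
Context (D : set (R * R)) (a b c e : R) (ab : a < b) (ce : c < e).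
Context (mD : measurable (D : set (RT * RT))) (sub : D `<=` obox a b c e).

Let mb : measurable (box a b c e : set (RT * RT)) := @measurable_box R a b c e.

Let Dbox : D `<=` box a b c e.
Proof. by move=> z /sub/oboxP[/andP[/ltW h1 /ltW h2] /andP[/ltW h3 /ltW h4]]; apply/boxP; rewrite h1 h2 h3 h4. Qed.

Lemma Rintegral_test f phi : test_function D phi ->
  \int[area]_(z in D) (f z * phi z) = \int[area]_(z in box a b c e) (f z * phi z).
Proof.
move=> tphi; rewrite Rintegral_mkcond [RHS]Rintegral_mkcond; apply: Rintegral_eq => z _.
rewrite /patch; case: (asboolP (D z)) => Dz; first by rewrite !mem_set//; exact: Dbox.
by rewrite (test_outside tphi Dz) mulr0; case: ifP; case: ifP.
Qed.

Let mul_itg f phi : test_function D phi -> in_L2 area (box a b c e) f ->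
  itg area (box a b c e) (fun z => f z * phi z).
Proof.
move=> tphi fL; have [M hM] := test_bounded tphi.
have h : itg area (box a b c e) (fun z => phi z * f z).
  apply: (itgM_bounded mb (c := M)); first exact: in_L2_itg (area_box_lty _ _ _ _) fL.
    exact: test_meas tphi.
  by move=> z _; exact: hM.
by apply: eq_itg h => // z _; rewrite mulrC.
Qed.

(** Integration by parts is done on each horizontal slice of the box; the boundary terms vanish
    because [D] lies in the open box and test functions vanish outside [D]. *)
Lemma weak_slices1 f f1 : in_L2 area (box a b c e) f -> in_L2 area (box a b c e) f1 ->
  (forall y, c <= y <= e -> is_primitive a b (fun x => f (x, y)) (fun x => f1 (x, y))) ->
  is_weak_deriv D e1 f f1.
Proof.
move=> fL f1L prim; split; first exact: in_L2_sub f1L.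
move=> phi tphi; have td := test_derive e1 tphi.
rewrite !Rintegral_test//; apply/eqP; rewrite -addr_eq0 addrC -RintegralD//; [|exact: mul_itg|exact: mul_itg].
apply/eqP; apply: Rintegral_box_eq0; first by apply: itgD => //; exact: mul_itg.
apply: aeW => y yce _.
have d1 x : is_derive x 1 (fun s => phi (s, y)) ('D_e1 phi (x, y)).
  by apply: (@slice_derive1 phi (x, y)); have [s _ _] := tphi; exact: (s [::] (x, y)).
have c1 : continuous (fun x => 'D_e1 phi (x, y)).
  move=> x; apply: (@continuous_comp _ _ _ (fun x => (x, y) : R * R) ('D_e1 phi)); last exact: test_cts td _.
  exact: pair1_cts.
rewrite (is_primitive_ibp (ltW ab) (prim y yce) d1 c1).
rewrite !(test_outside tphi) ?mulr0 ?subrr//.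
- by move=> /sub/oboxP[]/=; rewrite ltxx.
- by move=> /sub/oboxP[]/=; rewrite ltxx andbF.
Qed.

Lemma weak_slices2 f f2 : in_L2 area (box a b c e) f -> in_L2 area (box a b c e) f2 ->
  (forall x, a <= x <= b -> is_primitive c e (fun y => f (x, y)) (fun y => f2 (x, y))) ->
  is_weak_deriv D e2 f f2.
Proof.
move=> fL f2L prim; split; first exact: in_L2_sub f2L.
move=> phi tphi; have td := test_derive e2 tphi.
rewrite !Rintegral_test//; apply/eqP; rewrite -addr_eq0 addrC -RintegralD//; [|exact: mul_itg|exact: mul_itg].
have itot : itg area (box a b c e) (fun z => f2 z * phi z + f z * 'D_e2 phi z).
  by apply: itgD => //; exact: mul_itg.
have [si <-] := itg_swap_box itot; apply/eqP; apply: Rintegral_box_eq0 => //.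
apply: aeW => x xab _.
have d1 y : is_derive y 1 (fun s => phi (x, s)) ('D_e2 phi (x, y)).
  by apply: (@slice_derive2 phi (x, y)); have [s _ _] := tphi; exact: (s [::] (x, y)).
have c1 : continuous (fun y => 'D_e2 phi (x, y)).
  move=> y; apply: (@continuous_comp _ _ _ (fun y => (x, y) : R * R) ('D_e2 phi)); last exact: test_cts td _.
  exact: pair2_cts.
rewrite /swap /= (is_primitive_ibp (ltW ce) (prim x xab) d1 c1).
rewrite !(test_outside tphi) ?mulr0 ?subrr//.
- by move=> /sub/oboxP[_]/=; rewrite ltxx.
- by move=> /sub/oboxP[_]/=; rewrite ltxx andbF.
Qed.

End test.
End slices.

(** * Averages of periodic functions over translations *)

Section waves.
Context {R : realType}.
Local Notation leb := (@lebesgue_measure R).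
Local Notation RT := (measurableTypeR R).
Local Notation area := (@area R).
Implicit Types (a b c e x y T tau : R) (p : R -> R) (w : R * R -> R) (D : set (R * R)).

Lemma periodic_meas p : periodic p -> itg leb `[0, 1] p -> measurable_fun setT (p : RT -> R).
Proof.
move=> pp pi.
have -> : [set: RT] = \bigcup_(n : nat) (`[- n%:R, n%:R]%classic : set RT).
  apply/seteqP; split => // x _; have [n [h1 h2]] := int_bounds x x.
  by exists n => //; rewrite /= in_itv/= h1.
apply/measurable_fun_bigcup => //= n; exact: itg_meas (periodic_itg (- n%:R) n%:R pp pi).
Qed.

Lemma wave_meas T tau p (E : set (RT * RT)) : measurable_fun setT (p : RT -> R) ->
  measurable_fun E (fun z : RT * RT => p (z.1 / T + tau)).
Proof.
move=> mp; apply: (measurable_funS measurableT) => //.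
apply: (@measurableT_comp _ _ _ _ _ _ p) => //.
rewrite (_ : (fun x : RT * RT => _) = (fun x : RT => T^-1 * x + tau) \o fst).
  by apply: measurableT_comp; [exact: aff_meas|exact: measurable_fst].
by apply/funext => z /=; rewrite mulrC.
Qed.

Lemma wave_itg a b c e T tau p : 0 < T -> periodic p -> itg leb `[0, 1] p ->
  itg area (box a b c e) (fun z => p (z.1 / T + tau)).
Proof.
move=> T0 pp pi; have Ti : 0 < T^-1 by rewrite invr_gt0.
have [h _] := @itg_affine_pos R T^-1 tau a b p Ti (periodic_itg _ _ pp pi).
have [h2 _] := tensor_itg_box h (continuous_itg c e (@cst_continuous R R (1 : R))).
by apply: eq_itg h2 => [|z _]; [exact: measurable_box|rewrite mulr1 mulrC].
Qed.

(** Fubini in position and translation: at a fixed point the integral over one period of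
    translations is the mean of [p]. *)
Lemma wave_mean (D : set (RT * RT)) a b c e T p w (M : R) : 0 < T -> a <= b -> c <= e -> periodic p -> itg leb `[0, 1] p ->
  measurable D -> D `<=` box a b c e -> measurable_fun D (w : RT * RT -> R) -> (forall z, D z -> `|w z| <= M) ->
  let A tau := \int[area]_(z in D) (w z * p (z.1 / T + tau)) in
  itg leb `[0, 1] A /\
  \int[leb]_(tau in `[0, 1]) A tau = (\int[leb]_(x in `[0, 1]) p x) * \int[area]_(z in D) w z.
Proof.
move=> T0 ab ce pp pi mD DQ mw wM A.
have Ti : 0 < T^-1 by rewrite invr_gt0.
have mp := periodic_meas pp pi; have mb := @measurable_box R a b c e.
pose W := w \_ D; have mW : measurable_fun setT (W : RT * RT -> R) by exact/(measurable_restrictT _ mD).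
have M0 : 0 <= `|M| by [].
have WM z : `|W z| <= `|M|.
  rewrite /W patchE; case: ifPn => [/set_mem/wM/le_trans|_]; last by rewrite normr0.
  by apply; exact: ler_norm.
have WE (F : R * R -> R) : \int[area]_(z in D) (w z * F z) = \int[area]_(z in box a b c e) (W z * F z).
  rewrite Rintegral_mkcond [RHS]Rintegral_mkcond; apply: Rintegral_eq => z _.
  rewrite /W /patch; case: (boolP (z \in D)) => zD; last by rewrite mul0r; case: ifP.
  by rewrite mem_set//; apply: DQ; exact: set_mem zD.
have Wi : itg area (box a b c e) W.
  apply: (itg_bounded mb (c := `|M|)); [exact: area_box_lty|exact: measurable_funS mW|by move=> z _; exact: WM].
(* the section lengths of [D] weighted by [w] *)
pose S x := \int[leb]_(y in `[c, e]) W (x, y).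
have W0 (z : R * R) : ~ (c <= z.2 <= e) -> W z = 0.
  move=> nz; rewrite /W patchE; case: ifPn => // /set_mem/DQ/boxP[_]; by [].
have [Wsi _] := itg_swap_box Wi.
have Si : itg leb `[a, b] S by have := itg_section_box Wsi.
have sliceW x : itg leb `[c, e] (fun y => W (x, y)).
  apply: (@itg_bounded _ _ _ leb _ (measurable_itv _) _ `|M|); [exact: leb_itv_lty| |by move=> y _; exact: WM].
  apply: (measurable_funS measurableT) => //; apply: (measurableT_comp mW).
  exact: measurable_fun_pair.
have AE tau : A tau = \int[leb]_(x in `[a, b]) (S x * p (x / T + tau)).
  have wi : itg area (box a b c e) (fun z => W z * p (z.1 / T + tau)).
    apply: (itgM_bounded mb (c := `|M|)); [exact: wave_itg|exact: measurable_funS mW|by move=> z _; exact: WM].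
  have [i1 E1] := itg_swap_box wi.
  rewrite /A WE -E1 Rintegral_box//; apply: Rintegral_eq => x _.
  by rewrite /swap /= RintegralZr.
have SM x : `|S x| <= `|M| * (e - c).
  apply: le_trans (Rintegral_le_norm (sliceW x)) _; rewrite -Rintegral_itv_cst//.
  apply: le_Rintegral => //; [exact: itg_abs|exact: (continuous_itg c e (@cst_continuous R R `|M|))].
(* Joint integrability: for each [x] the integral of the absolute value over the translations equals
   the same constant [K], by periodicity. *)
have prod_i : itg area (box a b 0 1) (fun z => S z.1 * p (z.1 / T + z.2)).
  have mpp : measurable_fun setT (fun z : RT * RT => p (z.1 / T + z.2)).
    apply: (@measurableT_comp _ _ _ _ _ _ p) => //; apply: measurable_funD; last exact: measurable_snd.
    rewrite (_ : (fun x : RT * RT => _) = (fun x : RT => T^-1 * x + 0) \o fst).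
      by apply: measurableT_comp; [exact: aff_meas|exact: measurable_fst].
    by apply/funext => z /=; rewrite mulrC addr0.
  pose q := (fun z : R * R => p (z.1 / T + z.2)) \_ (box a b 0 1).
  have mb1 := @measurable_box R a b 0 1.
  have ap := itg_abs pi; have app : periodic (fun x => `|p x|) by move=> x; rewrite pp.
  pose K := \int[leb]_(x in `[0, 1]) `|p x|.
  have mI (s t : R) : measurable (`[s, t]%classic : set RT) by [].
  have qi : itg area (box a b 0 1) (fun z => p (z.1 / T + z.2)).
    apply/(integrable_mkcond _ mb1); rewrite restrict_EFin.
    have mq : measurable_fun setT (fun z : RT * RT => (q z)%:E).
      by apply/measurable_EFinP/(measurable_restrictT _ mb1); exact: measurable_funS mpp.
    apply/(@integrable12ltyP _ _ _ _ _ leb leb _ mq) => /=.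
    have -> : (fun x => (\int[leb]_y `|(q (x, y))%:E|)%E) = (fun x => (((cst K : R -> R) \_ `[a, b]) x)%:E).
      apply/funext => x; rewrite /q [in RHS]/patch; case: ifPn => xab.
        have hs : itg leb `[0 + x / T, 1 + x / T] (fun s => `|p s|) := periodic_itg _ _ app ap.
        have [i1 E1] := itg_shift hs; have := periodic_int (x / T) app ap.
        rewrite [x / T + 1]addrC -[X in `[X, _]]add0r E1 => E3; rewrite -[cst K x]/K /K -E3 (EFin_Rintegral _ i1)//.
        rewrite [RHS]integral_mkcond; apply: eq_integral => y _.
        rewrite /patch in_setX xab/=; case: ifP => _; first by rewrite addrC.
        by rewrite normr0.
      by rewrite integral0_eq// => y _; rewrite /patch in_setX (negbTE xab)/= normr0.
    rewrite -EFin_Rintegral ?ltry//; apply: itg_patch (mI a b) _.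
    exact: (continuous_itg a b (@cst_continuous R R K)).
  apply: (itgM_bounded mb1 (c := `|M| * (e - c)) qi) => [|z _]; last exact: SM.
  apply: (measurable_funS measurableT) => //; apply: (@measurableT_comp _ _ _ _ _ _ S); last exact: measurable_fst.
  apply: eq_measurable_fun (measurable_Rint mW) => x _.
  rewrite /S [RHS]Rintegral_mkcond; apply: Rintegral_eq => y _; rewrite /patch; case: ifPn => // /negP yn.
  by rewrite W0//= => h; apply: yn; apply/mem_set; rewrite /= in_itv.
have [i1 E1] := itg_swap_box prod_i.
split.
  by apply: eq_itg (itg_section_box prod_i) => // tau _; rewrite AE.
transitivity (\int[area]_(z in box a b 0 1) (S z.1 * p (z.1 / T + z.2))).
  by rewrite Rintegral_box//; apply: Rintegral_eq => tau _; rewrite AE.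
rewrite -E1 Rintegral_box//.
have inner x : \int[leb]_(t in `[0, 1]) p (x / T + t) = \int[leb]_(t in `[0, 1]) p t.
  have hs : itg leb `[0 + x / T, 1 + x / T] p := periodic_itg _ _ pp pi.
  have [_ E2] := itg_shift hs; have := periodic_int (x / T) pp pi.
  rewrite [x / T + 1]addrC -[X in `[X, _]]add0r E2 => <-; apply: Rintegral_eq => t _; by rewrite addrC.
have slice x : itg leb `[0, 1] (fun t => p (x / T + t)).
  have hs : itg leb `[0 + x / T, 1 + x / T] p := periodic_itg _ _ pp pi.
  by have [h _] := itg_shift hs; apply: eq_itg h => // t _; rewrite addrC.
transitivity (\int[leb]_(x in `[a, b]) (S x * \int[leb]_(t in `[0, 1]) p t)).
  by apply: Rintegral_eq => x _; rewrite /swap /= RintegralZl// inner.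
rewrite RintegralZr// mulrC; congr (_ * _).
have := WE (fun=> 1); under eq_Rintegral do rewrite mulr1; move=> ->.
under [RHS]eq_Rintegral do rewrite mulr1.
by have [_ <-] := itg_swap_box Wi; rewrite Rintegral_box.
Qed.

End waves.

(** * Strips along the boundary *)

Section boundary.
Context {R : realType}.
Local Notation leb := (@lebesgue_measure R).
Local Notation RT := (measurableTypeR R).
Local Notation area := (@area R).
Implicit Types (a b c e x y r s t K L T : R) (rho : R * R -> R) (D U : set (R * R)) (p z : R * R).

Definition square p r : set (R * R) := box (p.1 - r) (p.1 + r) (p.2 - r) (p.2 + r).

Lemma squareP p r z : square p r z <-> `|z.1 - p.1| <= r /\ `|z.2 - p.2| <= r.
Proof.
rewrite /square; split => [/boxP[/andP[h1 h2] /andP[h3 h4]]|]; first by rewrite !ler_norml; split; apply/andP; split; lra.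
rewrite !ler_norml => -[/andP[h1 h2] /andP[h3 h4]]; apply/boxP; split; apply/andP; split; lra.
Qed.

Lemma nbhs_square p (A : set (R * R)) : nbhs p A -> exists2 r, 0 < r & square p r `<=` A.
Proof.
move=> /nbhs_ballP[d /= d0 h]; exists (d / 2); first by rewrite divr_gt0.
move=> z /squareP[h1 h2]; apply: h; split; rewrite /ball /= distrC; apply: le_lt_trans; [exact: h1| |exact: h2|]; lra.
Qed.

Lemma C1_square U rho p t : open U -> smooth_on U rho -> U p -> 0 < t ->
  exists2 r, 0 < r & forall z, square p r z -> [/\ U z, `|'D_e1 rho z - 'D_e1 rho p| <= t &
    `|'D_e2 rho z - 'D_e2 rho p| <= t].
Proof.
move=> oU sm Up t0.
have cts (v : R * R) : \forall z \near p, `|'D_v rho z - 'D_v rho p| <= t.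
  have : {for p, continuous ('D_v rho)} by apply: differentiable_continuous; exact: (sm [:: v] p Up).
  by move=> /cvgrPdist_le/(_ t t0); apply: filterS => z; rewrite distrC.
have UN : \forall z \near p, U z by exact: open_nbhs_nbhs.
have H : nbhs p [set z | [/\ U z, `|'D_e1 rho z - 'D_e1 rho p| <= t & `|'D_e2 rho z - 'D_e2 rho p| <= t]].
  by apply: filterS3 UN (cts e1) (cts e2) => z *; split.
by have [r r0 h] := nbhs_square H; exists r => // z /h.
Qed.

Lemma mvt1 U rho a b y : smooth_on U rho -> a <= b -> (forall x, a <= x <= b -> U (x, y)) ->
  exists2 x, a <= x <= b & rho (b, y) - rho (a, y) = 'D_e1 rho (x, y) * (b - a).
Proof.
move=> sm ab hU.
have d x : a <= x <= b -> is_derive x 1 (fun s => rho (s, y)) ('D_e1 rho (x, y)).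
  by move=> h; apply: (@slice_derive1 R rho (x, y)); exact: (sm [::] _ (hU x h)).
move: ab; rewrite le_eqVlt => /orP[/eqP <-|ab].
  by exists a; rewrite ?lexx// !subrr mulr0.
have [||x xab E] := @MVT R (fun s => rho (s, y)) (fun x => 'D_e1 rho (x, y)) a b ab.
- by move=> x; rewrite in_itv/= => /andP[/ltW h1 /ltW h2]; apply: d; rewrite h1.
- apply: derivable_within_continuous => x; rewrite in_itv/= => xab.
  by have [] := d x xab.
by exists x => //; move: xab; rewrite in_itv/= => /andP[/ltW -> /ltW ->].
Qed.

Lemma mvt2 U rho x a b : smooth_on U rho -> a <= b -> (forall y, a <= y <= b -> U (x, y)) ->
  exists2 y, a <= y <= b & rho (x, b) - rho (x, a) = 'D_e2 rho (x, y) * (b - a).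
Proof.
move=> sm ab hU.
have d y : a <= y <= b -> is_derive y 1 (fun s => rho (x, s)) ('D_e2 rho (x, y)).
  by move=> h; apply: (@slice_derive2 R rho (x, y)); exact: (sm [::] _ (hU y h)).
move: ab; rewrite le_eqVlt => /orP[/eqP <-|ab].
  by exists a; rewrite ?lexx// !subrr mulr0.
have [||y yab E] := @MVT R (fun s => rho (x, s)) (fun y => 'D_e2 rho (x, y)) a b ab.
- by move=> y; rewrite in_itv/= => /andP[/ltW h1 /ltW h2]; apply: d; rewrite h1.
- apply: derivable_within_continuous => y; rewrite in_itv/= => yab.
  by have [] := d y yab.
by exists y => //; move: yab; rewrite in_itv/= => /andP[/ltW -> /ltW ->].
Qed.

Lemma gradient_neq0 U rho p v : smooth_on U rho -> U p -> 'D_v rho p != 0 ->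
  'D_e1 rho p != 0 \/ 'D_e2 rho p != 0.
Proof.
move=> sm Up; have df : differentiable rho p := sm [::] p Up.
have -> : v = v.1 *: (e1 : R * R) + v.2 *: (e2 : R * R).
  rewrite /e1 /e2; case: v => v1 v2 /=; apply/pair_equal_spec; rewrite /= /GRing.scale /= !mulr1 !mulr0 addr0 add0r; by split.
rewrite !deriveE// linearD !linearZ /=.
have [->|] := eqVneq ('d rho p e1) 0; last by left.
by have [->|] := eqVneq ('d rho p e2) 0; [rewrite !scaler0 addr0 eqxx|right].
Qed.

Lemma boundary_zero U D rho p : open U -> smooth_on U rho -> D `&` U = [set x | rho x < 0] `&` U ->
  closure D p -> ~ D p -> U p -> rho p = 0.
Proof.
move=> oU sm DU clp nDp Up; apply/eqP; rewrite eq_le; apply/andP; split; last first.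
  rewrite leNgt; apply/negP => h; apply: nDp.
  have : ([set x | rho x < 0] `&` U) p by [].
  by rewrite -DU => -[].
have cr : {for p, continuous rho} by apply: differentiable_continuous; exact: (sm [::] p Up).
rewrite leNgt; apply/negP => h.
have n1 : \forall z \near p, 0 < rho z by move/cvgr_gt : cr => /(_ 0 h).
have n2 : \forall z \near p, U z by exact: open_nbhs_nbhs.
have [z [Dz [rz Uz]]] := clp _ (filterI n1 n2).
have : (D `&` U) z by [].
by rewrite DU => -[/=]; rewrite ltNge (ltW rz).
Qed.

(** The parameter is the supremum of those for which the segment is in [D]; since [D] is open, the
    point at the supremum cannot belong to it. *)
Lemma segment_boundary D z r : open D -> D z -> ~ D (z.1 + r, z.2) ->
  exists2 s, 0 <= s <= 1 & closure D (z.1 + s * r, z.2) /\ ~ D (z.1 + s * r, z.2).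
Proof.
move=> oD Dz nD; pose g s : R * R := (z.1 + s * r, z.2).
have gc : continuous g.
  move=> s; apply: (@continuous_comp _ _ _ (fun s => z.1 + s * r) (fun x => (x, z.2) : R * R)); last exact: pair1_cts.
  by apply: cvgD; [exact: cvg_cst|apply: cvgM; [exact: cvg_id|exact: cvg_cst]].
pose A := [set s | 0 <= s <= 1 /\ D (g s)].
have A0 : A 0 by split; rewrite ?lexx ?ler01// /g mul0r addr0; case: z Dz {nD g gc A}.
have supA : has_sup A by split; [exists 0|exists 1 => s [/andP[]]].
have s0 : 0 <= sup A by apply: sup_ubound => //; case: supA.
have s1 : sup A <= 1 by apply: ge_sup; [exists 0|move=> s [/andP[]]].
exists (sup A); first by rewrite s0.
split.
  move=> V nV; have : nbhs (sup A) (g @^-1` V) by exact: gc.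
  move=> /nbhs_ballP[d /= d0 h]; have [s As hs] := sup_adherent d0 supA.
  exists (g s); split; first by case: As.
  apply: h; rewrite /ball /= ltr_norml; have : s <= sup A by apply: sup_ubound => //; case: supA.
  by move=> h; apply/andP; split; lra.
move=> Dg; have : nbhs (sup A) (g @^-1` D) by apply: gc; exact: open_nbhs_nbhs.
move=> /nbhs_ballP[d /= d0 h].
have sn1 : sup A < 1.
  rewrite lt_neqAle s1 andbT; apply/eqP => e1; apply: nD; move: Dg.
  by rewrite e1 mul1r.
pose s := Num.min 1 (sup A + d / 2).
have sA : sup A < s by rewrite /s lt_min sn1/=; lra.
have : s <= sup A.
  apply: sup_ubound; first by case: supA.
  split; first by rewrite (le_trans s0 (ltW sA))/= /s ge_min lexx.
  apply: h; rewrite /ball /= distrC gtr0_norm ?subr_gt0//.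
  have : s <= sup A + d / 2 by rewrite /s ge_min lexx orbT.
  by move=> h; lra.
by rewrite leNgt sA.
Qed.

(** By the mean value theorem two points where |f| is at most [K] are at distance at most 2 K / c,
    so the set lies in an interval of twice that length. *)
Lemma slow_set_leb (f f' : R -> R) a b c K : 0 < c -> (forall x, a <= x <= b -> is_derive x 1 f (f' x)) ->
  (forall x, a <= x <= b -> c <= `|f' x|) -> 0 <= K ->
  forall A : set RT, measurable A -> (forall x, A x -> a <= x <= b /\ `|f x| <= K) -> (leb A <= (4 * K / c)%:E)%E.
Proof.
move=> c0 df fc K0 A mA hA.
have [[x0 Ax0]|A0] := pselect (exists x, A x); last first.
  by rewrite (_ : A = set0) ?measure0 ?lee_fin ?divr_ge0 ?mulr_ge0// ?ltW//; apply/seteqP; split => // x Ax; apply: A0; exists x.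
have gap x y : A x -> A y -> x < y -> y - x <= 2 * K / c.
  move=> /hA[/andP[ax xb] fx] /hA[/andP[ay yb] fy] xy.
  have sub t : x <= t <= y -> a <= t <= b by move=> /andP[h1 h2]; rewrite (le_trans ax h1) (le_trans h2 yb).
  have [||t txy E] := @MVT R f f' x y xy.
  - by move=> t; rewrite in_itv/= => /andP[/ltW h1 /ltW h2]; apply: df; apply: sub; rewrite h1.
  - apply: derivable_within_continuous => t; rewrite in_itv/= => h.
    by have [] := df t (sub t h).
  move: txy; rewrite in_itv/= => /andP[/ltW h1 /ltW h2].
  have tab : a <= t <= b by apply: sub; rewrite h1.
  have : `|f y - f x| <= 2 * K by apply: le_trans (ler_normB _ _) _; lra.
  rewrite E normrM (gtr0_norm (_ : 0 < y - x)) ?subr_gt0// => h.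
  rewrite ler_pdivlMr// mulrC; apply: le_trans h; apply: ler_wpM2r; [by rewrite subr_ge0 ltW|exact: fc].
have sub : A `<=` `[x0 - 2 * K / c, x0 + 2 * K / c]%classic.
  have q0 : 0 <= 2 * K / c by rewrite divr_ge0 ?mulr_ge0// ltW.
  move=> x Ax; rewrite /= in_itv/=; case: (ltgtP x x0) => [lt|lt|->]; last by apply/andP; split; lra.
    by have := gap x x0 Ax Ax0 lt => h; apply/andP; split; lra.
  by have := gap x0 x Ax0 Ax lt => h; apply/andP; split; lra.
apply: (@le_trans _ _ (leb `[x0 - 2 * K / c, x0 + 2 * K / c]%classic)).
  by apply: le_measure => //; rewrite inE.
have q0 : 0 <= 2 * K / c by rewrite divr_ge0 ?mulr_ge0// ltW.
by rewrite leb_itv ?lee_fin; lra.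
Qed.

Lemma area_sections (B : set (RT * RT)) a b c e K : measurable B -> a <= b -> B `<=` box a b c e -> 0 <= K ->
  (forall x, a <= x <= b -> (leb [set y | B (x, y)] <= K%:E)%E) -> (area B <= ((b - a) * K)%:E)%E.
Proof.
move=> mB ab Bbox K0 h.
have E : area B = (\int[leb]_x leb [set y | B (x, y)])%E.
  rewrite /area /= /product_measure1; apply: eq_integral => x _; congr (leb _).
  by apply/seteqP; split => y; rewrite /xsection/= ?inE.
have mf : measurable_fun setT (fun x : RT => leb [set y | B (x, y)]).
  have -> : (fun x : RT => leb [set y | B (x, y)]) = (fun x : RT => leb (xsection B x)).
    by apply/funext => x; congr (leb _); apply/seteqP; split => y; rewrite /xsection/= ?inE.
  exact: measurable_fun_xsection.
have mab : measurable (`[a, b]%classic : set RT) by [].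
have Ki : itg leb setT ((cst K : R -> R) \_ `[a, b]).
  exact: itg_patch mab (continuous_itg a b (@cst_continuous R R K)).
rewrite E; apply: (@le_trans _ _ (\int[leb]_x (((cst K : R -> R) \_ `[a, b]) x)%:E)%E).
  apply: ge0_le_integral => //.
  - exact: measurable_int Ki.
  - move=> x _; rewrite /patch; case: ifPn => xab; first by apply: h; move/set_mem : xab; rewrite /= in_itv.
    rewrite (_ : [set y | B (x, y)] = set0) ?measure0//; apply/seteqP; split => // y /= /Bbox/boxP[/= xab' _].
    by move/negP : xab; apply; apply/mem_set; rewrite /= in_itv.
rewrite -EFin_Rintegral// lee_fin -Rintegral_mkcond.
by rewrite (Rintegral_itv_cst K ab) mulrC.
Qed.

Lemma area_swap (B : set (RT * RT)) : measurable B -> area [set z | B (swap z)] = area B.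
Proof.
move=> mB; have mS : measurable ([set z | B (swap z)] : set (RT * RT)).
  by have := @measurable_swap R measurableT B mB; rewrite setTI.
have := @integral_swap R (EFin \o \1_B) _ _.
rewrite (_ : (fun z => (EFin \o \1_B) (swap z)) = (EFin \o \1_([set z | B (swap z)]))); last first.
  by apply/funext => z; rewrite /= !indicE; congr ((_%:R)%:E); apply: asbool_equiv_eq.
rewrite !integral_indic// ?setIT; apply; first by exact/measurable_EFinP.
by move=> z; rewrite lee_fin.
Qed.

(** [rho] is controlled on [U] only, so the set is obtained by removing from the square an open
    subset of [U]. *)
Lemma sublevel_meas U rho p r K : open U -> smooth_on U rho -> square p r `<=` U ->
  measurable ([set z | square p r z /\ `|rho z| <= K] : set (RT * RT)).
Proof.
move=> oU sm sub.
have oS : open (U `&` [set z | K < `|rho z|]).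
  rewrite openE => z [Uz kz]; have cr : {for z, continuous rho} by apply: differentiable_continuous; exact: (sm [::] z Uz).
  have n1 : \forall y \near z, K < `|rho y|.
    have : `|rho y| @[y --> z] --> `|rho z| by exact: cvg_norm.
    by move/cvgr_gt => /(_ K kz).
  have n2 : \forall y \near z, U y by exact: open_nbhs_nbhs.
  exact: filterI n2 n1.
have mS := open_meas oS.
have -> : [set z | square p r z /\ `|rho z| <= K] = square p r `\` (U `&` [set z | K < `|rho z|]).
  apply/seteqP; split => z /=.
    by move=> [sz kz]; split => // -[_]; rewrite ltNge kz.
  move=> [sz h]; split => //; rewrite leNgt; apply/negP => kz; apply: h; split => //; exact: sub.
by apply: measurableD => //; exact: measurable_box.
Qed.

(** If a horizontal step of length at most [T] from [z] ends on the boundary, [rho] vanishes there,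
    so |rho| is at most L T at [z]. This sublevel set has area O(T), because one partial derivative
    of [rho] stays away from 0 near [p]. *)
Lemma patch_strip U D rho p v : open U -> smooth_on U rho -> D `&` U = [set x | rho x < 0] `&` U ->
  U p -> 'D_v rho p != 0 ->
  exists r C, [/\ 0 < r, 0 <= C & forall T, 0 < T -> exists B : set (RT * RT),
    [/\ measurable B, (area B <= (C * T)%:E)%E &
      forall z t, square p r z -> square p r (z.1 + t, z.2) -> `|t| <= T ->
        closure D (z.1 + t, z.2) -> ~ D (z.1 + t, z.2) -> B z]].
Proof.
move=> oU sm DU Up dv.
have [g0 g0p gor] : exists2 g : R, 0 < g & g <= `|'D_e1 rho p| \/ g <= `|'D_e2 rho p|.
  by have [h|h] := gradient_neq0 sm Up dv; [exists (`|'D_e1 rho p|)|exists (`|'D_e2 rho p|)]; rewrite ?normr_gt0//; [left|right].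
have t0 : 0 < g0 / 2 by rewrite divr_gt0.
have [r r0 hr] := C1_square oU sm Up t0.
pose L := `|'D_e1 rho p| + g0 / 2.
have L0 : 0 < L by rewrite ltr_wpDl.
have sqU : square p r `<=` U by move=> z /hr[].
exists r, ((p.1 + r - (p.1 - r)) * (4 * L / (g0 / 2))); split => //.
  by rewrite mulr_ge0 ?divr_ge0 ?mulr_ge0 ?ltW//; lra.
move=> T T0; pose B : set (RT * RT) := [set z | square p r z /\ `|rho z| <= L * T].
have mB : measurable B := sublevel_meas (L * T) oU sm sqU.
have LT0 : 0 <= L * T by rewrite mulr_ge0// ltW.
have Bsq : B `<=` square p r by move=> z [].
have inU z : square p r z -> U z by move=> /sqU.
exists B; split => //; last first.
  move=> z t sz szt tT cl nD; split => //.
  have r0q := boundary_zero oU sm DU cl nD (inU _ szt).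
  have seg s : Num.min z.1 (z.1 + t) <= s <= Num.max z.1 (z.1 + t) -> square p r (s, z.2).
    move: sz szt => /boxP[/andP[a1 a2] b1] /boxP[/= /andP[a3 a4] _] /andP[s1 s2]; apply/boxP; split => //=.
    apply/andP; split; first by apply: le_trans s1; rewrite le_min a1 a3.
    by apply: le_trans s2 _; rewrite ge_max a2 a4.
  have D1 s : Num.min z.1 (z.1 + t) <= s <= Num.max z.1 (z.1 + t) -> `|'D_e1 rho (s, z.2)| <= L.
    move=> /seg/hr[_ h _]; rewrite -[X in `|X|](subrK ('D_e1 rho p)) addrC.
    by apply: le_trans (ler_normD _ _) _; rewrite lerD2l.
  have fin (s : R) : Num.min z.1 (z.1 + t) <= s <= Num.max z.1 (z.1 + t) -> `|rho z| = `|'D_e1 rho (s, z.2) * t| -> `|rho z| <= L * T.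
    by move=> /D1 h ->; rewrite normrM ler_pM.
  case: (lerP 0 t) => t00.
    have le : z.1 <= z.1 + t by rewrite lerDl.
    have mn : Num.min z.1 (z.1 + t) = z.1 by exact: min_l.
    have mx : Num.max z.1 (z.1 + t) = z.1 + t by exact: max_r.
    have [|s st E] := mvt1 (y := z.2) sm le _.
      by move=> s st; apply/inU/seg; rewrite mn mx.
    apply: (fin s); first by rewrite mn mx.
    by move: E; rewrite r0q sub0r addrAC subrr add0r -surjective_pairing => <-; rewrite normrN.
  have le : z.1 + t <= z.1 by rewrite gerDl ltW.
  have mn : Num.min z.1 (z.1 + t) = z.1 + t by exact: min_r.
  have mx : Num.max z.1 (z.1 + t) = z.1 by exact: max_l.
  have [|s st E] := mvt1 (y := z.2) sm le _.
    by move=> s st; apply/inU/seg; rewrite mn mx.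
  apply: (fin s); first by rewrite mn mx.
  by move: E; rewrite r0q subr0 -surjective_pairing => ->; rewrite opprD addrA subrr add0r mulrN normrN.
have Q0 : 0 <= 4 * (L * T) / (g0 / 2) by rewrite divr_ge0 ?mulr_ge0// ltW.
have bound : (area B <= ((p.1 + r - (p.1 - r)) * (4 * (L * T) / (g0 / 2)))%:E)%E.
  (* The set is sliced along the direction in which the derivative is bounded below; the first
     direction is reduced to the second by exchanging coordinates. *)
  case: gor => gp.
  - have mS : measurable ([set z | B (swap z)] : set (RT * RT)).
      by have := @measurable_swap R measurableT B mB; rewrite setTI.
    rewrite -(area_swap mB).
    have -> : p.1 + r - (p.1 - r) = p.2 + r - (p.2 - r) by ring.
    apply: (@area_sections _ _ _ (p.1 - r) (p.1 + r)) => //; first lra.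
      by move=> z [/boxP[h1 h2] _]; apply/boxP.
    move=> y yp; apply: (@slow_set_leb (fun x => rho (x, y)) (fun x => 'D_e1 rho (x, y)) (p.1 - r) (p.1 + r)) => //.
    + move=> x xp; apply: (@slice_derive1 R rho (x, y)); apply: (sm [::]); apply/inU/boxP; by split.
    + move=> x xp; have [|_ h _] := hr (x, y); first by apply/boxP.
      have := lerB_dist ('D_e1 rho p) ('D_e1 rho p - 'D_e1 rho (x, y)); rewrite subKr distrC => h2.
      by have := h; rewrite distrC => h3; lra.
    + have -> : [set x | (fun z => B (swap z)) (y, x)] = ysection B y.
        by apply/seteqP; split => x; rewrite /ysection/= ?inE.
      exact: measurable_ysection.
    + by move=> x [/boxP[/= h1 _] h2].
  - apply: (@area_sections _ _ _ (p.2 - r) (p.2 + r)) => //; first lra.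
    move=> x xp; apply: (@slow_set_leb (fun y => rho (x, y)) (fun y => 'D_e2 rho (x, y)) (p.2 - r) (p.2 + r)) => //.
    + move=> y yp; apply: (@slice_derive2 R rho (x, y)); apply: (sm [::]); apply/inU/boxP; by split.
    + move=> y yp; have [|_ _ h] := hr (x, y); first by apply/boxP.
      have := lerB_dist ('D_e2 rho p) ('D_e2 rho p - 'D_e2 rho (x, y)); rewrite subKr distrC => h2.
      by have := h; rewrite distrC => h3; lra.
    + have -> : [set y | B (x, y)] = xsection B x by apply/seteqP; split => y; rewrite /xsection/= ?inE.
      exact: measurable_xsection.
    + by move=> y [/boxP[/= _ h1] h2].
by apply: le_trans bound _; rewrite lee_fin le_eqVlt; apply/orP; left; apply/eqP; field; rewrite gt_eqF.
Qed.

End boundary.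

(** * Global geometry of the domain: boundary strip and highest point *)

Section domain.
Context {R : realType}.
Local Notation leb := (@lebesgue_measure R).
Local Notation RT := (measurableTypeR R).
Local Notation area := (@area R).
Implicit Types (a b c e x y r s t K L T : R) (rho : R * R -> R) (D U A : set (R * R)) (p z : R * R).

Lemma domain_box D : bounded_set D -> exists2 N, 0 < N & forall z, D z -> `|z.1| <= N /\ `|z.2| <= N.
Proof.
move=> bD; have [M hM] : exists M : R, forall z, D z -> `|z| <= M.
  by have /filter_ex[M hM] : \forall M \near +oo, globally D [set x | `|x| <= M] := bD; exists M.
exists (`|M| + 1); first by rewrite ltr_wpDl.
move=> z /hM h; have h1 : `|z| <= `|M| + 1 by have := ler_norm M; lra.
by split; apply: le_trans h1; rewrite /Num.norm/= le_max lexx ?orbT.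
Qed.

Lemma closure_compact D : bounded_set D -> compact (closure D).
Proof.
move=> /domain_box[N N0 h].
have cQ : compact (`[- N, N]%classic `*` `[- N, N]%classic : set (R * R)).
  by apply: compact_setX; exact: segment_compact.
apply: (subclosed_compact _ cQ); first exact: closed_closure.
have hs : hausdorff_space (R * R)%type by exact: norm_hausdorff.
rewrite [X in _ `<=` X](closure_id _).1; last exact: compact_closed.
apply: closure_subset => z /h[]; rewrite !ler_norml => h1 h2; by split; rewrite /= in_itv.
Qed.

(** A point whose membership in [D] changes under the translation has a boundary point on the
    horizontal segment in between. The local strips catch such points, and compactness of the
    boundary leaves finitely many of them. *)
Lemma boundary_strip D : smooth_bounded_domain D -> exists C T0 : R, [/\ 0 <= C, 0 < T0 &
  forall T, 0 < T -> T <= T0 -> exists B : set (RT * RT), [/\ measurable B, (area B <= (C * T)%:E)%E &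
    forall z t, 0 <= t <= T -> ~ B z -> (D z <-> D (z.1 + t, z.2))]].
Proof.
move=> [_ oD _ bD sD]; have cD := closure_compact bD.
pose Kb := closure D `&` ~` D.
have cK : compact Kb.
  by apply: (subclosed_compact _ cD); [apply: closedI; [exact: closed_closure|exact: open_closedC]|move=> z []].
pose P A := exists C T0 : R, [/\ 0 <= C, 0 < T0 &
  forall T, 0 < T -> T <= T0 -> exists B : set (RT * RT), [/\ measurable B, (area B <= (C * T)%:E)%E &
    forall z t, `|t| <= T -> A (z.1 + t, z.2) -> Kb (z.1 + t, z.2) -> B z]].
have loc p : exists A, open A /\ (Kb p -> A p /\ P A).
  have [[clp nDp]|nK] := pselect (Kb p); last by exists setT; split; [exact: openT|].
  have [U [rho [oU Up sm [v dv] DU]]] := sD p clp nDp.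
  have [r [C [r0 C0 h]]] := patch_strip oU sm DU Up dv.
  have r20 : 0 < r / 2 by rewrite divr_gt0.
  exists (ball p (r / 2)); split; first exact: ball_open.
  move=> _; split; first exact: ballxx.
  exists C, (r / 2); split => // T T0 Tr; have [B [mB aB hB]] := h T T0.
  exists B; split => // z t tT [b1 b2] [cl nD].
  move: b1 b2; rewrite /ball /= ![`|p.1 - _|]distrC ![`|p.2 - _|]distrC => b1 b2.
  apply: (hB z t) => //.
    apply/squareP; split; last by apply: ltW; lra.
    have : `|z.1 + t - p.1 - t| <= `|z.1 + t - p.1| + `|t| by exact: ler_normB.
    have -> : z.1 + t - p.1 - t = z.1 - p.1 by ring.
    by lra.
  by apply/squareP => /=; split; apply: ltW; lra.
have Pmono A A' : A `<=` A' -> P A' -> P A.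
  move=> AA [C [T0 [C0 T00 h]]]; exists C, T0; split => // T Tp TT; have [B [mB aB hB]] := h T Tp TT.
  by exists B; split => // z t tT /AA; exact: hB.
have PU A A' : P A -> P A' -> P (A `|` A').
  move=> [C [T0 [C0 T00 h]]] [C' [T0' [C0' T00' h']]]; exists (C + C'), (Num.min T0 T0'); split.
  - exact: addr_ge0.
  - by rewrite lt_min T00.
  move=> T Tp; rewrite le_min => /andP[t1 t2].
  have [B [mB aB hB]] := h T Tp t1; have [B' [mB' aB' hB']] := h' T Tp t2.
  exists (B `|` B'); split; first exact: measurableU.
    by rewrite mulrDl EFinD; apply: le_trans (measureU2 _ _ _) _ => //; exact: leeD.
  by move=> z t tT [Az|Az] Kz; [left; exact: hB Kz|right; exact: hB' Kz].
have P0 : P set0.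
  exists 0, 1; split => // T T0 _; exists set0; split => //; by rewrite measure0 mul0r.
(* Otherwise the sets whose complement in the boundary has property P
   form a proper filter, which has no cluster point. *)
have [C [T0 [C0 T00 h]]] : P Kb.
  apply: contrapT => nP; pose F : set_system (R * R) := [set A | P (Kb `\` A)].
  have FF : ProperFilter F.
    split; first by rewrite /F /= setD0.
    split; first by rewrite /F /= setDT.
      by move=> A A' FA FA'; rewrite /F /= setDIr; exact: PU.
    by move=> A A' AA; apply: Pmono => z [Kz nA]; split => // Az; apply: nA; exact: AA.
  have [|p [Kp cl]] := cK F FF; first by rewrite /F /= setDv.
  have [A [oA /(_ Kp)[Ap PA]]] := loc p.
  have FA : F (~` A) by apply: Pmono PA => z [_ /contrapT].
  by have [z []] := cl _ _ FA (open_nbhs_nbhs (conj oA Ap)).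
exists C, T0; split => // T Tp TT; have [B [mB aB hB]] := h T Tp TT.
exists B; split => // z t /andP[t0 tT] nB; split => Dz; apply: contrapT => nD; apply: nB.
  have [s' /andP[s0 s1] [cl nDs]] := segment_boundary oD Dz nD.
  have Ks : Kb (z.1 + s' * t, z.2) by [].
  apply: (hB z (s' * t)) => //.
  by rewrite ger0_norm ?mulr_ge0// (le_trans _ tT)// ler_piMl.
(* For the converse the segment is run through backwards, starting from the translated point. *)
have nD' : ~ D ((z.1 + t, z.2).1 + (- t), (z.1 + t, z.2).2) by rewrite /= addrK -surjective_pairing.
have [s' /andP[s0 s1] [cl nDs]] := segment_boundary oD Dz nD'.
have e : (z.1 + t, z.2).1 + s' * (- t) = z.1 + (1 - s') * t by rewrite /=; ring.
rewrite e /= in cl nDs.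
have Ks : Kb (z.1 + (1 - s') * t, z.2) by [].
apply: (hB z ((1 - s') * t)) => //.
rewrite ger0_norm ?mulr_ge0 ?subr_ge0// (le_trans _ tT)// ler_piMl// gerBl//.
Qed.

Lemma dist_between (c s a b x : R) : `|a - c| <= s -> `|b - c| <= s -> a <= x <= b -> `|x - c| <= s.
Proof. by rewrite !ler_norml => /andP[? ?] /andP[? ?] /andP[? ?]; apply/andP; split; lra. Qed.

(** At a highest point the differential of [rho] is vertical. Hence, for any [M] and small [T], the
    domain contains the box of width [M * T] at depths between [T / 2] and [T] below it. On this box
    the exponential is at least exp (-1), and its area is [M * T ^+ 2 / 2] with [M] arbitrary. *)
Lemma top_point D : smooth_bounded_domain D -> exists H, (forall z, D z -> z.2 <= H) /\
  forall K, exists2 T0, 0 < T0 & forall T, 0 < T -> T <= T0 ->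
    K * T ^+ 2 <= \int[area]_(z in D) expR ((z.2 - H) / T).
Proof.
move=> [[z0 Dz0] oD _ bD sD]; have cD := closure_compact bD.
have mD := open_meas oD.
have [p /set_mem clp pmax] := @compact_EVT_max (R * R)%type R snd (closure D) (ex_intro _ z0 (subset_closure Dz0)) cD
  (continuous_subspaceT (@snd_cts R)).
have top z : D z -> z.2 < p.2.
  move=> Dz; have : nbhs z D by exact: open_nbhs_nbhs.
  move=> /nbhs_square[r r0 h].
  have : D (z.1, z.2 + r) by apply: h; apply/squareP; rewrite /= subrr normr0 addrC addKr gtr0_norm// lexx ltW.
  by move=> /subset_closure/mem_set/pmax/=; lra.
have nDp : ~ D p by move=> /top; rewrite ltxx.
have [U [rho [oU Up sm [v dv] DU]]] := sD p clp nDp.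
have rho0 := boundary_zero oU sm DU clp nDp Up.
have DUE z : U z -> rho z < 0 -> D z.
  by move=> Uz rz; have : ([set x | rho x < 0] `&` U) z by []; rewrite -DU => -[].
have pos z : U z -> p.2 <= z.2 -> 0 <= rho z.
  by move=> Uz pz; rewrite leNgt; apply/negP => /(DUE z Uz)/top; rewrite ltNge pz.
set d1 := 'D_e1 rho p; set d2 := 'D_e2 rho p.
(* Otherwise [rho] would be negative at a neighbouring point of the same height [p.2], which would
   then belong to [D]. *)
have d10 : d1 = 0.
  apply: contrapT => /eqP d1n; have t0 : 0 < `|d1| / 2 by rewrite divr_gt0// normr_gt0.
  have [r r0 hr] := C1_square oU sm Up t0.
  have sq x : `|x - p.1| <= r -> square p r (x, p.2).
    by move=> h; apply/squareP; rewrite /= subrr normr0 (ltW r0).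
  have [dn|dp] := ltP d1 0.
    have [||x xp E] := @mvt1 R U rho p.1 (p.1 + r) p.2 sm _ _; first by rewrite lerDl ltW.
      move=> x /andP[x1 x2]; have [] // := hr (x, p.2); apply: sq; rewrite ger0_norm ?subr_ge0//; lra.
    have /andP[x1 x2] := xp; have [|_ h _] := hr (x, p.2); first by apply: sq; rewrite ger0_norm ?subr_ge0//; lra.
    have [|Ur _ _] := hr (p.1 + r, p.2); first by apply: sq; rewrite addrC addKr gtr0_norm.
    have := pos (p.1 + r, p.2) Ur (lexx _); move: E; rewrite -surjective_pairing rho0 subr0 => ->.
    move: h; rewrite -/d1 (ltr0_norm dn) ler_norml => /andP[_ h]; have : 'D_e1 rho (x, p.2) < 0 by lra.
    by move=> n; rewrite addrC addKr pmulr_lge0// leNgt n.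
  have {}dp : 0 < d1 by rewrite lt_neqAle eq_sym d1n.
  have [||x xp E] := @mvt1 R U rho (p.1 - r) p.1 p.2 sm _ _; first by rewrite gerBl ltW.
    move=> x /andP[x1 x2]; have [] // := hr (x, p.2); apply: sq; rewrite ler0_norm ?subr_le0//; lra.
  have /andP[x1 x2] := xp; have [|_ h _] := hr (x, p.2); first by apply: sq; rewrite ler0_norm ?subr_le0//; lra.
  have [|Ur _ _] := hr (p.1 - r, p.2).
    by apply: sq; rewrite addrAC subrr add0r normrN gtr0_norm.
  have := pos (p.1 - r, p.2) Ur (lexx _); move: E; rewrite -surjective_pairing rho0 sub0r => E.
  have -> : rho (p.1 - r, p.2) = - ('D_e1 rho (x, p.2) * (p.1 - (p.1 - r))) by rewrite -E opprK.
  move: h; rewrite -/d1 (gtr0_norm dp) ler_norml => /andP[h _]; have : 0 < 'D_e1 rho (x, p.2) by lra.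
  by move=> n; rewrite opprB addrCA subrr addr0 oppr_ge0 pmulr_lle0// leNgt n.
(* A negative derivative would make [rho] negative above [p]; it is not zero because the
   differential does not vanish. *)
have d2p : 0 < d2.
  have d2n : d2 != 0 by have [h|h] := gradient_neq0 sm Up dv; [move: h; rewrite -/d1 d10 eqxx|exact: h].
  rewrite lt_neqAle eq_sym d2n /= leNgt; apply/negP => dn.
  have t0 : 0 < - d2 / 2 by rewrite divr_gt0// oppr_gt0.
  have [r r0 hr] := C1_square oU sm Up t0.
  have sq y : `|y - p.2| <= r -> square p r (p.1, y).
    by move=> h; apply/squareP; rewrite /= subrr normr0 (ltW r0).
  have [||y yp E] := @mvt2 R U rho p.1 p.2 (p.2 + r) sm _ _; first by rewrite lerDl ltW.
    move=> y /andP[y1 y2]; have [] // := hr (p.1, y); apply: sq; rewrite ger0_norm ?subr_ge0//; lra.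
  have /andP[y1 y2] := yp; have [|_ _ h] := hr (p.1, y); first by apply: sq; rewrite ger0_norm ?subr_ge0//; lra.
  have [|Ur _ _] := hr (p.1, p.2 + r); first by apply: sq; rewrite addrC addKr gtr0_norm.
  have := pos (p.1, p.2 + r) Ur; rewrite /= lerDl => /(_ (ltW r0)).
  move: E; rewrite -surjective_pairing rho0 subr0 => ->.
  move: h; rewrite -/d2 ler_norml => /andP[_ h]; have : 'D_e2 rho (p.1, y) < 0 by lra.
  by move=> n; rewrite addrC addKr pmulr_lge0// leNgt n.
exists p.2; split => [z /top/ltW//|K].
have e0 : 0 < expR (-1) :> R by exact: expR_gt0.
(* Chosen so that exp (-1) times [M / 2] exceeds |K|. *)
pose M := `|K| * expR 1 * 2 + 1.
have M0 : 0 < M by rewrite ltr_wpDl// !mulr_ge0// expR_ge0.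
(* The first bound makes [rho] at most [- d2 * T / 4] on the vertical line through [p]; the second
   limits the horizontal variation over [M * T / 2] to [d2 * T / 8]. *)
pose t := Num.min (d2 / 2) (d2 / (4 * M)).
have t0 : 0 < t by rewrite lt_min !divr_gt0// mulr_gt0.
have [r r0 hr] := C1_square oU sm Up t0.
exists (Num.min r (r / M)); first by rewrite lt_min r0 divr_gt0.
move=> T T0; rewrite le_min => /andP[Tr TrM].
have MT : M * T <= r by rewrite mulrC -ler_pdivlMr.
pose Q : set (RT * RT) := box (p.1 - M * T / 2) (p.1 + M * T / 2) (p.2 - T) (p.2 - T / 2).
have MT0 : 0 < M * T by rewrite mulr_gt0.
have inr x y : `|x - p.1| <= M * T / 2 -> p.2 - T <= y <= p.2 -> square p r (x, y).
  move=> hx /andP[y1 y2]; apply/squareP; split => /=; first lra.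
  by rewrite ler0_norm ?subr_le0//; lra.
have QD : Q `<=` D.
  move=> [x y] /boxP/=[/andP[x1 x2] /andP[y1 y2]].
  have xr : `|x - p.1| <= M * T / 2 by rewrite ler_norml; apply/andP; split; lra.
  have inU x' y' : `|x' - p.1| <= M * T / 2 -> p.2 - T <= y' <= p.2 -> U (x', y').
    by move=> h1 h2; have [] := hr _ (inr _ _ h1 h2).
  have T20 : 0 <= T / 2 by rewrite divr_ge0// ltW.
  have yp2 : y <= p.2 by rewrite (le_trans y2)// gerBl.
  have yp : p.2 - T <= y <= p.2 by rewrite y1.
  apply: DUE; first exact: inU.
  have MT20 : `|p.1 - p.1| <= M * T / 2 by rewrite subrr normr0; lra.
  have [|y' /andP[y'1 y'2] E2] := @mvt2 R U rho p.1 y p.2 sm yp2 _.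
    by move=> y' /andP[h1 h2]; apply: inU => //; rewrite (le_trans y1 h1).
  have y'p : p.2 - T <= y' <= p.2 by rewrite (le_trans y1 y'1).
  have [_ _ h2] := hr _ (inr _ _ MT20 y'p).
  have D2 : d2 / 2 <= 'D_e2 rho (p.1, y').
    move: h2; rewrite -/d2 ler_norml => /andP[h2 _]; have : t <= d2 / 2 by rewrite /t ge_min lexx.
    lra.
  have vert : rho (p.1, y) <= - (d2 / 2) * (T / 2).
    have -> : rho (p.1, y) = - ('D_e2 rho (p.1, y') * (p.2 - y)).
      by rewrite -E2 -surjective_pairing rho0 sub0r opprK.
    rewrite mulNr lerN2; apply: ler_pM => //; [by rewrite divr_ge0// ltW|by rewrite lerBrDl -lerBrDr].
  have horiz : `|rho (x, y) - rho (p.1, y)| <= d2 / (4 * M) * (M * T / 2).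
    have D1 x' : `|x' - p.1| <= M * T / 2 -> `|'D_e1 rho (x', y)| <= d2 / (4 * M).
      move=> h; have [_ h1 _] := hr _ (inr x' y h yp).
      by move: h1; rewrite -/d1 d10 subr0 => /le_trans; apply; rewrite /t ge_min lexx orbT.
    have [xp|px] := leP x p.1.
      have [|x' /andP[a1 a2] E] := @mvt1 R U rho x p.1 y sm xp _.
        by move=> x' xb; apply: inU => //; exact: dist_between xr MT20 xb.
      rewrite distrC E normrM; apply: ler_pM => //; last by rewrite distrC.
      by apply: D1; apply: dist_between xr MT20 _; rewrite a1.
    have [|x' /andP[a1 a2] E] := @mvt1 R U rho p.1 x y sm (ltW px) _.
      by move=> x' xb; apply: inU => //; exact: dist_between MT20 xr xb.
    rewrite E normrM; apply: ler_pM => //.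
    by apply: D1; apply: dist_between MT20 xr _; rewrite a1.
  have e : d2 / (4 * M) * (M * T / 2) = d2 * T / 8 by field; rewrite gt_eqF.
  have dT : 0 < d2 * T by rewrite mulr_gt0.
  move: horiz; rewrite e ler_norml => /andP[_ h]; have e' : - (d2 / 2) * (T / 2) = - (d2 * T / 4) by field.
  by move: vert; rewrite e'; lra.
have mQ : measurable Q := @measurable_box R _ _ _ _.
have Dfin : (area D < +oo)%E.
  have [N N0 hN] := domain_box bD.
  apply: (@le_lt_trans _ _ (area (box (- N) N (- N) N))); last exact: area_box_lty.
  apply: le_measure; rewrite ?inE//; first exact: measurable_box.
  by move=> z /hN[]; rewrite !ler_norml => h1 h2; apply/boxP.
have zeta_i : itg area D (fun z => expR ((z.2 - p.2) / T)).
  apply: (itg_bounded mD (c := 1)) => //.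
    apply: continuous_meas2 => z; apply: (@continuous_comp _ _ _ (fun z : R * R => (z.2 - p.2) / T) expR); last exact: continuous_expR.
    by apply: cvgM; [apply: cvgB; [exact: snd_cts|exact: cvg_cst]|exact: cvg_cst].
  move=> z /top zp; rewrite ger0_norm ?expR_ge0// -expR0 ler_expR.
  by rewrite mulr_le0_ge0 ?invr_ge0 ?(ltW T0)// subr_le0 ltW.
have step : expR (-1) * (M * T * (T / 2)) <= \int[area]_(z in D) expR ((z.2 - p.2) / T).
  have [ci cE] := tensor_itg_box (continuous_itg (p.1 - M * T / 2) (p.1 + M * T / 2) (@cst_continuous R R (expR (-1))))
     (continuous_itg (p.2 - T) (p.2 - T / 2) (@cst_continuous R R (1 : R))).
  apply: (@le_trans _ _ (\int[area]_(z in Q) (expR (-1) * 1))).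
    rewrite cE !Rintegral_itv_cst; [|lra|lra].
    by rewrite le_eqVlt; apply/orP; left; apply/eqP; field.
  apply: (@le_trans _ _ (\int[area]_(z in Q) expR ((z.2 - p.2) / T))).
    apply: le_Rintegral => //; first exact: integrableS zeta_i.
    move=> z /boxP[_ /andP[y1 y2]]; rewrite mulr1 ler_expR ler_pdivlMr//; lra.
  rewrite Rintegral_mkcond [leRHS]Rintegral_mkcond; apply: le_Rintegral => //.
  - by apply: (itg_patch mQ); exact: integrableS zeta_i.
  - exact: itg_patch mD zeta_i.
  - move=> z _; rewrite /patch; case: ifPn => [/set_mem/QD Dz|_]; first by rewrite mem_set.
    by case: ifP => // _; exact: expR_ge0.
apply: le_trans step.
have -> : expR (-1) * (M * T * (T / 2)) = (`|K| * (expR 1 * expR (-1)) + expR (-1) / 2) * T ^+ 2.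
  by rewrite /M; field.
rewrite -expRD subrr expR0 mulr1; apply: ler_wpM2r; first exact: sqr_ge0.
by have := ler_norm K; lra.
Qed.

End domain.

(** * Unit cells with amplitude and phase *)

Section cells.
Context {R : realType}.
Local Notation leb := (@lebesgue_measure R).
Local Notation RT := (measurableTypeR R).
Implicit Types (a b c e x y k : R) (f g F G S Z : R -> R).

Definition fr y : R := y - (Num.floor y)%:~R.

Lemma fr_itv y : 0 <= fr y < 1.
Proof.
have := floor_itv y; rewrite /fr intrD => /andP[h1 h2].
by apply/andP; split; [rewrite subr_ge0|rewrite ltrBlDl].
Qed.

Lemma fr_id y : 0 <= y < 1 -> fr y = y.
Proof. by move=> h; rewrite /fr (@floor_def _ y 0) ?subr0// add0r. Qed.

Lemma frD1 y : fr (y + 1) = fr y.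
Proof. by rewrite /fr floorDrz ?rpred1// floor1 intrD opprD addrACA subrr addr0. Qed.

Lemma periodic_fr F : periodic (fun y => F (fr y)).
Proof. by move=> y; rewrite frD1. Qed.

Lemma is_primitive_oo a b f g1 g2 : (forall x, a < x < b -> g1 x = g2 x) ->
  is_primitive a b f g1 -> is_primitive a b f g2.
Proof.
move=> E [gi h].
have gi2 : itg leb `[a, b] g2.
  apply: itg_oo_cc; have gi' : itg leb `]a, b[ g1.
    by apply: integrableS gi => //; apply: subset_itv; rewrite bnd_simp.
  by apply: eq_itg gi' => // x; rewrite /= in_itv; exact: E.
split => // x /andP[ax xb]; rewrite h ?ax//; congr (_ + _).
have i1 := itg_sub gi (lexx a) xb; have i2 := itg_sub gi2 (lexx a) xb.
rewrite -(Rintegral_oo_cc i1) -(Rintegral_oo_cc i2); apply: Rintegral_eq => t.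
by rewrite /= in_itv/= => /andP[h1 h2]; apply: E; rewrite h1 (lt_le_trans h2 xb).
Qed.

Lemma itg_fr F : itg leb `[0, 1] F -> itg leb `[0, 1] (fun y => F (fr y)) /\
  \int[leb]_(x in `[0, 1]) F (fr x) = \int[leb]_(x in `[0, 1]) F x.
Proof.
move=> Fi; have Fi' : itg leb `]0, 1[ F.
  by apply: integrableS Fi => //; apply: subset_itv; rewrite bnd_simp.
have E x : `]0, 1[%classic x -> F x = F (fr x).
  by rewrite /= in_itv/= => /andP[/ltW h1 h2]; rewrite fr_id ?h1.
have i2 : itg leb `[0, 1] (fun y => F (fr y)) by apply: itg_oo_cc; apply: eq_itg Fi'.
split => //; rewrite -(Rintegral_oo_cc Fi) -(Rintegral_oo_cc i2).
by apply: Rintegral_eq => x /E ->.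
Qed.

(** The equality of the end values makes the periodic continuation continuous across integers. *)
Lemma primitive_fr F G a b : F 1 = F 0 -> is_primitive 0 1 F G -> a <= b ->
  is_primitive a b (fun y => F (fr y)) (fun y => G (fr y)).
Proof.
move=> F10 FG; apply: periodic_primitive; [exact: periodic_fr|exact: periodic_fr|].
have FG' : is_primitive 0 1 F (fun y => G (fr y)).
  by apply: is_primitive_oo FG => x /andP[/ltW h1 h2]; rewrite fr_id ?h1.
apply: eq_is_primitive FG' => // x /andP[x0]; rewrite le_eqVlt => /orP[/eqP ->|x1].
  by rewrite -[X in fr X]add0r frD1 fr_id ?lexx ?ltr01.
by rewrite fr_id ?x0.
Qed.

Lemma is_primitive_derive a b f g : a <= b -> (forall x, is_derive x 1 f (g x)) -> continuous g ->
  is_primitive a b f g.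
Proof.
move=> ab df cg; split; first exact: continuous_itg.
move=> x /andP[ax xb].
rewrite (_ : \int[leb]_(t in `[a, x]) g t = f x - f a); first by rewrite addrC subrK.
by apply: FTC => //; exact: continuous_subspaceT.
Qed.

(* A profile [S] with phase [Z] on a unit cell; [S cos (Z b + k)] matches at
   the endpoints of the cell although [Z] may jump where [S] vanishes. *)
Record cell (S S' Z : R -> R) : Prop := Cell {
  cell_le1 : forall x, `|S x| <= 1;
  cell_Zle : forall x, 0 <= x <= 1 -> `|Z x| <= 1;
  cell_Z : measurable_fun (`[0, 1]%classic : set RT) (Z : RT -> R);
  cell_L2 : in_L2 leb `[0, 1] S';
  cell_match : forall b k, S 1 * cos (Z 1 * b + k) = S 0 * cos (Z 0 * b + k);
  cell_prim : forall b k, is_primitive 0 1 (fun x => S x * cos (Z x * b + k))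
    (fun x => S' x * cos (Z x * b + k) - S x * sin (Z x * b + k) * b) }.

Lemma cos_shift x : cos (x - pi / 2) = sin x.
Proof. by rewrite cosB cos_pihalf sin_pihalf mulr0 add0r mulr1. Qed.

Lemma sin_shift x : sin (x - pi / 2) = - cos x.
Proof. exact: sinBpihalf. Qed.

Lemma is_derive_cos_lin c k x : is_derive x 1 (fun s => cos (c * s + k)) (- sin (c * x + k) * c).
Proof. by apply: is_derive_eq; rewrite -![_ *: _]/(_ * _); ring. Qed.

Lemma cts_sin_lin c k : continuous (fun s => sin (c * s + k)).
Proof.
move=> s; apply: (@continuous_comp _ _ _ (fun s => c * s + k) sin); last exact: continuous_sin.
by apply: cvgD; [apply: cvgM; [exact: cvg_cst|exact: cvg_id]|exact: cvg_cst].
Qed.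

(** The addition formula separates the phase of the cell from the linear phase [A * x]. The sine
    that it produces is a cosine shifted by pi / 2, hence covered by [cell_prim] with
    [k - pi / 2]. *)
Lemma cell_slice S S' Z (A b k T tau a e : R) : cell S S' Z -> 0 < T -> a <= e ->
  let y x := x / T + tau in
  is_primitive a e
    (fun x => S (fr (y x)) * cos (A * x + Z (fr (y x)) * b + k))
    (fun x => S' (fr (y x)) / T * cos (A * x + Z (fr (y x)) * b + k)
      - S (fr (y x)) * sin (A * x + Z (fr (y x)) * b + k) * (A + b / T)).
Proof.
move=> cS T0 ae y; have Ti : 0 < T^-1 by rewrite invr_gt0.
have le : T^-1 * a + tau <= T^-1 * e + tau by rewrite lerD2r ler_pM2l.
have aff k' := is_primitive_affine_pos Ti (primitive_fr (a := T^-1 * a + tau) (b := T^-1 * e + tau)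
  (cell_match cS b k') (cell_prim cS b k') le).
have c1 k' : continuous (fun x => - sin (A * x + k') * A).
  by move=> x; apply: cvgM; [apply: cvgN; exact: cts_sin_lin|exact: cvg_cst].
have m1 := is_primitive_mul ae (aff k) (is_derive_cos_lin A 0) (c1 0).
have m2 := is_primitive_mul ae (aff (k - pi / 2)) (is_derive_cos_lin A (- (pi / 2))) (c1 _).
have := is_primitive_lin (-1) m2 m1; congr (is_primitive _ _ _ _); apply/funext => x;
  rewrite /y [x / T]mulrC; set r := fr _; rewrite !addr0 -(addrA (A * x)) (addrA (Z r * b));
  set P := Z r * b + k; rewrite ?(cosD (A * x) P) ?(sinD (A * x) P) !cos_shift ?sin_shift; ring.
Qed.

Lemma cell_vertical (b b' : R -> R) (Om x1 s z k a e : R) : a <= e ->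
  (forall x, is_derive x 1 b (b' x)) -> continuous b' ->
  is_primitive a e (fun x2 => s * cos (Om * x1 * x2 + z * b x2 + k))
    (fun x2 => - (s * sin (Om * x1 * x2 + z * b x2 + k) * (Om * x1 + z * b' x2))).
Proof.
move=> ae db cb'.
have cb : continuous b by move=> x; apply: differentiable_continuous; apply/derivable1_diffP; have [] := db x.
apply: is_primitive_derive => //.
  move=> x; have dbx := db x; apply: is_derive_eq.
  by rewrite -![_ *: _]/(_ * _); ring.
move=> x; apply: cvgN; apply: cvgM; last first.
  by apply: cvgD; [exact: cvg_cst|apply: cvgM; [exact: cvg_cst|exact: cb']].
apply: cvgM; first exact: cvg_cst.
apply: (@continuous_comp _ _ _ (fun x2 => Om * x1 * x2 + z * b x2 + k) sin); last exact: continuous_sin.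
apply: cvgD; last exact: cvg_cst.
by apply: cvgD; apply: cvgM; [exact: cvg_cst|exact: cvg_id|exact: cvg_cst|exact: cb].
Qed.

End cells.

Import ComplexField.Normc.

(** * The complex wave and its covariant gradient *)

Section wave_fields.
Local Open Scope complex_scope.
Context {R : realType}.
Local Notation leb := (@lebesgue_measure R).
Local Notation RT := (measurableTypeR R).
Local Notation area := (@area R).
Implicit Types (D : set (R * R)) (u : R * R -> R[i]) (x z : R * R).

Lemma normc_sqr (z : R[i]) : normc z ^+ 2 = complex.Re z ^+ 2 + complex.Im z ^+ 2.
Proof. by case: z => p q /=; rewrite sqr_sqrtr// addr_ge0// sqr_ge0. Qed.

Lemma normc_cov (w1 w2 p q c : R) : normc ((w1 +i* w2) - 'i * c%:C * (p +i* q)) ^+ 2 =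
  (w1 + c * q) ^+ 2 + (w2 - c * p) ^+ 2.
Proof. by rewrite normc_sqr /=; ring. Qed.

Lemma cov_grad_sqE D Om u x : cov_grad_sq D Om u x =
  (weak_deriv D e1 (fun y => complex.Re (u y)) x - Om * x.2 * complex.Im (u x)) ^+ 2 +
  (weak_deriv D e1 (fun y => complex.Im (u y)) x + Om * x.2 * complex.Re (u x)) ^+ 2 +
  ((weak_deriv D e2 (fun y => complex.Re (u y)) x + Om * x.1 * complex.Im (u x)) ^+ 2 +
  (weak_deriv D e2 (fun y => complex.Im (u y)) x - Om * x.1 * complex.Re (u x)) ^+ 2).
Proof.
rewrite /cov_grad_sq /weak_derivC /perp; case: (u x) => p q.
rewrite !normc_cov /=.
do 4 (set d := weak_deriv _ _ _ _; move: d => ?); ring.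
Qed.

Lemma potentialE eps delta (z1 z2 : R[i]) : potential eps delta z1 z2 =
  (1 - (complex.Re z1 ^+ 2 + complex.Im z1 ^+ 2) - (complex.Re z2 ^+ 2 + complex.Im z2 ^+ 2)) ^+ 2 / (4 * eps ^+ 2)
  + (delta - 1) / (2 * eps ^+ 2) * ((complex.Re z1 ^+ 2 + complex.Im z1 ^+ 2) * (complex.Re z2 ^+ 2 + complex.Im z2 ^+ 2)).
Proof. by rewrite /potential !normc_sqr. Qed.

Section wave.
Context (S S' Z : R -> R) (cS : cell S S' Z) (b b' : R -> R) (Om T tau : R) (T0 : 0 < T).
Context (db : forall x : R, is_derive x 1 b (b' x)) (cb' : continuous b').

Definition cellpos z : R := fr (z.1 / T + tau).

(** The term [Om * z.1 * z.2] cancels the vector potential in the second direction and doubles it in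
    the first, where the slope [b / T] of the cell phase can compensate it. *)
Definition phase k z : R := Om * z.1 * z.2 + Z (cellpos z) * b z.2 + k.

Definition wave k z : R := S (cellpos z) * cos (phase k z).

Definition wave1 k z : R := S' (cellpos z) / T * cos (phase k z)
  - S (cellpos z) * sin (phase k z) * (Om * z.2 + b z.2 / T).

Definition wave2 k z : R := - (S (cellpos z) * sin (phase k z) * (Om * z.1 + Z (cellpos z) * b' z.2)).

Let cb : continuous b.
Proof. by move=> x; apply: differentiable_continuous; apply/derivable1_diffP; have [] := db x. Qed.

Lemma itg_cellS : itg leb `[0, 1] S.
Proof.
have h := within_itg (is_primitive_cts ler01 (cell_prim cS 0 0)).
by apply: eq_itg h => // x _; rewrite mulr0 addr0 cos0 mulr1.
Qed.

Lemma itg_cellZ : itg leb `[0, 1] Z.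
Proof.
apply: (@itg_bounded _ _ _ leb _ (measurable_itv _) _ 1); [exact: leb_itv_lty|exact: cell_Z cS|].
by move=> x; rewrite /= in_itv; exact: (cell_Zle cS).
Qed.

Lemma itg_cellS' : itg leb `[0, 1] S'.
Proof. by apply: in_L2_itg (cell_L2 cS) => //; exact: leb_itv_lty. Qed.

Lemma cellpos_meas (F : R -> R) (E : set (RT * RT)) : itg leb `[0, 1] F -> measurable_fun E (fun z : RT * RT => F (cellpos z)).
Proof.
move=> Fi; apply: (@wave_meas R T tau (fun y => F (fr y)) E).
by apply: periodic_meas; [exact: periodic_fr|exact: (itg_fr Fi).1].
Qed.

Lemma fst_meas (E : set (RT * RT)) : measurable_fun E (fun z : RT * RT => z.1 : R).
Proof. by apply: continuous_meas2; exact: fst_cts. Qed.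

Lemma snd_meas (h : R -> R) (E : set (RT * RT)) : continuous h -> measurable_fun E (fun z : RT * RT => h z.2).
Proof.
by move=> ch; apply: continuous_meas2 => z; apply: (continuous_comp (@snd_cts R z)); exact: ch.
Qed.

Lemma snd_meas0 (E : set (RT * RT)) : measurable_fun E (fun z : RT * RT => z.2 : R).
Proof. by apply: continuous_meas2; exact: snd_cts. Qed.

Lemma phase_meas k (E : set (RT * RT)) : measurable_fun E (phase k : RT * RT -> R).
Proof.
apply: measurable_funD => //; apply: measurable_funD.
  by apply: measurable_funM; [apply: measurable_funM => //; exact: fst_meas|exact: snd_meas0].
by apply: measurable_funM; [exact: cellpos_meas itg_cellZ|exact: snd_meas].
Qed.

Lemma cos_meas k (E : set (RT * RT)) : measurable_fun E (fun z : RT * RT => cos (phase k z)).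
Proof.
apply: (@measurableT_comp _ _ _ _ _ _ cos); last exact: phase_meas.
exact: continuous_meas (@continuous_cos R).
Qed.

Lemma sin_meas k (E : set (RT * RT)) : measurable_fun E (fun z : RT * RT => sin (phase k z)).
Proof.
apply: (@measurableT_comp _ _ _ _ _ _ sin); last exact: phase_meas.
exact: continuous_meas (@continuous_sin R).
Qed.

Lemma wave_meas2 k (E : set (RT * RT)) : measurable_fun E (wave k : RT * RT -> R).
Proof. by apply: measurable_funM; [exact: cellpos_meas itg_cellS|exact: cos_meas]. Qed.

Lemma wave_le1 k z : `|wave k z| <= 1.
Proof.
by rewrite /wave normrM mulr_ile1//; [exact: (cell_le1 cS)|exact: cos_max].
Qed.

Lemma cts_bounded (h : R -> R) (c e : R) : continuous h -> exists M : R, 0 <= M /\ forall x : R, c <= x <= e -> `|h x| <= M.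
Proof.
move=> ch; have [ce|ec] := leP c e; last first.
  by exists 0; split => // x /andP[h1 h2]; have := lt_le_trans ec (le_trans h1 h2); rewrite ltxx.
have [xm _ hm] := EVT_max ce (continuous_subspaceT (fun x : R => cvg_norm (ch x))).
by exists (`|h xm|); split => // x xc; exact: hm.
Qed.

Lemma cellpos_itg (F : R -> R) a c p q : itg leb `[0, 1] F -> itg area (box a c p q) (fun z => F (cellpos z)).
Proof.
move=> Fi; apply: (@wave_itg R a c p q T tau (fun y => F (fr y))) => //; [exact: periodic_fr|exact: (itg_fr Fi).1].
Qed.

Lemma wave1_L2 k a c p q : in_L2 area (box a c p q) (wave1 k).
Proof.
have mb := @measurable_box R a c p q.
have S'L : in_L2 area (box a c p q) (fun z => S' (cellpos z)).
  split; first exact: cellpos_meas itg_cellS'.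
  have h := @cellpos_itg (fun x : R => S' x ^+ 2) a c p q (cell_L2 cS).2.
  exact: h.
apply: in_L2B => //.
  have := in_L2M_bounded mb S'L (g := fun z => T^-1 * cos (phase k z)) (c := T^-1) _ _.
  have mc : measurable_fun (box a c p q : set (RT * RT)) (fun z : RT * RT => T^-1 * cos (phase k z)).
    by apply: measurable_funM => //; exact: cos_meas.
  move=> /(_ mc) H.
  rewrite (_ : (fun z => _) = (fun z => T^-1 * cos (phase k z) * S' (cellpos z))).
    apply: H => z _; rewrite normrM (gtr0_norm (_ : 0 < T^-1)) ?invr_gt0//.
    by rewrite ler_piMr ?invr_ge0 ?(ltW T0)//; exact: cos_max.
  by apply/funext => z; ring.
have [M [M0 hM]] := cts_bounded p q cb.
apply: (in_L2_bounded mb (c := `|Om| * (`|p| + `|q|) + M / T)); [exact: area_box_lty| |].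
  apply: measurable_funM; first by apply: measurable_funM; [exact: cellpos_meas itg_cellS|exact: sin_meas].
  apply: measurable_funD; first by apply: measurable_funM => //; exact: snd_meas0.
  by apply: measurable_funM => //; exact: snd_meas.
move=> z /boxP[_ /andP[z1 z2]]; rewrite normrM -[X in _ <= X]mul1r; apply: ler_pM => //.
  by rewrite normrM mulr_ile1//; [exact: (cell_le1 cS)|exact: sin_max].
apply: le_trans (ler_normD _ _) _; apply: lerD; rewrite normrM.
  rewrite ler_wpM2l// ler_norml; have := ler_norm (- p); rewrite normrN; have := ler_norm q.
  by have := normr_ge0 p; have := normr_ge0 q => *; apply/andP; split; lra.
rewrite (gtr0_norm (_ : 0 < T^-1)) ?invr_gt0// ler_wpM2r ?invr_ge0 ?(ltW T0)//.
by apply: hM; rewrite z1.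
Qed.

Lemma wave2_L2 k a c p q : in_L2 area (box a c p q) (wave2 k).
Proof.
have mb := @measurable_box R a c p q.
have [M [M0 hM]] := cts_bounded p q cb'.
apply: (in_L2_bounded mb (c := `|Om| * (`|a| + `|c|) + M)); [exact: area_box_lty| |].
  apply: measurableT_comp => //.
  apply: measurable_funM; first by apply: measurable_funM; [exact: cellpos_meas itg_cellS|exact: sin_meas].
  apply: measurable_funD; first by apply: measurable_funM => //; exact: fst_meas.
  by apply: measurable_funM; [exact: cellpos_meas itg_cellZ|exact: snd_meas].
move=> z /boxP[/andP[z1 z2] zpq]; rewrite normrN normrM -[X in _ <= X]mul1r; apply: ler_pM => //.
  by rewrite normrM mulr_ile1//; [exact: (cell_le1 cS)|exact: sin_max].
apply: le_trans (ler_normD _ _) _; apply: lerD; rewrite normrM.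
  rewrite ler_wpM2l// ler_norml; have := ler_norm (- a); rewrite normrN; have := ler_norm c.
  by have := normr_ge0 a; have := normr_ge0 c => *; apply/andP; split; lra.
rewrite -[X in _ <= X]mul1r; apply: ler_pM => //; last exact: hM.
by apply: (cell_Zle cS); have /andP[-> /ltW ->] := fr_itv (z.1 / T + tau).
Qed.

Lemma wave_L2 k a c p q : in_L2 area (box a c p q) (wave k).
Proof.
apply: (in_L2_bounded (@measurable_box R a c p q) (c := 1)); [exact: area_box_lty|exact: wave_meas2|].
by move=> z _; exact: wave_le1.
Qed.

Context (D : set (R * R)) (oD : open D) (N : R) (N0 : 0 < N) (DN : D `<=` obox (- N) N (- N) N).

Let mD : measurable (D : set (RT * RT)) := open_meas oD.
Let NN : - N < N. Proof. by rewrite gtrN. Qed.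

Lemma wave_weak1 k : is_weak_deriv D e1 (wave k) (wave1 k).
Proof.
apply: (weak_slices1 NN mD DN); [exact: wave_L2|exact: wave1_L2|].
move=> y _; have := cell_slice (Om * y) (b y) k tau cS T0 (ltW NN).
by congr (is_primitive _ _ _ _); apply/funext => x; rewrite /wave /wave1 /phase /cellpos /= ![Om * y * x]mulrAC.
Qed.

Lemma wave_weak2 k : is_weak_deriv D e2 (wave k) (wave2 k).
Proof.
apply: (weak_slices2 NN mD DN); [exact: wave_L2|exact: wave2_L2|].
move=> x _; exact: (@cell_vertical R b b' Om x (S (fr (x / T + tau))) (Z (fr (x / T + tau))) k (- N) N (ltW NN) db cb').
Qed.

(** This is S exp (i phase): shifting the phase by - pi / 2 turns the cosine of the real part into
    the sine of the imaginary part. *)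
Definition wave_field z : R[i] := wave 0 z +i* wave (- (pi / 2)) z.

Lemma wave_H1C : H1C D wave_field.
Proof.
have Dbox : D `<=` box (- N) N (- N) N.
  by move=> z /DN/oboxP[/andP[/ltW h1 /ltW h2] /andP[/ltW h3 /ltW h4]]; apply/boxP; rewrite h1 h2 h3 h4.
have L k : in_L2 area D (wave k) := in_L2_sub (@measurable_box R _ _ _ _) mD Dbox (wave_L2 k _ _ _ _).
split; split; [exact: L|exists (wave1 0)|exists (wave2 0)|exact: L|exists (wave1 (- (pi / 2)))|exists (wave2 (- (pi / 2)))].
- exact: wave_weak1.
- exact: wave_weak2.
- exact: wave_weak1.
- exact: wave_weak2.
Qed.

Lemma wave_normc z : normc (wave_field z) ^+ 2 = S (cellpos z) ^+ 2.
Proof.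
rewrite normc_sqr /wave_field /= /wave /phase addr0 cos_shift.
by rewrite !exprMn -mulrDr cos2Dsin2 mulr1.
Qed.

(** In polar form the squared covariant gradient is |grad S|^2 plus S^2 times the squared difference
    of the phase gradient and the vector potential; this difference has components
    [2 * Om * z.2 + b / T] and [Z * b']. *)
Lemma wave_kinetic (Dfin : (area D < +oo)%E) :
  (\int[area]_(z in D) (2^-1 * cov_grad_sq D Om wave_field z)%:E =
   \int[area]_(z in D) (2^-1 * ((S' (cellpos z) / T) ^+ 2 + S (cellpos z) ^+ 2 *
     ((2 * Om * z.2 + b z.2 / T) ^+ 2 + (Z (cellpos z) * b' z.2) ^+ 2)))%:E)%E.
Proof.
have wd v f g : is_weak_deriv D v f g -> measurable_fun (D : set (RT * RT)) (weak_deriv D v f : RT * RT -> R) /\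
    ae_eq area D (weak_deriv D v f) g.
  move=> w; have w' : is_weak_deriv D v f (weak_deriv D v f).
    by apply: (@getPex _ (is_weak_deriv D v f)); exists g.
  by split; [case: w'.1|exact: weak_deriv_unique oD Dfin w' w].
have [m1 a1] := wd _ _ _ (wave_weak1 0); have [m2 a2] := wd _ _ _ (wave_weak1 (- (pi / 2))).
have [m3 a3] := wd _ _ _ (wave_weak2 0); have [m4 a4] := wd _ _ _ (wave_weak2 (- (pi / 2))).
have mw k : measurable_fun (D : set (RT * RT)) (wave k : RT * RT -> R) by exact: wave_meas2.
have mS (F : R -> R) : itg leb `[0, 1] F -> measurable_fun (D : set (RT * RT)) (fun z : RT * RT => F (cellpos z)).
  exact: cellpos_meas.
apply: ae_eq_integral => //.
- apply/measurable_EFinP; under eq_fun do rewrite cov_grad_sqE /wave_field /=.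
  have mf : measurable_fun (D : set (RT * RT)) (fun z : RT * RT => Om * z.1).
    by apply: measurable_funM => //; exact: fst_meas.
  have ms : measurable_fun (D : set (RT * RT)) (fun z : RT * RT => Om * z.2).
    by apply: measurable_funM => //; exact: snd_meas0.
  have q1 := measurable_funX 2 (measurable_funB m1 (measurable_funM ms (mw (- (pi / 2))))).
  have q2 := measurable_funX 2 (measurable_funD m2 (measurable_funM ms (mw 0))).
  have q3 := measurable_funX 2 (measurable_funD m3 (measurable_funM mf (mw (- (pi / 2))))).
  have q4 := measurable_funX 2 (measurable_funB m4 (measurable_funM mf (mw 0))).
  by apply: measurable_funM => //; exact: (measurable_funD (measurable_funD q1 q2) (measurable_funD q3 q4)).
- apply/measurable_EFinP; apply: measurable_funM => //; apply: measurable_funD.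
    by apply: measurable_funX; apply: measurable_funM => //; exact: mS itg_cellS'.
  apply: measurable_funM; first by apply: measurable_funX; exact: mS itg_cellS.
  apply: measurable_funD; apply: measurable_funX.
    apply: measurable_funD; first by apply: measurable_funM => //; exact: snd_meas0.
    by apply: measurable_funM => //; exact: snd_meas.
  by apply: measurable_funM; [exact: mS itg_cellZ|exact: snd_meas].
- have a12 : \forall z \ae area, (D z -> weak_deriv D e1 (wave 0) z = wave1 0 z) /\
      (D z -> weak_deriv D e1 (wave (- (pi / 2))) z = wave1 (- (pi / 2)) z).
    by move: a1 a2; apply: filterS2.
  have a34 : \forall z \ae area, (D z -> weak_deriv D e2 (wave 0) z = wave2 0 z) /\
      (D z -> weak_deriv D e2 (wave (- (pi / 2))) z = wave2 (- (pi / 2)) z).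
    by move: a3 a4; apply: filterS2.
  move: a12 a34; apply: filterS2; first exact: (ae_filter_ringOfSetsType area).
  move=> z [h1 h2] [h3 h4] Dz.
  rewrite cov_grad_sqE /wave_field /= h1// h2// h3// h4//; congr (_%:E).
  rewrite /wave1 /wave2 /wave /phase addr0; set P := _ + Z _ * _; rewrite !cos_shift !sin_shift.
  have := cos2Dsin2 P; set C := cos P; set Sn := sin P => CS.
  have -> : 2 * Om * z.2 + b z.2 / T = (Om * z.2 + b z.2 / T) + Om * z.2 by ring.
  set s := S _; set s' := S' _ / T; set B := Om * z.2 + _ / T; set Zb := Z _ * b' _.
  transitivity (2^-1 * ((s' ^+ 2 + s ^+ 2 * (B + Om * z.2) ^+ 2) * (C ^+ 2 + Sn ^+ 2) + (s ^+ 2 * Zb ^+ 2) * (C ^+ 2 + Sn ^+ 2))); last by rewrite CS; ring.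
  ring.
Qed.

End wave.
End wave_fields.

(** * The two stripe cells and the tilt of the profile *)

Section stripe_cells.
Context {R : realType}.
Local Notation leb := (@lebesgue_measure R).
Local Notation RT := (measurableTypeR R).
Local Notation h := (2^-1 : R).
Implicit Types (x y k b c : R) (P : R -> R).

Let mI (p q : R) : measurable (`[p, q]%classic : set RT). Proof. by []. Qed.
Let h0 : 0 <= h. Proof. by rewrite invr_ge0. Qed.
Let h1 : h <= 1. Proof. by lra. Qed.
Let h2 : 1 - h = h. Proof. by field. Qed.

(** A profile on half a cell is continued by reflection at 1/2; correspondingly its derivative is
    continued with the opposite sign, by [odd_ext]. *)
Definition ev P x := if x <= h then P x else P (1 - x).

Definition odd_ext P x := if x <= h then P x else - P (1 - x).

Lemma ev_right P x : h <= x -> ev P x = P (-1 * x + 1).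
Proof.
rewrite /ev le_eqVlt => /orP[/eqP <-|xh]; first by rewrite lexx mulN1r addrC h2.
by rewrite leNgt xh mulN1r addrC.
Qed.

Lemma evE P (F : R -> R) x : F (ev P x) = ev (fun y => F (P y)) x.
Proof. by rewrite /ev; case: ifP. Qed.

Lemma itg_ev P : itg leb `[0, h] P -> itg leb `[0, 1] (ev P) /\
  \int[leb]_(x in `[0, 1]) ev P x = 2 * \int[leb]_(x in `[0, h]) P x.
Proof.
move=> Pi; have n1 : (-1 : R) < 0 by rewrite ltrN10.
have l : itg leb `[0, h] (ev P) by apply: eq_itg Pi => // x; rewrite /= in_itv/= /ev => /andP[_ ->].
have e0 : -1 * 1 + 1 = 0 :> R by rewrite mulN1r addNr.
have e1 : -1 * h + 1 = h by rewrite mulN1r addrC h2.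
have [r0 rE] : itg leb `[h, 1] (fun x => P (-1 * x + 1)) /\
    \int[leb]_(x in `[0, h]) P x = - -1 * \int[leb]_(x in `[h, 1]) P (-1 * x + 1).
  by have := @itg_affine_neg R (-1) 1 h 1 P n1; rewrite e0 e1; apply.
have r : itg leb `[h, 1] (ev P).
  by apply: eq_itg r0 => // x; rewrite /= in_itv/= => /andP[hx _]; rewrite ev_right.
have i := itg_glue h0 h1 l r; split => //.
rewrite (Rintegral_split i (b := h)) ?h0//.
have -> : \int[leb]_(x in `[0, h]) ev P x = \int[leb]_(x in `[0, h]) P x.
  by apply: Rintegral_eq => x; rewrite /= in_itv/= /ev => /andP[_ ->].
have -> : \int[leb]_(x in `[h, 1]) ev P x = \int[leb]_(x in `[h, 1]) P (-1 * x + 1).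
  by apply: Rintegral_eq => x; rewrite /= in_itv/= => /andP[hx _]; rewrite ev_right.
by rewrite rE; ring.
Qed.

Lemma is_primitive_ev P g : is_primitive 0 h P g -> is_primitive 0 1 (ev P) (odd_ext g).
Proof.
move=> Pg; have n1 : (-1 : R) < 0 by rewrite ltrN10.
apply: (is_primitive_glue h0 h1).
  apply: (is_primitive_oo (g1 := g)) => [x /andP[_ /ltW xh]|]; first by rewrite /odd_ext xh.
  by apply: eq_is_primitive Pg => // x /andP[_ xh]; rewrite /ev xh.
have := @is_primitive_affine_neg R (-1) 1 h 1 P g n1.
rewrite mulr1 addNr mulN1r addrC h2 => /(_ Pg) H.
apply: (is_primitive_oo (g1 := fun x => -1 * g (-1 * x + 1))) => [x /andP[hx _]|].
  by rewrite /odd_ext leNgt hx /= !mulN1r addrC.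
by apply: eq_is_primitive H => // x /andP[hx _]; rewrite ev_right.
Qed.

Context (Th G : R -> R) (ThG : is_primitive 0 1 Th G) (GL : in_L2 leb `[0, 1] G).
Context (Th0 : Th 0 = 0) (Th1 : Th 1 = 0) (Thh : Th h = pi / 2).

(** The perturbation vanishes where [Th] is 0 or pi / 2, so the end values and the middle value are
    kept. Its first-order effect on the mass density, sin^2 (2 Th), is nonnegative. *)
Definition tilt s x := Th x + s * sin (2 * Th x).

Definition tilt' s x := (1 + 2 * s * cos (2 * Th x)) * G x.

Lemma tilt_primitive s : is_primitive 0 1 (tilt s) (tilt' s).
Proof.
have h := is_primitive_lin s (is_primitive_sin ler01 (is_primitive_lin 1 ThG ThG)) ThG.
move: h; congr (is_primitive _ _ _ _); apply/funext => x; rewrite /tilt /tilt' !mul1r.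
  by rewrite addrC mulr2n mulrDl mul1r.
have -> : Th x + Th x = 2 * Th x by rewrite mulr2n mulrDl mul1r.
by ring.
Qed.

Let cTh : {within `[0, 1], continuous Th} := is_primitive_cts ler01 ThG.

Let ctilt s : {within `[0, 1], continuous (tilt s)} := is_primitive_cts ler01 (tilt_primitive s).

Lemma tilt_itg s (F : R -> R) : continuous F -> itg leb `[0, 1] (fun x => F (tilt s x)).
Proof. by move=> cF; apply: within_itg => x; apply: (cvg_comp _ _ (@ctilt s x)); exact: cF. Qed.

Lemma base_itg (F : R -> R) : continuous F -> itg leb `[0, 1] (fun x => F (Th x)).
Proof. by move=> cF; apply: within_itg => x; apply: (cvg_comp _ _ (@cTh x)); exact: cF. Qed.

Lemma tilt'_L2 s : in_L2 leb `[0, 1] (tilt' s).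
Proof.
apply: (in_L2M_bounded _ GL (c := 1 + 2 * `|s|)) => //.
  have c2 : continuous (fun t : R => 1 + 2 * s * cos (2 * t)).
    move=> t; apply: cvgD; first exact: cvg_cst; apply: cvgM; first exact: cvg_cst.
    apply: (@continuous_comp _ _ _ (fun t : R => 2 * t) cos); last exact: continuous_cos.
    by apply: cvgM; [exact: cvg_cst|exact: cvg_id].
  exact: itg_meas (base_itg c2).
move=> x _; apply: le_trans (ler_normD _ _) _; rewrite normr1 lerD2l normrM normrM ger0_norm//.
by rewrite ler_piMr ?mulr_ge0//; exact: cos_max.
Qed.

Lemma tilt0 s : tilt s 0 = 0. Proof. by rewrite /tilt Th0 mulr0 sin0 mulr0 addr0. Qed.
Lemma tilt1 s : tilt s 1 = 0. Proof. by rewrite /tilt Th1 mulr0 sin0 mulr0 addr0. Qed.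
Lemma tilth s : tilt s h = pi / 2.
Proof. by rewrite /tilt Thh (_ : 2 * (pi / 2) = pi) ?sinpi ?mulr0 ?addr0//; field. Qed.

Lemma cos_affine_derive (b k c x : R) :
  is_derive x 1 (fun x => cos ((x - c) * b + k)) (- (sin ((x - c) * b + k) * b)).
Proof. by apply: is_derive_eq; rewrite -![_ *: _]/(_ * _); ring. Qed.

Lemma sin_affine_cts (b k c : R) : continuous (fun x => - (sin ((x - c) * b + k) * b)).
Proof.
move=> x; apply: cvgN; apply: cvgM; last exact: cvg_cst.
apply: (@continuous_comp _ _ _ (fun x => (x - c) * b + k) sin); last exact: continuous_sin.
apply: cvgD; last exact: cvg_cst.
by apply: cvgM; [apply: cvgB; [exact: cvg_id|exact: cvg_cst]|exact: cvg_cst].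
Qed.

Lemma cell_prim_affine (a e c : R) (S S' : R -> R) b k : a <= e -> is_primitive a e S S' ->
  is_primitive a e (fun x => S x * cos ((x - c) * b + k))
    (fun x => S' x * cos ((x - c) * b + k) - S x * sin ((x - c) * b + k) * b).
Proof.
move=> ae SS'; have := is_primitive_mul ae SS' (cos_affine_derive b k c) (@sin_affine_cts b k c).
by congr (is_primitive _ _ _ _); apply/funext => x; rewrite mulrN mulrA.
Qed.

Lemma L2_trig_tilt (F : R -> R) s : continuous F -> (forall x, `|F x| <= 1) ->
  in_L2 leb `[0, 1] (fun x => F (tilt s x) * tilt' s x).
Proof.
move=> cF F1; apply: (in_L2M_bounded _ (tilt'_L2 s) (c := 1)) => //.
exact: itg_meas (tilt_itg s cF).
Qed.

(** The sine amplitude vanishes at the ends of the cell, so its phase is measured from the middle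
    and may jump at the integers. *)
Definition Z1 x := x - h.

(** The cosine amplitude vanishes at 1/2, so its phase is measured from the nearest end and jumps at
    1/2. *)
Definition Z2 x := if x <= h then x else x - 1.

Lemma Z2_itg : itg leb `[0, 1] Z2.
Proof.
have cid (c : R) : continuous (fun x : R => x - c).
  by move=> x; apply: cvgB; [exact: cvg_id|exact: cvg_cst].
apply: (itg_glue h0 h1).
  have := continuous_itg 0 h (cid 0); apply: eq_itg => // x; rewrite /= in_itv/= /Z2 => /andP[_ ->].
  by rewrite subr0.
apply: itg_oo_cc; have h' : itg leb `]h, 1[ (fun x => x - 1).
  by apply: integrableS (continuous_itg h 1 (cid 1)) => //; apply: subset_itv; rewrite bnd_simp.
by apply: eq_itg h' => // x; rewrite /= in_itv/= /Z2 => /andP[hx _]; rewrite leNgt hx.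
Qed.

Lemma cell_sin s : cell (fun x => sin (tilt s x)) (fun x => cos (tilt s x) * tilt' s x) Z1.
Proof.
split.
- by move=> x; exact: sin_max.
- by move=> x /andP[x0 x1]; rewrite ler_norml /Z1; have := h0; have := h2 => *; apply/andP; split; lra.
- by apply: measurable_funB.
- by apply: L2_trig_tilt; [exact: continuous_cos|exact: cos_max].
- by move=> b k; rewrite tilt0 tilt1 sin0 !mul0r.
- move=> b k; apply: cell_prim_affine => //; apply: is_primitive_sin => //; exact: tilt_primitive.
Qed.

Lemma cell_cos s : cell (fun x => cos (tilt s x)) (fun x => - sin (tilt s x) * tilt' s x) Z2.
Proof.
have pc := is_primitive_cos ler01 (tilt_primitive s).
split.
- by move=> x; exact: cos_max.
- move=> x /andP[x0 x1]; rewrite ler_norml /Z2; have := h0; have := h1 => *.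
  by case: (leP x h) => hx; apply/andP; split; lra.
- exact: itg_meas Z2_itg.
- apply: (@L2_trig_tilt (fun x => - sin x)) => [x|x]; last by rewrite normrN sin_max.
  by apply: cvgN; exact: continuous_sin.
- by move=> b k; rewrite tilt0 tilt1 /Z2 h0 leNgt invf_lt1// ltr1n subrr.
- move=> b k; apply: (is_primitive_glue h0 h1).
    have pl := cell_prim_affine 0 b k h0 (is_primitive_sub pc (lexx 0) h0 h1).
    apply: is_primitive_oo (eq_is_primitive _ h0 pl) => [x /andP[_ /ltW xh]|x /andP[_ xh]];
      by rewrite /Z2 xh subr0.
  have pr := cell_prim_affine 1 b k h1 (is_primitive_sub pc h0 h1 (lexx 1)).
  apply: is_primitive_oo (eq_is_primitive _ h1 pr) => [x /andP[hx _]|x /andP[]].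
    by rewrite /Z2 leNgt hx.
  (* At 1/2 the two branches of [Z2] disagree, but there the amplitude is cos (pi / 2) = 0. *)
  rewrite le_eqVlt => /orP[/eqP <- _|hx _]; first by rewrite tilth cos_pihalf !mul0r.
  by rewrite /Z2 leNgt hx.
Qed.

End stripe_cells.

(** * Boundary fluctuations of periodic functions *)

Section fluctuation.
Context {R : realType}.
Local Notation leb := (@lebesgue_measure R).
Local Notation RT := (measurableTypeR R).
Local Notation area := (@area R).
Implicit Types (a b c e x y T tau t r : R) (p F : R -> R) (D B : set (R * R)).

Lemma Rintegral_box_shift (F : R * R -> R) a b c e t : itg area (box (a + t) (b + t) c e) F ->
  itg area (box a b c e) (fun z => F (z.1 + t, z.2)) ->
  (forall y, itg leb `[a + t, b + t] (fun x => F (x, y))) ->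
  \int[area]_(z in box (a + t) (b + t) c e) F z = \int[area]_(z in box a b c e) F (z.1 + t, z.2).
Proof.
move=> i1 i2 i3; rewrite (Rintegral_box i1) (Rintegral_box i2); apply: Rintegral_eq => y _.
by have [_ ->] := itg_shift (i3 y).
Qed.

Lemma patch_wave_itg D a b c e T tau p : 0 < T -> periodic p -> itg leb `[0, 1] p -> measurable (D : set (RT * RT)) ->
  itg area (box a b c e) ((fun z => p (z.1 / T + tau)) \_ D) /\
  forall y, itg leb `[a, b] (fun x => ((fun z => p (z.1 / T + tau)) \_ D) (x, y)).
Proof.
move=> T0 pp pi mD; have mp := periodic_meas pp pi.
have mF : measurable_fun setT ((fun z => p (z.1 / T + tau)) \_ D : RT * RT -> R).
  by apply/(measurable_restrictT _ mD); exact: wave_meas.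
have le1 z : `|((fun z : R * R => p (z.1 / T + tau)) \_ D) z| <= `|p (z.1 / T + tau)|.
  by rewrite patchE; case: ifP => // _; rewrite normr0.
have ap := itg_abs pi; have app : periodic (fun x => `|p x|) by move=> x; rewrite pp.
split.
  apply: (@itg_le _ _ _ _ _ (@measurable_box R a b c e) _ (fun z => `|p (z.1 / T + tau)|)) => //.
    exact: measurable_funS mF.
  exact: (@wave_itg R a b c e T tau (fun x => `|p x|)).
move=> y; have Ti : 0 < T^-1 by rewrite invr_gt0.
apply: (@itg_le _ _ _ leb _ (measurable_itv _) _ (fun x => `|p (T^-1 * x + tau)|)).
- apply: (measurable_funS measurableT) => //; apply: (measurableT_comp mF).
  exact: measurable_fun_pair.
- by have [] := @itg_affine_pos R T^-1 tau a b (fun x => `|p x|) Ti (periodic_itg _ _ app ap).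
- by move=> x _; rewrite [T^-1 * x]mulrC; exact: (le1 (x, y)).
Qed.

Lemma Rintegral_patch D (E : set (R * R)) (F : R * R -> R) : D `<=` E ->
  \int[area]_(z in E) (F \_ D) z = \int[area]_(z in D) F z.
Proof.
move=> DE; rewrite -Rintegral_mkcondr (_ : E `&` D = D)//.
by apply/seteqP; split => [z []//|z Dz]; split => //; exact: DE.
Qed.

(* Averaging over the translations by [t] in [[0, T]] turns a periodic function
   into its mean; [D] and its translates differ only inside [B]. *)
Lemma fluctuation D B (N T tau : R) p : measurable (D : set (RT * RT)) -> measurable (B : set (RT * RT)) ->
  D `<=` box (- N) N (- N) N -> 0 < T <= N -> periodic p -> itg leb `[0, 1] p ->
  (forall z t, 0 <= t <= T -> ~ B z -> (D z <-> D (z.1 + t, z.2))) ->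
  `|\int[area]_(z in D) p (z.1 / T + tau) - fine (area D) * \int[leb]_(x in `[0, 1]) p x| <=
  \int[area]_(z in B `&` box (- (2 * N)) (2 * N) (- N) N) `|p (z.1 / T + tau)|.
Proof.
move=> mD mB DN /andP[T0 TN] pp pi strip.
have ap := itg_abs pi; have app : periodic (fun x => `|p x|) by move=> x; rewrite pp.
set Q := box _ _ _ _; set Y := \int[area]_(z in _ `&` _) _; have mQ : measurable (Q : set (RT * RT)) := @measurable_box R _ _ _ _.
have NN : - N <= N by lra.
have DQ t : 0 <= t <= T -> D `<=` box (- (2 * N) + t) (2 * N + t) (- N) N.
  move=> /andP[t0 tT] z /DN/boxP[/andP[z1 z2] /andP[z3 z4]]; apply/boxP.
  by split; apply/andP; split => //; lra.
pose q r := \int[area]_(z in D) p (z.1 / T + (tau + r)).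
have pp' c : periodic (fun x => p (x + c)) by move=> x; rewrite addrAC pp.
have step r : 0 <= r <= 1 -> `|q r - q 0| <= Y.
  (* The horizontal translation by [(1 - r) * T] turns the offset [tau + r] into [tau + 1], which is
     [tau] by periodicity. *)
  move=> /andP[r0 r1]; pose t := (1 - r) * T.
  have tT : 0 <= t <= T by rewrite mulr_ge0 ?subr_ge0 ?(ltW T0)//= ler_piMl ?(ltW T0)// gerBl.
  pose F := (fun z : R * R => p (z.1 / T + (tau + r))) \_ D.
  pose Ft := (fun z : R * R => p (z.1 / T + tau)) \_ [set z | D (z.1 + t, z.2)].
  have mDt : measurable ([set z | D (z.1 + t, z.2)] : set (RT * RT)).
    have mt : measurable_fun setT (fun z : RT * RT => (z.1 + t, z.2) : RT * RT).
      apply: measurable_fun_pair; last exact: measurable_snd.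
      by apply: measurable_funD => //; exact: measurable_fst.
    by have := mt measurableT _ mD; rewrite setTI.
  have FE z : F (z.1 + t, z.2) = Ft z.
    have yE : (z.1 + t) / T + (tau + r) = z.1 / T + tau + 1.
      by rewrite /t; field; rewrite gt_eqF.
    by rewrite /F /Ft !patchE /= yE pp; congr (if _ then _ else _); apply/idP/idP => /set_mem h; exact/mem_set.
  have [iF sF] := @patch_wave_itg D (- (2 * N) + t) (2 * N + t) (- N) N T (tau + r) p T0 pp pi mD.
  have [iFt _] := @patch_wave_itg _ (- (2 * N)) (2 * N) (- N) N T tau p T0 pp pi mDt.
  have [i0 _] := @patch_wave_itg D (- (2 * N)) (2 * N) (- N) N T tau p T0 pp pi mD.
  have -> : q r = \int[area]_(z in Q) Ft z.
    rewrite /q -(Rintegral_patch (fun z => p (z.1 / T + (tau + r))) (DQ _ tT)).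
    rewrite Rintegral_box_shift//; first by apply: Rintegral_eq => z _; exact: FE.
    by apply: eq_itg iFt => // z _; rewrite -FE.
  have -> : q 0 = \int[area]_(z in Q) ((fun z : R * R => p (z.1 / T + tau)) \_ D) z.
    rewrite Rintegral_patch; first by rewrite /q addr0.
    by have := DQ 0; rewrite !addr0; apply; rewrite lexx ltW.
  have id := itgB mQ iFt i0; rewrite -(RintegralB mQ iFt i0).
  have := le_normr_Rintegral mQ id; move/le_trans; apply.
  rewrite /Y setIC Rintegral_mkcondr; apply: le_Rintegral => //; first exact: itg_abs id.
    by have [] := @patch_wave_itg B (- (2 * N)) (2 * N) (- N) N T tau (fun x => `|p x|) T0 app ap mB.
  move=> z _; rewrite /Ft !patchE /=.
  have [zB|zB] := boolP (z \in B).
    case: ifP => _; case: ifP => _; by rewrite ?subrr ?subr0 ?sub0r ?normrN ?normr0.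
  have /(strip _ _ tT) E : ~ B z by move=> /mem_set h; rewrite h in zB.
  rewrite (_ : (z \in [set z | D (z.1 + t, z.2)]) = (z \in D)); first by rewrite subrr normr0.
  by apply/idP/idP => /set_mem h; apply/mem_set; apply/E.
have [qi qE] : itg leb `[0, 1] q /\ \int[leb]_(r in `[0, 1]) q r = fine (area D) * \int[leb]_(x in `[0, 1]) p x.
  have psh : itg leb `[0 + tau, 1 + tau] p := periodic_itg _ _ pp pi.
  have [i1 E1] := itg_shift psh.
  have [] := @wave_mean R D (- N) N (- N) N T (fun x => p (x + tau)) (cst 1) 1 T0 NN NN (pp' _) i1 mD DN (measurable_cst _).
    by move=> z _; rewrite normr1.
  have -> : (fun tau0 => \int[area]_(z in D) (cst 1 z * p (z.1 / T + tau0 + tau))) = q.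
    apply/funext => r; apply: Rintegral_eq => z _; rewrite mul1r; congr p; ring.
  move=> i2 ->; split => //; rewrite -E1 [1 + tau]addrC add0r periodic_int// mulrC.
  by rewrite Rintegral_cst// mul1r.
have c1 (k : R) : \int[leb]_(r in `[0, 1]) k = k by rewrite Rintegral_itv_cst// subr0 mulr1.
have ic (k : R) : itg leb `[0, 1] (fun=> k) := continuous_itg 0 1 (@cst_continuous R R k).
rewrite (_ : \int[area]_(z in D) p (z.1 / T + tau) = q 0); last by rewrite /q addr0.
rewrite -qE ler_norml; apply/andP; split.
  rewrite lerBrDr addrC lerBlDr -[X in _ <= X]c1 ; apply: le_Rintegral => // r.
  rewrite /= in_itv/= => /step; rewrite ler_norml => /andP[_]; lra.
rewrite lerBlDr -[X in X <= _]c1 -[X in _ <= X + _]c1 -RintegralD//; apply: le_Rintegral => //; first exact: itgD.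
move=> r; rewrite /= in_itv/= => /step; rewrite ler_norml => /andP[]; lra.
Qed.

End fluctuation.

(** * Restoring the mass constraint *)

Section correction.
Context {R : realType}.
Local Notation leb := (@lebesgue_measure R).
Local Notation RT := (measurableTypeR R).
Local Notation area := (@area R).
Implicit Types (E : set (R * R)) (w : R * R -> R).

(** Collects finitely many smallness conditions on [T], each linear in [T], into one threshold. *)
Lemma small_scale (l : seq (R * R)) : all (fun q => (0 <= q.1) && (0 < q.2)) l ->
  exists2 T1, 0 < T1 & forall T, 0 < T -> T <= T1 -> all (fun q => q.1 * T <= q.2) l.
Proof.
elim: l => [_|[a b] l IH /= /andP[/andP[a0 b0] /IH[T1 T10 H]]]; first by exists 1.
have a1 : 0 < a + 1 by rewrite ltr_wpDl.
exists (Num.min T1 (b / (a + 1))); first by rewrite lt_min T10 divr_gt0.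
move=> T T0; rewrite le_min => /andP[h1 h2]; rewrite H// andbT.
apply: le_trans (_ : (a + 1) * T <= b); first by rewrite ler_wpM2r ?(ltW T0)// lerDl.
by rewrite mulrC -ler_pdivlMr.
Qed.

Lemma dist_le (x y e : R) : x <= y + e -> y <= x + e -> `|x - y| <= e.
Proof. by move=> *; rewrite ler_norml; apply/andP; split; lra. Qed.

Lemma half_mean (p q m b : R) : - b <= p - q * m -> b <= m * q / 2 -> m * q / 2 <= p.
Proof. by move=> *; lra. Qed.

Lemma shift_above (p0 p1 q b t s e : R) : - b <= p0 - q -> b + t <= s -> - e <= p1 - p0 - s -> e <= t -> q <= p1.
Proof. by move=> *; lra. Qed.

Lemma shift_below (p0 p1 q b t s e : R) : p0 - q <= b -> b + t <= s -> p1 - p0 - - s <= e -> e <= t -> p1 <= q.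
Proof. by move=> *; lra. Qed.

Lemma collect (f g b0 b1 b1' b2 b2' la g' X : R) : f <= b0 + b1 + b2 + la -> b1 <= b1' -> b2 <= b2' ->
  g <= g' -> b0 + b1' + b2' + g' < X - la -> f + g <= X.
Proof. by move=> *; lra. Qed.

Lemma half_gain (g q : R) : q <= g / 2 -> - g + q <= - (g / 2).
Proof. by move=> *; lra. Qed.

Lemma gain_wins (x y p q t u : R) : x <= p * t -> y <= - u -> (p + q + 1) * t <= u -> 0 < t -> x + q * t + y < 0.
Proof. by move=> *; lra. Qed.

Lemma exists_lt_mean (A : R -> R) X : itg leb `[0, 1] A -> \int[leb]_(x in `[0, 1]) A x < X ->
  exists tau, A tau < X.
Proof.
move=> Ai AX; apply: contrapT => nex; suff : X <= \int[leb]_(x in `[0, 1]) A x by rewrite leNgt AX.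
have <- : \int[leb]_(x in `[0, 1]) X = X by rewrite Rintegral_itv_cst// subr0 mulr1.
apply: le_Rintegral => //; first exact: (continuous_itg 0 1 (@cst_continuous R R X)).
by move=> x _; rewrite leNgt; apply/negP => h; apply: nex; exists x.
Qed.

Definition wave_int E w T (F : R -> R) tau := \int[area]_(z in E) (w z * F (cellpos T tau z)).

Section bounded_region.
Context (E : set (RT * RT)) (a b c e : R) (mE : measurable E) (Eb : E `<=` box a b c e) (ab : a <= b) (ce : c <= e).
Context (w : RT * RT -> R) (M : R) (mw : measurable_fun E w) (wM : forall z, E z -> `|w z| <= M).
Context (T : R) (T0 : 0 < T).

Lemma wave_int_itg (F : R -> R) tau : itg leb `[0, 1] F -> itg area E (fun z => w z * F (cellpos T tau z)).
Proof.
move=> Fi; apply: (itgM_bounded mE (c := M)) => //.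
have h : itg area (box a b c e) (fun z => F (cellpos T tau z)) := cellpos_itg tau T0 a b c e Fi.
exact: integrableS (@measurable_box R a b c e) mE Eb h.
Qed.

Lemma wave_int_mean (F : R -> R) : itg leb `[0, 1] F -> itg leb `[0, 1] (wave_int E w T F) /\
  \int[leb]_(tau in `[0, 1]) wave_int E w T F tau = (\int[leb]_(x in `[0, 1]) F x) * \int[area]_(z in E) w z.
Proof.
move=> Fi; have [Fi' <-] := itg_fr Fi.
exact: (wave_mean T0 ab ce (@periodic_fr R F) Fi' mE Eb mw wM).
Qed.

Lemma le_wave_int (F G : R -> R) tau : itg leb `[0, 1] F -> itg leb `[0, 1] G -> (forall z, E z -> 0 <= w z) ->
  (forall x, F x <= G x) -> wave_int E w T F tau <= wave_int E w T G tau.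
Proof.
move=> Fi Gi w0 FG; apply: le_Rintegral => //; [exact: wave_int_itg|exact: wave_int_itg|].
by move=> z Ez; rewrite ler_wpM2l ?w0.
Qed.

Lemma wave_intD (F G : R -> R) tau : itg leb `[0, 1] F -> itg leb `[0, 1] G ->
  wave_int E w T (fun x => F x + G x) tau = wave_int E w T F tau + wave_int E w T G tau.
Proof.
move=> Fi Gi; rewrite /wave_int -RintegralD//; [|exact: wave_int_itg|exact: wave_int_itg].
by apply: Rintegral_eq => z _; rewrite mulrDr.
Qed.

Lemma wave_intZ (F : R -> R) k tau : itg leb `[0, 1] F ->
  wave_int E w T (fun x => k * F x) tau = k * wave_int E w T F tau.
Proof.
move=> Fi; rewrite /wave_int -RintegralZl//; last exact: wave_int_itg.
by apply: Rintegral_eq => z _; rewrite mulrCA.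
Qed.

Lemma wave_int_cst k tau : wave_int E w T (fun=> k) tau = k * \int[area]_(z in E) w z.
Proof.
rewrite -RintegralZl//; first by apply: Rintegral_eq => z _; rewrite mulrC.
have i1 : itg leb `[0, 1] (fun=> 1 : R) := continuous_itg 0 1 (@cst_continuous R R 1).
by have := wave_int_itg tau i1; apply: eq_itg => // z _; rewrite mulr1.
Qed.

End bounded_region.

(** Positivity comes from the lower bound at the highest point with K = 1, the exponential being at
    most 1 on [D]. *)
Lemma domain_area (D : set (R * R)) : smooth_bounded_domain D -> 0 < fine (area D) /\ (area D < +oo)%E.
Proof.
move=> sD; have [_ oD _ bD _] := sD; have [N N0 hN] := domain_box bD; have mD := open_meas oD.
have Dfin : (area D < +oo)%E.
  apply: le_lt_trans (area_box_lty (- N) N (- N) N); apply: le_measure; rewrite ?inE//; first exact: measurable_box.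
  by move=> z /hN[h1 h2]; apply/boxP; rewrite -!ler_norml.
split=> //; have [H [DH top]] := top_point sD; have [T T0 /(_ T T0 (lexx _))] := top 1.
have T2 : 0 < T ^+ 2 by rewrite exprn_gt0.
rewrite mul1r => h; apply: (lt_le_trans T2); apply: (le_trans h).
have mz : measurable_fun (D : set (RT * RT)) (fun z : RT * RT => expR ((z.2 - H) / T) : R).
  apply: continuous_meas2 => z.
  apply: (@continuous_comp _ _ _ (fun z : R * R => (z.2 - H) / T) expR); last exact: continuous_expR.
  apply: cvgM; last exact: cvg_cst; apply: cvgB; [exact: snd_cts|exact: cvg_cst].
have z1 z : D z -> `|expR ((z.2 - H) / T)| <= 1.
  by move=> /DH h2; rewrite ger0_norm ?expR_ge0// -expR0 ler_expR pmulr_lle0 ?invr_gt0// subr_le0.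
rewrite -[leRHS]mul1r -Rintegral_cst//; apply: le_Rintegral => //.
- exact: (itg_bounded mD Dfin mz z1).
- exact: itg_cst.
- by move=> z /z1; apply: le_trans; exact: ler_norm.
Qed.

Section mass_correction.
Context (S F : R -> R -> R) (m1 hh W Gn : R -> R) (alpha l c : R) (c0 : 0 <= c).
Context (Si : forall s, itg leb `[0, 1] (S s)) (S01 : forall s x, 0 <= S s x <= 1).
Context (Slip : forall s s' x, `|S s x - S s' x| <= c * `|s - s'|).
Context (Stay : forall s x, `|S s x - S 0 x - s * m1 x| <= c * s ^+ 2).
Context (m1i : itg leb `[0, 1] m1) (m101 : forall x, 0 <= m1 x <= 1).
Context (m1pos : 0 < \int[leb]_(x in `[0, 1]) m1 x) (Smean : \int[leb]_(x in `[0, 1]) S 0 x = alpha).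
Context (Fi : forall s, itg leb `[0, 1] (F s)).
Context (Ftay : forall s x, `|s| <= 1 -> F s x - l * S s x <= F 0 x - l * S 0 x + s * hh x + s ^+ 2 * W x).
Context (hhi : itg leb `[0, 1] hh) (hh0 : \int[leb]_(x in `[0, 1]) hh x = 0).
Context (Wi : itg leb `[0, 1] W) (W0 : forall x, 0 <= W x) (Gi : itg leb `[0, 1] Gn) (Gneg : \int[leb]_(x in `[0, 1]) Gn x < 0).
Context (D : set (R * R)) (sD : smooth_bounded_domain D).

Let one : R * R -> R := fun=> 1.

Lemma Rintegral_one : \int[area]_(z in D) one z = fine (area D).
Proof. by rewrite /one Rintegral_cst ?mul1r//; apply: open_meas; case: sD. Qed.

(** For every translation, intermediate values give a tilt of size O(T) that restores the mass: the
    defect is O(T) and the mass increases at a rate bounded below. The energy density may then be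
    replaced by [F - l * S], whose first-order part [hh] has mean zero. The average over
    translations of all losses is O(T^2), less than the gain of the layer, so some translation does
    at least as well. *)
Lemma mass_correction : exists H, (forall z, D z -> z.2 <= H) /\
  exists2 T1, 0 < T1 & forall T, 0 < T -> T <= T1 -> exists tau s, [/\ `|s| <= 1,
    wave_int D one T (S s) tau = alpha * fine (area D) &
    wave_int D one T (F s) tau + wave_int D (fun z => expR ((z.2 - H) / T)) T (fun x => Gn x + c * `|s|) tau
      <= fine (area D) * \int[leb]_(x in `[0, 1]) F 0 x].
Proof.
have [_ oD _ bD _] := sD; have [N N0 hN] := domain_box bD.
have mD : measurable (D : set (RT * RT)) := open_meas oD.
have mI : measurable (`[0, 1]%classic : set RT) by [].
have NN : - N <= N by lra.
have Db : D `<=` box (- N) N (- N) N.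
  by move=> z /hN[h1 h2]; apply/boxP; rewrite -!ler_norml.
have [H [DH top]] := top_point sD; exists H; split => //.
have [C [Ts [C0 Ts0 strip]]] := boundary_strip sD.
have [d0 Dfin] := domain_area sD; set d := fine (area D) in d0 *.
pose zeta T (z : R * R) : R := expR ((z.2 - H) / T).
have mone (E : set (RT * RT)) : measurable_fun E (one : RT * RT -> R) by exact: measurable_cst.
have one1 (E : set (RT * RT)) z : E z -> `|one z| <= 1 by rewrite /one normr1.
have mz T : measurable_fun (D : set (RT * RT)) (zeta T : RT * RT -> R).
  apply: continuous_meas2 => z.
  apply: (@continuous_comp _ _ _ (fun z : R * R => (z.2 - H) / T) expR); last exact: continuous_expR.
  apply: cvgM; last exact: cvg_cst; apply: cvgB; [exact: snd_cts|exact: cvg_cst].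
have z01 T z : 0 < T -> D z -> 0 <= zeta T z <= 1.
  move=> T0 /DH h; rewrite /zeta expR_ge0/= -expR0 ler_expR pmulr_lle0 ?invr_gt0// subr_le0//.
have z1 T z : 0 < T -> D z -> `|zeta T z| <= 1.
  by move=> T0 Dz; have /andP[h1 h2] := z01 T z T0 Dz; rewrite ger0_norm.
pose m := \int[leb]_(x in `[0, 1]) m1 x; have m0 : 0 < m by exact: m1pos.
pose g := - \int[leb]_(x in `[0, 1]) Gn x; have g0 : 0 < g by rewrite oppr_gt0.
pose Hh := \int[leb]_(x in `[0, 1]) `|hh x|; pose Wd := \int[leb]_(x in `[0, 1]) W x.
have Hh0 : 0 <= Hh by apply: Rintegral_ge0.
have Wd0 : 0 <= Wd by apply: Rintegral_ge0 => x _; exact: W0.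
(* With the rate at least [m * d / 2], a tilt [k * T] changes the mass by [(C + 1) * T]: the defect
   [C * T] and a margin for the quadratic error. *)
have [k k0 kE] : exists2 k, 0 < k & k = 2 * (C + 1) / (m * d).
  have C1 : 0 < C + 1 by rewrite ltr_wpDl.
  by exists (2 * (C + 1) / (m * d)) => //; rewrite divr_gt0 ?mulr_gt0.
(* Half of the gain, [g / 2] times the integral of the exponential, exceeds all losses of order
   [T ^+ 2] once that integral is at least [K1 * T ^+ 2]. *)
pose K1 := 2 * (k * C * Hh + k ^+ 2 * d * Wd + 1) / g.
have [T2 T20 hT2] := top K1.
have [] := @small_scale [:: (1, Ts); (1, N); (1, T2); (C, m * d / 2); (k, 1); (c * k ^+ 2 * d, 1); (c * k, g / 2)].
  rewrite /= !ler01 Ts0 N0 T20 C0 ltr01 (ltW k0) !mulr_ge0 ?exprn_ge0 ?(ltW k0) ?(ltW d0)//.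
  by rewrite !divr_gt0 ?mulr_gt0.
move=> T1 T10 small; exists T1 => // T T0 TT1.
have := small T T0 TT1; rewrite /= !mul1r andbT => /and5P[TTs TN TT2 CT /and3P[kT cT gT]].
have [B [mB aB hB]] := strip T T0 TTs.
pose E := B `&` box (- (2 * N)) (2 * N) (- N) N.
have mE : measurable (E : set (RT * RT)) by apply: measurableI => //; exact: measurable_box.
have Eb : E `<=` box (- (2 * N)) (2 * N) (- N) N by move=> z [].
have NN2 : - (2 * N) <= 2 * N by lra.
have aE : \int[area]_(z in E) one z <= C * T.
  rewrite /one Rintegral_cst// mul1r -lee_fin.
  have EB : (area E <= area B)%E by apply: le_measure => //; rewrite ?inE//; exact: subIsetl.
  rewrite fineK; first exact: le_trans EB aB.
  by rewrite ge0_fin_numE//; apply: le_lt_trans (le_trans EB aB) (ltry _).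
have fluct (P : R -> R) tau : itg leb `[0, 1] P ->
    `|wave_int D one T P tau - d * \int[leb]_(x in `[0, 1]) P x| <= wave_int E one T (fun x => `|P x|) tau.
  move=> Pi; have [Pi' <-] := itg_fr Pi.
  have := @fluctuation R D B N T tau (fun y => P (fr y)) mD mB Db _ (@periodic_fr R P) Pi' hB.
  rewrite T0 TN => /(_ isT); congr (`|_ - _| <= _); apply: Rintegral_eq => z _; by rewrite /one mul1r.
(* Densities with values in [0, 1] fluctuate by O(T) for every translation. For an unbounded density
   such as [hh] the right-hand side of [fluct] is O(T) only on average. *)
have fluct1 (P : R -> R) tau : itg leb `[0, 1] P -> (forall x, 0 <= P x <= 1) ->
    `|wave_int D one T P tau - d * \int[leb]_(x in `[0, 1]) P x| <= C * T.
  move=> Pi P01; apply: le_trans (fluct P tau Pi) _; apply: le_trans aE.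
  have i1 : itg leb `[0, 1] (fun=> 1 : R) := continuous_itg 0 1 (@cst_continuous R R 1).
  have := @le_wave_int _ _ _ _ _ mE Eb one 1 (mone E) (@one1 E) T T0 (fun x => `|P x|) (fun=> 1) tau (itg_abs Pi) i1.
  rewrite (wave_int_cst mE Eb (mone E) (@one1 E) T0) mul1r; apply => // x.
  by have /andP[h1 h2] := P01 x; rewrite ger0_norm.
have Wint F' tau : itg leb `[0, 1] F' -> itg area D (fun z => one z * F' (cellpos T tau z)).
  exact: (wave_int_itg mD Db (mone D) (@one1 D) T0).
have addD F1 F2 tau : itg leb `[0, 1] F1 -> itg leb `[0, 1] F2 ->
    wave_int D one T (fun x => F1 x + F2 x) tau = wave_int D one T F1 tau + wave_int D one T F2 tau.
  exact: (wave_intD mD Db (mone D) (@one1 D) T0).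
have sclD F1 r tau : itg leb `[0, 1] F1 -> wave_int D one T (fun x => r * F1 x) tau = r * wave_int D one T F1 tau.
  exact: (wave_intZ mD Db (mone D) (@one1 D) T0).
have cstD r tau : wave_int D one T (fun=> r) tau = r * d.
  by rewrite (wave_int_cst mD Db (mone D) (@one1 D) T0) Rintegral_one.
have leD F1 F2 tau : itg leb `[0, 1] F1 -> itg leb `[0, 1] F2 -> (forall x, F1 x <= F2 x) ->
    wave_int D one T F1 tau <= wave_int D one T F2 tau.
  move=> i1 i2; exact: (le_wave_int mD Db (mone D) (@one1 D) T0 tau i1 i2).
have icst r : itg leb `[0, 1] (fun=> r : R) := continuous_itg 0 1 (@cst_continuous R R r).
have mass tau : exists s, `|s| <= k * T /\ wave_int D one T (S s) tau = alpha * d.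
  pose M s := wave_int D one T (S s) tau.
  have Mlip s s' : M s <= M s' + c * `|s - s'| * d.
    rewrite -(cstD (c * `|s - s'|) tau) -addD//; apply: leD => //; first exact: itgD.
    by move=> x; rewrite -lerBlDl; apply: le_trans (Slip s s' x); exact: ler_norm.
  have Mc : {within `[- (k * T), k * T], continuous M}.
    apply: continuous_subspaceT => s; apply/cvgrPdist_le => e e0.
    have cd : 0 < c * d + 1 by rewrite ltr_wpDl ?mulr_ge0 ?(ltW d0).
    near=> s'; have ss' : `|s - s'| <= e / (c * d + 1).
      by near: s'; apply: cvgr_dist_le; [exact: cvg_id|exact: divr_gt0].
    have b1 : c * `|s - s'| * d <= e.
      apply: le_trans (_ : `|s - s'| * (c * d + 1) <= _); last by rewrite -ler_pdivlMr.
      by rewrite mulrDr mulr1 [c * _]mulrC -mulrA lerDl.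
    have h1 := Mlip s s'; have h2 := Mlip s' s; rewrite distrC in h2.
    by apply: dist_le; [apply: le_trans h1 _|apply: le_trans h2 _]; rewrite lerD2l.
  have M0 : `|M 0 - d * alpha| <= C * T by rewrite -Smean; exact: fluct1.
  pose mm := wave_int D one T m1 tau.
  have mm1 : m * d / 2 <= mm.
    by have := fluct1 m1 tau m1i m101; rewrite -/m -/mm ler_norml => /andP[h _]; exact: half_mean h CT.
  have Mt s : `|M s - M 0 - s * mm| <= c * s ^+ 2 * d.
    have i3 := itgZ mI s m1i.
    have i4 : itg leb `[0, 1] (fun x => S 0 x + s * m1 x) by apply: itgD.
    have E4 : wave_int D one T (fun x => S 0 x + s * m1 x) tau = M 0 + s * mm by rewrite addD// sclD.
    have u1 : M s <= (M 0 + s * mm) + c * s ^+ 2 * d.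
      rewrite -E4 -(cstD (c * s ^+ 2) tau) -addD//; apply: leD => //; first exact: itgD.
      by move=> x; rewrite -lerBlDl opprD addrA; apply: le_trans (Stay s x); exact: ler_norm.
    have u2 : (M 0 + s * mm) <= M s + c * s ^+ 2 * d.
      rewrite -E4 -(cstD (c * s ^+ 2) tau) -addD//; apply: leD => //; first exact: itgD.
      move=> x; rewrite -lerBlDl; apply: le_trans (Stay s x); apply: le_trans (ler_norm _) _.
      by rewrite distrC opprD addrA.
    by rewrite -addrA -opprD; exact: dist_le.
  have kT0 : 0 < k * T by rewrite mulr_gt0.
  have kmm : C * T + T <= k * T * mm.
    rewrite -[X in _ + X]mul1r -mulrDl.
    apply: le_trans (_ : k * T * (m * d / 2) <= _); last by rewrite ler_wpM2l// ltW.
    by rewrite le_eqVlt; apply/orP; left; apply/eqP; rewrite kE; field; rewrite !gt_eqF.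
  have quad : c * (k * T) ^+ 2 * d <= T.
    have -> : c * (k * T) ^+ 2 * d = T * (c * k ^+ 2 * d * T) by ring.
    by rewrite ler_piMr ?(ltW T0).
  have /andP[a1 a2] : - (C * T) <= M 0 - d * alpha <= C * T by rewrite -ler_norml.
  have up : d * alpha <= M (k * T).
    by have := Mt (k * T); rewrite ler_norml => /andP[h _]; exact: shift_above a1 kmm h quad.
  have dn : M (- (k * T)) <= d * alpha.
    by have := Mt (- (k * T)); rewrite sqrrN mulNr ler_norml => /andP[_ h]; exact: shift_below a2 kmm h quad.
  have kk : - (k * T) <= k * T by rewrite (le_trans _ (ltW kT0))// oppr_le0 ltW.
  have [] := IVT kk Mc (v := d * alpha).
    by rewrite ge_min dn le_max up orbT.
  by move=> s; rewrite in_itv/= -ler_norml => hs Ms; exists s; split => //; rewrite -[LHS]/(M s) Ms mulrC.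
(* The tilt depends on [tau] in an uncontrolled way. [A] replaces it by its bound [k * T], which
   leaves explicit functions of [tau] that can be integrated. *)
pose A tau := wave_int D one T (fun x => F 0 x - l * S 0 x) tau + k * T * wave_int E one T (fun x => `|hh x|) tau
  + (k * T) ^+ 2 * wave_int D one T W tau + wave_int D (zeta T) T (fun x => Gn x + c * (k * T)) tau.
pose X := d * \int[leb]_(x in `[0, 1]) F 0 x - l * (alpha * d).
suff [tau At] : exists tau, A tau < X.
  have [s [sk Ms]] := mass tau; exists tau, s; split => //; first exact: le_trans kT.
  have s1 : `|s| <= 1 by exact: le_trans kT.
  have s2 : s ^+ 2 <= (k * T) ^+ 2 by rewrite -real_normK ?num_real// ler_sqr ?nnegrE//; apply: le_trans sk.
  have i0 : itg leb `[0, 1] (fun x => F 0 x - l * S 0 x) by apply: itgB => //; exact: itgZ.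
  have ihh := itgZ mI s hhi; have iW := itgZ mI (s ^+ 2) Wi.
  have ilS := itgZ mI l (Si s).
  have i2 : itg leb `[0, 1] (fun x => (F 0 x - l * S 0 x) + s * hh x) by exact: itgD.
  have i3 : itg leb `[0, 1] (fun x => (F 0 x - l * S 0 x) + s * hh x + s ^+ 2 * W x) by exact: itgD.
  have bulk : wave_int D one T (F s) tau <= wave_int D one T (fun x => F 0 x - l * S 0 x) tau
      + s * wave_int D one T hh tau + s ^+ 2 * wave_int D one T W tau + l * (alpha * d).
    rewrite -Ms -!sclD// -!addD//; apply: leD => //; first exact: itgD.
    by move=> x; rewrite -lerBlDr; exact: Ftay.
  have lin : s * wave_int D one T hh tau <= k * T * wave_int E one T (fun x => `|hh x|) tau.
    have := fluct hh tau hhi; rewrite hh0 mulr0 subr0 => fl.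
    apply: le_trans (ler_norm _) _; rewrite normrM; exact: ler_pM.
  have sqr : s ^+ 2 * wave_int D one T W tau <= (k * T) ^+ 2 * wave_int D one T W tau.
    by apply: ler_wpM2r => //; apply: Rintegral_ge0 => z _; rewrite /one mul1r.
  have gain : wave_int D (zeta T) T (fun x => Gn x + c * `|s|) tau <= wave_int D (zeta T) T (fun x => Gn x + c * (k * T)) tau.
    have zz z : D z -> 0 <= zeta T z by move=> Dz; have /andP[] := z01 T z T0 Dz.
    have zz1 z : D z -> `|zeta T z| <= 1 by exact: z1.
    apply: (le_wave_int mD Db (mz T) zz1 T0) => //; [exact: itgD|exact: itgD|].
    by move=> x; rewrite lerD2l ler_wpM2l.
  exact: (collect bulk lin sqr gain At).
have i0 : itg leb `[0, 1] (fun x => F 0 x - l * S 0 x) by apply: itgB => //; exact: itgZ.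
have zz1 z : D z -> `|zeta T z| <= 1 by exact: z1.
have [j1 e1] := wave_int_mean mD Db NN NN (mone D) (@one1 D) T0 i0.
have [j2 e2] := wave_int_mean mE Eb NN2 NN (mone E) (@one1 E) T0 (itg_abs hhi).
have [j3 e3] := wave_int_mean mD Db NN NN (mone D) (@one1 D) T0 Wi.
have iG : itg leb `[0, 1] (fun x => Gn x + c * (k * T)) by exact: itgD.
have [j4 e4] := wave_int_mean mD Db NN NN (mz T) zz1 T0 iG.
have j2' := itgZ mI (k * T) j2; have j3' := itgZ mI ((k * T) ^+ 2) j3.
have j12 := itgD mI j1 j2'; have j123 := itgD mI j12 j3'.
apply: exists_lt_mean; first exact: itgD.
rewrite (RintegralD mI j123 j4) (RintegralD mI j12 j3') (RintegralD mI j1 j2') (RintegralZl _ mI j2) (RintegralZl _ mI j3).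
rewrite e1 e2 e3 e4 Rintegral_one -/d.
rewrite (RintegralB mI (Fi 0) (itgZ mI l (Si 0))) (RintegralZl l mI (Si 0)) Smean.
rewrite (RintegralD mI Gi (icst _)) Rintegral_itv_cst// subr0 mulr1 -/Hh -/Wd -[\int[leb]_(x in _) Gn x]opprK -/g.
set V := \int[area]_(z in D) _; set a := \int[area]_(z in E) _.
have VT : K1 * T ^+ 2 <= V by exact: hT2.
have V0 : 0 <= V by apply: Rintegral_ge0 => z Dz; have /andP[] := z01 T z T0 Dz.
have gV : (- g + c * (k * T)) * V <= - (g / 2) * V by apply: ler_wpM2r => //; apply: half_gain; rewrite mulrA.
have gK : (k * C * Hh + k ^+ 2 * d * Wd + 1) * T ^+ 2 <= g / 2 * V.
  apply: le_trans (_ : g / 2 * (K1 * T ^+ 2) <= _); last by rewrite ler_wpM2l// divr_ge0 ?(ltW g0).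
  by rewrite le_eqVlt; apply/orP; left; apply/eqP; rewrite /K1; field; rewrite gt_eqF.
have aH : k * T * (Hh * a) <= k * C * Hh * T ^+ 2.
  have -> : k * C * Hh * T ^+ 2 = k * T * (Hh * (C * T)) by ring.
  by rewrite ler_wpM2l ?mulr_ge0 ?(ltW k0) ?(ltW T0)// ler_wpM2l.
have T2p : 0 < T ^+ 2 by rewrite exprn_gt0.
rewrite /X; set I0 := \int[leb]_(x in _) F 0 x.
have -> : (I0 - l * alpha) * d + k * T * (Hh * a) + (k * T) ^+ 2 * (Wd * d) + (- g + c * (k * T)) * V =
  d * I0 - l * (alpha * d) + (k * T * (Hh * a) + k ^+ 2 * d * Wd * T ^+ 2 + (- g + c * (k * T)) * V) by ring.
by rewrite gtrDl; rewrite mulNr in gV; exact: gain_wins aH gV gK T2p.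
Unshelve. all: by end_near.
Qed.

End mass_correction.
End correction.

(** * Taylor estimates for the tilted profile *)

Section stripe_density.
Context {R : realType}.
Local Notation leb := (@lebesgue_measure R).
Local Notation RT := (measurableTypeR R).
Local Notation area := (@area R).
Local Notation h := (2^-1 : R).
Implicit Types (x y s t : R).

Lemma cos_taylor x t : `|cos (x + t) - cos x + t * sin x| <= t ^+ 2.
Proof.
have dcos y : is_derive y 1 (cos : R -> R) (- sin y) by exact: is_derive_cos.
have ls y z : `|sin y - sin z| <= `|y - z|.
  by apply: (@lipschitz1 R sin cos) => u; exact: cos_max.
have cc : continuous (cos : R -> R) := @continuous_cos R.
have [t0|t0] := leP 0 t.
  have xt : x <= x + t by rewrite lerDl.
  have [z] := @MVT_segment R cos (fun y => - sin y) x (x + t) xt (fun z _ => dcos z) (continuous_subspaceT cc).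
  rewrite in_itv/= => /andP[xz zt] ->.
  have -> : - sin z * (x + t - x) + t * sin x = t * (sin x - sin z) by ring.
  rewrite normrM (ger0_norm t0) expr2 ler_wpM2l//; apply: le_trans (ls _ _) _.
  by rewrite ler_norml; apply/andP; split; lra.
have xt : x + t <= x by rewrite gerDl ltW.
have [z] := @MVT_segment R cos (fun y => - sin y) (x + t) x xt (fun z _ => dcos z) (continuous_subspaceT cc).
rewrite in_itv/= => /andP[xz zt] E.
have -> : cos (x + t) - cos x + t * sin x = t * (sin x - sin z) by rewrite -opprB E; ring.
rewrite normrM (ltr0_norm t0) -sqrrN expr2 ler_wpM2l ?oppr_ge0 ?(ltW t0)//; apply: le_trans (ls _ _) _.
by rewrite ler_norml; apply/andP; split; lra.
Qed.

Lemma sin_sqrE x : sin x ^+ 2 = (1 - cos (2 * x)) / 2.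
Proof.
by have := cos2Dsin2 x; rewrite (_ : 2 * x = x + x) ?cosD; [|ring]; move=> h; lra.
Qed.

Lemma sin_sqr_taylor x t : `|sin (x + t) ^+ 2 - sin x ^+ 2 - t * sin (2 * x)| <= 2 * t ^+ 2.
Proof.
rewrite !sin_sqrE mulrDr; have := cos_taylor (2 * x) (2 * t); rewrite !ler_norml => /andP[h1 h2].
by apply/andP; split; lra.
Qed.

Lemma sin_sqr_lip x y : `|sin x ^+ 2 - sin y ^+ 2| <= `|x - y|.
Proof.
rewrite !sin_sqrE; have : `|cos (2 * x) - cos (2 * y)| <= `|2 * x - 2 * y|.
  by apply: (@lipschitz1 R cos (fun x => - sin x)) => u; rewrite normrN; exact: sin_max.
rewrite -mulrBr normrM ger0_norm// !ler_norml => /andP[h1 h2]; by apply/andP; split; lra.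
Qed.

Lemma sin_sqr01 x : 0 <= sin x ^+ 2 <= 1.
Proof. by rewrite sqr_ge0 -real_normK ?num_real// exprn_ile1 ?normr_ge0//; exact: sin_max. Qed.

Section tilt_estimates.
Context (Th : R -> R).
Local Notation tilt := (tilt Th).

Lemma mass_lip s t x : `|sin (tilt s x) ^+ 2 - sin (tilt t x) ^+ 2| <= `|s - t|.
Proof.
apply: le_trans (sin_sqr_lip _ _) _; rewrite /tilt opprD addrACA subrr add0r -mulrBl normrM.
by rewrite ler_piMr//; exact: sin_max.
Qed.

Lemma mass_taylor s x : `|sin (tilt s x) ^+ 2 - sin (Th x) ^+ 2 - s * sin (2 * Th x) ^+ 2| <= 2 * s ^+ 2.
Proof.
have := sin_sqr_taylor (Th x) (s * sin (2 * Th x)); rewrite -mulrA -expr2 => /le_trans; apply.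
have /andP[_ h1] := sin_sqr01 (2 * Th x).
by rewrite exprMn ler_pM2l// ler_piMr// sqr_ge0.
Qed.

Lemma mixing_taylor s x : sin (2 * tilt s x) ^+ 2 <=
  sin (2 * Th x) ^+ 2 + s * (2 * sin (2 * Th x) * sin (4 * Th x)) + 8 * s ^+ 2.
Proof.
rewrite /tilt mulrDr; have := sin_sqr_taylor (2 * Th x) (2 * (s * sin (2 * Th x))).
rewrite ler_norml => /andP[_]; rewrite !exprMn mulrA (_ : 2 * (2 * Th x) = 4 * Th x); last by ring.
have /andP[h0 h1] := sin_sqr01 (2 * Th x).
have : s ^+ 2 * sin (2 * Th x) ^+ 2 <= s ^+ 2 by rewrite ler_piMr// sqr_ge0.
set q := sin _ ^+ 2; set u := s ^+ 2 * _; move=> h2 h3; lra.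
Qed.

End tilt_estimates.

(** The derivative term is expanded exactly, the mass and mixing terms by their Taylor bounds. [A]
    will be the coefficient of the mass density minus the multiplier, of either sign, whence |A| in
    the quadratic part. *)
Lemma lagrange_expand (A K S0 S1 m1 Q0 Q1 n1 g c2 s : R) : 0 <= K ->
  `|S1 - S0 - s * m1| <= 2 * s ^+ 2 -> Q1 <= Q0 + s * n1 + 8 * s ^+ 2 ->
  2^-1 * ((1 + 2 * s * c2) * g) ^+ 2 + A * S1 + K * Q1 <=
  2^-1 * g ^+ 2 + A * S0 + K * Q0 + s * (2 * c2 * g ^+ 2 + A * m1 + K * n1)
    + s ^+ 2 * (2 * (c2 * g) ^+ 2 + 2 * `|A| + 8 * K).
Proof.
move=> K0 hS hQ; have hK : K * (Q1 - Q0 - s * n1) <= K * (8 * s ^+ 2) by rewrite ler_wpM2l//; lra.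
have hA : A * (S1 - S0 - s * m1) <= `|A| * (2 * s ^+ 2).
  by apply: le_trans (ler_norm _) _; rewrite normrM ler_wpM2l.
rewrite -subr_ge0; set rhs := (X in 0 <= X).
have -> : rhs = (`|A| * (2 * s ^+ 2) - A * (S1 - S0 - s * m1)) + (K * (8 * s ^+ 2) - K * (Q1 - Q0 - s * n1)).
  by rewrite /rhs; field.
by rewrite addr_ge0// subr_ge0.
Qed.

Section optimal.
Context (lambda alpha mu : R) (theta g : R -> R) (l0 : 0 < lambda) (al01 : 0 < alpha < 1) (mu0 : 0 < mu).
Context (tg : profile_pair alpha theta g).

Definition Th := ev theta.
Definition Gd := odd_ext g.

Let h0 : 0 <= h. Proof. by rewrite invr_ge0. Qed.
Let h2 : 1 - h = h. Proof. by field. Qed.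
Let mI (p q : R) : measurable (`[p, q]%classic : set RT). Proof. by []. Qed.

Lemma Th_primitive : is_primitive 0 1 Th Gd.
Proof. by apply: is_primitive_ev; case: tg. Qed.

Let tc : {within `[0, h], continuous theta}.
Proof. by apply: is_primitive_cts h0 _; case: tg => + _ _ _ _; exact. Qed.

Lemma Gd_sqr x : Gd x ^+ 2 = ev (fun y => g y ^+ 2) x.
Proof. by rewrite /Gd /odd_ext /ev; case: ifP; rewrite ?sqrrN. Qed.

Lemma Gd_L2 : in_L2 leb `[0, 1] Gd.
Proof.
split; first by have [/itg_meas] := Th_primitive.
have [_ [_ gi] _ _ _] := tg; have [ei _] := itg_ev gi.
by apply: eq_itg ei => // x _; rewrite Gd_sqr.
Qed.

Lemma Th0 : Th 0 = 0. Proof. by rewrite /Th /ev h0; case: tg. Qed.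
Lemma Th1 : Th 1 = 0. Proof. by rewrite /Th ev_right ?mulr1 ?addNr; [case: tg|lra]. Qed.
Lemma Thh : Th h = pi / 2. Proof. by rewrite /Th /ev lexx; case: tg. Qed.

Lemma sin_Th x : sin (Th x) ^+ 2 = ev (fun y => sin (theta y) ^+ 2) x.
Proof. by rewrite /Th (evE theta (fun t => sin t ^+ 2)). Qed.

Lemma Th_mass : \int[leb]_(x in `[0, 1]) (sin (Th x) ^+ 2) = alpha.
Proof.
have [_ _ <- _ _] := tg; have [_ <-] := itg_ev (itg_sin2 tc).
by apply: Rintegral_eq => x _; rewrite sin_Th.
Qed.

Lemma tilt0E x : tilt Th 0 x = Th x. Proof. by rewrite /tilt mul0r addr0. Qed.

(** If sin (2 theta) vanished almost everywhere, cos (2 theta), whose derivative contains it as a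
    factor, would be constant; but it goes from 1 to -1. This quantity is the rate at which the tilt
    changes the mass. *)
Lemma mixing_gt0 : 0 < \int[leb]_(x in `[0, 1]) (sin (2 * Th x) ^+ 2).
Proof.
have [_ E] := itg_ev (itg_trig 2 tc).
have -> : \int[leb]_(x in `[0, 1]) (sin (2 * Th x) ^+ 2) = 2 * \int[leb]_(x in `[0, h]) (sin (2 * theta x) ^+ 2).
  by rewrite -E; apply: Rintegral_eq => x _; rewrite /Th (evE theta (fun t => sin (2 * t) ^+ 2)).
rewrite mulr_gt0// lt_neqAle mixing_ge0 andbT eq_sym; apply/eqP => I0.
have [tp gL _ t0 t1] := tg.
have [_ /(_ h)] := is_primitive_cos h0 (is_primitive_lin 1 tp tp).
rewrite h0 lexx => /(_ isT); rewrite t0 t1 !mul1r addr0 -splitr cospi cos0.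
have sL : in_L2 leb `[0, h] (fun x => sin (2 * theta x)).
  apply: (@in_L2_bounded _ _ _ leb _ (mI 0 h) _ 1) => [||x _]; [exact: leb_itv_lty| |exact: sin_max].
  have := itg_meas (itg_cts_comp (F := fun t => sin (2 * t)) _ tc); apply.
  move=> t; apply: (@continuous_comp _ _ _ (fun t : R => 2 * t) sin); last exact: continuous_sin.
  by apply: cvgM; [exact: cvg_cst|exact: cvg_id].
have I0' : mixing theta = 0 := I0.
have : (\int[leb]_(x in `[0, h]) (sin (2 * theta x) * (-2 * g x))) ^+ 2 <=
    mixing theta * \int[leb]_(x in `[0, h]) ((-2 * g x) ^+ 2).
  exact: (cauchy_schwarz (mI 0 h) sL (in_L2Z (mI 0 h) (-2) gL)).
rewrite I0' mul0r => sq0 E0.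
have : \int[leb]_(x in `[0, h]) (sin (2 * theta x) * (-2 * g x)) = -2.
  move: E0; set J := \int[leb]_(t in _) (- _ * _) => E0; transitivity J; last by lra.
  apply: Rintegral_eq => x _.
  by rewrite mul1r (_ : theta x + theta x = 2 * theta x) ?mul1r; [ring|ring].
by move=> e; move: sq0; rewrite e sqrrN; lra.
Qed.

(** Second moment of the first density about the middle of its stripe; it measures the cross term
    between the boundary layer and the stripe phase. *)
Definition kappa := \int[leb]_(x in `[0, 1]) (Z1 x ^+ 2 * sin (Th x) ^+ 2).

Let cTh (F : R -> R) : continuous F -> itg leb `[0, 1] (fun x => F (Th x)).
Proof. move=> cF; exact: (base_itg Th_primitive cF). Qed.

Let cZ1 (k : nat) : continuous (fun x : R => Z1 x ^+ k).
Proof.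
move=> x; apply: (@continuous_comp _ _ _ (fun x : R => Z1 x) (fun t => t ^+ k)); last exact: exprn_continuous.
by apply: cvgB; [exact: cvg_id|exact: cvg_cst].
Qed.

Lemma Z1_sqr01 x : 0 <= x <= 1 -> 0 <= Z1 x ^+ 2 <= 1.
Proof.
move=> /andP[x0 x1]; rewrite sqr_ge0 -real_normK ?num_real// exprn_ile1 ?normr_ge0//.
by rewrite ler_norml /Z1; apply/andP; split; lra.
Qed.

Lemma Z2_sqr01 x : 0 <= x <= 1 -> 0 <= Z2 x ^+ 2 <= 1.
Proof.
move=> /andP[x0 x1]; rewrite sqr_ge0 -real_normK ?num_real// exprn_ile1 ?normr_ge0//.
by rewrite ler_norml /Z2; case: (leP x h) => ?; apply/andP; split; lra.
Qed.

Let sTh : itg leb `[0, 1] (fun x => sin (Th x) ^+ 2).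
Proof.
by have := cTh (@sin2_cts R 1); apply: eq_itg => // x _; rewrite mul1r.
Qed.

Let bounded_itg (F P : R -> R) (c : R) : measurable_fun (`[0, 1]%classic : set RT) (P : RT -> R) ->
  (forall x, 0 <= x <= 1 -> `|P x| <= c) -> itg leb `[0, 1] F -> itg leb `[0, 1] (fun x => P x * F x).
Proof. by move=> mP Pc Fi; apply: (itgM_bounded _ (c := c)) => // x; rewrite /= in_itv; exact: Pc. Qed.

Let kappa_itg : itg leb `[0, 1] (fun x => Z1 x ^+ 2 * sin (Th x) ^+ 2).
Proof.
apply: (bounded_itg (c := 1)) => //; first by apply: continuous_meas => //; exact: (cZ1 (k := 2)).
by move=> x /Z1_sqr01/andP[p q]; rewrite ger0_norm.
Qed.

(** [Z1] vanishes only at 1/2, so a zero moment would force sin (Th) to vanish almost everywhere,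
    against the positive mass alpha. *)
Lemma kappa_gt0 : 0 < kappa.
Proof.
have k0 x : `[0, 1]%classic x -> 0 <= Z1 x ^+ 2 * sin (Th x) ^+ 2 by move=> _; rewrite mulr_ge0// sqr_ge0.
rewrite lt_neqAle Rintegral_ge0// andbT eq_sym; apply/eqP => /(Rintegral_eq0_ae (mI 0 1) kappa_itg k0) ae.
have : \int[leb]_(x in `[0, 1]) (sin (Th x) ^+ 2) = \int[leb]_(x in `[0, 1]) 0.
  apply: ae_Rintegral => //; first exact: itg_meas sTh.
  move: ae (ae_neq h); apply: filterS2 => x E xh xI; have /eqP := E xI.
  by rewrite mulf_eq0 sqrf_eq0 subr_eq0 (negbTE xh)/= => /eqP.
by rewrite Th_mass Rintegral0 => a0; move: al01; rewrite a0 ltxx.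
Qed.

End optimal.
End stripe_density.

(** The quadratic term is made linear in the exponential [z] by z^2 <= z; replacing the tilted
    density [S] by [S0] then costs a multiple of [s]. *)
Lemma layer_le (R : realType) (S S0 z b q m s : R) : 0 <= z <= 1 -> 0 <= q <= 1 -> 0 <= b -> 0 <= m -> 0 <= S ->
  `|S - S0| <= s ->
  2^-1 * S * (b ^+ 2 * z ^+ 2 * (1 + q) - 4 * m * b * z * q) <=
  z * (2^-1 * S0 * ((1 + q) * b ^+ 2 - 4 * m * b * q) + (2 + b ^+ 2 + 2 * m * b) * s).
Proof.
move=> /andP[z0 z1] /andP[q0 q1] b0 m0 S_0 hS.
have b2 : 0 <= b ^+ 2 := sqr_ge0 b.
set P := (1 + q) * b ^+ 2 - 4 * m * b * q.
have mb : 0 <= m * b by rewrite mulr_ge0.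
have P_le : `|P| <= 2 * b ^+ 2 + 4 * (m * b).
  have bq : b ^+ 2 * q <= b ^+ 2 by rewrite ler_piMr.
  have bq0 : 0 <= b ^+ 2 * q by rewrite mulr_ge0.
  have mq : m * b * q <= m * b by rewrite ler_piMr.
  have mq0 : 0 <= m * b * q by rewrite mulr_ge0.
  have -> : P = b ^+ 2 + b ^+ 2 * q - 4 * (m * b * q) by rewrite /P; ring.
  by rewrite ler_norml; apply/andP; split; lra.
have dP : (S - S0) * P <= s * (2 * b ^+ 2 + 4 * (m * b)).
  by apply: le_trans (ler_norm _) _; rewrite normrM ler_pM.
have s0 : 0 <= s by apply: le_trans hS.
have zz : 0 <= S * (b ^+ 2 * (1 + q)) * (z * (1 - z)).
  have q2 : 0 <= 1 + q by rewrite addr_ge0.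
  have z2 : 0 <= 1 - z by rewrite subr_ge0.
  by rewrite !mulr_ge0.
have zP : 0 <= z * (s * (2 * b ^+ 2 + 4 * (m * b)) - (S - S0) * P) by rewrite mulr_ge0// subr_ge0.
have zs : 0 <= z * s by rewrite mulr_ge0.
rewrite -subr_ge0; set rhs := (X in 0 <= X).
have -> : rhs = 2^-1 * (S * (b ^+ 2 * (1 + q)) * (z * (1 - z))) + 2^-1 * (z * (s * (2 * b ^+ 2 + 4 * (m * b)) - (S - S0) * P)) + 2 * (z * s).
  by rewrite /rhs /P; field.
by rewrite !addr_ge0// mulr_ge0.
Qed.

(** * The rescaled energy density of the stripes and its corrections *)

Section stripe_correction.
Context {R : realType}.
Local Notation leb := (@lebesgue_measure R).
Local Notation RT := (measurableTypeR R).
Local Notation area := (@area R).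
Local Notation h := (2^-1 : R).
Implicit Types (x y s t : R).
Context (lambda alpha mu : R) (theta g : R -> R) (l0 : 0 < lambda) (al01 : 0 < alpha < 1) (mu0 : 0 < mu).
Context (tg : profile_pair alpha theta g).
Local Notation th := (Th theta).
Local Notation gd := (Gd g).

Let h0 : 0 <= h. Proof. by rewrite invr_ge0. Qed.
Let h2 : 1 - h = h. Proof. by field. Qed.
Let mI (p q : R) : measurable (`[p, q]%classic : set RT). Proof. by []. Qed.

(** The phase cost 2 mu^4 (Z1^2 sin^2 + Z2^2 cos^2) is rewritten as 2 mu^4 Z2^2 plus this
    coefficient times sin^2, which makes it affine in the mass density. *)
Definition contrast x := 2 * mu ^+ 4 * (Z1 x ^+ 2 - Z2 x ^+ 2).

Definition mixing_weight := mu ^+ 2 / (8 * lambda).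

Definition stripe_mass s x := sin (tilt th s x) ^+ 2.

(** [T ^+ 2] times the energy density of the tilted array without boundary layer; the weight of the
    mixing term comes from 4 sin^2 cos^2 = sin^2 of the double angle. *)
Definition stripe_density s x := 2^-1 * (tilt' th gd s x) ^+ 2 + contrast x * stripe_mass s x
  + mixing_weight * sin (2 * tilt th s x) ^+ 2 + 2 * mu ^+ 4 * Z2 x ^+ 2.

(* phase slope of the boundary layer at the top of the domain; the choice that
   minimizes the mean of [layer_gain] up to a constant factor *)
Definition layer_slope := mu ^+ 2 * kappa theta.

(** Coefficient of the exponential in the rescaled change of energy caused by the layer, at zero
    tilt and after bounding the square of the exponential by the exponential. *)
Definition layer_gain x := 2^-1 * sin (th x) ^+ 2 * ((1 + Z1 x ^+ 2) * layer_slope ^+ 2 - 4 * mu ^+ 2 * layer_slope * Z1 x ^+ 2).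

Definition layer_bound := 2 + layer_slope ^+ 2 + 2 * mu ^+ 2 * layer_slope.

Let tp := Th_primitive tg.
Let GL := Gd_L2 tg.

Let cI (F : R -> R) : continuous F -> itg leb `[0, 1] F.
Proof. by move=> cF; exact: continuous_itg. Qed.

Let Z1i : itg leb `[0, 1] (fun x => Z1 x ^+ 2).
Proof.
apply: cI => x; apply: (@continuous_comp _ _ _ (fun x : R => Z1 x) (fun t => t ^+ 2)); last exact: exprn_continuous.
by apply: cvgB; [exact: cvg_id|exact: cvg_cst].
Qed.

Let Z2i : itg leb `[0, 1] (fun x => Z2 x ^+ 2).
Proof.
apply: (@itg_bounded _ _ _ leb _ (mI 0 1) _ 1); first exact: leb_itv_lty.
  by apply: measurable_funX; exact: itg_meas (@Z2_itg R).
by move=> x; rewrite /= in_itv/= => /(Z2_sqr01)/andP[p q]; rewrite ger0_norm.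
Qed.

Let Ai : itg leb `[0, 1] contrast.
Proof. by apply: itgZ => //; exact: itgB. Qed.

Let A_le x : 0 <= x <= 1 -> `|contrast x| <= 2 * mu ^+ 4.
Proof.
move=> xI; have /andP[a1 a2] := Z1_sqr01 xI; have /andP[b1 b2] := Z2_sqr01 xI.
have m4 : 0 <= 2 * mu ^+ 4 by rewrite mulr_ge0// exprn_ge0 ?ltW.
rewrite /contrast normrM (ger0_norm m4) ler_piMr// ler_norml; apply/andP; split; lra.
Qed.

Let boundedM (F P : R -> R) (c : R) : measurable_fun (`[0, 1]%classic : set RT) (P : RT -> R) ->
  (forall x, 0 <= x <= 1 -> `|P x| <= c) -> itg leb `[0, 1] F -> itg leb `[0, 1] (fun x => P x * F x).
Proof. by move=> mP Pc stripe_density_itg; apply: (itgM_bounded _ (c := c)) => // x; rewrite /= in_itv; exact: Pc. Qed.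

Let Si s : itg leb `[0, 1] (stripe_mass s).
Proof.
have := tilt_itg tp s (@sin2_cts R 1); apply: eq_itg => // x _; by rewrite mul1r.
Qed.

Let Ki : 0 <= mixing_weight.
Proof. by rewrite divr_ge0 ?exprn_ge0 ?(ltW mu0)// mulr_ge0// ltW. Qed.

Lemma stripe_density_itg s : itg leb `[0, 1] (stripe_density s).
Proof.
have t2 := (tilt'_L2 tp GL s).2; apply: itgD => //; last by apply: itgZ.
apply: itgD => //; last by apply: itgZ => //; exact: (tilt_itg tp s (@sin2_cts R 2)).
apply: itgD => //; first exact: itgZ.
by apply: (boundedM (c := 2 * mu ^+ 4)) => //; exact: itg_meas Ai.
Qed.

Let m1i : itg leb `[0, 1] (fun x => sin (2 * th x) ^+ 2).
Proof. exact: (base_itg tp (@sin2_cts R 2)). Qed.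

(** The derivative of [stripe_density] in the tilt at 0. *)
Definition density_slope x := 2 * cos (2 * th x) * gd x ^+ 2 + contrast x * sin (2 * th x) ^+ 2
  + mixing_weight * (2 * sin (2 * th x) * sin (4 * th x)).

Let slope_itg : itg leb `[0, 1] density_slope.
Proof.
have csin (k : R) : continuous (fun t : R => sin (k * t)).
  move=> t; apply: (@continuous_comp _ _ _ (fun t : R => k * t) sin); last exact: continuous_sin.
  by apply: cvgM; [exact: cvg_cst|exact: cvg_id].
apply: itgD => //; last first.
  apply: itgZ => //; apply: (base_itg (F := fun t => 2 * sin (2 * t) * sin (4 * t)) tp) => t.
  by apply: cvgM; [apply: cvgM; [exact: cvg_cst|exact: csin]|exact: csin].
apply: itgD => //; last by apply: (boundedM (c := 2 * mu ^+ 4)) => //; exact: itg_meas Ai.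
apply: (boundedM (c := 2)) => //; last exact: GL.2.
  apply: (itg_meas (base_itg (F := fun t => 2 * cos (2 * t)) tp _)) => t; apply: cvgM; first exact: cvg_cst.
  apply: (@continuous_comp _ _ _ (fun t : R => 2 * t) cos); last exact: continuous_cos.
  by apply: cvgM; [exact: cvg_cst|exact: cvg_id].
by move=> x _; rewrite normrM ger0_norm// ler_piMr//; exact: cos_max.
Qed.

(** On half a cell (x - 1/2)^2 - x^2 = 1/4 - x, which yields the terms alpha / 2 and - 4 x sin^2 of
    the moment; the integral 1/24 of x^2 yields its constant 1/6. *)
Lemma stripe_density_mean : \int[leb]_(x in `[0, 1]) stripe_density 0 x = mu ^+ 2 * pair_energy lambda alpha mu theta g.
Proof.
have [pt [_ g2] mass _ _] := tg; have tc := is_primitive_cts h0 pt.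
have sy : continuous (fun y : R => y ^+ 2) := @exprn_continuous R 2.
have i1 : itg leb `[0, h] (fun y => g y ^+ 2) := g2.
have i2 := itg_sin2 tc; have i3 := itg_moment tc.
have i4 : itg leb `[0, h] (fun y : R => y ^+ 2) := continuous_itg 0 h sy.
have i5 := itg_trig 2 tc; have mh := mI 0 h.
have j1 := itgZ mh h i1; have j2 := itgZ mh (mu ^+ 4 / 2) i2; have j3 := itgZ mh (- (2 * mu ^+ 4)) i3.
have j4 := itgZ mh (2 * mu ^+ 4) i4; have j5 := itgZ mh mixing_weight i5.
have k2 := itgD mh j1 j2; have k3 := itgD mh k2 j3; have k4 := itgD mh k3 j4; have k5 := itgD mh k4 j5.
have [_ E] := itg_ev k5.
rewrite (RintegralD mh k4 j5) (RintegralD mh k3 j4) (RintegralD mh k2 j3) (RintegralD mh j1 j2) in E.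
rewrite (RintegralZl _ mh i1) (RintegralZl _ mh i2) (RintegralZl _ mh i3) (RintegralZl _ mh i4) (RintegralZl _ mh i5) in E.
have Y : \int[leb]_(y in `[0, h]) (y ^+ 2) = 24^-1 :> R.
  transitivity (h ^+ 3 / 3 - 0 ^+ 3 / 3 : R); last by field.
  apply: (@FTC R (fun y => y ^+ 3 / 3)) => //; last exact: continuous_subspaceT.
  by move=> y _; apply: is_derive_eq; rewrite -![_ *: _]/(_ * _); field.
transitivity (2 * (h * (\int[leb]_(x in `[0, h]) (g x ^+ 2)) + mu ^+ 4 / 2 * (\int[leb]_(x in `[0, h]) (sin (theta x) ^+ 2)) +
  - (2 * mu ^+ 4) * (\int[leb]_(x in `[0, h]) (x * sin (theta x) ^+ 2)) + 2 * mu ^+ 4 * 24^-1 + mixing_weight * mixing theta)).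
  rewrite -Y -E; apply: Rintegral_eq => x _.
  rewrite /stripe_density /contrast /stripe_mass tilt0E /tilt' mulr0 mul0r addr0 mul1r Gd_sqr /Th.
  by rewrite /Z1 /Z2 /ev; case: (x <= h); field.
have -> : \int[leb]_(x in `[0, h]) (sin (theta x) ^+ 2) = alpha / 2 by rewrite -mass [2 * _]mulrC mulfK.
by rewrite /pair_energy /moment /mixing_weight; field; rewrite !gt_eqF.
Qed.

Lemma layer_gain_le z s x : 0 <= x <= 1 -> 0 <= z <= 1 ->
  2^-1 * stripe_mass s x * (layer_slope ^+ 2 * z ^+ 2 * (1 + Z1 x ^+ 2) - 4 * mu ^+ 2 * layer_slope * z * Z1 x ^+ 2) <=
  z * (layer_gain x + layer_bound * `|s|).
Proof.
move=> xI z01; have k0 : 0 <= layer_slope by rewrite mulr_ge0 ?sqr_ge0 ?ltW// (kappa_gt0 al01 tg).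
have /andP[S0 _] := sin_sqr01 (tilt th s x).
have lip : `|stripe_mass s x - sin (th x) ^+ 2| <= `|s| by have := mass_lip th s 0 x; rewrite tilt0E subr0.
exact: (layer_le z01 (Z1_sqr01 xI) k0 (sqr_ge0 mu) S0 lip).
Qed.

Lemma layer_gain_itg : itg leb `[0, 1] layer_gain.
Proof.
have i0 : itg leb `[0, 1] (fun x => 2^-1 * ((1 + Z1 x ^+ 2) * layer_slope ^+ 2 - 4 * mu ^+ 2 * layer_slope * Z1 x ^+ 2)).
  apply: itgZ => //; apply: itgB => //; last exact: itgZ.
  have i1 : itg leb `[0, 1] (fun=> 1 : R) := cI (@cst_continuous R R 1).
  by apply: eq_itg (itgZ (mI 0 1) (layer_slope ^+ 2) (itgD (mI 0 1) i1 Z1i)) => // x _; rewrite mulrC.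
have := boundedM (itg_meas (base_itg tp (@sin2_cts R 1))) (c := 1) _ i0.
have b1 x : 0 <= x <= 1 -> `|sin (1 * th x) ^+ 2| <= 1.
  by move=> _; have /andP[p q] := sin_sqr01 (1 * th x); rewrite ger0_norm.
by move=> /(_ b1); apply: eq_itg => // x _; rewrite /layer_gain mul1r; ring.
Qed.

(** Bounding (1 + Z1^2) sin^2 by 2 leaves slope^2 - 2 mu^2 slope kappa, which equals - slope^2 for
    the chosen slope mu^2 kappa. *)
Lemma layer_gain_lt0 : \int[leb]_(x in `[0, 1]) layer_gain x < 0.
Proof.
have k0 := kappa_gt0 al01 tg; have b0 : 0 < layer_slope by rewrite mulr_gt0 ?exprn_gt0.
have m1 := mI 0 1.
have i1 : itg leb `[0, 1] (fun=> layer_slope ^+ 2 : R) := cI (@cst_continuous R R _).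
have i2 : itg leb `[0, 1] (fun x => Z1 x ^+ 2 * sin (th x) ^+ 2).
  have := boundedM (c := 1) (itg_meas Z1i) _ (base_itg tp (@sin2_cts R 1)).
  have b1 x : 0 <= x <= 1 -> `|Z1 x ^+ 2| <= 1 by move=> /Z1_sqr01/andP[p q]; rewrite ger0_norm.
  by move=> /(_ b1); apply: eq_itg => // x _; rewrite mul1r.
have i3 := itgZ m1 (2 * mu ^+ 2 * layer_slope) i2.
apply: le_lt_trans (_ : \int[leb]_(x in `[0, 1]) (layer_slope ^+ 2 - 2 * mu ^+ 2 * layer_slope * (Z1 x ^+ 2 * sin (th x) ^+ 2)) < 0).
  apply: le_Rintegral => //; [exact: layer_gain_itg|exact: itgB|].
  move=> x; rewrite /= in_itv/= => xI; have /andP[q0 q1] := Z1_sqr01 xI; have /andP[s0 s1] := sin_sqr01 (th x).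
  have b2 : 0 <= layer_slope ^+ 2 by exact: sqr_ge0.
  have sz : sin (th x) ^+ 2 * (1 + Z1 x ^+ 2) <= 2 by apply: le_trans (_ : 1 * (1 + Z1 x ^+ 2) <= _); [rewrite ler_wpM2r//; lra|lra].
  have := ler_wpM2r b2 sz; rewrite /layer_gain -subr_ge0 => hh; rewrite -subr_ge0.
  have h4 : 0 <= 2^-1 * (2 * layer_slope ^+ 2 - sin (th x) ^+ 2 * (1 + Z1 x ^+ 2) * layer_slope ^+ 2) by rewrite mulr_ge0.
  by apply: le_trans h4 _; rewrite le_eqVlt; apply/orP; left; apply/eqP; field.
rewrite (RintegralB m1 i1 i3) (RintegralZl _ m1 i2) Rintegral_itv_cst// subr0 mulr1 -/(kappa theta).
have -> : layer_slope ^+ 2 - 2 * mu ^+ 2 * layer_slope * kappa theta = - layer_slope ^+ 2 by rewrite /layer_slope; ring.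
by rewrite oppr_lt0 exprn_gt0.
Qed.

Lemma stripe_correction (D : set (R * R)) : smooth_bounded_domain D -> exists H, (forall z, D z -> z.2 <= H) /\
  exists2 T1 : R, 0 < T1 & forall T : R, 0 < T -> T <= T1 -> exists tau s : R, 
    wave_int D (fun=> 1) T (stripe_mass s) tau = alpha * fine (area D) /\
    wave_int D (fun=> 1) T (stripe_density s) tau +
      wave_int D (fun z => expR ((z.2 - H) / T)) T (fun x => layer_gain x + layer_bound * `|s|) tau
      <= fine (area D) * (mu ^+ 2 * pair_energy lambda alpha mu theta g).
Proof.
move=> sD; have k0 := kappa_gt0 al01 tg; have b0 : 0 < layer_slope by rewrite mulr_gt0 ?exprn_gt0.
have c2 : 2 <= layer_bound.
  have p1 : 0 <= layer_slope ^+ 2 := sqr_ge0 _.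
  have p2 : 0 <= 2 * mu ^+ 2 * layer_slope by apply: (mulr_ge0 _ (ltW b0)); rewrite mulr_ge0 ?sqr_ge0.
  by rewrite /layer_bound -addrA lerDl addr_ge0.
have m1 := mI 0 1; have P0 := mixing_gt0 tg.
(* The multiplier is the ratio of the first-order changes of energy and mass, so that [hh] has mean
   zero. *)
pose l := (\int[leb]_(x in `[0, 1]) density_slope x) / \int[leb]_(x in `[0, 1]) (sin (2 * th x) ^+ 2).
pose hh x := density_slope x - l * sin (2 * th x) ^+ 2.
pose W x := 2 * (cos (2 * th x) * gd x) ^+ 2 + 2 * `|contrast x - l| + 8 * mixing_weight.
have ic (k : R) : itg leb `[0, 1] (fun=> k) := cI (@cst_continuous R R k).
have il := itgZ m1 l m1i.
have hi : itg leb `[0, 1] hh by exact: itgB.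
have h00 : \int[leb]_(x in `[0, 1]) hh x = 0.
  by rewrite /hh (RintegralB m1 slope_itg il) (RintegralZl _ m1 m1i) /l divfK ?subrr// gt_eqF.
have Wi : itg leb `[0, 1] W.
  apply: itgD => //; apply: itgD => //; last by apply: itgZ => //; apply: itg_abs; exact: itgB.
  apply: itgZ => //; have cc : continuous (fun t : R => cos (2 * t)).
    move=> t; apply: (@continuous_comp _ _ _ (fun t : R => 2 * t) cos); last exact: continuous_cos.
    by apply: cvgM; [exact: cvg_cst|exact: cvg_id].
  by have [] := in_L2M_bounded m1 GL (itg_meas (base_itg tp cc)) (c := 1) (fun x _ => cos_max _).
have W0 x : 0 <= W x by rewrite /W !addr_ge0// mulr_ge0// sqr_ge0.
have S01 s x : 0 <= stripe_mass s x <= 1 by exact: sin_sqr01.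
have lip s t x : `|stripe_mass s x - stripe_mass t x| <= layer_bound * `|s - t|.
  by apply: le_trans (mass_lip th s t x) _; rewrite ler_peMl//; lra.
have tay2 s x : `|stripe_mass s x - stripe_mass 0 x - s * sin (2 * th x) ^+ 2| <= 2 * s ^+ 2.
  by have := mass_taylor th s x; rewrite -(tilt0E theta x).
have tay s x : `|stripe_mass s x - stripe_mass 0 x - s * sin (2 * th x) ^+ 2| <= layer_bound * s ^+ 2.
  apply: le_trans (tay2 s x) _.
  by rewrite ler_wpM2r// sqr_ge0.
have P01 x : 0 <= sin (2 * th x) ^+ 2 <= 1 by exact: sin_sqr01.
have mean : \int[leb]_(x in `[0, 1]) stripe_mass 0 x = alpha.
  by rewrite -(Th_mass tg); apply: Rintegral_eq => x _; rewrite /stripe_mass tilt0E.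
have Ftay s x : `|s| <= 1 -> stripe_density s x - l * stripe_mass s x <=
    stripe_density 0 x - l * stripe_mass 0 x + s * hh x + s ^+ 2 * W x.
  move=> _; have := @lagrange_expand R (contrast x - l) mixing_weight (stripe_mass 0 x) (stripe_mass s x)
    (sin (2 * th x) ^+ 2) (sin (2 * th x) ^+ 2) (sin (2 * tilt th s x) ^+ 2) (2 * sin (2 * th x) * sin (4 * th x))
    (gd x) (cos (2 * th x)) s Ki.
  move=> /(_ (tay2 s x) (mixing_taylor th s x)).
  rewrite -(lerD2r (2 * mu ^+ 4 * Z2 x ^+ 2)); congr (_ <= _).
    by rewrite /stripe_density /tilt'; ring.
  by rewrite /hh /W /density_slope /stripe_density /tilt' !tilt0E mulr0 mul0r addr0 mul1r; ring.
have b0' : 0 <= layer_bound by lra.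
have [H [DH [T1 T10 hT]]] := mass_correction b0' Si S01 lip tay m1i P01 P0 mean stripe_density_itg Ftay hi h00 Wi W0 layer_gain_itg layer_gain_lt0 sD.
exists H; split => //; exists T1 => // T T0 TT1; have [tau [s [_ e1 e2]]] := hT T T0 TT1.
by exists tau, s; split => //; rewrite -stripe_density_mean.
Qed.

End stripe_correction.

(** * The competitor and its energy *)

Section competitor.
Context {R : realType}.
Local Notation leb := (@lebesgue_measure R).
Local Notation RT := (measurableTypeR R).
Local Notation area := (@area R).
Implicit Types (x y s t : R).

Lemma wave_density_meas (S S' Z b b' : R -> R) (Om T tau : R) (E : set (RT * RT)) : cell S S' Z ->
  continuous b -> continuous b' -> measurable_fun E (fun z : RT * RT =>
   2^-1 * ((S' (cellpos T tau z) / T) ^+ 2 + S (cellpos T tau z) ^+ 2 *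
     ((2 * Om * z.2 + b z.2 / T) ^+ 2 + (Z (cellpos T tau z) * b' z.2) ^+ 2))).
Proof.
move=> cS cb cb'; apply: measurable_funM => //; apply: measurable_funD.
  by apply: measurable_funX; apply: measurable_funM => //; exact: cellpos_meas (itg_cellS' cS).
apply: measurable_funM; first by apply: measurable_funX; exact: cellpos_meas (itg_cellS cS).
apply: measurable_funD; apply: measurable_funX.
  apply: measurable_funD; first by apply: measurable_funM => //; exact: snd_meas0.
  by apply: measurable_funM => //; exact: snd_meas.
by apply: measurable_funM; [exact: cellpos_meas (itg_cellZ cS)|exact: snd_meas].
Qed.

(** Collects the two kinetic densities and the potential. The first potential term vanishes as the
    total density is 1, and [Om * T ^+ 2 = mu ^+ 2] brings out the common factor 1 / T^2; the part
    with [zeta] is the effect of the layer. *)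
Lemma density_sum (sn cs z1 z2 tp lam mu k zeta Om T eps : R) : T != 0 -> lam != 0 -> sn ^+ 2 + cs ^+ 2 = 1 ->
  Om * T ^+ 2 = mu ^+ 2 ->
  2^-1 * ((cs * tp / T) ^+ 2 + sn ^+ 2 * ((k * zeta / T) ^+ 2 + (z1 * ((k * zeta - 2 * mu ^+ 2) / T)) ^+ 2)) +
  2^-1 * ((- sn * tp / T) ^+ 2 + cs ^+ 2 * (0 ^+ 2 + (z2 * (- (2 * mu ^+ 2) / T)) ^+ 2)) +
  ((1 - sn ^+ 2 - cs ^+ 2) ^+ 2 / (4 * eps ^+ 2) + Om / (2 * lam) * (sn ^+ 2 * cs ^+ 2)) =
  (T ^+ 2)^-1 * ((2^-1 * tp ^+ 2 + 2 * mu ^+ 4 * (z1 ^+ 2 - z2 ^+ 2) * sn ^+ 2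
    + mu ^+ 2 / (8 * lam) * (2 * sn * cs) ^+ 2 + 2 * mu ^+ 4 * z2 ^+ 2) +
   2^-1 * sn ^+ 2 * (k ^+ 2 * zeta ^+ 2 * (1 + z1 ^+ 2) - 4 * mu ^+ 2 * k * zeta * z1 ^+ 2)).
Proof.
move=> T0 l0 e1 OT; have -> : Om = mu ^+ 2 / T ^+ 2 by rewrite -OT mulfK// expf_neq0.
have -> : 1 - sn ^+ 2 - cs ^+ 2 = 0 by rewrite -e1; ring.
rewrite expr0n /= mul0r add0r.
transitivity ((T ^+ 2)^-1 * (2^-1 * (tp ^+ 2 * (sn ^+ 2 + cs ^+ 2)) + 2^-1 * sn ^+ 2 * (k ^+ 2 * zeta ^+ 2 * (1 + z1 ^+ 2)
  - 4 * mu ^+ 2 * k * zeta * z1 ^+ 2) + 2 * mu ^+ 4 * z1 ^+ 2 * sn ^+ 2 + 2 * mu ^+ 4 * z2 ^+ 2 * cs ^+ 2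
  + mu ^+ 2 / (2 * lam) * (sn ^+ 2 * cs ^+ 2))); first by field; rewrite l0 T0.
have -> : cs ^+ 2 = 1 - sn ^+ 2 by rewrite -e1; ring.
rewrite !exprMn; have -> : cs ^+ 2 = 1 - sn ^+ 2 by rewrite -e1; ring.
by field; rewrite l0 T0.
Qed.

Lemma rescale_energy (Om T m d e : R) : T != 0 -> Om * T ^+ 2 = m -> (T ^+ 2)^-1 * (d * (m * e)) = Om * d * e.
Proof. by move=> T0 <-; field. Qed.

Context (lambda alpha mu : R) (theta g : R -> R) (l0 : 0 < lambda) (al01 : 0 < alpha < 1) (mu0 : 0 < mu).
Context (tg : profile_pair alpha theta g) (D : set (R * R)) (sD : smooth_bounded_domain D).

Lemma competitor : exists2 T1 : R, 0 < T1 & forall T eps delta Om : R, 0 < T -> T <= T1 ->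
  Om * T ^+ 2 = mu ^+ 2 -> 1 < delta -> (delta - 1) / (2 * eps ^+ 2) = Om / (2 * lambda) ->
  exists2 w, admissible D alpha w &
    (energy D eps delta Om w <= (Om * fine (area D) * pair_energy lambda alpha mu theta g)%:E)%E.
Proof.
have [H [DH [T1 T10 hT]]] := stripe_correction l0 al01 mu0 tg sD.
have [_ oD _ bD _] := sD; have [N N0 hN] := domain_box bD; have mD : measurable (D : set (RT * RT)) := open_meas oD.
have [d0 Dfin] := domain_area sD; set d := fine (area D) in d0 *.
exists T1 => // T eps delta Om T0 TT1 OT d1 potc; have [tau [s [mass bound]]] := hT T T0 TT1.
have T0' : T != 0 by rewrite gt_eqF.
set th := Th theta; set gd := Gd g; set k := layer_slope mu theta.
have tp := Th_primitive tg; have GL := Gd_L2 tg.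
have c1 := cell_sin tp GL (Th0 tg) (Th1 tg) s.
have c2 := cell_cos tp GL (Th0 tg) (Th1 tg) (Thh tg) s.
pose zeta (y : R) : R := expR ((y - H) / T).
have dzeta y : is_derive y 1 zeta (zeta y / T).
  by apply: is_derive_eq; rewrite -![_ *: _]/(_ * _) /zeta; ring.
have czeta : continuous zeta.
  by move=> y; apply: differentiable_continuous; apply/derivable1_diffP; have [] := dzeta y.
(* The linear parts cancel the field in the first direction. The layer [k * zeta] is added for the
   first component only, and enters its phase multiplied by the position [Z1] in the stripe. *)
pose b1 y := k * zeta y - 2 * Om * T * y; pose b1' y := k * (zeta y / T) - 2 * Om * T.
pose b2 y := - (2 * Om * T * y); pose b2' (y : R) := - (2 * Om * T).
have db1 y : is_derive y 1 b1 (b1' y).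
  by have dz := dzeta y; apply: is_derive_eq; rewrite -![_ *: _]/(_ * _) /b1'; ring.
have db2 y : is_derive y 1 b2 (b2' y).
  by apply: is_derive_eq; rewrite -![_ *: _]/(_ * _) /b2'; ring.
have cb1' : continuous b1'.
  move=> y; apply: cvgB; last exact: cvg_cst; apply: cvgM; first exact: cvg_cst.
  by apply: cvgM; [exact: czeta|exact: cvg_cst].
have cb2' : continuous b2' by move=> y; exact: cvg_cst.
have der_cts (b b' : R -> R) : (forall y, is_derive y 1 b (b' y)) -> continuous b.
  by move=> db y; apply: differentiable_continuous; apply/derivable1_diffP; have [] := db y.
have N1 : 0 < N + 1 by rewrite ltr_wpDl ?ltW.
have DN : D `<=` obox (- (N + 1)) (N + 1) (- (N + 1)) (N + 1).
  move=> z /hN[h1 h2]; apply/oboxP; rewrite -!ltr_norml.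
  by split; [apply: le_lt_trans h1 _|apply: le_lt_trans h2 _]; rewrite ltrDl.
pose u1 := wave_field (fun x => sin (tilt th s x)) Z1 b1 Om T tau.
pose u2 := wave_field (fun x => cos (tilt th s x)) Z2 b2 Om T tau.
have n1 z : normc (u1 z) ^+ 2 = sin (tilt th s (cellpos T tau z)) ^+ 2 by rewrite wave_normc.
have n2 z : normc (u2 z) ^+ 2 = cos (tilt th s (cellpos T tau z)) ^+ 2 by rewrite wave_normc.
have Db : D `<=` box (- N) N (- N) N by move=> z /hN[h1 h2]; apply/boxP; rewrite -!ler_norml.
have mone : measurable_fun (D : set (RT * RT)) (cst 1 : RT * RT -> R) by exact: measurable_cst.
have one1 z : D z -> `|cst 1 z : R| <= 1 by rewrite normr1.
have Sint : itg leb `[0, 1] (stripe_mass theta s).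
  by have := tilt_itg tp s (@sin2_cts R 1); apply: eq_itg => // x _; rewrite mul1r.
have SI := wave_int_itg mD Db mone one1 T0 tau Sint.
exists (u1, u2).
  split.
  - exact: (wave_H1C c1 Om tau T0 db1 cb1' oD N1 DN).
  - exact: (wave_H1C c2 Om tau T0 db2 cb2' oD N1 DN).
  - rewrite /mean_density /=; transitivity (d^-1 * (alpha * d)); last by field; rewrite gt_eqF.
    by congr (_ * _); rewrite -mass; apply: Rintegral_eq => z _; rewrite n1 mul1r.
  - rewrite /mean_density /=; transitivity (d^-1 * (d - alpha * d)); last by field; rewrite gt_eqF.
    congr (_ * _); rewrite -mass -[X in X - _]mul1r -Rintegral_cst// -RintegralB//; last exact: itg_cst.
    apply: Rintegral_eq => z _; rewrite n2 mul1r /stripe_mass -/th.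
    by have := cos2Dsin2 (tilt th s (cellpos T tau z)); lra.
pose cp z := cellpos T tau z.
pose k1 (z : R * R) := 2^-1 * ((cos (tilt th s (cp z)) * tilt' th gd s (cp z) / T) ^+ 2 + sin (tilt th s (cp z)) ^+ 2 *
  ((2 * Om * z.2 + b1 z.2 / T) ^+ 2 + (Z1 (cp z) * b1' z.2) ^+ 2)).
pose k2 (z : R * R) := 2^-1 * ((- sin (tilt th s (cp z)) * tilt' th gd s (cp z) / T) ^+ 2 + cos (tilt th s (cp z)) ^+ 2 *
  ((2 * Om * z.2 + b2 z.2 / T) ^+ 2 + (Z2 (cp z) * b2' z.2) ^+ 2)).
pose P (z : R * R) := potential eps delta (u1 z) (u2 z).
have mk1 : measurable_fun (D : set (RT * RT)) (k1 : RT * RT -> R).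
  have hm := wave_density_meas Om T tau (E := D) c1 (der_cts _ _ db1) cb1'; exact: hm.
have mk2 : measurable_fun (D : set (RT * RT)) (k2 : RT * RT -> R).
  have hm := wave_density_meas Om T tau (E := D) c2 (der_cts _ _ db2) cb2'; exact: hm.
have PE z : P z = Om / (2 * lambda) * (sin (tilt th s (cp z)) ^+ 2 * cos (tilt th s (cp z)) ^+ 2).
  rewrite /P /potential n1 n2 potc -/(cp z); have := cos2Dsin2 (tilt th s (cp z)).
  set c := cos _ ^+ 2; set n := sin _ ^+ 2 => cn; have -> : 1 - n - c = 0 by rewrite -cn; ring.
  by rewrite expr0n /= mul0r add0r.
have mP : measurable_fun (D : set (RT * RT)) (P : RT * RT -> R).
  have -> : P = (fun z => Om / (2 * lambda) * (sin (tilt th s (cp z)) ^+ 2 * cos (tilt th s (cp z)) ^+ 2)) := funext PE.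
  apply: measurable_funM => //; apply: measurable_funM; apply: measurable_funX.
    exact: cellpos_meas (itg_cellS c1).
  exact: cellpos_meas (itg_cellS c2).
have Om0 : 0 < Om by rewrite -(pmulr_lgt0 _ (_ : 0 < T ^+ 2)) ?OT exprn_gt0.
have k10 z : 0 <= k1 z by rewrite /k1 mulr_ge0// addr_ge0 ?sqr_ge0// mulr_ge0 ?sqr_ge0// addr_ge0 ?sqr_ge0.
have k20 z : 0 <= k2 z by rewrite /k2 mulr_ge0// addr_ge0 ?sqr_ge0// mulr_ge0 ?sqr_ge0// addr_ge0 ?sqr_ge0.
have P0 z : 0 <= P z.
  rewrite PE.
  apply: mulr_ge0; last by apply: mulr_ge0; exact: sqr_ge0.
  by apply: divr_ge0; [exact: ltW|apply: mulr_ge0 => //; exact: ltW].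
(* This is the integrand controlled by [stripe_correction], scaled back by 1 / T^2; it dominates the
   energy density pointwise. *)
pose r (z : R * R) := (T ^+ 2)^-1 * (1 * stripe_density lambda mu theta g s (cp z) +
  zeta z.2 * (layer_gain mu theta (cp z) + layer_bound mu theta * `|s|)).
have T20 : 0 < (T ^+ 2)^-1 by rewrite invr_gt0 exprn_gt0.
have OTT : 2 * Om * T = 2 * mu ^+ 2 / T by rewrite -OT; field.
have ler z : D z -> k1 z + k2 z + P z <= r z.
  move=> Dz; set x := cp z.
  have xI : 0 <= x <= 1 by have /andP[-> /ltW ->] := fr_itv (z.1 / T + tau).
  have z01 : 0 <= zeta z.2 <= 1.
    by rewrite expR_ge0/= -expR0 ler_expR pmulr_lle0 ?invr_gt0// subr_le0; exact: DH.
  have h1 : 2 * Om * z.2 + b1 z.2 / T = k * zeta z.2 / T by rewrite /b1; field.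
  have h2 : b1' z.2 = (k * zeta z.2 - 2 * mu ^+ 2) / T by rewrite /b1' OTT; field.
  have h3 : 2 * Om * z.2 + b2 z.2 / T = 0 by rewrite /b2; field.
  have h4 : b2' z.2 = - (2 * mu ^+ 2) / T by rewrite /b2' OTT mulNr.
  have cs1 : sin (tilt th s x) ^+ 2 + cos (tilt th s x) ^+ 2 = 1 by rewrite addrC cos2Dsin2.
  have e0 : (1 - sin (tilt th s x) ^+ 2 - cos (tilt th s x) ^+ 2) ^+ 2 / (4 * eps ^+ 2) = 0.
    by rewrite -cs1 (_ : _ - _ - _ = 0) ?expr0n/= ?mul0r//; ring.
  have := density_sum (Z1 x) (Z2 x) (tilt' th gd s x) k (zeta z.2) eps T0' (lt0r_neq0 l0) cs1 OT.
  rewrite e0 add0r => E; rewrite /k1 /k2 PE -/x h1 h2 h3 h4 E /r ler_wpM2l ?(ltW T20)// mul1r.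
  apply: lerD; last exact: (layer_gain_le mu al01 tg s xI z01).

  have s2 y : sin (2 * y) = 2 * sin y * cos y :> R.
    by rewrite (_ : 2 * y = y + y); [rewrite sinD; ring|ring].
  by rewrite /stripe_density /contrast /stripe_mass s2.
have mz : measurable_fun (D : set (RT * RT)) (fun z : RT * RT => zeta z.2 : R) by exact: snd_meas.
have z1 z : D z -> `|zeta z.2| <= 1.
  move=> Dz; rewrite ger0_norm ?expR_ge0// /zeta -expR0 ler_expR pmulr_lle0 ?invr_gt0// subr_le0; exact: DH.
have icst : itg leb `[0, 1] (fun=> layer_bound mu theta * `|s| : R) := continuous_itg 0 1 (@cst_continuous R R _).
have ld := wave_int_itg mD Db mone one1 T0 tau (stripe_density_itg lambda mu0 tg s).
have mI : measurable (`[0, 1]%classic : set RT) by [].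
have lg := wave_int_itg mD Db mz z1 T0 tau (itgD mI (layer_gain_itg mu tg) icst).
have ri : itg area D r by apply: itgZ => //; exact: itgD.
have rE : \int[area]_(z in D) r z <= Om * d * pair_energy lambda alpha mu theta g.
  rewrite /r (RintegralZl _ mD (itgD mD ld lg)) (RintegralD mD ld lg).
  apply: le_trans (ler_wpM2l (ltW T20) bound) _; by rewrite (rescale_energy _ _ T0' OT).
rewrite /energy /= (wave_kinetic c1 Om tau T0 db1 cb1' oD N1 DN Dfin) (wave_kinetic c2 Om tau T0 db2 cb2' oD N1 DN Dfin).
rewrite -/(k1 _) -/(k2 _) -/(P _).
have mE (f : R * R -> R) : measurable_fun (D : set (RT * RT)) (f : RT * RT -> R) ->
  measurable_fun (D : set (RT * RT)) (fun z : RT * RT => (f z)%:E) by move=> mf; exact/measurable_EFinP.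
have kp z : 0 <= k1 z + k2 z + P z := addr_ge0 (addr_ge0 (k10 z) (k20 z)) (P0 z).
have m12 := measurable_funD mk1 mk2; have m123 := measurable_funD m12 mP.
apply: (@le_trans _ _ (\int[area]_(z in D) (k1 z + k2 z + P z)%:E)%E).
  under [leRHS]eq_integral do rewrite EFinD.
  rewrite ge0_integralD//; [|by move=> z _; rewrite lee_fin addr_ge0|exact: mE|by move=> z _; rewrite lee_fin|exact: mE].
  rewrite leeD2r//; under [leRHS]eq_integral do rewrite EFinD.
  by rewrite ge0_integralD//; [by move=> z _; rewrite lee_fin|exact: mE|by move=> z _; rewrite lee_fin|exact: mE].
apply: le_trans (_ : (\int[area]_(z in D) (r z)%:E <= _)%E); last by rewrite -EFin_Rintegral// lee_fin.
apply: ge0_le_integral => //.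
- by move=> z _; rewrite lee_fin; exact: kp.
- exact: mE.
- by apply: mE; exact: itg_meas ri.

Qed.

End competitor.

(** * Minimizers of the full energy *)

Section minimizer.
Context {R : realType}.
Local Open Scope complex_scope.
Local Notation RT := (measurableTypeR R).
Local Notation area := (@area R).
Local Notation I := (bool * bool)%type.
Local Notation F := (R * R -> R).
Context (D : set (R * R)) (sD : smooth_bounded_domain D) (eps delta Om alpha : R) (eps0 : 0 < eps) (d1 : 1 < delta).

Let oD : open D. Proof. by case: sD. Qed.
Let mD : measurable (D : set (RT * RT)) := open_meas oD.
Let Dfin : (area D < +oo)%E := (domain_area sD).2.
Let d := fine (area D).

(* Component [(k, r)] is the real ([r = true]) or imaginary part of [u_1]
   ([k = true]) or [u_2]. *)
Definition conj_part (i : I) : I := (i.1, ~~ i.2).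

(** Coefficient of the conjugate part in the covariant derivative. Multiplication by i gives
    opposite signs to real and imaginary parts, and the two components of the rotated vector give
    opposite signs to the two directions. *)
Definition rotation (j : bool * I) : F := fun z =>
  (if j.1 == j.2.2 then -1 else 1) * Om * (if j.1 then z.2 else z.1).

Definition density (t : I -> R) k := t (k, true) ^+ 2 + t (k, false) ^+ 2.

Definition real_potential (t : I -> R) : R :=
  (1 - density t true - density t false) ^+ 2 / (4 * eps ^+ 2)
  + (delta - 1) / (2 * eps ^+ 2) * (density t true * density t false).

Definition complex_field (f : I -> F) k z : R[i] := f (k, true) z +i* f (k, false) z.

Definition real_fields (w : (R * R -> R[i]) * (R * R -> R[i])) (i : I) : F := fun z =>
  let u := if i.1 then w.1 z else w.2 z in if i.2 then complex.Re u else complex.Im u.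

Definition mass_fraction (k : bool) : R := if k then alpha else 1 - alpha.

Definition real_admissible : set (I -> F) := [set f | forall k,
  \int[area]_(z in D) (f (k, true) z ^+ 2) + \int[area]_(z in D) (f (k, false) z ^+ 2) = mass_fraction k * d].

Local Notation kin := (kin D conj_part rotation).
Local Notation pot := (pot D real_potential).
Local Notation cov := (cov conj_part rotation).

Let e4 : 0 <= (4 * eps ^+ 2)^-1. Proof. by rewrite invr_ge0 mulr_ge0 ?sqr_ge0. Qed.

Let density_ge0 t k : 0 <= density t k. Proof. by rewrite addr_ge0 ?sqr_ge0. Qed.

Lemma real_potential_ge t : (1 - density t true - density t false) ^+ 2 / (4 * eps ^+ 2) <= real_potential t.
Proof.
rewrite lerDl mulr_ge0 ?mulr_ge0 ?density_ge0 ?invr_ge0 ?subr_ge0 ?(ltW d1)//.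
by rewrite mulr_ge0 ?sqr_ge0.
Qed.

Lemma real_potential_ge0 t : 0 <= real_potential t.
Proof. by apply: le_trans (real_potential_ge t); rewrite mulr_ge0 ?sqr_ge0. Qed.

(** With [n] the total density, n^2 <= 2 (1 - n)^2 + 2, and (1 - n)^2 is at most [4 * eps ^+ 2]
    times the potential. *)
Lemma real_potential_coercive t i : t i ^+ 4 <= (8 * eps ^+ 2 + 2) * (1 + real_potential t).
Proof.
set n := density t true + density t false.
have in_le : t i ^+ 2 <= n.
  have p x := sqr_ge0 (t x); have := p (true, true); have := p (true, false); have := p (false, true); have := p (false, false).
  by rewrite /n /density; case: i => [[] []]; move=> *; lra.
have e2 : 0 < 4 * eps ^+ 2 by rewrite mulr_gt0// exprn_gt0.
have := real_potential_ge t; rewrite ler_pdivrMr// -addrA -opprD -/n.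
move: (real_potential_ge0 t); set P := real_potential t => P0 hP.
have t4 : t i ^+ 4 <= n ^+ 2.
  have -> : t i ^+ 4 = (t i ^+ 2) ^+ 2 by rewrite -exprM.
  by rewrite ler_sqr ?nnegrE ?sqr_ge0// (le_trans _ in_le) ?sqr_ge0.
have n2 : n ^+ 2 <= 2 * (1 - n) ^+ 2 + 2.
  by rewrite -subr_ge0 (_ : _ - _ = (n - 2) ^+ 2) ?sqr_ge0//; ring.
have ee : 0 <= eps ^+ 2 by exact: sqr_ge0.
apply: (le_trans t4); apply: (le_trans n2).
have -> : (8 * eps ^+ 2 + 2) * (1 + P) = 2 * (P * (4 * eps ^+ 2)) + (8 * eps ^+ 2 + 2 * P) + 2 by ring.
by rewrite lerD2r -[leLHS]addr0; apply: lerD; [rewrite ler_pM2l|rewrite addr_ge0// mulr_ge0].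
Qed.

Lemma real_potential_cvg (x : nat -> I -> R) (l : I -> R) : (forall i, x n i @[n --> \oo] --> l i) ->
  real_potential (x n) @[n --> \oo] --> real_potential l.
Proof.
move=> xl; have sq (y : nat -> R) (c : R) : y n @[n --> \oo] --> c -> y n ^+ 2 @[n --> \oo] --> c ^+ 2.
  by move=> yc; exact: (cvgM yc yc).
have dn k : density (x n) k @[n --> \oo] --> density l k by apply: cvgD; exact: sq.
apply: cvgD; apply: cvgM; [|exact: cvg_cst|exact: cvg_cst|exact: cvgM].
by apply: sq; apply: cvgB => //; apply: cvgB => //; exact: cvg_cst.
Qed.

Lemma real_potential_meas (f : I -> F) : (forall i, measurable_fun (D : set (RT * RT)) (f i : RT * RT -> R)) ->
  measurable_fun (D : set (RT * RT)) (fun z : RT * RT => real_potential (f ^~ z)).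
Proof.
move=> mf; have md k : measurable_fun (D : set (RT * RT)) (fun z : RT * RT => density (f ^~ z) k).
  by apply: measurable_funD; apply: measurable_funX; exact: mf.
apply: measurable_funD; apply: measurable_funM => //; last exact: measurable_funM.
by apply: measurable_funX; apply: measurable_funB => //; exact: measurable_funB.
Qed.

Lemma rotation_meas j : measurable_fun (D : set (RT * RT)) (rotation j : RT * RT -> R).
Proof.
apply: measurable_funM => //; case: j.1; [exact: snd_meas0|exact: fst_meas].
Qed.

Lemma rotation_bounded : exists A, forall j z, D z -> `|rotation j z| <= A.
Proof.
have [_ _ _ bD _] := sD; have [N N0 hN] := domain_box bD; exists (`|Om| * N) => j z /hN[h1 h2].
rewrite /rotation !normrM; have -> : `|if j.1 == j.2.2 then -1 else 1 : R| = 1.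
  by case: ifP; rewrite ?normrN normr1.
by rewrite mul1r ler_wpM2l//; case: ifP.
Qed.

(** The masses are continuous for strong L^2 convergence, which the compactness argument
    provides. *)
Lemma real_admissible_closed (f_ : nat -> I -> F) f : (forall n, real_admissible (f_ n)) ->
  (forall n i, in_L2 area D (f_ n i)) -> (forall i, in_L2 area D (f i)) ->
  (forall n i, \int[area]_(z in D) ((f_ n i z - f i z) ^+ 2) <= 4^-1 ^+ n) -> real_admissible f.
Proof.
move=> adm L_ L dist k.
have lim i : \int[area]_(z in D) (f_ n i z ^+ 2) @[n --> \oo] --> \int[area]_(z in D) (f i z ^+ 2).
  by apply: (L2_cvg_sqr mD (c := 1)) => // n; rewrite mul1r.
pose M (g : I -> F) := \int[area]_(z in D) (g (k, true) z ^+ 2) + \int[area]_(z in D) (g (k, false) z ^+ 2).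
have h : M (f_ n) @[n --> \oo] --> M f by apply: cvgD; exact: lim.
have ME : (fun n => M (f_ n)) = (fun=> mass_fraction k * d) by apply/funext => n; exact: adm.
rewrite ME in h; rewrite -/(M f) -(cvg_lim (@norm_hausdorff _ R) h).
exact: (cvg_lim (@norm_hausdorff _ R) (cvg_cst _)).
Qed.

Lemma kinetic_energyE v k : in_H1 D v ->
  (\int[area]_(z in D) (2^-1 * cov_grad_sq D Om (complex_field v.1 k) z)%:E =
  (2^-1 * (\sum_(b : bool) \sum_(r : bool) \int[area]_(z in D) (cov v (b, (k, r)) z ^+ 2)))%:E)%E.
Proof.
move=> H1v; have [Lv wv] := H1v; have [A hA] := rotation_bounded.
have Lc j : in_L2 area D (cov v j) := in_L2_cov oD conj_part rotation_meas hA j H1v.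
have wd b r : measurable_fun (D : set (RT * RT)) (weak_deriv D (dir b) (v.1 (k, r)) : RT * RT -> R) /\
    ae_eq area D (weak_deriv D (dir b) (v.1 (k, r))) (v.2 (b, (k, r))).
  have w' : is_weak_deriv D (dir b) (v.1 (k, r)) (weak_deriv D (dir b) (v.1 (k, r))).
    by apply: (@getPex _ (is_weak_deriv D (dir b) (v.1 (k, r)))); exists (v.2 (b, (k, r))); exact: (wv (b, (k, r))).
  by split; [case: w'.1|exact: weak_deriv_unique oD Dfin w' (wv (b, (k, r)))].
have [m1 a1] := wd true true; have [m2 a2] := wd true false.
have [m3 a3] := wd false true; have [m4 a4] := wd false false.
have mv r : measurable_fun (D : set (RT * RT)) (v.1 (k, r) : RT * RT -> R) by case: (Lv (k, r)).
have sqi b r : itg area D (fun z => cov v (b, (k, r)) z ^+ 2) := in_L2_sqr (Lc _).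
rewrite !big_bool /=.
have ii := itgD mD (itgD mD (sqi true true) (sqi true false)) (itgD mD (sqi false true) (sqi false false)).
rewrite -(RintegralD mD (sqi true true) (sqi true false)) -(RintegralD mD (sqi false true) (sqi false false)).
rewrite -(RintegralD mD (itgD mD (sqi true true) (sqi true false)) (itgD mD (sqi false true) (sqi false false))).
rewrite -(RintegralZl _ mD ii) (EFin_Rintegral mD (itgZ mD _ ii)).
have mf : measurable_fun (D : set (RT * RT)) (fun z : RT * RT => Om * z.1).
  by apply: measurable_funM => //; exact: fst_meas.
have ms : measurable_fun (D : set (RT * RT)) (fun z : RT * RT => Om * z.2).
  by apply: measurable_funM => //; exact: snd_meas0.
apply: ae_eq_integral => //.
- apply/measurable_EFinP; under eq_fun do rewrite cov_grad_sqE /complex_field /=.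
  have q1 := measurable_funX 2 (measurable_funB m1 (measurable_funM ms (mv false))).
  have q2 := measurable_funX 2 (measurable_funD m2 (measurable_funM ms (mv true))).
  have q3 := measurable_funX 2 (measurable_funD m3 (measurable_funM mf (mv false))).
  have q4 := measurable_funX 2 (measurable_funB m4 (measurable_funM mf (mv true))).
  by apply: measurable_funM => //; exact: (measurable_funD (measurable_funD q1 q2) (measurable_funD q3 q4)).
- by apply/measurable_EFinP; exact: itg_meas (itgZ mD _ ii).
- have a12 : \forall z \ae area, (D z -> weak_deriv D e1 (v.1 (k, true)) z = v.2 (true, (k, true)) z) /\
      (D z -> weak_deriv D e1 (v.1 (k, false)) z = v.2 (true, (k, false)) z).
    by move: a1 a2; apply: filterS2.
  have a34 : \forall z \ae area, (D z -> weak_deriv D e2 (v.1 (k, true)) z = v.2 (false, (k, true)) z) /\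
      (D z -> weak_deriv D e2 (v.1 (k, false)) z = v.2 (false, (k, false)) z).
    by move: a3 a4; apply: filterS2.
  move: a12 a34; apply: filterS2; first exact: (ae_filter_ringOfSetsType area).
  move=> z [h1 h2] [h3 h4] Dz; rewrite cov_grad_sqE /complex_field /= h1// h2// h3// h4//; congr (_%:E).
  by rewrite /cov /rotation /conj_part /=; congr (_ * _); ring.
Qed.

Lemma real_energyE v : in_H1 D v ->
  energy D eps delta Om (complex_field v.1 true, complex_field v.1 false) = ((kin v / 2)%:E + pot v.1)%E.
Proof.
move=> H1v; rewrite /energy /= !kinetic_energyE// -EFinD; congr (_%:E + _)%E; last first.
  by apply: eq_integral => z _; rewrite potentialE.
rewrite /kin; pose G (b : bool) (i : I) := \int[area]_(z in D) (cov v (b, i) z ^+ 2).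
rewrite (eq_bigr (fun j => G j.1 j.2)); last by case.
rewrite -(pair_bigA _ G) /= !big_bool /=.
have E b : \sum_i G b i = \sum_(k : bool) \sum_(r : bool) G b (k, r).
  rewrite (pair_bigA _ (fun k r => G b (k, r))) /=; by apply: eq_bigr => -[].
by rewrite !E !big_bool /= /G; field.
Qed.

Lemma real_fieldsK w : (complex_field (real_fields w) true, complex_field (real_fields w) false) = w.
Proof.
case: w => u1 u2; rewrite /complex_field /real_fields /=.
by congr pair; apply/funext => z; [case: (u1 z)|case: (u2 z)].
Qed.

Lemma admissibleE f : (forall i, in_L2 area D (f i)) ->
  (mean_density D (complex_field f true) = alpha /\ mean_density D (complex_field f false) = 1 - alpha)
  <-> real_admissible f.
Proof.
move=> L; have d0 : 0 < d := (domain_area sD).1.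
have E k : mean_density D (complex_field f k) = mass_fraction k <->
    \int[area]_(z in D) (f (k, true) z ^+ 2) + \int[area]_(z in D) (f (k, false) z ^+ 2) = mass_fraction k * d.
  rewrite -(RintegralD mD (in_L2_sqr (L _)) (in_L2_sqr (L _))) /mean_density -/d.
  rewrite (_ : \int[area]_(x in D) _ = \int[area]_(z in D) (f (k, true) z ^+ 2 + f (k, false) z ^+ 2)); last first.
    by apply: Rintegral_eq => z _; rewrite normc_sqr.
  split => [<-|->]; last by rewrite mulrC mulfK// gt_eqF.
  by rewrite mulrC mulrA divff ?mul1r// gt_eqF.
split => [[h1 h2] [|]|h]; [exact/E|exact/E|].
by split; apply/E; exact: h.
Qed.

Lemma in_H1_state w : admissible D alpha w ->
  exists v : state I, [/\ in_H1 D v, real_admissible v.1 & (complex_field v.1 true, complex_field v.1 false) = w].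
Proof.
move=> [H1 H2 m1 m2]; pose f := real_fields w.
have Hf i : [/\ in_L2 area D (f i), exists g, is_weak_deriv D e1 (f i) g & exists g, is_weak_deriv D e2 (f i) g].
  by case: i => [[] []]; [exact: H1.1|exact: H1.2|exact: H2.1|exact: H2.2].
have L i : in_L2 area D (f i) by case: (Hf i).
have fw := real_fieldsK w.
exists (f, fun j : bool * I => weak_deriv D (dir j.1) (f j.2)); split => //=.
  split => // -[b i] /=; apply: (@getPex _ (is_weak_deriv D (dir b) (f i))).
  by have [_ [g1 h1] [g2 h2]] := Hf i; case: b; [exists g1|exists g2].
by apply/(admissibleE L); rewrite -fw in m1 m2.
Qed.

(** In real components the problem has the form of [exists_minimizer]; the element of finite energy
    makes the infimum finite. *)
Lemma energy_min_exists w0 : admissible D alpha w0 -> (energy D eps delta Om w0 < +oo)%E ->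
  exists2 w, admissible D alpha w & forall w', admissible D alpha w' ->
    (energy D eps delta Om w <= energy D eps delta Om w')%E.
Proof.
move=> /in_H1_state[v0 [Hv0 Av0 <-]]; rewrite real_energyE// => fin0.
have [A hA] := rotation_bounded.
have pot0 : (pot v0.1 < +oo)%E.
  by move: fin0; rewrite !ltey; apply: contra => /eqP ->; rewrite addey.
have C0 : 0 <= 8 * eps ^+ 2 + 2 by rewrite addr_ge0// mulr_ge0// sqr_ge0.
have ex0 : exists v, [/\ in_H1 D v, real_admissible v.1 & (pot v.1 < +oo)%E] by exists v0.
have [v [Hv Av vmin]] := exists_minimizer oD Dfin conj_part rotation_meas hA real_potential_ge0 real_potential_cvg
  real_potential_meas C0 real_potential_coercive real_admissible_closed ex0.
exists (complex_field v.1 true, complex_field v.1 false).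
  have [L wv] := Hv; have [m1 m2] := (admissibleE L).2 Av.
  have h1 k r : H1 D (v.1 (k, r)).
    by split => //; [exists (v.2 (true, (k, r))); exact: (wv (true, (k, r)))|exists (v.2 (false, (k, r))); exact: (wv (false, (k, r)))].
  by split => //=; split; exact: h1.
by move=> w' /in_H1_state[u [Hu Au <-]]; rewrite !real_energyE//; exact: vmin.
Qed.

End minimizer.

Lemma stripe_scale (R : rcfType) (lam mu et : R) : 0 < lam -> et != 0 ->
  lam / et ^+ 2 * (mu * et / Num.sqrt lam) ^+ 2 = mu ^+ 2.
Proof.
move=> l0 e0; rewrite expr_div_n sqr_sqrtr ?ltW// exprMn; field.
by rewrite e0 gt_eqF.
Qed.

Theorem theorem1p3 (R : realType) (D : set (R * R)) (alpha lambda : R)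
    (delta Omega : R -> R) :
  smooth_bounded_domain D ->
  0 < alpha < 1 ->
  0 < lambda ->
  (\forall eps \near 0^'+, 1 < delta eps) ->
  delta eps @[eps --> 0^'+] --> (1 : R) ->
  eps_tilde delta eps @[eps --> 0^'+] --> (0 : R) ->
  (\forall eps \near 0^'+, Omega eps = lambda / eps_tilde delta eps ^+ 2) ->
  eps / eps_tilde delta eps ^+ 2 @[eps --> 0^'+] --> (0 : R) ->
  exists2 e : R, is_stripe_min lambda alpha e &
    \forall eps \near 0^'+,
      exists2 m : \bar R,
        is_min [set energy D eps (delta eps) (Omega eps) w
               | w in admissible D alpha] m &
        (m <= (Omega eps * fine (area D) * e)%:E)%E.
Proof.
move=> sD al01 l0 d1 _ et0 OmE _.
have [mu [theta [g [mu0 tg emin]]]] := stripe_min_exists l0 al01.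
exists (pair_energy lambda alpha mu theta g) => //.
have [T1 T10 comp] := competitor l0 al01 mu0 tg sD.
have sl : 0 < Num.sqrt lambda by rewrite sqrtr_gt0.
have c0 : 0 < T1 * Num.sqrt lambda / mu by rewrite divr_gt0 ?mulr_gt0.
near=> eps.
have eps0 : 0 < eps by near: eps; exact: nbhs_right_gt.
have d1' : 1 < delta eps by near: eps.
have OE : Omega eps = lambda / eps_tilde delta eps ^+ 2 by near: eps.
have small : `|eps_tilde delta eps| < T1 * Num.sqrt lambda / mu.
  near: eps; have /cvgrPdist_lt/(_ _ c0) := et0; apply: filterS => x; by rewrite sub0r normrN.
set et := eps_tilde delta eps in OE small.
have sd : 0 < Num.sqrt (delta eps - 1) by rewrite sqrtr_gt0 subr_gt0.
have et_gt0 : 0 < et by rewrite /et /eps_tilde divr_gt0.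
have etE : et ^+ 2 = eps ^+ 2 / (delta eps - 1) by rewrite /et /eps_tilde expr_div_n sqr_sqrtr// subr_ge0 ltW.
have dn : delta eps - 1 != 0 by rewrite gt_eqF// subr_gt0.
(* This is mu divided by the square root of the angular velocity, written through [et]. *)
pose T := mu * et / Num.sqrt lambda.
have T0 : 0 < T by apply: divr_gt0 => //; exact: mulr_gt0.
have TT1 : T <= T1.
  rewrite /T ler_pdivrMr// mulrC -ler_pdivlMr//.
  by apply: ltW; apply: le_lt_trans small; exact: ler_norm.
have OT : Omega eps * T ^+ 2 = mu ^+ 2.
  by rewrite OE; apply: stripe_scale; rewrite // gt_eqF.
(* Both sides equal 1 / (2 et^2): the segregation coefficient and the rotation are tied by
   lambda. *)
have pot : (delta eps - 1) / (2 * eps ^+ 2) = Omega eps / (2 * lambda).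
  rewrite OE etE; field; by rewrite dn !gt_eqF.
have [w0 adm0 e0] := comp T eps (delta eps) (Omega eps) T0 TT1 OT d1' pot.
have [w adm wmin] := energy_min_exists sD eps0 d1' adm0 (le_lt_trans e0 (ltry _)).
exists (energy D eps (delta eps) (Omega eps) w); last first.
  exact: le_trans (wmin w0 adm0) e0.
split; first by exists w.
by move=> _ [w' adm' <-]; exact: wmin.
Unshelve. all: by end_near.
Qed.
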